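(* Let $n\ge 3$ and let $G$ be a cohomogeneity two group of isometries acting on $\mathbb{R}^n$. Then every $G$-invariant biharmonic hypersurface in $\mathbb{R}^n$ is minimal.
   Context: **Biharmonic and minimal hypersurfaces.** An isometric immersion $\varphi:M^{n-1}\to\mathbb{R}^n$ with mean curvature vector field $H=(H_1,\dots,H_n)$ is called biharmonic if $\Delta H=(\Delta H_1,\dots,\Delta H_n)=0$, where $\Delta$ is the Laplace-Beltrami operator of the induced metric on $M$ (sign convention: $\Delta h=-h''$ on $\mathbb{R}$). Equivalently, $\varphi$ is a critical point of the bienergy $E_2(\varphi)=\frac12\int_M|\tau(\varphi)|^2\,dv$, with $\tau(\varphi)=\operatorname{trace}\nabla d\varphi$. It is minimal if $H\equiv 0$. **Cohomogeneity.** A Lie subgroup $G$ of the isometry group of $\mathbb{R}^n$ is called an isometry group of $\mathbb{R}^n$. Its cohomogeneity is the codimension in $\mathbb{R}^n$ of its orbits of maximal dimension (the principal orbits). The cohomogeneity of a $G$-invariant submanifold is its dimension minus the dimension of the principal orbits; thus, when $G$ has cohomogeneity two, $G$-invariant hypersurfaces have cohomogeneity one. **Standing setting for cohomogeneity two groups.** The groups $G$ considered are those of the Hsiang-Lawson classification (they correspond to the isotropy representations of symmetric spaces of rank two). Each such $G$ has a type $d\in\{1,2,3,4,6\}$ and multiplicities $m_0,\dots,m_{d-1}$ (positive integers with $\sum_{i=0}^{d-1} m_i=n-2$) such that the following holds. Put $w_{(d,i)}(x,y)=x\sin(i\pi/d)-y\cos(i\pi/d)$, $0\le i\le d-1$.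 1. The orbit space $Q=\mathbb{R}^n/G$ is identified with the linear cone of angle $\pi/d$ $$Q=\{(x,y)\in\mathbb{R}^2: y\ge 0,\ x\sin(\pi/d)-y\cos(\pi/d)\ge 0\},$$ and the metric on $Q$ making the projection $\Pi:\mathbb{R}^n\to Q$ a Riemannian submersion (over the interior of $Q$, whose points correspond to principal orbits) is the flat metric $dx^2+dy^2$. 2. The volume $V(x,y)$ of the principal orbit $\Pi^{-1}(x,y)$ satisfies, up to a positive multiplicative constant, $V^2(x,y)=\prod_{i=0}^{d-1}[w_{(d,i)}(x,y)]^{2m_i}$. 3. A $G$-invariant hypersurface is described by its profile curve: it is $\Sigma_\gamma=\Pi^{-1}(\gamma)$ with $\gamma(s)=(x(s),y(s))$ a curve in $Q$ parametrized by arc length, $\dot x^2+\dot y^2=1$. With respect to the unit normal $\eta$ with $d\Pi(\eta)=\nu=-\dot y\,\partial_x+\dot x\,\partial_y$, the principal curvatures of $\Sigma_\gamma$ (over the interior of $Q$) are $$k_i=-\tfrac12\,\nu\big(\ln[w_{(d,i)}(x,y)]^2\big)=\frac{\dot y\sin(i\pi/d)+\dot x\cos(i\pi/d)}{w_{(d,i)}(x,y)}\quad (0\le i\le d-1),$$ with multiplicity $m_i$, together with $k_d=\ddot y\,\dot x-\ddot x\,\dot y$ with multiplicity one. *)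

(* Defs.v *)
From HB Require Import structures.
From mathcomp Require Import all_boot all_order all_algebra.
From mathcomp Require Import all_classical all_reals all_analysis.

Set Implicit Arguments.
Unset Strict Implicit.
Unset Printing Implicit Defensive.

Import Order.TTheory GRing.Theory Num.Theory.
Import numFieldNormedType.Exports.

Local Open Scope classical_set_scope.
Local Open Scope ring_scope.

(* Points of R^n are row vectors, and linear maps act on the right.  The norm
   that the library puts on 'rV[R]_n is the sup norm; it is used here only
   through its topology and for differentiability.  Lengths and angles always
   come from [dotv]. *)

Definition dotv (R : realType) (n : nat) (v w : 'rV[R]_n) : R :=
  \sum_(j < n) v 0 j * w 0 j.

Definition enorm (R : realType) (n : nat) (v : 'rV[R]_n) : R :=
  Num.sqrt (dotv v v).

Definition row2 (R : realType) (x y : R) : 'rV[R]_2 :=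
  \row_(j < 2) (if j == 0 then x else y).

Definition partial (R : realType) (m : nat) (V : normedModType R) (i : 'I_m)
    (f : 'rV[R]_m -> V) : 'rV[R]_m -> V :=
  fun u => 'D_(delta_mx 0 i) f u.

(* C^oo on the open set U: every iterated partial derivative is differentiable
   at every point of U. *)
Definition smooth_on (R : realType) (m : nat) (V : normedModType R)
    (U : set 'rV[R]_m) (f : 'rV[R]_m -> V) : Prop :=
  forall (l : seq 'I_m) (u : 'rV[R]_m), U u ->
    differentiable (foldr (fun i h => partial i h) f l) u.

Definition smooth_fun_on (R : realType) (I : set R) (f : R -> R) : Prop :=
  forall (k : nat) (t : R), I t -> derivable (derive1n k f) t 1.

(* Row i of the matrix 'J psi u is the tangent vector d_i psi (u). *)
Definition immersion_on (R : realType) (m n : nat) (U : set 'rV[R]_m)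
    (psi : 'rV[R]_m -> 'rV[R]_n) : Prop :=
  smooth_on U psi /\ forall u, U u -> row_free ('J psi u).

Definition metric (R : realType) (m n : nat) (psi : 'rV[R]_m -> 'rV[R]_n)
    (u : 'rV[R]_m) : 'M[R]_m :=
  'J psi u *m ('J psi u)^T.

Definition inv_metric (R : realType) (m n : nat)
    (psi : 'rV[R]_m -> 'rV[R]_n) (u : 'rV[R]_m) : 'M[R]_m :=
  invmx (metric psi u).

(* Delta h = - (det g)^(-1/2) d_i ((det g)^(1/2) g^ij d_j h), so that
   Delta h = - h'' on the real line. *)
Definition laplace_beltrami (R : realType) (m n : nat)
    (psi : 'rV[R]_m -> 'rV[R]_n) (h : 'rV[R]_m -> R) (u : 'rV[R]_m) : R :=
  - ((Num.sqrt (\det (metric psi u)))^-1 *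
     \sum_(i < m) partial i (fun v =>
        Num.sqrt (\det (metric psi v)) *
        \sum_(j < m) inv_metric psi v i j * partial j h v) u).

Definition normal_part (R : realType) (m n : nat)
    (psi : 'rV[R]_m -> 'rV[R]_n) (u : 'rV[R]_m) (v : 'rV[R]_n) : 'rV[R]_n :=
  v - v *m ('J psi u)^T *m inv_metric psi u *m 'J psi u.

(* The second fundamental form is B(d_i, d_j) = (d_i d_j psi)^normal, and the
   mean curvature vector is its trace divided by the dimension m. *)
Definition mean_curvature (R : realType) (m n : nat)
    (psi : 'rV[R]_m -> 'rV[R]_n) (u : 'rV[R]_m) : 'rV[R]_n :=
  m%:R^-1 *: \sum_(i < m) \sum_(j < m)
    inv_metric psi u i j *: normal_part psi u (partial i (partial j psi) u).

(* Matrix, in the basis of the d_i psi, of the shape operator X |-> - d eta (X)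
   with respect to a normal vector eta. *)
Definition shape_operator (R : realType) (m n : nat)
    (psi : 'rV[R]_m -> 'rV[R]_n) (u : 'rV[R]_m) (eta : 'rV[R]_n) : 'M[R]_m :=
  inv_metric psi u *m
  (\matrix_(i < m, j < m) dotv (partial i (partial j psi) u) eta).

(* Inverse of a chart of M: a homeomorphism from an open subset of R^(n-1) onto
   an open subset of M, in which phi is a smooth immersion.  Two such
   parametrizations are automatically smoothly compatible, because a smooth
   immersion is locally an embedding; hence phi alone determines the smooth
   structure of M, and the metric of M is the one induced by phi. *)
Definition local_param (R : realType) (n : nat) (M : topologicalType)
    (phi : M -> 'rV[R]_n) (U : set 'rV[R]_n.-1) (u : 'rV[R]_n.-1 -> M) : Prop :=
  [/\ open U,
      {within U, continuous u},
      (forall a b, U a -> U b -> u a = u b -> a = b),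
      (forall V : set 'rV[R]_n.-1, V `<=` U -> open V -> open (u @` V)) &
      immersion_on U (phi \o u)].

Definition immersed_hypersurface (R : realType) (n : nat) (M : topologicalType)
    (phi : M -> 'rV[R]_n) : Prop :=
  [/\ hausdorff_space M,
      @second_countable M &
      forall p : M, exists U u, local_param phi U u /\ (u @` U) p].

Definition biharmonic (R : realType) (n : nat) (M : topologicalType)
    (phi : M -> 'rV[R]_n) : Prop :=
  forall U u, local_param phi U u -> forall v, U v -> forall j : 'I_n,
    laplace_beltrami (phi \o u) (fun w => mean_curvature (phi \o u) w 0 j) v
    = 0.

Definition minimal (R : realType) (n : nat) (M : topologicalType)
    (phi : M -> 'rV[R]_n) : Prop :=
  forall U u, local_param phi U u -> forall v, U v ->
    mean_curvature (phi \o u) v = 0.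

(* The pair (A, b), with A orthogonal, stands for the isometry p |-> p A + b. *)
Definition isom_app (R : realType) (n : nat) (g : 'M[R]_n * 'rV[R]_n)
    (p : 'rV[R]_n) : 'rV[R]_n :=
  p *m g.1 + g.2.

Definition isom_one (R : realType) (n : nat) : 'M[R]_n * 'rV[R]_n :=
  (1%:M, 0).

(* isom_app (isom_mul g h) p = isom_app g (isom_app h p). *)
Definition isom_mul (R : realType) (n : nat) (g h : 'M[R]_n * 'rV[R]_n) :
    'M[R]_n * 'rV[R]_n :=
  (h.1 *m g.1, h.2 *m g.1 + g.2).

(* Lie subgroups are taken to be closed, in the topology of R^(n x n) x R^n. *)
Definition isometry_group (R : realType) (n : nat)
    (G : set ('M[R]_n * 'rV[R]_n)) : Prop :=
  [/\ closed G,
      (forall g, G g -> g.1 *m (g.1)^T = 1%:M),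
      G (isom_one R n),
      (forall g h, G g -> G h -> G (isom_mul g h)) &
      (forall g, G g -> exists2 h, G h & isom_mul h g = isom_one R n)].

Definition orbit (R : realType) (n : nat) (G : set ('M[R]_n * 'rV[R]_n))
    (p : 'rV[R]_n) : set 'rV[R]_n :=
  [set isom_app g p | g in G].

(* The last clause makes psi a homeomorphism onto its image. *)
Definition embedded_submanifold (R : realType) (n k : nat)
    (S : set 'rV[R]_n) : Prop :=
  forall p, S p ->
    exists (W : set 'rV[R]_n) (U : set 'rV[R]_k) (psi : 'rV[R]_k -> 'rV[R]_n),
    [/\ open W /\ W p,
        open U,
        immersion_on U psi,
        (forall a b, U a -> U b -> psi a = psi b -> a = b) /\
        psi @` U = S `&` W &
        forall V : set 'rV[R]_k, V `<=` U -> open V ->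
          exists2 W' : set 'rV[R]_n, open W' & psi @` V = S `&` W'].

Definition orbit_has_dim (R : realType) (n : nat)
    (G : set ('M[R]_n * 'rV[R]_n)) (p : 'rV[R]_n) (k : nat) : Prop :=
  embedded_submanifold k (orbit G p).

Definition cohomogeneity (R : realType) (n : nat)
    (G : set ('M[R]_n * 'rV[R]_n)) (c : nat) : Prop :=
  exists k, [/\ (k + c = n)%N,
    (exists p, orbit_has_dim G p k) &
    forall p j, orbit_has_dim G p j -> (j <= k)%N].

(* G-invariance of an immersed hypersurface: G acts continuously on M and phi
   is equivariant.  When phi is an embedding, this says that the subset phi(M)
   of R^n is invariant under G. *)
Definition G_invariant (R : realType) (n : nat) (G : set ('M[R]_n * 'rV[R]_n))
    (M : topologicalType) (phi : M -> 'rV[R]_n) : Prop :=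
  exists act : 'M[R]_n * 'rV[R]_n -> M -> M,
  [/\ (forall p, act (isom_one R n) p = p),
      (forall g h p, G g -> G h -> act (isom_mul g h) p = act g (act h p)),
      {within G `*` [set: M], continuous (fun gp => act gp.1 gp.2)} &
      (forall g p, G g -> phi (act g p) = isom_app g (phi p))].

Definition wfun (R : realType) (d i : nat) (x y : R) : R :=
  x * sin (i%:R * pi / d%:R) - y * cos (i%:R * pi / d%:R).

Definition cone (R : realType) (d : nat) : set 'rV[R]_2 :=
  [set z | 0 <= z 0 1 /\
           0 <= z 0 0 * sin (pi / d%:R) - z 0 1 * cos (pi / d%:R)].

(* The projection Pi induces a homeomorphism from R^n / G onto the cone. *)
Definition orbit_space_is_cone (R : realType) (n : nat)
    (G : set ('M[R]_n * 'rV[R]_n)) (d : nat) (Pi : 'rV[R]_n -> 'rV[R]_2) :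
    Prop :=
  [/\ continuous Pi,
      range Pi = @cone R d,
      (forall p q, Pi p = Pi q <-> orbit G p q) &
      (forall A : set 'rV[R]_n, open A ->
        exists2 B : set 'rV[R]_2, open B & Pi @` A = @cone R d `&` B)].

(* The differential of f at p is onto and is an isometry on the orthogonal
   complement of its kernel. *)
Definition riemannian_submersion_at (R : realType) (n k : nat)
    (f : 'rV[R]_n -> 'rV[R]_k) (p : 'rV[R]_n) : Prop :=
  \rank ('J f p) = k /\
  forall v : 'rV[R]_n,
    (forall w : 'rV[R]_n, w *m 'J f p = 0 -> dotv w v = 0) ->
    dotv (v *m 'J f p) (v *m 'J f p) = dotv v v.

(* Hausdorff measure of dimension k >= 1, without normalizing constant: on
   k-dimensional submanifolds it is a constant multiple of the k-dimensional
   volume.  The number r i bounds the diameter of the i-th covering set. *)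
Definition hausdorff_measure (R : realType) (n k : nat) (S : set 'rV[R]_n) :
    \bar R :=
  ereal_sup [set ereal_inf [set s | exists (C : nat -> set 'rV[R]_n)
                                           (r : nat -> R),
      [/\ S `<=` \bigcup_i C i,
          (forall i, 0 <= r i <= delta),
          (forall i p q, C i p -> C i q -> enorm (p - q) <= r i) &
          s = (\sum_(0 <= i <oo) (r i ^+ k)%:E)%E]]
    | delta in [set delta : R | 0 < delta]].

Definition orbit_volume (R : realType) (n : nat)
    (G : set ('M[R]_n * 'rV[R]_n)) (p : 'rV[R]_n) : \bar R :=
  hausdorff_measure (n - 2) (orbit G p).

Definition orbit_volume_formula (R : realType) (n : nat)
    (G : set ('M[R]_n * 'rV[R]_n)) (d : nat) (mult : 'I_d -> nat)
    (Pi : 'rV[R]_n -> 'rV[R]_2) : Prop :=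
  exists2 c : R, 0 < c & forall p, interior (@cone R d) (Pi p) ->
    exists V : R, [/\ 0 < V, orbit_volume G p = V%:E &
      V ^+ 2 =
        c * \prod_(i < d) wfun d i (Pi p 0 0) (Pi p 0 1) ^+ (2 * mult i)].

Definition profile_curve (R : realType) (d : nat) (a b : R) (x y : R -> R) :
    Prop :=
  [/\ smooth_fun_on `]a, b[%classic x,
      smooth_fun_on `]a, b[%classic y &
      forall t, a < t < b ->
        (derive1 x t) ^+ 2 + (derive1 y t) ^+ 2 = 1 /\
        interior (@cone R d) (row2 (x t) (y t))].

(* psi parametrizes an open piece of the inverse image of the curve (x, y)
   under Pi; s is the arc length parameter of the curve. *)
Definition profile_param (R : realType) (n : nat) (Pi : 'rV[R]_n -> 'rV[R]_2)
    (a b : R) (x y : R -> R) (U : set 'rV[R]_n.-1)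
    (psi : 'rV[R]_n.-1 -> 'rV[R]_n) (s : 'rV[R]_n.-1 -> R) : Prop :=
  [/\ open U,
      immersion_on U psi,
      smooth_on U s &
      forall v, U v -> a < s v < b /\ Pi (psi v) = row2 (x (s v)) (y (s v))].

Definition invariant_hypersurfaces_have_profiles (R : realType) (n : nat)
    (G : set ('M[R]_n * 'rV[R]_n)) (d : nat) (Pi : 'rV[R]_n -> 'rV[R]_2) :
    Prop :=
  forall (M : topologicalType) (phi : M -> 'rV[R]_n),
    immersed_hypersurface phi -> G_invariant G phi ->
    forall p : M, interior (@cone R d) (Pi (phi p)) ->
    exists (U : set 'rV[R]_n.-1) (u : 'rV[R]_n.-1 -> M)
           (a b : R) (x y : R -> R) (s : 'rV[R]_n.-1 -> R),
    [/\ local_param phi U u /\ (u @` U) p,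
        profile_curve d a b x y,
        profile_param Pi a b x y U (phi \o u) s &
        exists2 W : set 'rV[R]_n, open W &
          (phi \o u) @` U =
            W `&` Pi @^-1` [set row2 (x t) (y t) | t in `]a, b[%classic]].

Definition curv (R : realType) (d i : nat) (x y : R -> R) (t : R) : R :=
  (derive1 y t * sin (i%:R * pi / d%:R) +
   derive1 x t * cos (i%:R * pi / d%:R))
    / wfun d i (x t) (y t).

Definition curv_profile (R : realType) (x y : R -> R) (t : R) : R :=
  derive1n 2 y t * derive1 x t - derive1n 2 x t * derive1 y t.

(* The principal curvatures with multiplicities are the roots, with their
   multiplicities, of the characteristic polynomial of the shape operator with
   respect to the unit normal eta for which d Pi (eta) = (- y', x'). *)
Definition principal_curvature_formula (R : realType) (n d : nat)
    (mult : 'I_d -> nat) (Pi : 'rV[R]_n -> 'rV[R]_2) : Prop :=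
  forall (a b : R) (x y : R -> R) (U : set 'rV[R]_n.-1)
         (psi : 'rV[R]_n.-1 -> 'rV[R]_n) (s : 'rV[R]_n.-1 -> R),
    profile_curve d a b x y -> profile_param Pi a b x y U psi s ->
    forall (v : 'rV[R]_n.-1) (eta : 'rV[R]_n), U v ->
      dotv eta eta = 1 ->
      (forall i : 'I_n.-1, dotv (partial i psi v) eta = 0) ->
      eta *m 'J Pi (psi v) = row2 (- derive1 y (s v)) (derive1 x (s v)) ->
    char_poly (shape_operator psi v eta) =
      ('X - (curv_profile x y (s v))%:P) *
      \prod_(i < d) ('X - (curv d i x y (s v))%:P) ^+ mult i.

(* The properties that the cohomogeneity two groups of the Hsiang-Lawson
   classification (isotropy representations of rank two symmetric spaces) have
   in common.  The principal orbits are those of dimension n - 2, and they lie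
   over the interior of the cone.  The classification itself is not encoded:
   any group with these properties is allowed. *)
Definition hsiang_lawson (R : realType) (n : nat)
    (G : set ('M[R]_n * 'rV[R]_n)) (d : nat) (mult : 'I_d -> nat)
    (Pi : 'rV[R]_n -> 'rV[R]_2) : Prop :=
  [/\ [/\ d \in [:: 1; 2; 3; 4; 6]%N, (forall i, (0 < mult i)%N) &
          ((\sum_(i < d) mult i) + 2 = n)%N],
      orbit_space_is_cone G d Pi,
      [/\ smooth_on (Pi @^-1` interior (@cone R d)) Pi,
          (forall p, interior (@cone R d) (Pi p) ->
             riemannian_submersion_at Pi p) &
          (forall p, orbit_has_dim G p (n - 2) <->
             interior (@cone R d) (Pi p))],
      orbit_volume_formula G mult Pi &
      invariant_hypersurfaces_have_profiles G d Pi /\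
      principal_curvature_formula mult Pi].

(* Main.v *)
From HB Require Import structures.
From mathcomp Require Import all_boot all_order all_algebra.
From mathcomp Require Import fingroup perm.
From mathcomp Require Import all_classical all_reals all_analysis.
From mathcomp Require complex.
From mathcomp Require Import ring lra zify.
Require Import Defs.

(* Over the interior of the cone the projection is a Riemannian submersion onto a flat base.
   This forces its horizontal distribution to be integrable with totally geodesic leaves:
   straight horizontal lines project isometrically, and the principal curvature formula,
   applied to lines through a point, identifies the Laplacians of the coordinates of the
   projection with the gradient of the logarithm of the orbit volume.  The mean curvature
   field of an invariant hypersurface is then basic, and its tangential and normal parts
   give two ordinary differential equations for the profile curve.  By the tangential one,
   either f' = 0 for the mean curvature function f, and then the normal one gives f = 0, or
   the curvature k of the profile satisfies 3 k = - sum m_i k_i together with a polynomial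
   relation.  In the latter case, with Y = z / conj z for the position z = x + i y and
   U = (z')^2, the arc lies on an algebraic curve in the (Y, U)-plane which is invariant
   under a polynomial vector field; comparing the two highest coefficients in U of the
   equation of that curve shows that there is no such curve.  Finally, the points of an
   invariant hypersurface over the interior of the cone are dense, by a nearest point
   argument, and the mean curvature is continuous. *)

Set Implicit Arguments.
Unset Strict Implicit.
Unset Printing Implicit Defensive.

Import Order.TTheory GRing.Theory Num.Theory.
Import numFieldNormedType.Exports.

Local Open Scope classical_set_scope.
Local Open Scope ring_scope.

(** * Plane curves invariant under the flow of biharmonic arcs *)

(** The constant 3 comes from the tangential equation [f' * (2 k + n1 f) = 0] with [n1 f = k + S].
    The pair (Y, U) is invariant under homotheties, and in these coordinates the arc follows an
    autonomous system up to a change of time, so that a single plane curve has to be excluded. All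
    types and multiplicities are handled at once, except that the argument compares two walls, so
    that type 1 is treated by hand. Three points need an argument because the hypotheses do not
    state them. Nothing is said about the Laplacians of the coordinates of the projection, which are
    recovered from test hypersurfaces over lines. A profile is provided in one chart around each
    point, and the transition to another chart is a priori only continuous. Orbits over the boundary
    of the cone are only known not to have dimension n - 2, which does not by itself prevent their
    union from containing a piece of hypersurface. *)

Lemma spec_eq0_factor (C : fieldType) (y0 : C) (K : {poly {poly C}}) :
  map_poly (horner_eval y0) K = 0 ->
  exists K1 : {poly {poly C}}, K = ('X - y0%:P)%:P * K1.
Proof.
move=> K0; exists (map_poly (fun p => p %/ ('X - y0%:P)) K).
apply/polyP=> i; rewrite coefCM coef_map_id0 ?div0p //.
have : root K`_i y0.
  by move/polyP: K0 => /(_ i); rewrite coef_map coef0 /= => /eqP.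
by move/factor_theorem => [q ->]; rewrite mulpK ?polyXsubC_eq0 // mulrC.
Qed.

(* Gauss's lemma, for a primitive polynomial [H] over [C[Y]]. *)
Lemma primitive_divides (C : closedFieldType) (H : {poly {poly C}}) :
  (forall y0, map_poly (horner_eval y0) H != 0) ->
  forall (c : {poly C}) (f K : {poly {poly C}}), c != 0 ->
  c%:P * f = K * H -> exists K', f = K' * H.
Proof.
move=> primH c; have [n] := ubnP (size c); elim: n c => // n IH c szc f K c0 e.
have [/eqP sz1|sz1] := boolP (size c == 1%N).
  have [a a0 ca] := size_poly1P _ (introT eqP sz1).
  exists ((a^-1)%:P%:P * K); rewrite -mulrA -e ca mulrA -!polyCM.
  by rewrite mulVf // mul1r.
have [y0 ry0] := closed_rootP _ sz1.
have /factor_theorem [c1 ec] := ry0.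
have K0 : map_poly (horner_eval y0) K = 0.
  have := congr1 (map_poly (horner_eval y0)) e.
  rewrite !rmorphM /= map_polyC /= /horner_eval (eqP ry0) mul0r => /esym/eqP.
  by rewrite mulf_eq0 (negbTE (primH y0)) orbF => /eqP.
have [K1 eK] := spec_eq0_factor K0.
have c10 : c1 != 0 by apply: contraNneq c0 => c10; rewrite ec c10 mul0r.
apply: (IH c1 _ f K1) => //.
  by move: szc; rewrite ec size_Mmonic ?monicXsubC // size_XsubC addn2 /=.
have nz : ('X - y0%:P)%:P != 0 :> {poly {poly C}}.
  by rewrite polyC_eq0 polyXsubC_eq0.
apply: (mulfI nz); rewrite !mulrA -eK -e ec !polyCM; ring.
Qed.

Lemma no_root_const (C : closedFieldType) (h : {poly C}) :
  (forall y0, ~~ root h y0) -> exists2 a, a != 0 & h = a%:P.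
Proof.
move=> nr; apply/size_poly1P/negPn/negP => sz1.
by have [y0 ry0] := closed_rootP _ sz1; move: (nr y0); rewrite ry0.
Qed.

(** In characteristic zero a root of [h] of multiplicity n is a root of [h'] of multiplicity exactly
    n - 1, so the divisibility leaves one factor to [P]. *)
Lemma root_of_dvd_deriv (C : numFieldType) (h P : {poly C}) (y0 : C) :
  h != 0 -> h %| P * h^`() -> root h y0 -> root P y0.
Proof.
move=> h0 dv ry.
have [n [g ng eh]] := multiplicity_XsubC h y0.
move: ng; rewrite h0 /= => ng.
have n0 : (0 < n)%N.
  by rewrite lt0n; apply: contraTneq ry => n0; rewrite eh n0 expr0 mulr1.
move: dv; rewrite eh derivM; case: n n0 eh => // n _ eh.
rewrite deriv_exp derivXsubC mul1r /= -scaler_nat.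
set x := 'X - y0%:P.
have -> : P * (g^`() * x ^+ n.+1 + g * (n.+1%:R *: x ^+ n))
   = (P * (g^`() * x + n.+1%:R *: g)) * x ^+ n.
  by rewrite exprS -!scalerAr -!mul_polyC; ring.
rewrite exprS mulrA dvdp_mul2r ?expf_neq0 ?polyXsubC_eq0 // => dv.
have : x %| P * (g^`() * x + n.+1%:R *: g).
  by apply: dvdp_trans dv; rewrite dvdp_mull.
rewrite dvdp_XsubCl rootM => /orP[//|].
rewrite /root !hornerE subrr mulr0 add0r mulf_eq0 pnatr_eq0 /=.
by move: ng; rewrite /root => /negbTE ->.
Qed.

(** Eliminating the curvature of a biharmonic arc and its derivative by [3 k = - K] and
    [3 k1 = Q - k T] turns nine times its normal equation into this form, up to a factor i, once the
    [k i] are multiplied by the imaginary unit (see [bicubic_i]). It is homogeneous of degree three,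
    so a common factor of the [k i] and [t i] can be cleared. *)
Definition bicubic (A : comNzRingType) d (m : 'I_d -> nat) (k t : 'I_d -> A) : A :=
  let K := \sum_i k i *+ m i in
  let T := \sum_i t i *+ m i in
  3 * T * (\sum_i (k i * t i) *+ m i) + K * T ^+ 2 - K ^+ 3
  - 6 * K * (\sum_i k i ^+ 2 *+ m i) - 3 * K * (\sum_i t i ^+ 2 *+ m i)
  - 9 * (\sum_i (k i * t i ^+ 2) *+ m i).

Lemma rmorph_bicubic (A B : comNzRingType) (h : {rmorphism A -> B}) d
    (m : 'I_d -> nat) (k t : 'I_d -> A) :
  h (bicubic m k t) = bicubic m (h \o k) (h \o t).
Proof.
have hs (F : 'I_d -> A) : h (\sum_i F i *+ m i) = \sum_i h (F i) *+ m i.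
  by rewrite rmorph_sum; apply: eq_bigr => i _; rewrite rmorphMn.
rewrite /bicubic !(rmorphB, rmorphD, rmorphM, rmorphXn, rmorph_nat) !hs.
have e1 : \sum_i h (k i * t i) *+ m i = \sum_i (h (k i) * h (t i)) *+ m i.
  by apply: eq_bigr => i _; rewrite rmorphM.
have e2 : \sum_i h (k i ^+ 2) *+ m i = \sum_i h (k i) ^+ 2 *+ m i.
  by apply: eq_bigr => i _; rewrite rmorphXn.
have e3 : \sum_i h (t i ^+ 2) *+ m i = \sum_i h (t i) ^+ 2 *+ m i.
  by apply: eq_bigr => i _; rewrite rmorphXn.
have e4 : \sum_i h (k i * t i ^+ 2) *+ m i = \sum_i (h (k i) * h (t i) ^+ 2) *+ m i.
  by apply: eq_bigr => i _; rewrite rmorphM rmorphXn.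
by rewrite e1 e2 e3 e4 rmorph1; ring.
Qed.

(** The situation on a wall, where all the terms but one vanish. *)
Lemma bicubic_single (A : comNzRingType) d (m : 'I_d -> nat) (k t : 'I_d -> A) i :
  (forall j, j != i -> k j = 0) -> (forall j, j != i -> t j = 0) ->
  bicubic m k t = (m i)%:R * k i *
   (((m i)%:R ^+ 2 - 9) * t i ^+ 2 - ((m i)%:R ^+ 2 + 6 * (m i)%:R) * k i ^+ 2).
Proof.
move=> k0 t0.
have sE (F : 'I_d -> A) : (forall j, j != i -> F j = 0) ->
    \sum_j F j *+ m j = (m i)%:R * F i.
  move=> F0; rewrite (bigD1 i) //= big1 ?addr0 ?mulr_natl // => j ji.
  by rewrite F0 // mul0rn.
rewrite /bicubic !sE; first (by ring); move=> j ji;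
  by rewrite ?k0 ?t0 ?expr0n ?mul0r.
Qed.

Lemma subrE_factor (A : comNzRingType) (a r h l : A) n :
  a - r * (h *+ n) = l * h -> a = (l + r *+ n) * h.
Proof. by move=> e; rewrite mulrDl -e mulrnAl mulrnAr subrK. Qed.

Lemma subrE_lead (A : idomainType) (a r h l : A) n : h != 0 -> a = 0 ->
  a - r * (h *+ n) = l * h -> l = - (r *+ n).
Proof.
move=> h0 a0 e; apply: (mulIf h0); rewrite -e a0 sub0r mulNr; congr (- _).
by rewrite mulrnAr mulrnAl.
Qed.

(** Rearranges the equation for the second highest coefficient of the flow: [0] stands for the
    derivative of the constant leading coefficient [c], and the multiples [n] and [n.+1] of [r * g]
    leave one copy. *)
Lemma subrE_next (A : comNzRingType) (a b r r' g c l : A) n :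
  a - b * 0 - r * (g *+ n) - r' * (c *+ n.+1) = - (r *+ n.+1) * g + l * c ->
  a + r * g = c * (r' *+ n.+1 + l).
Proof.
rewrite -[g *+ n]mulr_natl -[c *+ n.+1]mulr_natl -[r *+ n.+1]mulr_natl.
rewrite -[r' *+ n.+1]mulr_natl -natr1 => e.
have -> : a = a - b * 0 - r * (n%:R * g) - r' * ((n%:R + 1) * c)
  + r * (n%:R * g) + r' * ((n%:R + 1) * c) by ring.
rewrite e; ring.
Qed.

Lemma poly_size2 (A : nzRingType) (p : {poly A}) : (size p <= 2)%N ->
  p = (p`_1)%:P * 'X + (p`_0)%:P.
Proof.
move=> sp; apply/polyP => -[|[|k]];
  rewrite coefD coefCM coefX coefC /= ?mulr0 ?mulr1 ?add0r ?addr0 //.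
by rewrite nth_default // (leq_trans sp).
Qed.

Lemma size_deriv_leq (A : nzRingType) (p : {poly A}) :
  (size p^`() <= (size p).-1)%N.
Proof.
have [->|p0] := eqVneq p 0; first by rewrite deriv0 size_poly0.
by rewrite -ltnS prednK ?lt_size_deriv // size_poly_gt0.
Qed.

Section InvariantCurve.
Context (C : numClosedFieldType) (d : nat) (m : 'I_d -> nat) (y : 'I_d -> C).
Hypothesis m_gt0 : forall i, (0 < m i)%N.
Hypothesis y_inj : injective y.
Hypothesis y_neq0 : forall i, y i != 0.

(** In the application the inner variable is Y = z / conj z, and Y = [y i] is the line of the i-th
    wall. The residue polynomials are the numerators of the partial fractions with terms
    [m i / (Y - y i)] and [m i * y i / (Y - y i)]. *)
Definition wall_poly : {poly C} := \prod_i ('X - (y i)%:P).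
Definition cowall_poly i : {poly C} := \prod_(j | j != i) ('X - (y j)%:P).
Definition residue_poly : {poly C} := \sum_i (m i)%:R *: cowall_poly i.
Definition residue_poly' : {poly C} := \sum_i ((m i)%:R * y i) *: cowall_poly i.

(** Along an arc, [kap i] is i times the i-th principal curvature and [tau i] the logarithmic
    derivative of the i-th wall function, both multiplied by one factor common to all indices. *)
Definition kap i : {poly {poly C}} := (cowall_poly i)%:P * ('X + (y i)%:P%:P).
Definition tau i : {poly {poly C}} := (cowall_poly i)%:P * ('X - (y i)%:P%:P).

Definition biharmonic_poly : {poly {poly C}} := bicubic m kap tau.

(* With [Y] the inner and [U] the outer variable, a multiple of the derivation along an arc. *)
Definition flow (H : {poly {poly C}}) : {poly {poly C}} :=
  (3 * wall_poly)%:P * ('X - 'X%:P) * map_poly deriv H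
  - 2 * 'X * (residue_poly%:P * 'X + residue_poly'%:P) * H^`().

Lemma cowall_neq0 i : (cowall_poly i).[y i] != 0.
Proof.
rewrite horner_prod; apply/prodf_neq0 => j ji.
rewrite !hornerE subr_eq0; apply: contraNneq ji => /y_inj ->; exact: eqxx.
Qed.

Lemma cowall_eq0 i j : j != i -> (cowall_poly j).[y i] = 0.
Proof.
move=> ji; rewrite /cowall_poly (bigD1 i) 1?eq_sym //= hornerM !hornerE subrr.
by rewrite mul0r.
Qed.

Lemma wall_poly_root x : root wall_poly x -> exists i, x = y i.
Proof.
rewrite /root horner_prod => /eqP/eqP/prodf_eq0[i _].
by rewrite !hornerE subr_eq0 => /eqP; exists i.
Qed.

Lemma wall_poly0 i : wall_poly.[y i] = 0.
Proof. by rewrite horner_prod (bigD1 i) //= !hornerE subrr mul0r. Qed.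

Lemma residue_polyE i : residue_poly.[y i] = (m i)%:R * (cowall_poly i).[y i].
Proof.
rewrite horner_sum (bigD1 i) //= big1 ?addr0 ?hornerZ // => j ji.
by rewrite hornerZ cowall_eq0 ?mulr0.
Qed.

Lemma residue_poly'E i :
  residue_poly'.[y i] = (m i)%:R * y i * (cowall_poly i).[y i].
Proof.
rewrite horner_sum (bigD1 i) //= big1 ?addr0 ?hornerZ // => j ji.
by rewrite hornerZ cowall_eq0 ?mulr0.
Qed.

Lemma spec_biharmonic i :
  map_poly (horner_eval (y i)) biharmonic_poly =
  ((cowall_poly i).[y i] ^+ 3 * (m i)%:R)%:P * ('X + (y i)%:P) *
   (((m i)%:R ^+ 2 - 9)%:P * ('X - (y i)%:P) ^+ 2
    - ((m i)%:R ^+ 2 + 6 * (m i)%:R)%:P * ('X + (y i)%:P) ^+ 2).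
Proof.
have kE j : map_poly (horner_eval (y i)) (kap j) =
    (cowall_poly j).[y i]%:P * ('X + (y j)%:P).
  by rewrite rmorphM rmorphD /= !map_polyC map_polyX /= /horner_eval hornerC.
have tE j : map_poly (horner_eval (y i)) (tau j) =
    (cowall_poly j).[y i]%:P * ('X - (y j)%:P).
  by rewrite rmorphM rmorphB /= !map_polyC map_polyX /= /horner_eval hornerC.
have k0 j : j != i -> map_poly (horner_eval (y i)) (kap j) = 0.
  by move=> ji; rewrite kE cowall_eq0 // polyC0 mul0r.
have t0 j : j != i -> map_poly (horner_eval (y i)) (tau j) = 0.
  by move=> ji; rewrite tE cowall_eq0 // polyC0 mul0r.
rewrite /biharmonic_poly rmorph_bicubic (@bicubic_single _ _ _ _ _ i) //=.
rewrite kE tE -!polyC_natr !(polyCM, polyCD, polyCB, polyC_exp).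
rewrite !polyC_natr; ring.
Qed.

Lemma biharmonic_specE i : exists2 a : C, a != 0 &
  map_poly (horner_eval (y i)) biharmonic_poly =
  a%:P * ('X + (y i)%:P) *
   (((m i)%:R ^+ 2 - 9)%:P * ('X - (y i)%:P) ^+ 2
    - ((m i)%:R ^+ 2 + 6 * (m i)%:R)%:P * ('X + (y i)%:P) ^+ 2).
Proof.
eexists; last exact: spec_biharmonic.
by rewrite mulf_neq0 ?expf_neq0 ?cowall_neq0 // pnatr_eq0 -lt0n.
Qed.

(** The squares cancel and leave - (6 m + 9). Up to nonzero factors this number is both the leading
    and the constant coefficient on the i-th wall. *)
Lemma lead_neq0 i : (m i)%:R ^+ 2 - 9 - ((m i)%:R ^+ 2 + 6 * (m i)%:R) != 0 :> C.
Proof.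
have -> : (m i)%:R ^+ 2 - 9 - ((m i)%:R ^+ 2 + 6 * (m i)%:R) =
   - (6 * m i + 9)%:R :> C by rewrite natrD natrM; ring.
by rewrite oppr_eq0 pnatr_eq0 addn_eq0 andbF.
Qed.

(** Nonvanishing on the walls, here and in [biharmonic_bot], passes to the leading and constant
    coefficients of every divisor of [biharmonic_poly]. *)
Lemma biharmonic_top i : (biharmonic_poly`_3).[y i] != 0.
Proof.
have [a a0 e] := biharmonic_specE i.
have := congr1 (fun p : {poly C} => p`_3) e.
rewrite coef_map /= /horner_eval => ->.
set b := _ - 9; set c := _ + _ * _.
have -> : a%:P * ('X + (y i)%:P) * (b%:P * ('X - (y i)%:P) ^+ 2 -
     c%:P * ('X + (y i)%:P) ^+ 2) =
   (a * (b - c))%:P * 'X^3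
   + (a * (- b * y i - c * y i *+ 3))%:P * 'X^2
   + (a * (- b * y i ^+2 - c * y i ^+ 2 *+ 3))%:P * 'X
   + (a * (b - c) * y i ^+ 3)%:P.
  by rewrite !(polyCM, polyCD, polyCB, polyC_exp, polyCN, polyCMn); ring.
rewrite !coefD !coefCM !coefXn coefX coefC /= !mulr0 !addr0 mulr1.
by rewrite mulf_neq0 // lead_neq0.
Qed.

Lemma biharmonic_bot i : (biharmonic_poly`_0).[y i] != 0.
Proof.
have [a a0 e] := biharmonic_specE i.
have := congr1 (fun p : {poly C} => p`_0) e.
rewrite coef_map /= /horner_eval => ->.
set b := _ - 9; set c := _ + _ * _.
rewrite -horner_coef0 !(hornerM, hornerN, hornerD, horner_exp, hornerC, hornerX).
have -> : a * (0 + y i) * (b * (0 - y i) ^+ 2 - c * (0 + y i) ^+ 2)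
   = a * y i ^+ 3 * (b - c) by ring.
by rewrite !mulf_neq0 ?expf_neq0 ?y_neq0 ?lead_neq0.
Qed.

Lemma size_biharmonic : (size biharmonic_poly <= 4)%N.
Proof.
have szk i : (size (kap i) <= 2)%N.
  rewrite (leq_trans (size_polyMleq _ _)) // size_XaddC size_polyC.
  by case: (_ != 0).
have szt i : (size (tau i) <= 2)%N.
  rewrite (leq_trans (size_polyMleq _ _)) // size_XsubC size_polyC.
  by case: (_ != 0).
have szM (p q : {poly {poly C}}) a b c : (size p <= a.+1)%N -> (size q <= b.+1)%N ->
   (a + b <= c)%N -> (size (p * q)%R <= c.+1)%N.
  move=> pa qb abc; apply: leq_trans (size_polyMleq _ _) _; lia.
have szS (F : 'I_d -> {poly {poly C}}) c : (forall i, (size (F i) <= c)%N) ->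
   (size (\sum_i F i *+ m i)%R <= c)%N.
  move=> Fc; apply: leq_trans (size_sum _ _ _) _; apply/bigmax_leqP => i _.
  rewrite -mulr_natl -polyC_natr mul_polyC.
  exact: leq_trans (size_scale_leq _ _) (Fc i).
have szN n (p : {poly {poly C}}) c : (size p <= c)%N -> (size (n%:R * p)%R <= c)%N.
  by move=> pc; rewrite -polyC_natr mul_polyC (leq_trans (size_scale_leq _ _)).
have szD (p q : {poly {poly C}}) c : (size p <= c)%N -> (size q <= c)%N ->
    (size (p + q)%R <= c)%N.
  by move=> pc qc; rewrite (leq_trans (size_polyD _ _)) // geq_max pc.
have szB (p q : {poly {poly C}}) c : (size p <= c)%N -> (size q <= c)%N ->
    (size (p - q)%R <= c)%N by move=> pc qc; rewrite szD // size_polyN.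
have szX (p : {poly {poly C}}) : (size p <= 2)%N -> (size (p ^+ 2)%R <= 3)%N.
  by move=> p2; rewrite expr2; apply: (szM _ _ 1 1).
have szK : (size (\sum_i kap i *+ m i)%R <= 2)%N by apply: szS.
have szT : (size (\sum_i tau i *+ m i)%R <= 2)%N by apply: szS.
rewrite /biharmonic_poly /bicubic.
apply: (szB); [apply: (szB); [apply: (szB); [apply: (szB); [apply: (szD)|]|]|]|].
- apply: (szM _ _ 1 2)%N => //; first exact: szN.
  by apply: szS => i; apply: (szM _ _ 1 1)%N.
- by apply: (szM _ _ 1 2)%N => //; apply: szX.
- by rewrite exprS; apply: (szM _ _ 1 2)%N => //; apply: szX.
- apply: (szM _ _ 1 2)%N => //; first exact: szN.
  by apply: szS => i; apply: szX.
- apply: (szM _ _ 1 2)%N => //; first exact: szN.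
  by apply: szS => i; apply: szX.
- apply: szN; apply: szS => i; apply: (szM _ _ 1 2)%N => //; exact: szX.
Qed.

Lemma coef_flow0 (H : {poly {poly C}}) :
  (flow H)`_0 = - (3 * wall_poly * 'X * (H`_0)^`()).
Proof.
rewrite /flow coefB -!mulrA coefCM coef0M coefB coefX coefC /= coef_map /=.
rewrite [2 * _]mulrA [2 * 'X]mulrC -!mulrA coefXM /= subr0 sub0r; ring.
Qed.

Lemma coef_flowS (H : {poly {poly C}}) k :
  (flow H)`_k.+1 = 3 * wall_poly * (H`_k)^`() - 3 * wall_poly * 'X * (H`_k.+1)^`()
    - 2 * residue_poly * (H`_k *+ k) - 2 * residue_poly' * (H`_k.+1 *+ k.+1).
Proof.
have -> : flow H = (3 * wall_poly)%:P * ('X * map_poly deriv H)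
  - (3 * wall_poly * 'X)%:P * map_poly deriv H
  - (2 * residue_poly)%:P * ('X * ('X * H^`()))
  - (2 * residue_poly')%:P * ('X * H^`()).
  by rewrite /flow !polyCM polyC_natr; ring.
have XH j : ('X * H^`())`_j = H`_j *+ j.
  by rewrite coefXM; case: j => [|j] /=; rewrite ?mulr0n // coef_deriv.
rewrite !coefB !coefCM coefXM /= !coef_map /= [('X * ('X * _))`__]coefXM /= !XH.
done.
Qed.

Lemma coefM_top (A : nzRingType) (u v : {poly A}) a b :
  (size u <= a.+1)%N -> (size v <= b.+1)%N -> (u * v)`_(a + b) = u`_a * v`_b.
Proof.
move=> ua vb; rewrite coefM.
have ab : (a < (a + b).+1)%N by rewrite ltnS leq_addr.
rewrite (bigD1 (Ordinal ab)) //= addKn big1 ?addr0 // => -[i iab] /=.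
rewrite -val_eqE /= => ia.
have [lt|ge] := ltnP i a.
  by rewrite [v`_ _]nth_default ?mulr0 // (leq_trans vb) //; lia.
rewrite [u`_ _]nth_default ?mul0r // (leq_trans ua) //; lia.
Qed.

Lemma size_wall : size wall_poly = d.+1.
Proof. by rewrite size_prod_XsubC /index_enum -enumT size_enum_ord. Qed.

Lemma wall_top : wall_poly`_d = 1.
Proof.
by have /monicP := monic_prod_XsubC (index_enum 'I_d) predT y;
  rewrite lead_coefE -/wall_poly size_wall.
Qed.

Lemma cowallM i : cowall_poly i * ('X - (y i)%:P) = wall_poly.
Proof. by rewrite /wall_poly (bigD1 i) //= mulrC. Qed.

Lemma size_cowall i : size (cowall_poly i) = d.
Proof.
apply/eqP; rewrite -eqSS -size_wall -(cowallM i) size_Mmonic ?monicXsubC //.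
  by rewrite size_XsubC addn2.
by apply/negP => /eqP c0; have := cowall_neq0 i; rewrite c0 horner0 eqxx.
Qed.

Lemma cowall_top i : (cowall_poly i)`_d.-1 = 1.
Proof.
have : lead_coef wall_poly = 1 by rewrite lead_coefE size_wall wall_top.
rewrite -(cowallM i) lead_coef_Mmonic ?monicXsubC //.
by rewrite lead_coefE size_cowall.
Qed.

Lemma size_residue : (size residue_poly <= d)%N.
Proof.
apply: leq_trans (size_sum _ _ _) _; apply/bigmax_leqP => i _.
by rewrite (leq_trans (size_scale_leq _ _)) ?size_cowall.
Qed.

Lemma size_residue' : (size residue_poly' <= d)%N.
Proof.
apply: leq_trans (size_sum _ _ _) _; apply/bigmax_leqP => i _.
by rewrite (leq_trans (size_scale_leq _ _)) ?size_cowall.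
Qed.

Lemma residue_top : residue_poly`_d.-1 = (\sum_i m i)%:R.
Proof.
rewrite coef_sum natr_sum; apply: eq_bigr => i _.
by rewrite coefZ cowall_top mulr1.
Qed.

(** The hypotheses on [I] isolate what is used of the ideal of the polynomials in (Y, U) that vanish
    along an arc; [Icancel] and [Iconst] reflect that Y is not constant there. *)
Context (I : {poly {poly C}} -> Prop).
Hypothesis ID : forall p q, I p -> I q -> I (p + q).
Hypothesis IM : forall p q, I q -> I (p * q).
Hypothesis Icancel : forall y0 p, I (('X - y0%:P)%:P * p) -> I p.
Hypothesis Iflow : forall p, I p -> I (flow p).
Hypothesis Iconst : forall c, I c%:P -> c = 0.
Hypothesis Ibih : I biharmonic_poly.

(** Minimize the degree in U, then the degree of the leading coefficient. A factor Y - y0 could be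
    cancelled inside [I], lowering the second degree without changing the first, so a minimizer is
    primitive. *)
Lemma minimal_in_ideal : (0 < d)%N -> exists H : {poly {poly C}},
  [/\ I H, H != 0, (1 < size H)%N,
    (forall y0, map_poly (horner_eval y0) H != 0) &
    (forall p, I p -> (size p < size H)%N -> p = 0)].
Proof.
move=> d0.
pose Q n := `[< exists H, [/\ I H, H != 0 & n = size H] >].
have exQ : exists n, Q n.
  exists (size biharmonic_poly); apply/asboolP; exists biharmonic_poly; split=> //.
  by apply: contraNneq (biharmonic_top (Ordinal d0)) => ->; rewrite coef0 horner0.
case: (ex_minnP exQ) => e /asboolP [H0 [IH0 H00 eH0]] emin.
have small p : I p -> (size p < e)%N -> p = 0.
  move=> Ip pe; apply: contraTeq pe => p0; rewrite -leqNgt emin //.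
  by apply/asboolP; exists p.
pose Q' n := `[< exists H, [/\ I H, H != 0, size H = e & n = size (lead_coef H)] >].
have exQ' : exists n, Q' n.
  by exists (size (lead_coef H0)); apply/asboolP; exists H0.
case: (ex_minnP exQ') => l /asboolP [H [IH Hn0 He lH]] lmin.
exists H; split=> //; last by rewrite He.
- rewrite ltnNge; apply/negP => /size1_polyC eH.
  by move: IH Hn0; rewrite eH => /Iconst ->; rewrite polyC0 eqxx.
- move=> y0; apply/negP => /eqP /spec_eq0_factor [K eK].
  have K0 : K != 0 by apply: contraNneq Hn0 => K0; rewrite eK K0 mulr0.
  have IK : I K by apply: (@Icancel y0); rewrite -eK.
  have x0 : 'X - y0%:P != 0 :> {poly C} by rewrite polyXsubC_eq0.
  have szK : size K = e.
    by rewrite -He eK mul_polyC size_scale.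
  have : (l <= size (lead_coef K))%N.
    by apply: lmin; apply/asboolP; exists K.
  rewrite lH eK lead_coefM lead_coefC size_mul ?lead_coef_eq0 // size_XsubC.
  by rewrite /= ltnn.
Qed.

(** The pseudo-remainder by [H] lies in [I] and is smaller than [H], hence zero; Gauss's lemma then
    removes the power of the leading coefficient. *)
Lemma minimal_divides (H p : {poly {poly C}}) : I H -> H != 0 ->
  (forall y0, map_poly (horner_eval y0) H != 0) ->
  (forall p, I p -> (size p < size H)%N -> p = 0) ->
  I p -> exists K : {poly {poly C}}, p = K * H.
Proof.
move=> IH H0 prim small Ip.
have := Pdiv.Idomain.divp_eq p H.
have -> : p %% H = 0.
  apply: small; last by rewrite Pdiv.Idomain.ltn_modp.
  have -> : p %% H = (lead_coef H ^+ scalp p H)%:P * p + (- (p %/ H)) * H.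
    by rewrite mul_polyC (Pdiv.Idomain.divp_eq p H); ring.
  by apply: ID; apply: IM.
rewrite addr0 -mul_polyC => e.
by apply: (primitive_divides prim _ e); rewrite expf_neq0 ?lead_coef_eq0.
Qed.

(* The sum of the roots of the minimal polynomial [H] would be a polynomial of
   degree one in [Y] taking the value [- e Y_i] at each wall, and the growth of
   the flow at infinity is incompatible with its leading coefficient. *)
Theorem no_invariant_curve (i0 i1 : 'I_d) : i0 != i1 -> False.
Proof.
move=> i01; have d0 : (0 < d)%N by case: (i0) => ?; lia.
have [H [IH H0 szH prim small]] :=
  minimal_in_ideal d0.
have [K eK] := minimal_divides IH H0 prim small Ibih.
have [L eL] := minimal_divides IH H0 prim small (Iflow IH).
(* [H] has degree e + 1 in U. The flow raises this degree by at most one, so the cofactor [L] has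
   degree at most one. *)
have [e szHe] : {e | size H = e.+2} by exists (size H).-2; lia.
have He2 k : (e.+1 < k)%N -> H`_k = 0 by move=> ek; rewrite nth_default ?szHe.
have he0 : H`_e.+1 != 0 by have := H0; rewrite -lead_coef_eq0 lead_coefE szHe.
have szf : (size (flow H) <= e.+3)%N.
  apply/leq_sizeP => -[|k] ek; first by rewrite ltn0 in ek.
  rewrite coef_flowS !He2 ?(leq_trans _ ek) //.
  by rewrite deriv0 !mul0rn !mulr0 !subr0.
have szL : (size L <= 2)%N.
  have [->|L0] := eqVneq L 0; first by rewrite size_poly0.
  move: szf; rewrite eL size_mul // szHe; move: (size (L : seq _)) => s; lia.
have LE := poly_size2 szL.
have e0 : - (3 * wall_poly * 'X * (H`_0)^`()) = L`_0 * H`_0.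
  by rewrite -coef_flow0 eL coef0M.
have eS k : 3 * wall_poly * (H`_k)^`() - 3 * wall_poly * 'X * (H`_k.+1)^`()
    - 2 * residue_poly * (H`_k *+ k) - 2 * residue_poly' * (H`_k.+1 *+ k.+1)
   = L`_1 * H`_k + L`_0 * H`_k.+1.
  by rewrite -coef_flowS eL LE mulrDl -mulrA coefD !coefCM coefXM /= -LE.
have f3 : size biharmonic_poly = 4%N.
  apply/eqP; rewrite eqn_leq size_biharmonic /= ltnNge; apply/negP => s3.
  by have := biharmonic_top i0; rewrite nth_default // horner0 eqxx.
have he_wall i : (H`_e.+1).[y i] != 0.
  have : lead_coef biharmonic_poly = lead_coef K * lead_coef H.
    by rewrite eK lead_coefM.
  rewrite !lead_coefE f3 szHe /= => ef.
  by have := biharmonic_top i; rewrite ef hornerM mulf_eq0 negb_or => /andP[].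
have h0_wall i : (H`_0).[y i] != 0.
  have := biharmonic_bot i.
  by rewrite eK coef0M hornerM mulf_eq0 negb_or => /andP[].
have etop : 3 * wall_poly * (H`_e.+1)^`() - 2 * residue_poly * (H`_e.+1 *+ e.+1)
   = L`_1 * H`_e.+1.
  by have := eS e.+1; rewrite (He2 e.+2) // deriv0 mul0rn !mulr0 !subr0 addr0.
(* A root of the leading coefficient would be a root of [wall_poly] by [root_of_dvd_deriv], which
   [he_wall] excludes. *)
have [c c0 ec] : exists2 c, c != 0 & H`_e.+1 = c%:P.
  apply: no_root_const => y0; apply/negP => ry0.
  have dv : H`_e.+1 %| (3 * wall_poly) * (H`_e.+1)^`().
    rewrite (subrE_factor etop).
    by rewrite dvdp_mull.
  have := root_of_dvd_deriv he0 dv ry0.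
  rewrite -polyC_natr rootM rootC pnatr_eq0 /= => /wall_poly_root [i ei].
  by move: (he_wall i) ry0; rewrite /root -ei => /negbTE ->.
have L1E : L`_1 = - (2 * residue_poly *+ e.+1).
  by apply: subrE_lead etop; rewrite // ec derivC mulr0.
have eg : 3 * wall_poly * (H`_e)^`() + 2 * residue_poly * H`_e =
   c%:P * (2 * residue_poly' *+ e.+1 + L`_0).
  by apply: subrE_next; rewrite -L1E -ec -(eS e) ec derivC.
(* On a wall [wall_poly] kills the left side of [e0], while the constant coefficient of [H] does not
   vanish there. *)
have L0_wall i : (L`_0).[y i] = 0.
  have := congr1 (horner^~ (y i)) e0; rewrite !hornerE wall_poly0.
  rewrite mulr0 !mul0r oppr0 => /esym/eqP.
  by rewrite mulf_eq0 (negbTE (h0_wall i)) orbF => /eqP.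
set g := H`_e in eg; set l0 := L`_0 in e0 eg L0_wall.
have g_wall i : g.[y i] = c * e.+1%:R * y i.
  have := congr1 (horner^~ (y i)) eg.
  rewrite -!polyC_natr !(hornerM, hornerD, hornerMn, hornerC) wall_poly0.
  rewrite residue_polyE residue_poly'E L0_wall.
  rewrite mulr0 mul0r add0r addr0 -mulrA -mulr_natl => h.
  have nz : 2 * ((m i)%:R * (cowall_poly i).[y i]) != 0.
    by rewrite !mulf_neq0 ?cowall_neq0 ?pnatr_eq0 // -lt0n.
  apply: (mulfI nz); move: h; rewrite mulr1 -[2 * _ * g.[_]]mulrA => ->; ring.
set j := (size (H`_0)).-1.
have h00 : H`_0 != 0.
  by apply: contraNneq (h0_wall i0) => ->; rewrite horner0.
have szh0 : size (H`_0) = j.+1 by rewrite /j prednK // lt0n size_poly_eq0.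
have sz3P : (size (3 * wall_poly)%R <= d.+1)%N.
  by rewrite -polyC_natr mul_polyC (leq_trans (size_scale_leq _ _)) ?size_wall.
have sz3PX : (size (3 * wall_poly * 'X)%R <= d.+2)%N.
  have [->|nz] := eqVneq (3 * wall_poly : {poly C}) 0.
    by rewrite mul0r size_poly0.
  by rewrite size_mulX.
have szl0 : (size l0 <= d.+1)%N.
  have [->|l00] := eqVneq l0 0; first by rewrite size_poly0.
  have : (size (l0 * H`_0)%R <= d.+1 + j)%N.
    rewrite -e0 size_polyN (leq_trans (size_polyMleq _ _)) //.
    rewrite -subn1 leq_subLR addnA add1n leq_add //.
    by rewrite (leq_trans (size_deriv_leq _)) // szh0.
  by rewrite size_mul // szh0 addnS /= leq_add2r.
have wall3_top : (3 * wall_poly : {poly C})`_d = 3.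
  by rewrite -polyC_natr coefCM wall_top mulr1.
(* Top coefficients in [e0]: the derivative brings down the degree j of the constant coefficient of
   [H], and [3 * wall_poly] contributes 3. *)
have l0_top : l0`_d = - (3 * j)%:R.
  have lh0 : (H`_0)`_j != 0 by rewrite -[j]/(j.+1.-1) -szh0 -lead_coefE lead_coef_eq0.
  apply: (mulIf lh0); rewrite -coefM_top ?szh0 // -e0 coefN mulNr; congr (- _).
  have := size_deriv_leq (H`_0); rewrite szh0 /=; case: (j) => [|j'] szd.
    have -> : (H`_0)^`() = 0 by apply/eqP; rewrite -size_poly_eq0 -leqn0.
    by rewrite mulr0 coef0 muln0 mul0r.
  by rewrite addnS -addSn coefM_top // coefMX /= wall3_top coef_deriv -mulr_natr natrM; ring.
(* The coefficient of degree d + p in [eg]: [residue_poly'] has degree below d and drops out, while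
   the top coefficient of [residue_poly] is the sum of the multiplicities. *)
have top p : (size g <= p.+2)%N ->
    (3 * p.+1%:R + 2 * (\sum_i m i)%:R) * g`_p.+1 = c * l0`_(d + p).
  move=> szgp; have := congr1 (fun q : {poly C} => q`_(d + p)) eg.
  rewrite coefD coefCM coefD coefMn.
  rewrite (_ : (2 * residue_poly' : {poly C})`_(d + p) = 0); last first.
    by rewrite -polyC_natr coefCM nth_default ?mulr0 // (leq_trans size_residue') ?leq_addr.
  rewrite mul0rn add0r => <-; rewrite mulrDl; congr (_ + _).
    rewrite coefM_top //; first by rewrite wall3_top coef_deriv -mulrA [p.+1%:R * _]mulr_natl.
    by rewrite (leq_trans (size_deriv_leq _)) // -subn1 leq_subLR add1n.
  rewrite (_ : (d + p)%N = (d.-1 + p.+1)%N); last by rewrite addnS -addSn prednK.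
  rewrite coefM_top //.
    by rewrite -polyC_natr coefCM residue_top.
  by rewrite prednK // -polyC_natr mul_polyC (leq_trans (size_scale_leq _ _)) ?size_residue.
have szg : (size g <= 2)%N.
  rewrite leqNgt; apply/negP => szg.
  have [p szp] : {p | size g = p.+3} by exists (size g - 3)%N; lia.
  have := top p.+1; rewrite szp leqnn => /(_ isT)/eqP.
  rewrite [l0`_ _]nth_default; last by rewrite (leq_trans szl0) // -addn1 leq_add2l.
  rewrite mulr0 -!natrM -natrD mulf_eq0 pnatr_eq0 addn_eq0 /=.
  by rewrite -[p.+2]/(p.+3.-1) -szp -lead_coefE lead_coef_eq0 -size_poly_eq0 szp.
have ge x : g.[x] = g`_0 + g`_1 * x.
  by rewrite [in LHS](poly_size2 szg) !hornerE addrC.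
(* An affine polynomial taking the values [c * e.+1 * y i] at two distinct walls has this slope.
   This is where a second wall is needed. *)
have g1 : g`_1 = c * e.+1%:R.
  have y01 : y i0 - y i1 != 0 by rewrite subr_eq0 (inj_eq y_inj).
  apply: (mulIf y01).
  have := congr2 (fun a b => a - b) (g_wall i0) (g_wall i1).
  rewrite !ge => h; move: h; rewrite -mulrBr => <-; ring.
(* In degree d, after division by c, [eg] says that (3 + 2 sum m) (e + 1) + 3 j = 0 for natural
   numbers. *)
have := top 0%N szg; rewrite addn0 l0_top g1 => /eqP.
have -> : c * - (3 * j)%:R = - (c * (3 * j)%:R) by ring.
rewrite -subr_eq0 opprK.
have -> : (3 * 1 + 2 * (\sum_i m i)%:R) * (c * e.+1%:R) + c * (3 * j)%:R =
   c * ((3 + 2 * (\sum_i m i)) * e.+1 + 3 * j)%:R.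
  by rewrite natrD !natrM natrD natrM; ring.
by rewrite mulf_eq0 (negbTE c0) pnatr_eq0 addn_eq0 muln_eq0.
Qed.

End InvariantCurve.

(** * Directional derivatives *)

Definition dder (R : realType) (V : normedModType R) (f : V -> R) (a v : V)
  (df : R) : Prop := is_derive a v f df.

Lemma dderE (R : realType) (V : normedModType R) (v : V) (f : V -> R) (a : V) (df : R) :
  dder f a v df -> 'D_v f a = df.
Proof. by move=> h; rewrite (@derive_val _ _ _ _ _ _ _ h). Qed.

Lemma dder_derivable (R : realType) (V : normedModType R) (v : V) (f : V -> R) (a : V) (df : R) :
  dder f a v df -> derivable f a v.
Proof. by case. Qed.

Lemma dderP (R : realType) (V : normedModType R) (v : V) (f : V -> R) (a : V) :
  derivable f a v -> dder f a v ('D_v f a).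
Proof. by move=> /derivableP. Qed.

Lemma dder_eq (R : realType) (V : normedModType R) (v : V) (f : V -> R) (a : V) (d e : R) :
  dder f a v d -> d = e -> dder f a v e.
Proof. by move=> h <-. Qed.

Lemma dder_near (R : realType) (V : normedModType R) (v : V) (f g : V -> R) (a : V) (d : R) :
  (\forall x \near a, f x = g x) -> dder f a v d -> dder g a v d.
Proof. by move=> fg; apply: near_eq_is_derive. Qed.

Lemma dder_uniq (R : realType) (V : normedModType R) (v : V) (f : V -> R) (a : V) (d e : R) :
  dder f a v d -> dder f a v e -> d = e.
Proof. by move=> /dderE <- /dderE <-. Qed.

Lemma dder_cst (R : realType) (V : normedModType R) (v : V) (c : R) (a : V) :
  dder (fun _ => c) a v 0.
Proof. exact: is_derive_cst. Qed.

Lemma dderD (R : realType) (V : normedModType R) (v : V) (f g : V -> R) (a : V) (d e : R) :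
  dder f a v d -> dder g a v e -> dder (fun x => f x + g x) a v (d + e).
Proof. by move=> hf hg; apply: is_deriveD. Qed.

Lemma dderN (R : realType) (V : normedModType R) (v : V) (f : V -> R) (a : V) (d : R) :
  dder f a v d -> dder (fun x => - f x) a v (- d).
Proof. by move=> hf; apply: is_deriveN. Qed.

Lemma dderB (R : realType) (V : normedModType R) (v : V) (f g : V -> R) (a : V) (d e : R) :
  dder f a v d -> dder g a v e -> dder (fun x => f x - g x) a v (d - e).
Proof. by move=> hf hg; apply: is_deriveB. Qed.

Lemma dderM (R : realType) (V : normedModType R) (v : V) (f g : V -> R) (a : V) (d e : R) :
  dder f a v d -> dder g a v e -> dder (fun x => f x * g x) a v (d * g a + f a * e).
Proof.
move=> hf hg; apply: is_derive_eq (is_deriveM hf hg) _.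
by rewrite /GRing.scale /=; ring.
Qed.

Lemma dderZ (R : realType) (V : normedModType R) (v : V) (c : R) (f : V -> R) (a : V) (d : R) :
  dder f a v d -> dder (fun x => c * f x) a v (c * d).
Proof.
move=> hf; apply: (dder_eq (dderM (dder_cst v c a) hf)).
by rewrite mul0r add0r.
Qed.

Lemma dderV (R : realType) (V : normedModType R) (v : V) (f : V -> R) (a : V) (d : R) :
  f a != 0 -> dder f a v d -> dder (fun x => (f x)^-1) a v (- d / f a ^+ 2).
Proof.
move=> fa0 [fd fE]; split; first exact: derivableV.
by rewrite deriveV // fE /GRing.scale /= -exprVn; ring.
Qed.

Lemma dder_div (R : realType) (V : normedModType R) (v : V) (f g : V -> R) (a : V) (d e : R) :
  dder f a v d -> dder g a v e -> g a != 0 ->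
  dder (fun x => f x / g x) a v ((d - f a / g a * e) / g a).
Proof.
move=> hf hg ga0; apply: (dder_eq (dderM hf (dderV ga0 hg))).
by field.
Qed.

Lemma dder_sum (R : realType) (V : normedModType R) (v : V) (I : Type) (r : seq I)
    (P : pred I) (f : I -> V -> R) (a : V) (d : I -> R) :
  (forall i, P i -> dder (f i) a v (d i)) ->
  dder (fun x => \sum_(i <- r | P i) f i x) a v (\sum_(i <- r | P i) d i).
Proof.
move=> h; elim: r => [|i r IH].
  rewrite big_nil (_ : (fun x => _) = (fun=> 0)); first exact: dder_cst.
  by apply/funext => x; rewrite big_nil.
rewrite big_cons (_ : (fun x => _) = (fun x => if P i then f i x + \sum_(i <- r | P i) f i x
   else \sum_(i <- r | P i) f i x)); last by apply/funext => x; rewrite big_cons.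
by case: ifP => // /h hi; apply: dderD.
Qed.

Lemma dder_pow (R : realType) (V : normedModType R) (v : V) (f : V -> R) (a : V) (d : R) n :
  dder f a v d -> dder (fun x => f x ^+ n) a v (n%:R * f a ^+ n.-1 * d).
Proof.
move=> hf; elim: n => [|n IH].
  rewrite (_ : (fun x => _) = (fun=> 1)); last by apply/funext => x; rewrite expr0.
  by apply: dder_eq (dder_cst _ _ _) _; rewrite !mul0r.
rewrite (_ : (fun x => _) = (fun x => f x * f x ^+ n)); last first.
  by apply/funext => x; rewrite exprS.
apply: dder_eq (dderM hf IH) _ => /=; case: n {IH} => [|n].
  by rewrite !expr0; ring.
by rewrite /= exprS -natr1 -[n.+2%:R]natr1 -natr1; ring.
Qed.

Lemma dder1_cont (R : realType) (f : R -> R) (t d : R) :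
  dder f t 1 d -> {for t, continuous f}.
Proof. by move=> [h _]; apply: differentiable_continuous; apply/derivable1_diffP. Qed.

Lemma near_itvoo (R : realType) (a b t : R) : a < t < b ->
  \forall s \near t, a < s < b.
Proof.
move=> /andP[at_ tb]; near=> s; apply/andP; split.
  by near: s; apply: lt_nbhsr.
by near: s; apply: lt_nbhsl.
Unshelve. all: by end_near. Qed.

Lemma dder1_neq0 (R : realType) (f : R -> R) (t d : R) :
  dder f t 1 d -> f t != 0 -> \forall s \near t, f s != 0.
Proof. by move=> /dder1_cont fc f0; exact: (cvgr_neq0 _ fc f0). Qed.

Lemma nbhs_itvoo (R : realType) (P : R -> Prop) (t : R) :
  (\forall s \near t, P s) -> exists a b, a < t < b /\ forall s, a < s < b -> P s.
Proof.
move=> /nbhs_ballP[e /= e0 he]; exists (t - e), (t + e); split.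
  by rewrite ltrBlDr !ltrDl e0.
by move=> s hs; apply: he; rewrite /ball /= ltr_distlC.
Qed.

(** * Biharmonic arcs in the cone *)

Section ComplexArcs.
Import complex.
Local Open Scope complex_scope.

Definition cderiv (R : realType) (F : R -> R[i]) (t : R) (D : R[i]) : Prop :=
  dder (fun s => Re (F s)) t 1 (Re D) /\ dder (fun s => Im (F s)) t 1 (Im D).

Lemma cderiv_eq (R : realType) (F : R -> R[i]) t (D D' : R[i]) :
  D = D' -> cderiv F t D -> cderiv F t D'.
Proof. by move=> ->. Qed.

Lemma cderiv_cst (R : realType) (z : R[i]) t : cderiv (fun _ => z) t 0.
Proof. by split; apply: is_derive_cst. Qed.

Lemma cderivD (R : realType) (F G : R -> R[i]) t (D E : R[i]) :
  cderiv F t D -> cderiv G t E -> cderiv (fun s => F s + G s) t (D + E).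
Proof.
have Re_D (z w : R[i]) : Re (z + w) = Re z + Re w by case: z w => ? ? [].
have Im_D (z w : R[i]) : Im (z + w) = Im z + Im w by case: z w => ? ? [].
move=> [F1 F2] [G1 G2]; split.
  rewrite Re_D (_ : (fun s => _) = (fun s => Re (F s) + Re (G s))).
    exact: dderD.
  by apply/funext => s.
rewrite Im_D (_ : (fun s => _) = (fun s => Im (F s) + Im (G s))).
  exact: dderD.
by apply/funext => s.
Qed.

Lemma cderivM (R : realType) (F G : R -> R[i]) t (D E : R[i]) :
  cderiv F t D -> cderiv G t E ->
  cderiv (fun s => F s * G s) t (D * G t + F t * E).
Proof.
have Re_M (z w : R[i]) : Re (z * w) = Re z * Re w - Im z * Im w.
  by case: z w => ? ? [].
have Im_M (z w : R[i]) : Im (z * w) = Re z * Im w + Im z * Re w.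
  by case: z w => ? ? [].
move=> [F1 F2] [G1 G2]; split.
  rewrite (_ : (fun s => _) = (fun s => Re (F s) * Re (G s) - Im (F s) * Im (G s))).
    apply: dder_eq (dderB (dderM F1 G1) (dderM F2 G2)) _.
    by case: (F t) (G t) (D) (E) => a b [a' b'] [c e] [c' e'] /=; ring.
  by apply/funext => s.
rewrite (_ : (fun s => _) = (fun s => Re (F s) * Im (G s) + Im (F s) * Re (G s))).
  apply: dder_eq (dderD (dderM F1 G2) (dderM F2 G1)) _.
  by case: (F t) (G t) (D) (E) => a b [a' b'] [c e] [c' e'] /=; ring.
by apply/funext => s.
Qed.

Lemma cderiv_real (R : realType) (f : R -> R) (t df : R) :
  dder f t 1 df -> cderiv (fun s => (f s)%:C) t df%:C.
Proof. by move=> fD; split=> //=; exact: dder_cst. Qed.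

Lemma cderiv_pair (R : realType) (f g : R -> R) (t df dg : R) :
  dder f t 1 df -> dder g t 1 dg -> cderiv (fun s => f s +i* g s) t (df +i* dg).
Proof. by []. Qed.

Lemma cderiv_near0 (R : realType) (F : R -> R[i]) t (D : R[i]) :
  (\forall s \near t, F s = 0) -> cderiv F t D -> D = 0.
Proof.
move=> F0 [F1 F2].
have h1 : Re D = 0.
  apply: dder_uniq F1 _; apply: dder_near (dder_cst _ 0 _).
  by apply: filterS F0 => s ->.
have h2 : Im D = 0.
  apply: dder_uniq F2 _; apply: dder_near (dder_cst _ 0 _).
  by apply: filterS F0 => s ->.
by apply/eqP; rewrite eq_complex h1 h2 !eqxx.
Qed.

Lemma cderiv_neq0 (R : realType) (F : R -> R[i]) t (D : R[i]) :
  cderiv F t D -> F t != 0 -> \forall s \near t, F s != 0.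
Proof.
move=> [F1 F2]; rewrite eq_complex negb_and => /orP[] nz.
  have := dder1_neq0 F1 nz; apply: filterS => s.
  by apply: contraNneq => ->.
have := dder1_neq0 F2 nz; apply: filterS => s.
by apply: contraNneq => ->.
Qed.

Lemma cderiv_poly (R : realType) (p : {poly R[i]}) (Y : R -> R[i]) t DY :
  cderiv Y t DY -> cderiv (fun s => p.[Y s]) t (p^`().[Y t] * DY).
Proof.
move=> hY; elim/poly_ind: p => [|p c IH].
  rewrite deriv0 horner0 mul0r (_ : (fun s => _) = (fun _ => 0)).
    exact: cderiv_cst.
  by apply/funext => s; rewrite horner0.
rewrite (_ : (fun s => _) = (fun s => p.[Y s] * Y s + c)); last first.
  by apply/funext => s; rewrite !hornerE.
apply: cderiv_eq (cderivD (cderivM IH hY) (cderiv_cst c t)).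
rewrite derivD derivM derivX derivC !hornerE; ring.
Qed.

Definition ev2 (C : comNzRingType) (H : {poly {poly C}}) (y u : C) : C :=
  H.[u%:P].[y].

Lemma ev2M (C : comNzRingType) (H G : {poly {poly C}}) y u :
  ev2 (H * G) y u = ev2 H y u * ev2 G y u.
Proof. by rewrite /ev2 !hornerM. Qed.

Lemma ev2D (C : comNzRingType) (H G : {poly {poly C}}) y u :
  ev2 (H + G) y u = ev2 H y u + ev2 G y u.
Proof. by rewrite /ev2 !hornerD. Qed.

Lemma ev2N (C : comNzRingType) (H : {poly {poly C}}) y u :
  ev2 (- H) y u = - ev2 H y u.
Proof. by rewrite /ev2 !hornerN. Qed.

Lemma ev2C (C : comNzRingType) (p : {poly C}) y u : ev2 p%:P y u = p.[y].
Proof. by rewrite /ev2 hornerC. Qed.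

Lemma ev2X (C : comNzRingType) (y u : C) : ev2 'X y u = u.
Proof. by rewrite /ev2 hornerX hornerC. Qed.

Lemma ev2_rmorph (C : comNzRingType) (H : {poly {poly C}}) y u :
  ev2 H y u = (horner_eval y \o horner_eval u%:P) H.
Proof. by []. Qed.

Lemma cderiv_poly2 (R : realType) (H : {poly {poly R[i]}}) (Y U : R -> R[i]) t DY DU :
  cderiv Y t DY -> cderiv U t DU ->
  cderiv (fun s => ev2 H (Y s) (U s)) t
    (ev2 (map_poly deriv H) (Y t) (U t) * DY + ev2 H^`() (Y t) (U t) * DU).
Proof.
move=> hY hU; elim/poly_ind: H => [|H c IH].
  rewrite deriv0 map_poly0 /ev2 !horner0 !mul0r addr0.
  rewrite (_ : (fun s => _) = (fun _ => 0)); first exact: cderiv_cst.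
  by apply/funext => s; rewrite !horner0.
rewrite (_ : (fun s => _) = (fun s => ev2 H (Y s) (U s) * U s + c.[Y s])); last first.
  by apply/funext => s; rewrite ev2D ev2M ev2X ev2C.
apply: cderiv_eq (cderivD (cderivM IH hU) (cderiv_poly c hY)).
have -> : map_poly deriv (H * 'X + c%:P) = map_poly deriv H * 'X + c^`()%:P.
  apply/polyP => i; rewrite coef_map /= !coefD !coefMX !coefC.
  by case: i => [|i] /=; rewrite ?add0r ?addr0 // coef_map.
rewrite derivD derivM derivX derivC addr0 mulr1 !ev2D !ev2M ev2X ev2C; ring.
Qed.

Definition wall_angle (R : realType) (d i : nat) : R := i%:R * pi / d%:R.

(** For (c1, c2) the unit velocity of the profile, [tcurv] is the derivative of ln w_i along the
    profile and [ncurv] is the principal curvature k_i. *)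
Definition tcurv (R : realType) (d i : nat) (x y c1 c2 : R) : R :=
  (c1 * sin (wall_angle R d i) - c2 * cos (wall_angle R d i)) / wfun d i x y.

Definition ncurv (R : realType) (d i : nat) (x y c1 c2 : R) : R :=
  (c2 * sin (wall_angle R d i) + c1 * cos (wall_angle R d i)) / wfun d i x y.

Definition wall_unit (R : realType) (d i : nat) : R[i] :=
  cos (wall_angle R d i) +i* sin (wall_angle R d i).

(** The wall angles lie in [0, pi), so their doubles are distinct modulo 2 pi. Arguments of complex
    numbers are avoided: equal squares force sin (q - p) = 0, although q - p lies strictly between 0
    and pi. *)
Lemma wall_unit_inj (R : realType) (d : nat) :
  injective (fun i : 'I_d => wall_unit R d i ^+ 2).
Proof.
suff lt (i j : 'I_d) : (i < j)%N -> wall_unit R d i ^+ 2 != wall_unit R d j ^+ 2.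
  move=> i j; have [/lt|/lt|/val_inj//] := ltngtP i j => /eqP // h e.
  by rewrite -e in h.
move=> ij; have d0 : (0 < d)%N by apply: leq_ltn_trans (ltn_ord i).
set p := wall_angle R d i; set q := wall_angle R d j.
have h : 0 < sin (q - p).
  apply: sin_gt0_pi; apply/andP; split.
    rewrite subr_gt0 /p /q /wall_angle ltr_pM2r ?invr_gt0 ?ltr0n //.
    by rewrite ltr_pM2r ?pi_gt0 // ltr_nat.
  rewrite ltrBlDr; apply: (@lt_le_trans _ _ pi); last first.
    by rewrite lerDl /p /wall_angle divr_ge0 ?mulr_ge0 ?ler0n ?pi_ge0.
  rewrite /q /wall_angle ltr_pdivrMr ?ltr0n // mulrC ltr_pM2l ?pi_gt0 //.
  by rewrite ltr_nat.
apply/eqP => e; move: h; rewrite sinB.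
have := e; rewrite /wall_unit -/p -/q !expr2; simpc => -[e1 e2].
have cp := cos2Dsin2 p; have cq := cos2Dsin2 q.
set a := cos p in e1 e2 cp *; set b := sin p in e1 e2 cp *.
set a' := cos q in e1 e2 cq *; set b' := sin q in e1 e2 cq *.
have : (b' * a - a' * b) ^+ 2 = 0.
  have -> : (b' * a - a' * b) ^+ 2 = ((a ^+2 + b ^+2) * (a'^+2 + b'^+2)
     - ((a * a - b * b) * (a' * a' - b' * b') + (a * b + b * a) * (a' * b' + b' * a'))) / 2.
    by field.
  rewrite cp cq e1 e2.
  have -> : (a' * a' - b' * b') * (a' * a' - b' * b') +
    (a' * b' + b' * a') * (a' * b' + b' * a') = (a' ^+2 + b' ^+2) ^+2 by ring.
  by rewrite cq; field.
by move/eqP; rewrite sqrf_eq0 => /eqP ->; rewrite ltxx.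
Qed.

Section Point.
Context (R : realType) (d : nat) (x y c1 c2 : R).
Hypothesis c1c2 : c1 ^+ 2 + c2 ^+ 2 = 1.
Hypothesis xy0 : x ^+ 2 + y ^+ 2 != 0.
Let Z := x +i* y.
Let Zb := x -i* y.
Let E := c1 +i* c2.
Let yi i := wall_unit R d i ^+ 2.

Lemma point_Zb_neq0 : Zb != 0.
Proof.
apply: contraNneq xy0 => -[-> /eqP]; rewrite oppr_eq0 => /eqP ->.
by rewrite expr0n addr0.
Qed.

Lemma point_E_neq0 : E != 0.
Proof.
apply/eqP => -[e1 e2]; move: c1c2; rewrite e1 e2 expr0n addr0 => /esym/eqP.
by rewrite oner_eq0.
Qed.

(** For a unit complex number u, z - u^2 conj z = 2 i u Im (z / u); for the i-th wall unit this
    imaginary part is - w_i. *)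
Lemma point_dist i : Z - yi i * Zb = - (2 * 'i%C * wall_unit R d i * (wfun d i x y)%:C).
Proof.
rewrite /Z /Zb /yi /wall_unit /wfun -/(wall_angle R d i).
have := cos2Dsin2 (wall_angle R d i).
set a := cos _; set b := sin _ => ab.
rewrite -[2]/(1 + 1) expr2; simpc; apply/eqP; rewrite eq_complex /=; apply/andP; split; apply/eqP.
  have abx : (a ^+ 2 + b ^+ 2) * x = x by rewrite ab mul1r.
  by lra.
have aby : (a ^+ 2 + b ^+ 2) * y = y by rewrite ab mul1r.
by lra.
Qed.

(** The identity behind [point_dist] for the unit vector E, whose conjugate is 1 / E: the quotient
    of the two is real up to the factor E. In [point_k] the real part of E / u replaces the
    imaginary part. *)
Lemma point_t i : wfun d i x y != 0 ->
  E ^+ 2 - yi i = (Z - yi i * Zb) * E * (tcurv d i x y c1 c2)%:C.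
Proof.
move=> w0; rewrite point_dist.
have := cos2Dsin2 (wall_angle R d i).
rewrite /tcurv /wall_unit /yi /E /wall_unit.
set a := cos _; set b := sin _ => ab; set w := wfun d i x y in w0 *.
have -> : (c1 * b - c2 * a) / w = w^-1 * (c1 * b - c2 * a) by rewrite mulrC.
rewrite -[2]/(1 + 1) !expr2; simpc.
apply/eqP; rewrite eq_complex /=; apply/andP; split; apply/eqP.
  transitivity ((a ^+ 2 + b ^+ 2) * (c1 * c1 - c2 * c2)
     - (c1 ^+ 2 + c2 ^+ 2) * (a * a - b * b)).
    by rewrite ab c1c2; ring.
  by field.
transitivity ((a ^+ 2 + b ^+ 2) * (c1 * c2 + c2 * c1)
     - (c1 ^+ 2 + c2 ^+ 2) * (a * b + b * a)).
  by rewrite ab c1c2; ring.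
by field.
Qed.

Lemma point_k i : wfun d i x y != 0 ->
  E ^+ 2 + yi i = (Z - yi i * Zb) * E * ('i%C * (ncurv d i x y c1 c2)%:C).
Proof.
move=> w0; rewrite point_dist.
have := cos2Dsin2 (wall_angle R d i).
rewrite /ncurv /wall_unit /yi /E /wall_unit.
set a := cos _; set b := sin _ => ab; set w := wfun d i x y in w0 *.
have -> : (c2 * b + c1 * a) / w = w^-1 * (c2 * b + c1 * a) by rewrite mulrC.
rewrite -[2]/(1 + 1) !expr2; simpc.
apply/eqP; rewrite eq_complex /=; apply/andP; split; apply/eqP.
  transitivity ((a ^+ 2 + b ^+ 2) * (c1 * c1 - c2 * c2)
     + (c1 ^+ 2 + c2 ^+ 2) * (a * a - b * b)).
    by rewrite ab c1c2; ring.
  by field.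
transitivity ((a ^+ 2 + b ^+ 2) * (c1 * c2 + c2 * c1)
     + (c1 ^+ 2 + c2 ^+ 2) * (a * b + b * a)).
  by rewrite ab c1c2; ring.
by field.
Qed.

End Point.

Lemma bicubic_scale (A : comNzRingType) d (m : 'I_d -> nat) (k t : 'I_d -> A) (l : A) :
  bicubic m (fun i => l * k i) (fun i => l * t i) = l ^+ 3 * bicubic m k t.
Proof.
have sE (F G : 'I_d -> A) (e : A) : (forall i, F i = e * G i) ->
    \sum_i F i *+ m i = e * (\sum_i G i *+ m i).
  by move=> FG; rewrite mulr_sumr; apply: eq_bigr => i _; rewrite FG mulrnAr.
rewrite /bicubic (@sE (fun i => l * k i) k l) // (@sE (fun i => l * t i) t l) //.
rewrite (@sE (fun i => l * k i * (l * t i)) (fun i => k i * t i) (l ^+ 2)) => [|i]; last by ring.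
rewrite (@sE (fun i => (l * k i) ^+ 2) (fun i => k i ^+ 2) (l ^+ 2)) => [|i]; last by ring.
rewrite (@sE (fun i => (l * t i) ^+ 2) (fun i => t i ^+ 2) (l ^+ 2)) => [|i]; last by ring.
rewrite (@sE (fun i => l * k i * (l * t i) ^+ 2) (fun i => k i * t i ^+ 2) (l ^+ 3)) => [|i]; last by ring.
ring.
Qed.

(** The terms of degree three in [k] change sign relative to those of degree one. *)
Lemma bicubic_i (R : realType) d (m : 'I_d -> nat) (k t : 'I_d -> R) :
  bicubic m (fun i => 'i%C * (k i)%:C) (fun i => (t i)%:C) =
  'i%C * (3 * (\sum_i t i *+ m i) * (\sum_i (k i * t i) *+ m i)
    + (\sum_i k i *+ m i) * (\sum_i t i *+ m i) ^+ 2
    + (\sum_i k i *+ m i) ^+ 3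
    + 6 * (\sum_i k i *+ m i) * (\sum_i k i ^+ 2 *+ m i)
    - 3 * (\sum_i k i *+ m i) * (\sum_i t i ^+ 2 *+ m i)
    - 9 * (\sum_i (k i * t i ^+ 2) *+ m i))%:C.
Proof.
have sE (F : 'I_d -> R[i]) (G : 'I_d -> R) (e : R[i]) : (forall i, F i = e * (G i)%:C) ->
    \sum_i F i *+ m i = e * (\sum_i G i *+ m i)%:C.
  move=> FG; rewrite rmorph_sum mulr_sumr; apply: eq_bigr => i _.
  by rewrite FG rmorphMn /= mulrnAr.
have i2 : 'i%C * 'i%C = -1 :> R[i] by rewrite -expr2 sqr_i.
rewrite /bicubic (@sE (fun i => 'i%C * (k i)%:C) k 'i%C) // (@sE (fun i => (t i)%:C) t 1) => [|i]; last by rewrite mul1r.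
rewrite (@sE (fun i => 'i%C * (k i)%:C * (t i)%:C) (fun i => k i * t i) 'i%C) => [|i]; last by rewrite rmorphM /= mulrA.
rewrite (@sE (fun i => ('i%C * (k i)%:C) ^+ 2) (fun i => k i ^+ 2) (-1)) => [|i]; last first.
  by rewrite exprMn sqr_i rmorphXn.
rewrite (@sE (fun i => (t i)%:C ^+ 2) (fun i => t i ^+ 2) 1) => [|i]; last by rewrite rmorphXn /= mul1r.
rewrite (@sE (fun i => 'i%C * (k i)%:C * (t i)%:C ^+ 2) (fun i => k i * t i ^+ 2) 'i%C) => [|i]; last first.
  by rewrite rmorphM rmorphXn /= -mulrA.
set K := \sum_i k i *+ m i; set T := \sum_i t i *+ m i.
rewrite !(rmorphB, rmorphD, rmorphM, rmorphXn, rmorph_nat) /=.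
have -> : ('i%C * K%:C) ^+ 3 = - ('i%C * K%:C ^+ 3).
  by rewrite exprMn exprS sqr_i; ring.
ring.
Qed.

Section Arc.
Context (R : realType) (d : nat) (m : 'I_d -> nat) (x y c1 c2 k k1 : R -> R).
Context (a b : R).
Hypothesis ab : a < b.
Hypothesis d_gt1 : (1 < d)%N.
Hypothesis m_gt0 : forall i, (0 < m i)%N.
Hypothesis dx : forall t, a < t < b -> dder x t 1 (c1 t).
Hypothesis dy : forall t, a < t < b -> dder y t 1 (c2 t).
Hypothesis dc1 : forall t, a < t < b -> dder c1 t 1 (- k t * c2 t).
Hypothesis dc2 : forall t, a < t < b -> dder c2 t 1 (k t * c1 t).
Hypothesis c1c2 : forall t, a < t < b -> c1 t ^+ 2 + c2 t ^+ 2 = 1.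
Hypothesis w_neq0 : forall t (i : 'I_d), a < t < b -> wfun d i (x t) (y t) != 0.
Hypothesis k_neq0 : forall t, a < t < b -> k t != 0.
Let kc (t : R) (i : 'I_d) := ncurv d i (x t) (y t) (c1 t) (c2 t).
Let tc (t : R) (i : 'I_d) := tcurv d i (x t) (y t) (c1 t) (c2 t).
(** The tangential equation of a biharmonic profile where f' does not vanish, its derivative, and
    the normal equation after elimination of the second derivative of [k]. *)
Hypothesis k_sum : forall t, a < t < b -> 3 * k t = - \sum_i kc t i *+ m i.
Hypothesis k1_sum : forall t, a < t < b ->
  3 * k1 t = \sum_i (kc t i * tc t i) *+ m i - k t * \sum_i tc t i *+ m i.
Hypothesis bih : forall t, a < t < b ->
  (\sum_i tc t i *+ m i) * k1 t - 3 * k t ^+ 3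
  - 2 * k t * (\sum_i kc t i ^+ 2 *+ m i) + k t * (\sum_i tc t i ^+ 2 *+ m i)
  - \sum_i (kc t i * tc t i ^+ 2) *+ m i = 0.

Let Z t := x t +i* y t.
Let Zb t := x t -i* y t.
Let E t := c1 t +i* c2 t.
Let Y t := Z t / Zb t.
Let U t := E t ^+ 2.
Let yi (i : 'I_d) := wall_unit R d i ^+ 2.

Lemma xy_neq0 t : a < t < b -> x t ^+ 2 + y t ^+ 2 != 0.
Proof.
move=> tab; apply: contraNneq (w_neq0 (Ordinal (ltnW d_gt1)) tab) => /eqP.
rewrite paddr_eq0 ?sqr_ge0 // !sqrf_eq0 => /andP[/eqP -> /eqP ->].
by rewrite /wfun !mul0r subrr.
Qed.

Lemma arc_Zb t : a < t < b -> Zb t != 0.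
Proof. by move=> tab; apply: point_Zb_neq0; apply: xy_neq0. Qed.

Lemma arc_E t : a < t < b -> E t != 0.
Proof. by move=> tab; apply: point_E_neq0; apply: c1c2. Qed.

Lemma cderiv_near (F G : R -> R[i]) t D :
  (\forall s \near t, F s = G s) -> cderiv F t D -> cderiv G t D.
Proof.
by move=> FG [F1 F2]; split; [apply: dder_near F1|apply: dder_near F2];
  apply: filterS FG => s ->.
Qed.

(** The derivative of z / conj z is (z' - Y conj z') / conj z, and conj z' = 1 / E. Writing Y as z^2
    / |z|^2 reduces this to products and a real reciprocal. *)
Lemma cderiv_Y t : a < t < b ->
  cderiv Y t ((U t - Y t) / (Zb t * E t)).
Proof.
move=> tab.
pose r s := (x s ^+ 2 + y s ^+ 2)^-1.
have YE s : a < s < b -> Y s = Z s * Z s * (r s)%:C.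
  move=> sab; rewrite /Y; apply: (mulIf (arc_Zb sab)); rewrite divfK ?arc_Zb //.
  have -> : Z s * Z s * (r s)%:C * Zb s = Z s * (Z s * Zb s * (r s)%:C) by ring.
  have -> : Z s * Zb s = (x s ^+ 2 + y s ^+ 2)%:C.
    by rewrite /Z /Zb; simpc; apply/eqP; rewrite eq_complex /=;
      apply/andP; split; apply/eqP; ring.
  by rewrite -rmorphM /= divff ?xy_neq0 // mulr1.
have dZ : cderiv Z t (E t) by apply: cderiv_pair; [exact: dx|exact: dy].
have dr : dder r t 1 (- (2 * x t * c1 t + 2 * y t * c2 t) * r t ^+ 2).
  apply: dder_eq (@dderV R R _ (fun s => x s ^+ 2 + y s ^+ 2) t _ (xy_neq0 tab) (dderD (dder_pow 2 (dx tab)) (dder_pow 2 (dy tab)))) _.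
  by rewrite /r /= exprVn !expr1.
apply: cderiv_near (_ : \forall s \near t, Z s * Z s * (r s)%:C = Y s) _.
  by near=> s; rewrite YE //; near: s; exact: near_itvoo.
apply: cderiv_eq (cderivM (cderivM dZ dZ) (cderiv_real dr)).
have Zb0 := arc_Zb tab; have E0 := arc_E tab.
have rE : (r t)%:C = (Z t * Zb t)^-1.
  have -> : Z t * Zb t = (x t ^+ 2 + y t ^+ 2)%:C.
    by rewrite /Z /Zb; simpc; apply/eqP; rewrite eq_complex /=;
      apply/andP; split; apply/eqP; ring.
  by rewrite /r fmorphV.
pose Eb := c1 t -i* c2 t.
have EEb : E t * Eb = 1.
  rewrite /E /Eb; simpc; apply/eqP; rewrite eq_complex /=; apply/andP; split; apply/eqP.
    by rewrite -(c1c2 tab); ring.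
  by ring.
have ZE : (2 * x t * c1 t + 2 * y t * c2 t)%:C = Z t * Eb + Zb t * E t.
  rewrite /E /Eb /Z /Zb; simpc; apply/eqP; rewrite eq_complex /=; apply/andP; split; apply/eqP.
    by ring.
  by ring.
have Z0 : Z t != 0.
  apply/eqP => e; have := xy_neq0 tab; case: e => -> ->.
  by rewrite expr0n addr0 eqxx.
rewrite rmorphM rmorphN rmorphXn /= ZE rE /Y /U.
have Eb0 : Eb != 0.
  by apply: contra_eq_neq EEb => ->; rewrite mulr0 eq_sym oner_neq0.
have -> : E t = Eb^-1 by apply: (mulIf Eb0); rewrite EEb mulVf.
by field; rewrite Zb0 Z0 Eb0.
Unshelve. all: by end_near. Qed.

Lemma cderiv_U t : a < t < b -> cderiv U t (2 * 'i%C * (k t)%:C * U t).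
Proof.
move=> tab.
have dE : cderiv E t ('i%C * (k t)%:C * E t).
  apply: cderiv_eq (cderiv_pair (dc1 tab) (dc2 tab)).
  by rewrite /E; simpc.
rewrite (_ : U = fun s => E s * E s); last by apply/funext => s; rewrite /U expr2.
apply: cderiv_eq (cderivM dE dE); ring.
Qed.

Lemma arc_wall t i : a < t < b ->
  (U t - yi i = (Y t - yi i) * (Zb t * E t) * (tc t i)%:C) *
  (U t + yi i = (Y t - yi i) * (Zb t * E t) * ('i%C * (kc t i)%:C)).
Proof.
move=> tab; have Zb0 := arc_Zb tab.
have e : (Y t - yi i) * (Zb t * E t) = (Z t - yi i * Zb t) * E t.
  by rewrite /Y; field.
split; rewrite e.
  exact: (point_t (c1c2 tab) (w_neq0 i tab)).
exact: (point_k (c1c2 tab) (w_neq0 i tab)).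
Qed.

Let I (H : {poly {poly R[i]}}) := forall t, a < t < b -> ev2 H (Y t) (U t) = 0.

Lemma arc_biharmonic : I (biharmonic_poly m yi).
Proof.
move=> t tab; rewrite ev2_rmorph /biharmonic_poly rmorph_bicubic.
pose l := (wall_poly yi).[Y t] * (Zb t * E t).
have cw i : (cowall_poly yi i).[Y t] * (Y t - yi i) = (wall_poly yi).[Y t].
  by rewrite -(cowallM yi i) hornerM !hornerE.
rewrite (_ : _ \o kap yi = fun i => l * ('i%C * (kc t i)%:C)); last first.
  apply/funext => i; rewrite /kap -[LHS]/(ev2 _ _ _) ev2M ev2D ev2X !ev2C hornerC.
  by rewrite arc_wall // /l -(cw i); ring.
rewrite (_ : _ \o tau yi = fun i => l * (tc t i)%:C); last first.
  apply/funext => i; rewrite /tau -[LHS]/(ev2 _ _ _) ev2M ev2D ev2N ev2X !ev2C hornerC.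
  by rewrite arc_wall // /l -(cw i); ring.
rewrite bicubic_scale bicubic_i.
have := bih tab; have := k_sum tab; have := k1_sum tab.
set T := \sum_i tc t i *+ m i; set K := \sum_i kc t i *+ m i.
set Q := \sum_i (kc t i * tc t i) *+ m i.
set A := \sum_i kc t i ^+ 2 *+ m i; set B := \sum_i tc t i ^+ 2 *+ m i.
set D := \sum_i (kc t i * tc t i ^+ 2) *+ m i.
move=> e1 e2 e3.
have -> : K = - (3 * k t) by rewrite e2 opprK.
have -> : Q = 3 * k1 t + k t * T by rewrite e1 subrK.
have -> : 3 * T * (3 * k1 t + k t * T) + - (3 * k t) * T ^+ 2 +
    (- (3 * k t)) ^+ 3 + 6 * - (3 * k t) * A - 3 * - (3 * k t) * B - 9 * D = 0.
  rewrite -[RHS](mulr0 9) -e3; ring.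
by rewrite rmorph0 !mulr0.
Qed.

(** Once the curvature is eliminated by [k_sum], [flow] is 3 [wall_poly] conj z E times the
    derivative of H (Y, U) along the arc. *)
Lemma arc_flow H : I H -> I (flow m yi H).
Proof.
move=> IH t tab; have Zb0 := arc_Zb tab; have E0 := arc_E tab.
have := cderiv_poly2 H (cderiv_Y tab) (cderiv_U tab).
move=> /cderiv_near0 e; rewrite /flow.
have {}e : ev2 (map_poly deriv H) (Y t) (U t) * ((U t - Y t) / (Zb t * E t)) +
   ev2 H^`() (Y t) (U t) * (2 * 'i%C * (k t)%:C * U t) = 0.
  by apply: e; near=> s; apply: IH; near: s; apply: near_itvoo.
pose P := (wall_poly yi).[Y t].
have eAB : (residue_poly m yi).[Y t] * U t + (residue_poly' m yi).[Y t] =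
   - (3 * 'i%C * (k t)%:C * P * (Zb t * E t)).
  rewrite !horner_sum mulr_suml -big_split /=.
  have -> : - (3 * 'i%C * (k t)%:C * P * (Zb t * E t)) =
     P * (Zb t * E t) * 'i%C * (\sum_i kc t i *+ m i)%:C.
    by rewrite -[\sum_i _]opprK -k_sum // rmorphN rmorphM rmorph_nat /=; ring.
  rewrite rmorph_sum mulr_sumr; apply: eq_bigr => i _.
  rewrite rmorphMn /= !hornerZ.
  have -> : (m i)%:R * (cowall_poly yi i).[Y t] * U t +
      (m i)%:R * yi i * (cowall_poly yi i).[Y t] =
    (m i)%:R * ((cowall_poly yi i).[Y t] * (U t + yi i)) by ring.
  rewrite arc_wall // -[_%:C *+ m i]mulr_natl /P -(cowallM yi i) hornerM hornerXsubC.
  ring.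
rewrite ev2D ev2N !ev2M !ev2D ev2N !ev2M !ev2C !ev2X hornerX hornerM -/P.
rewrite eAB.
have -> : (3 : {poly R[i]}).[Y t] = 3 by rewrite -polyC_natr hornerC.
rewrite !(hornerC (1 : R[i])) .
rewrite -[RHS](mulr0 (3 * P * (Zb t * E t))) -e; field.
by rewrite Zb0 E0.
Unshelve. all: by end_near. Qed.

(** If Y were constant, the vanishing of its derivative would give U = Y, so the direction of the
    arc would be constant too, against [k_neq0]. *)
Lemma Y_not_const t y0 : a < t < b -> ~ (\forall s \near t, Y s = y0).
Proof.
move=> tab Y0.
have UY : \forall s \near t, U s = y0.
  have [p [q [tpq pq]]] := nbhs_itvoo Y0.
  near=> s.
  have sab : a < s < b by near: s; exact: near_itvoo.
  have spq : p < s < q by near: s; exact: near_itvoo.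
  have : (U s - Y s) / (Zb s * E s) = 0.
    have := cderiv_Y sab.
    have : \forall r \near s, Y r - y0 = 0.
      by near=> r; rewrite pq ?subrr //; near: r; exact: near_itvoo.
    move=> h1 h2; apply: cderiv_near0 h1 _.
    by apply: cderiv_eq (cderivD h2 (cderiv_cst _ s)); rewrite addr0.
  move/eqP; rewrite mulf_eq0 invr_eq0 mulf_eq0 (negbTE (arc_Zb sab)).
  by rewrite (negbTE (arc_E sab)) !orbF subr_eq0 pq // => /eqP.
have : 2 * 'i%C * (k t)%:C * U t = 0.
  have h : \forall r \near t, U r - y0 = 0 by apply: filterS UY => r ->; rewrite subrr.
  apply: cderiv_near0 h _.
  by apply: cderiv_eq (cderivD (cderiv_U tab) (cderiv_cst _ t)); rewrite addr0.
move/eqP; rewrite !mulf_eq0 pnatr_eq0 /= => /orP[/orP[]|].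
- by rewrite eq_complex /= oner_eq0 andbF.
- by rewrite eq_complex /= eqxx andbT (negbTE (k_neq0 tab)).
- by rewrite orbb (negbTE (arc_E tab)).
Unshelve. all: by end_near. Qed.

(** Where H (Y, U) does not vanish, it does not vanish nearby either, and Y would be constant
    there. *)
Lemma arc_cancel y0 (H : {poly {poly R[i]}}) : I (('X - y0%:P)%:P * H) -> I H.
Proof.
move=> IH t tab; apply/eqP/negPn/negP => nz.
have h := cderiv_neq0 (cderiv_poly2 H (cderiv_Y tab) (cderiv_U tab)) nz.
apply: (@Y_not_const t y0 tab); near=> s.
have sab : a < s < b by near: s; exact: near_itvoo.
have := IH s sab; rewrite ev2M ev2C !hornerE => /eqP.
rewrite mulf_eq0 subr_eq0 => /orP[/eqP//|/eqP e].
have : ev2 H (Y s) (U s) != 0 by near: s.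
by rewrite e eqxx.
Unshelve. all: by end_near. Qed.

Lemma arc_const (c : {poly R[i]}) : I c%:P -> c = 0.
Proof.
have [n] := ubnP (size c); elim: n c => // n IHn c szc Ic.
have [t tab] : exists t, a < t < b by exists ((a + b) / 2); rewrite !midf_lt.
have [/eqP/eqP sz1|sz1] := boolP (size c == 1%N).
  have [e e0 ce] := size_poly1P _ (introT eqP (eqP sz1)).
  have := Ic t tab; rewrite ev2C ce hornerC => e00.
  by rewrite e00 polyC0.
have [y0 ry0] := closed_rootP _ sz1.
have /factor_theorem [c1' ec] := ry0.
have Ic1 : I c1'%:P.
  by apply: (@arc_cancel y0); rewrite -polyCM mulrC -ec.
have [c1'0|c10] := eqVneq c1' 0; first by rewrite ec c1'0 mul0r.
suff c1'0 : c1' = 0 by rewrite ec c1'0 mul0r.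
apply: IHn => //; move: szc.
by rewrite ec size_Mmonic ?monicXsubC // size_XsubC addn2 /=.
Qed.

Lemma no_biharmonic_arc : False.
Proof.
have y_neq0 i : yi i != 0.
  rewrite /yi expf_neq0 //; apply/eqP => -[e1 e2].
  have := cos2Dsin2 (wall_angle R d i); rewrite e1 e2 expr0n addr0 => /esym/eqP.
  by rewrite oner_eq0.
apply: (@no_invariant_curve _ d m yi m_gt0 (@wall_unit_inj R d) y_neq0 I
  _ _ arc_cancel arc_flow arc_const arc_biharmonic
  (Ordinal (ltnW d_gt1)) (Ordinal d_gt1)) => //.
- by move=> p q Ip Iq t tab; rewrite ev2D Ip // Iq // addr0.
- by move=> p q Iq t tab; rewrite ev2M Iq // mulr0.
Qed.

End Arc.

End ComplexArcs.

(** * The two differential equations of a biharmonic profile *)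

Lemma dderMn (R : realType) (V : normedModType R) (f : V -> R) (a v : V) (d : R) n :
  dder f a v d -> dder (fun x => f x *+ n) a v (d *+ n).
Proof.
move=> h; rewrite -[d *+ n]mulr_natl (_ : (fun x => _) = (fun x => n%:R * f x)).
  exact: dderZ.
by apply/funext => x; rewrite mulr_natl.
Qed.

Lemma derive1_dder (R : realType) (f : R -> R) (t d : R) : dder f t 1 d ->
  derive1 f t = d.
Proof. by move=> h; rewrite derive1E; apply: dderE. Qed.

Section Planar.
Context (R : realType) (d : nat) (m : 'I_d -> nat).
Context (x y c1 c2 k k1 k2 : R -> R) (a b : R).
Hypothesis d_gt0 : (0 < d)%N.
Hypothesis m_gt0 : forall i, (0 < m i)%N.
Hypothesis dx : forall t, a < t < b -> dder x t 1 (c1 t).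
Hypothesis dy : forall t, a < t < b -> dder y t 1 (c2 t).
Hypothesis dc1 : forall t, a < t < b -> dder c1 t 1 (- k t * c2 t).
Hypothesis dc2 : forall t, a < t < b -> dder c2 t 1 (k t * c1 t).
Hypothesis dk : forall t, a < t < b -> dder k t 1 (k1 t).
Hypothesis dk1 : forall t, a < t < b -> dder k1 t 1 (k2 t).
Hypothesis unit_speed : forall t, a < t < b -> c1 t ^+ 2 + c2 t ^+ 2 = 1.
Hypothesis w_neq0 : forall t (i : 'I_d), a < t < b -> wfun d i (x t) (y t) != 0.

Let kc t (i : 'I_d) := ncurv d i (x t) (y t) (c1 t) (c2 t).
Let tc t (i : 'I_d) := tcurv d i (x t) (y t) (c1 t) (c2 t).
Let S t := \sum_i kc t i *+ m i.
Let T t := \sum_i tc t i *+ m i.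
Let Q t := \sum_i (kc t i * tc t i) *+ m i.
Let K2 t := \sum_i kc t i ^+ 2 *+ m i.
Let T2 t := \sum_i tc t i ^+ 2 *+ m i.
Let KT2 t := \sum_i (kc t i * tc t i ^+ 2) *+ m i.
Context (n1 : R).
Hypothesis n1_neq0 : n1 != 0.
(** [f] is the mean curvature; [f1] and [f2] are its derivatives, computed from k_i' = (k - k_i) t_i
    and t_i' = - k k_i - t_i^2. *)
Let f t := (k t + S t) / n1.
Let f1 t := (k1 t + (k t * T t - Q t)) / n1.
Let f2 t := (k2 t + (k1 t * T t + k t * (- k t * S t - T2 t)
  - (k t * T2 t - KT2 t + (- k t * K2 t - KT2 t)))) / n1.

Lemma planar_w t i : a < t < b ->
  dder (fun t => wfun d i (x t) (y t)) t 1
    (c1 t * sin (wall_angle R d i) - c2 t * cos (wall_angle R d i)).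
Proof.
move=> tab; apply: dder_eq (dderB (dderM (dx tab) (dder_cst _ _ _))
  (dderM (dy tab) (dder_cst _ _ _))) _.
by rewrite !mulr0 !addr0.
Qed.

Lemma planar_kc t i : a < t < b -> dder (kc^~ i) t 1 ((k t - kc t i) * tc t i).
Proof.
move=> tab; have [d1 d2] := (dc1 tab, dc2 tab).
apply: dder_eq (dder_div
  (dderD (dderM d2 (dder_cst _ _ _)) (dderM d1 (dder_cst _ _ _))) (planar_w i tab) (w_neq0 i tab)) _.
by rewrite /kc /tc /ncurv /tcurv; field; apply: w_neq0.
Qed.

Lemma planar_tc t i : a < t < b ->
  dder (tc^~ i) t 1 (- k t * kc t i - tc t i ^+ 2).
Proof.
move=> tab; have [d1 d2] := (dc1 tab, dc2 tab).
apply: dder_eq (dder_div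
  (dderB (dderM d1 (dder_cst _ _ _)) (dderM d2 (dder_cst _ _ _))) (planar_w i tab) (w_neq0 i tab)) _.
by rewrite /kc /tc /ncurv /tcurv; field; apply: w_neq0.
Qed.

Lemma sumMn_lin (F G : 'I_d -> R) (e : R) :
  \sum_i (e * F i + G i) *+ m i = e * (\sum_i F i *+ m i) + \sum_i G i *+ m i.
Proof.
rewrite mulr_sumr -big_split /=; apply: eq_bigr => i _.
by rewrite mulrnDl mulrnAr.
Qed.

Lemma sumMn_N (F : 'I_d -> R) :
  \sum_i (- F i) *+ m i = - \sum_i F i *+ m i.
Proof. by rewrite -sumrN; apply: eq_bigr => i _; rewrite mulNrn. Qed.

Lemma sumMn_dder (F : R -> 'I_d -> R) (G : 'I_d -> R) t :
  (forall i, dder (F^~ i) t 1 (G i)) ->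
  dder (fun s => \sum_i F s i *+ m i) t 1 (\sum_i G i *+ m i).
Proof. by move=> h; apply: dder_sum => i _; apply: dderMn. Qed.

Lemma planar_S t : a < t < b -> dder S t 1 (k t * T t - Q t).
Proof.
move=> tab; apply: dder_eq (@sumMn_dder kc _ _ (fun i => planar_kc i tab)) _.
rewrite /T /Q -sumMn_N -sumMn_lin; apply: eq_bigr => i _; congr (_ *+ _); ring.
Qed.

Lemma planar_T t : a < t < b -> dder T t 1 (- k t * S t - T2 t).
Proof.
move=> tab; apply: dder_eq (@sumMn_dder tc _ _ (fun i => planar_tc i tab)) _.
by rewrite /S /T2 -sumMn_N -sumMn_lin.
Qed.

Lemma planar_Q t : a < t < b ->
  dder Q t 1 (k t * T2 t - KT2 t + (- k t * K2 t - KT2 t)).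
Proof.
move=> tab; apply: dder_eq (@sumMn_dder (fun s i => kc s i * tc s i) _ _
  (fun i => dderM (planar_kc i tab) (planar_tc i tab))) _.
rewrite /T2 /KT2 /K2 -sumMn_N -!sumMn_lin -big_split /=.
by apply: eq_bigr => i _; rewrite -mulrnDl; congr (_ *+ _); ring.
Qed.

Lemma planar_f t : a < t < b -> dder f t 1 (f1 t).
Proof.
move=> tab; apply: dder_eq (dderM (dderD (dk tab) (planar_S tab)) (dder_cst _ n1^-1 _)) _.
by rewrite mulr0 addr0.
Qed.

Lemma planar_f1 t : a < t < b -> dder f1 t 1 (f2 t).
Proof.
move=> tab; apply: dder_eq (dderM (dderD (dk1 tab) (dderB (dderM (dk tab)
  (planar_T tab)) (planar_Q tab))) (dder_cst _ n1^-1 _)) _.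
by rewrite mulr0 addr0.
Qed.

(** The field (F1, F2) is [f] times the unit normal of the profile. The sums subtracted in [ode1]
    and [ode2] are minus the Hessian of the logarithm of the orbit volume applied to this field. *)
Let F1 t := f t * - c2 t.
Let F2 t := f t * c1 t.
Let gF t (i : 'I_d) := (F1 t * sin (wall_angle R d i) - F2 t * cos (wall_angle R d i))
  / wfun d i (x t) (y t).
Hypothesis ode1 : forall t, a < t < b -> derive1n 2 F1 t + T t * derive1 F1 t
  - \sum_i (gF t i * (sin (wall_angle R d i) / wfun d i (x t) (y t))) *+ m i = 0.
Hypothesis ode2 : forall t, a < t < b -> derive1n 2 F2 t + T t * derive1 F2 t
  - \sum_i (gF t i * (- cos (wall_angle R d i) / wfun d i (x t) (y t))) *+ m i = 0.

Lemma planar_F1 t : a < t < b -> dder F1 t 1 (f1 t * - c2 t - f t * (k t * c1 t)).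
Proof.
move=> tab; have d2 := dc2 tab.
by apply: dder_eq (dderM (planar_f tab) (dderN d2)) _; rewrite /= [f t * - _]mulrN.
Qed.

Lemma planar_F2 t : a < t < b -> dder F2 t 1 (f1 t * c1 t + f t * (- k t * c2 t)).
Proof. by move=> tab; have d1 := dc1 tab; apply: dderM (planar_f tab) d1. Qed.

Lemma derive1n2_dder (F G : R -> R) (t e : R) : a < t < b ->
  (forall s, a < s < b -> dder F s 1 (G s)) -> dder G t 1 e -> derive1n 2 F t = e.
Proof.
move=> tab FG Ge; rewrite derive1nS; apply: derive1_dder; apply: dder_near Ge.
near=> s; rewrite derive1n1; apply/esym/derive1_dder/FG.
by near: s; exact: near_itvoo.
Unshelve. all: by end_near. Qed.

Lemma dder2_derive1 (F G : R -> R) (t e : R) : a < t < b ->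
  (forall s, a < s < b -> dder F s 1 (G s)) -> dder G t 1 e ->
  dder F t 1 (derive1 F t) /\ dder (derive1 F) t 1 (derive1n 2 F t).
Proof.
move=> tab FG Ge; split; first by rewrite (derive1_dder (FG t tab)); apply: FG.
rewrite (derive1n2_dder tab FG Ge); apply: dder_near Ge.
near=> s; apply/esym/derive1_dder/FG.
by near: s; exact: near_itvoo.
Unshelve. all: by end_near. Qed.

Lemma planar_dder2_F1 t : a < t < b ->
  dder F1 t 1 (derive1 F1 t) /\ dder (derive1 F1) t 1 (derive1n 2 F1 t).
Proof.
move=> tab; have [d1 d2] := (dc1 tab, dc2 tab).
exact: (dder2_derive1 tab planar_F1 (dderB (dderM (planar_f1 tab) (dderN d2))
   (dderM (planar_f tab) (dderM (dk tab) d1)))).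
Qed.

Lemma planar_dder2_F2 t : a < t < b ->
  dder F2 t 1 (derive1 F2 t) /\ dder (derive1 F2) t 1 (derive1n 2 F2 t).
Proof.
move=> tab; have [d1 d2] := (dc1 tab, dc2 tab).
exact: (dder2_derive1 tab planar_F2 (dderD (dderM (planar_f1 tab) d1)
   (dderM (planar_f tab) (dderM (dderN (dk tab)) d2)))).
Qed.

(** The vector equation is projected onto the normal (- c2, c1) and onto the tangent (c1, c2). *)
Lemma planar_odes t : a < t < b ->
  [/\ f2 t - f t * k t ^+ 2 + T t * f1 t - f t * K2 t = 0 &
      - 2 * f1 t * k t - f t * k1 t - T t * f t * k t + f t * Q t = 0].
Proof.
move=> tab; have [d1 d2] := (dc1 tab, dc2 tab).
have := ode1 tab; have := ode2 tab.
rewrite (derive1_dder (planar_F1 tab)) (derive1_dder (planar_F2 tab)).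
rewrite (derive1n2_dder tab planar_F1 (dderB (dderM (planar_f1 tab) (dderN d2))
   (dderM (planar_f tab) (dderM (dk tab) d1)))).
rewrite (derive1n2_dder tab planar_F2 (dderD (dderM (planar_f1 tab) d1)
   (dderM (planar_f tab) (dderM (dderN (dk tab)) d2)))).
set A2 := \sum_i _; set A1 := \sum_i _ => e2 e1.
have eN : c2 t * A1 - c1 t * A2 = - (f t * K2 t).
  rewrite /A1 /A2 /K2 !mulr_sumr -sumrB -sumrN; apply: eq_bigr => i _.
  rewrite !mulrnAr -mulrnBl -mulNrn; congr (_ *+ _).
  rewrite /gF /F1 /F2 /kc /ncurv; field; exact: w_neq0.
have eT : c1 t * A1 + c2 t * A2 = - (f t * Q t).
  rewrite /A1 /A2 /Q !mulr_sumr -big_split -sumrN; apply: eq_bigr => i _.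
  rewrite /= !mulrnAr -mulrnDl -mulNrn; congr (_ *+ _).
  rewrite /gF /F1 /F2 /kc /ncurv /tc /tcurv; field; exact: w_neq0.
have u := unit_speed tab.
split.
  transitivity ((c1 t ^+ 2 + c2 t ^+ 2) * (f2 t - f t * k t ^+ 2 + T t * f1 t) - f t * K2 t).
    by rewrite u; ring.
  have := congr1 ( *%R (c1 t)) e2; have := congr1 ( *%R (c2 t)) e1.
  by move: eN; clear; move: (c1 t) (c2 t) (k t) (k1 t) (f t) (f1 t) (f2 t) (T t) (K2 t) A1 A2 => *; lra.
transitivity ((c1 t ^+ 2 + c2 t ^+ 2) * (- 2 * f1 t * k t - f t * k1 t - T t * f t * k t)
   + f t * Q t); first by rewrite u; ring.
have := congr1 ( *%R (c2 t)) e2; have := congr1 ( *%R (c1 t)) e1.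
by move: eT; clear; move: (c1 t) (c2 t) (k t) (k1 t) (f t) (f1 t) (f2 t) (T t) (Q t) A1 A2 => *; lra.
Qed.

(** By the formula for n1 f', the last three terms of the tangential equation add up to - f n1 f',
    so that f' factors out. *)
Lemma planar_tangential t : a < t < b -> f1 t * (2 * k t + n1 * f t) = 0.
Proof.
move=> /planar_odes[_ e].
have e1 : n1 * f1 t = k1 t + (k t * T t - Q t) by rewrite /f1 mulrC divfK ?n1_neq0.
have -> : f1 t * (2 * k t + n1 * f t) = 2 * f1 t * k t + f t * (n1 * f1 t) by ring.
by rewrite e1 -[RHS]oppr0 -e; ring.
Qed.

(* [f' <> 0] is impossible: then [n1 f = - 2 k], so the arc is one of those
   excluded by [no_biharmonic_arc]. *)
Lemma planar_f1_eq0 t : a < t < b -> f1 t = 0.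
Proof.
move=> tab; apply/eqP/negPn/negP => f10.
have near_f1 : \forall s \near t, a < s < b /\ f1 s != 0.
  near=> s; split; first by near: s; exact: near_itvoo.
  by near: s; apply: dder1_neq0 f10; exact: planar_f1.
have [p [q [tpq Hpq]]] := nbhs_itvoo near_f1.
have kf s : p < s < q -> 3 * k s = - S s.
  move=> spq; have [sab f1s] := Hpq s spq.
  have := planar_tangential sab => /eqP; rewrite mulf_eq0 (negbTE f1s) /=.
  rewrite /f [n1 * _]mulrC divfK ?n1_neq0 // => /eqP e; lra.
have kk1 s : p < s < q -> 3 * k1 s = Q s - k s * T s.
  move=> spq; have [sab f1s] := Hpq s spq.
  apply: (dder_uniq (dderZ 3 (dk sab))).
  apply: dder_near (dder_eq (dderN (planar_S sab)) _); last by ring.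
  by near=> r; rewrite kf //; near: r; exact: near_itvoo.
have kk2 s : p < s < q -> 3 * k2 s = (k s * T2 s - KT2 s + (- k s * K2 s - KT2 s))
    - (k1 s * T s + k s * (- k s * S s - T2 s)).
  move=> spq; have [sab f1s] := Hpq s spq.
  apply: (dder_uniq (dderZ 3 (dk1 sab))).
  apply: dder_near (dderB (planar_Q sab) (dderM (dk sab) (planar_T sab))).
  by near=> r; rewrite kk1 //; near: r; exact: near_itvoo.
have f1E s : p < s < q -> f1 s = - 2 / n1 * k1 s.
  by move=> spq; rewrite /f1 -[k s * T s - Q s]opprB -kk1 //; field; exact: n1_neq0.
have bih s : p < s < q -> T s * k1 s - 3 * k s ^+ 3 - 2 * k s * K2 s + k s * T2 s
    - KT2 s = 0.
  move=> spq; have [sab f1s] := Hpq s spq; have [e _] := planar_odes sab.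
  have fE : f s = - 2 / n1 * k s.
    by rewrite /f -[S s]opprK -kf //; field; exact: n1_neq0.
  have f2E : f2 s = - 2 / n1 * k2 s.
    rewrite /f2 (_ : _ - _ = - (3 * k2 s)); first by field; exact: n1_neq0.
    by rewrite kk2 //; ring.
  move: e; rewrite fE f2E f1E // => e.
  have {}e : k2 s - k s * k s ^+ 2 + T s * k1 s - k s * K2 s = 0.
    have nz : - 2 / n1 != 0 by rewrite mulf_neq0 ?invr_eq0 ?n1_neq0 // oppr_eq0 pnatr_eq0.
    by apply: (mulfI nz); rewrite mulr0 -e; ring.
  have SE : S s = - (3 * k s) by rewrite kf // opprK.
  have := kk2 s spq; rewrite SE => e'.
  have e'' : 3 * (k2 s - k s * k s ^+ 2 + T s * k1 s - k s * K2 s) = 0 by rewrite e mulr0.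
  move: e' e''; move: (k s) (k1 s) (k2 s) (T s) (K2 s) (T2 s) (KT2 s) => *; lra.
(* [k] cannot vanish identically, for then [f1 = - 2 / n1 * k1] would vanish at t. *)
have [s0 [s0pq ks0]] : exists s, p < s < q /\ k s != 0.
  apply: contrapT => none.
  have k0 s : p < s < q -> k s = 0.
    by move=> spq; apply/eqP/negPn/negP => ks; apply: none; exists s.
  have : k1 t = 0.
    apply: dder_uniq (dk tab) _; apply: dder_near (dder_cst _ 0 _).
    by near=> r; rewrite k0 //; near: r; exact: near_itvoo.
  by move=> k10; move: f10; rewrite f1E // k10 mulr0 eqxx.
have [s0ab _] := Hpq s0 s0pq.
have near_k : \forall s \near s0, p < s < q /\ k s != 0.
  near=> s; split; first by near: s; exact: near_itvoo.
  by near: s; apply: dder1_neq0 ks0; exact: dk.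
have [p' [q' [s0pq' Hpq']]] := nbhs_itvoo near_k.
have pq' : p' < q' by case/andP: s0pq' => h1 h2; exact: lt_trans h1 h2.
have inab s : p' < s < q' -> a < s < b.
  by move=> /Hpq'[/Hpq[]].
have [d1|d1] := leqP d 1; last first.
  apply: (@no_biharmonic_arc R d m x y c1 c2 k k1 p' q') => //.
  - by move=> s /inab sab; exact: dx.
  - by move=> s /inab sab; exact: dy.
  - by move=> s /inab sab; exact: dc1.
  - by move=> s /inab sab; exact: dc2.
  - by move=> s /inab sab; exact: unit_speed.
  - by move=> s i /inab sab; exact: w_neq0.
  - by move=> s /Hpq'[].
  - by move=> s /Hpq'[spq _]; rewrite kf.
  - by move=> s /Hpq'[spq _]; rewrite kk1.
  - by move=> s /Hpq'[spq _]; rewrite bih.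
(* With a single wall, at angle 0, [no_biharmonic_arc] does not apply. The equations reduce to a
   quadratic relation with constant coefficients between c1 and c2; its derivative forces c2 = 0,
   and then the relation forces c1 = 0. *)
have ed : d = 1%N by apply/eqP; rewrite eqn_leq d1 d_gt0.
pose i0 := Ordinal d_gt0.
have uniqi (F : 'I_d -> R) : \sum_i F i *+ m i = (m i0)%:R * F i0.
  rewrite (bigD1 i0) //= big1 ?addr0 ?mulr_natl // => i; rewrite -val_eqE /=.
  have := ltn_ord i; rewrite [X in (_ < X)%N]ed ltnS leqn0 => /eqP ->.
  by rewrite eqxx.
set mm : R := (m i0)%:R in uniqi.
have m0 : mm != 0 by rewrite pnatr_eq0 -lt0n.
have quad s : p' < s < q' ->
    c1 s != 0 /\ (mm ^+ 2 - 9) * c2 s ^+ 2 + (mm ^+ 2 + 6 * mm) * c1 s ^+ 2 = 0.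
  move=> spq'; have [spq ks] := Hpq' s spq'; have sab := inab s spq'.
  have := bih s spq; have := kk1 s spq; have := kf s spq.
  rewrite /T /S /K2 /T2 /KT2 /Q !uniqi => e1 e2 e3.
  have w0 := w_neq0 i0 sab.
  have kcE : kc s i0 = c1 s / wfun d i0 (x s) (y s).
    by rewrite /kc /ncurv /wall_angle /= !mul0r sin0 cos0; ring.
  have tcE : tc s i0 = - c2 s / wfun d i0 (x s) (y s).
    by rewrite /tc /tcurv /wall_angle /= !mul0r sin0 cos0; ring.
  have kc0 : kc s i0 != 0.
    apply: contraNneq ks => kc0; rewrite kc0 mulr0 oppr0 in e1.
    by move/eqP: e1; rewrite mulf_eq0 pnatr_eq0.
  split; first by apply: contraNneq kc0 => c10; rewrite kcE c10 mul0r.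
  have kE : k s = - (mm * kc s i0) / 3 by lra.
  have k1E : k1 s = (mm * (kc s i0 * tc s i0) - k s * (mm * tc s i0)) / 3 by lra.
  have : mm * kc s i0 * ((mm ^+ 2 - 9) * tc s i0 ^+ 2 + (mm ^+ 2 + 6 * mm) * kc s i0 ^+ 2) = 0.
    by rewrite -[RHS](mulr0 9) -e3 k1E kE; field.
  move/eqP; rewrite mulf_eq0 [mm * kc s i0 == 0]mulf_eq0 (negbTE m0) (negbTE kc0) /=.
  move/eqP; rewrite kcE tcE => e.
  rewrite -[RHS](mulr0 (wfun d i0 (x s) (y s) ^+ 2)) -e; field; exact: w0.
have s0ab' := inab _ s0pq'.
have [d1' d2'] := (dc1 s0ab', dc2 s0ab').
have [c10 q0] := quad _ s0pq'; have [_ ks0'] := Hpq' _ s0pq'.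
have : (mm ^+ 2 - 9) * (2%:R * c2 s0 ^+ 1 * (k s0 * c1 s0)) +
   (mm ^+ 2 + 6 * mm) * (2%:R * c1 s0 ^+ 1 * (- k s0 * c2 s0)) = 0.
  apply: dder_uniq (dderD (dderZ _ (dder_pow 2 d2')) (dderZ _ (dder_pow 2 d1'))) _.
  apply: dder_near (dder_cst _ 0 _).
  near=> s; have [] // := quad s _; near: s; exact: near_itvoo.
have m9 : 6 * mm + 9 != 0 by rewrite /mm -natrM -natrD pnatr_eq0 addn_eq0 andbF.
rewrite !expr1 => e.
have : (6 * mm + 9) * (k s0 * (c1 s0 * c2 s0)) = 0 by lra.
move/eqP; rewrite !mulf_eq0 (negbTE m9) (negbTE ks0') (negbTE c10) /= => /eqP c20.
move: q0; rewrite c20 expr0n mulr0 add0r => /eqP.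
have -> : mm ^+ 2 + 6 * mm = mm * (mm + 6) by ring.
rewrite !mulf_eq0 (negbTE m0) (negbTE c10) !orbF /=.
by rewrite /mm -natrD pnatr_eq0 addn_eq0 andbF.
Unshelve. all: by end_near. Qed.

(** As f' = 0, the normal equation becomes f (k^2 + sum m_i k_i^2) = 0; if the second factor
    vanishes, so do [k] and all the k_i, and their sum is zero as well. *)
Theorem planar_biharmonic t : a < t < b -> k t + S t = 0.
Proof.
move=> tab; have [e _] := planar_odes tab.
have f20 : f2 t = 0.
  apply: dder_uniq (planar_f1 tab) _; apply: dder_near (dder_cst _ 0 _).
  by near=> s; rewrite planar_f1_eq0 //; near: s; exact: near_itvoo.
move: e; rewrite f20 planar_f1_eq0 // mulr0 addr0 sub0r -opprD -mulrDr => /eqP.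
rewrite oppr_eq0 mulf_eq0 /f mulf_eq0 invr_eq0 (negbTE n1_neq0) orbF.
case/orP => [/eqP //|]; rewrite paddr_eq0 ?sqr_ge0 //; last first.
  by apply: sumr_ge0 => i _; rewrite mulrn_wge0 ?sqr_ge0.
rewrite sqrf_eq0 => /andP[/eqP -> /eqP K20]; rewrite add0r.
rewrite /S big1 // => i _.
have K2_ge0 j : true -> 0 <= kc t j ^+ 2 *+ m j by rewrite mulrn_wge0 ?sqr_ge0.
have := @psumr_eq0P _ _ _ _ K2_ge0 K20 i isT.
by move/eqP; rewrite mulrn_eq0 sqrf_eq0 eqn0Ngt m_gt0 /= => /eqP ->; rewrite mul0rn.
Unshelve. all: by end_near. Qed.

End Planar.

(** * Calculus in several variables *)

Lemma near_eq_differentiable (R : realType) (V W : normedModType R) (f g : V -> W) (x : V) :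
  (\forall v \near x, f v = g v) -> differentiable f x -> differentiable g x.
Proof.
move=> fg /diff_locallyP[dc fE].
have fgx : f x = g x by apply: nbhs_singleton fg.
have gE : g \o shift x = cst (g x) + 'd f x +o_ 0 id.
  apply/eqaddoP => _/posnumP[e].
  move/eqaddoP: fE => /(_ e%:num (gt0 e)) fE.
  have fg0 : \forall v \near 0, f (v + x) = g (v + x).
    have := fg; rewrite (@near_shift _ _ 0 x) => h.
    by apply: filterS h => v; rewrite /= subr0.
  near=> v; rewrite /= !fctE /= -fgx.
  have -> : g (v + x) = f (v + x) by apply/esym; near: v.
  by near: v; apply: filterS fE => v; rewrite !fctE.
apply/diff_locallyP; rewrite (diff_unique dc gE); split => //.
Unshelve. all: by end_near. Qed.

Lemma differentiable_dder (R : realType) (V : normedModType R) (f : V -> R) (a v : V) :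
  differentiable f a -> dder f a v ('D_v f a).
Proof. by move=> df; apply: dderP; apply: diff_derivable. Qed.

Lemma differentiable_near (R : realType) (V W : normedModType R) (f : V -> W) (a : V) :
  differentiable f a -> {for a, continuous f}.
Proof. exact: differentiable_continuous. Qed.

Lemma diffD_ext (R : realType) (V : normedModType R) (f g : V -> R) (a : V) :
  differentiable f a -> differentiable g a -> differentiable (fun v => f v + g v) a.
Proof. exact: differentiableD. Qed.

Lemma diffM_ext (R : realType) (V : normedModType R) (f g : V -> R) (a : V) :
  differentiable f a -> differentiable g a -> differentiable (fun v => f v * g v) a.
Proof. exact: differentiableM. Qed.

Lemma diffV_ext (R : realType) (V : normedModType R) (f : V -> R) (a : V) :
  f a != 0 -> differentiable f a -> differentiable (fun v => (f v)^-1) a.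
Proof. by move=> fa0 df; exact: (differentiableV df fa0). Qed.

Lemma diff_sum_ext (R : realType) (V : normedModType R) (I : Type) (r : seq I) (P : pred I)
    (f : I -> V -> R) (a : V) :
  (forall i, P i -> differentiable (f i) a) ->
  differentiable (fun v => \sum_(i <- r | P i) f i v) a.
Proof.
move=> h; elim: r => [|i r IH].
  rewrite (_ : (fun x => _) = cst 0); first exact: differentiable_cst.
  by apply/funext => x; rewrite big_nil.
rewrite (_ : (fun x => _) = (fun x => if P i then f i x + \sum_(i <- r | P i) f i x
   else \sum_(i <- r | P i) f i x)); last by apply/funext => x; rewrite big_cons.
by case E: (P i) => //; apply: diffD_ext => //; exact: h.
Qed.

Lemma diff_prod_ext (R : realType) (V : normedModType R) (I : Type) (r : seq I) (P : pred I)
    (f : I -> V -> R) (a : V) :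
  (forall i, P i -> differentiable (f i) a) ->
  differentiable (fun v => \prod_(i <- r | P i) f i v) a.
Proof.
move=> h; elim: r => [|i r IH].
  rewrite (_ : (fun x => _) = cst 1); first exact: differentiable_cst.
  by apply/funext => x; rewrite big_nil.
rewrite (_ : (fun x => _) = (fun x => if P i then f i x * \prod_(i <- r | P i) f i x
   else \prod_(i <- r | P i) f i x)); last by apply/funext => x; rewrite big_cons.
by case E: (P i) => //; apply: diffM_ext => //; exact: h.
Qed.

Lemma diff_coord_ext (R : realType) (V : normedModType R) (m n : nat) (F : V -> 'M[R]_(m, n))
  (a : V) i j : differentiable F a -> differentiable (fun v => F v i j) a.
Proof.
move=> dF; exact: (differentiable_comp (g := fun N : 'M[R]_(m, n) => N i j) dF
  (differentiable_coord _ _ _)).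
Qed.

Lemma diff_rV (R : realType) (V : normedModType R) (n : nat) (F : V -> 'rV[R]_n) (a : V) :
  (forall j, differentiable (fun v => F v 0 j) a) -> differentiable F a.
Proof.
move=> h; rewrite (_ : F = \sum_(j < n) (fun v => F v 0 j *: delta_mx 0 j)); last first.
  by apply/funext => v; rewrite fct_sumE {1}(row_sum_delta (F v)).
by apply: differentiable_sum => j; apply: differentiableZl.
Qed.

Lemma partial_coord (R : realType) (m n : nat) (F : 'rV[R]_m -> 'rV[R]_n) (u : 'rV[R]_m) i j :
  differentiable F u -> partial i F u 0 j = partial i (fun v => F v 0 j) u.
Proof. by move=> dF; rewrite /partial derive_mx ?mxE //; apply: diff_derivable. Qed.

Lemma jacobianE (R : realType) (m n : nat) (F : 'rV[R]_m -> 'rV[R]_n) (u : 'rV[R]_m) i j :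
  differentiable F u -> ('J F u) i j = partial i (fun v => F v 0 j) u.
Proof.
by move=> dF; rewrite -partial_coord // /partial deriveE // /jacobian mxE.
Qed.

Lemma derive_partial (R : realType) (m : nat) (f : 'rV[R]_m -> R) (u w : 'rV[R]_m) :
  differentiable f u -> 'D_w f u = \sum_i w 0 i * partial i f u.
Proof.
move=> df; rewrite deriveE // {1}(row_sum_delta w) linear_sum; apply: eq_bigr => i _.
by rewrite linearZ /= /partial deriveE.
Qed.

Lemma partial_comp (R : realType) (m n : nat) (F : 'rV[R]_m -> 'rV[R]_n)
    (f : 'rV[R]_n -> R) (u : 'rV[R]_m) i :
  differentiable F u -> differentiable f (F u) ->
  partial i (fun v => f (F v)) u =
  \sum_j partial i (fun v => F v 0 j) u * partial j f (F u).
Proof.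
move=> dF df; rewrite {1}/partial deriveE; last exact: differentiable_comp.
rewrite (_ : (fun v => f (F v)) = f \o F) // diff_comp //= -deriveE // derive_partial //.
by apply: eq_bigr => j _; rewrite -deriveE // -/(partial i F u) partial_coord.
Qed.

Lemma partial_comp1 (R : realType) (m : nat) (s : 'rV[R]_m -> R) (c : R -> R)
    (u : 'rV[R]_m) i (c' : R) :
  differentiable s u -> dder c (s u) 1 c' ->
  differentiable (fun v => c (s v)) u /\
  partial i (fun v => c (s v)) u = c' * partial i s u.
Proof.
move=> ds dc.
have df : differentiable c (s u) by apply/derivable1_diffP; case: dc.
split; first exact: differentiable_comp.
rewrite {1}/partial deriveE; last exact: differentiable_comp.
rewrite (_ : (fun v => c (s v)) = c \o s) // diff_comp //= diff1E //.
by rewrite -deriveE // derive1E (dderE dc) /GRing.scale /= mulrC.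
Qed.

Lemma open_near (T : topologicalType) (U : set T) (P : T -> Prop) (u : T) :
  open U -> U u -> (forall v, U v -> P v) -> \forall v \near u, P v.
Proof. by move=> oU Uu UP; apply: filterS UP _; apply: open_nbhs_nbhs. Qed.

Lemma smooth_diff (R : realType) (m : nat) (V : normedModType R) (U : set 'rV[R]_m)
  (f : 'rV[R]_m -> V) u : smooth_on U f -> U u -> differentiable f u.
Proof. by move=> sf; apply: (sf [::]). Qed.

Lemma smooth_partial (R : realType) (m : nat) (V : normedModType R) (U : set 'rV[R]_m)
  (f : 'rV[R]_m -> V) i : smooth_on U f -> smooth_on U (partial i f).
Proof. by move=> sf l u Uu; have := sf (rcons l i) u Uu; rewrite foldr_rcons. Qed.

Lemma smooth_sub (R : realType) (m : nat) (V : normedModType R) (U U' : set 'rV[R]_m)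
  (f : 'rV[R]_m -> V) : U' `<=` U -> smooth_on U f -> smooth_on U' f.
Proof. by move=> UU sf l u /UU; apply: sf. Qed.

Lemma eq_on_partial (R : realType) (m : nat) (V : normedModType R) (U : set 'rV[R]_m)
  (f g : 'rV[R]_m -> V) i u : open U -> (forall v, U v -> f v = g v) -> U u ->
  partial i f u = partial i g u.
Proof. by move=> oU fg Uu; apply: near_eq_derive; apply: open_near fg. Qed.

(** Smoothness is coinductive: it is enough to find a class of functions differentiable on [U] which
    is stable under partial derivatives, up to equality on [U]. The other smoothness proofs exhibit
    such a class. *)
Lemma smooth_coind (R : realType) (m : nat) (V : normedModType R) (U : set 'rV[R]_m)
    (Q : ('rV[R]_m -> V) -> Prop) : open U ->
  (forall f, Q f -> (forall u, U u -> differentiable f u) /\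
     forall i, exists g, Q g /\ forall u, U u -> partial i f u = g u) ->
  forall f, Q f -> smooth_on U f.
Proof.
move=> oU step f Qf l.
have [g [Qg fg]] : exists g, Q g /\ forall u, U u ->
    foldr (fun i h => partial i h) f l u = g u.
  elim: l => [|i l [g [Qg fg]]] /=; first by exists f.
  have [_ /(_ i)[g' [Qg' gg']]] := step g Qg; exists g'; split=> // u Uu.
  by rewrite -gg' //; apply: eq_on_partial fg Uu.
move=> u Uu; apply: near_eq_differentiable (_ : differentiable g u).
  by apply: open_near Uu _ => // v Uv; rewrite fg.
by have [+ _] := step g Qg; apply.
Qed.

Lemma smooth_eq (R : realType) (m : nat) (V : normedModType R) (U : set 'rV[R]_m)
    (f g : 'rV[R]_m -> V) : open U -> (forall u, U u -> f u = g u) ->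
  smooth_on U f -> smooth_on U g.
Proof.
move=> oU fg sf.
pose Q (h : 'rV[R]_m -> V) := exists2 h', smooth_on U h' & forall u, U u -> h' u = h u.
suff sQ : forall h, Q h -> smooth_on U h by apply: sQ; exists f.
apply: smooth_coind => //.
move=> h [h' sh' h'h]; split.
  move=> u Uu; apply: near_eq_differentiable (smooth_diff sh' Uu).
  exact: open_near h'h.
move=> i; exists (partial i h); split=> //.
exists (partial i h'); first exact: smooth_partial.
by move=> u Uu; apply: eq_on_partial h'h Uu.
Qed.

(* Closed under partial derivatives as soon as those of the members of [B] belong to it. *)
Inductive smooth_class (R : realType) (m : nat) (U : set 'rV[R]_m)
    (B : ('rV[R]_m -> R) -> Prop) : ('rV[R]_m -> R) -> Prop :=
| SCbase f of B f : smooth_class U B f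
| SCcst c : smooth_class U B (fun=> c)
| SCadd f g of smooth_class U B f & smooth_class U B g :
    smooth_class U B (fun v => f v + g v)
| SCmul f g of smooth_class U B f & smooth_class U B g :
    smooth_class U B (fun v => f v * g v)
| SCcomp n (O : set 'rV[R]_n) (F : 'rV[R]_m -> 'rV[R]_n) (f : 'rV[R]_n -> R) of
    smooth_on O f & (forall j, smooth_class U B (fun v => F v 0 j)) &
    (forall u, U u -> O (F u)) : smooth_class U B (fun v => f (F v)).

Lemma SCsum (R : realType) (m : nat) (U : set 'rV[R]_m) B (I : Type) (r : seq I)
    (f : I -> 'rV[R]_m -> R) : (forall i, smooth_class U B (f i)) ->
  smooth_class U B (fun v => \sum_(i <- r) f i v).
Proof.
move=> h; elim: r => [|i r IH].
  rewrite (_ : (fun v => _) = (fun=> 0)); first exact: SCcst.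
  by apply/funext => v; rewrite big_nil.
rewrite (_ : (fun v => _) = (fun v => f i v + \sum_(i <- r) f i v)).
  exact: SCadd.
by apply/funext => v; rewrite big_cons.
Qed.

Lemma smooth_class_smooth (R : realType) (m : nat) (U : set 'rV[R]_m) B : open U ->
  (forall f, B f -> (forall u, U u -> differentiable f u) /\
     forall i, exists g, smooth_class U B g /\ forall u, U u -> partial i f u = g u) ->
  forall f, smooth_class U B f -> smooth_on U f.
Proof.
move=> oU stepB; apply: smooth_coind => // f.
elim=> {f} [f /stepB//|c|f g _ [df pf] _ [dg pg]|f g sf [df pf] sg [dg pg]
  |n O F f sf sF IH FO].
- split=> [u _|i]; first exact: differentiable_cst.
  exists (fun=> 0); split; first exact: SCcst.
  by move=> u _; apply: (dderE (dder_cst _ _ _)).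
- split=> [u Uu|i]; first by apply: diffD_ext; [exact: df|exact: dg].
  have [f' [sf' ef]] := pf i; have [g' [sg' eg]] := pg i.
  exists (fun v => f' v + g' v); split; first exact: SCadd.
  move=> u Uu; rewrite -ef // -eg //; apply: dderE.
  by apply: dderD; apply: differentiable_dder; [exact: df|exact: dg].
- split=> [u Uu|i]; first by apply: diffM_ext; [exact: df|exact: dg].
  have [f' [sf' ef]] := pf i; have [g' [sg' eg]] := pg i.
  exists (fun v => f' v * g v + f v * g' v); split.
    by apply: SCadd; apply: SCmul.
  move=> u Uu; rewrite -ef // -eg //; apply: dderE.
  by apply: dderM; apply: differentiable_dder; [exact: df|exact: dg].
- have dF u : U u -> differentiable F u.
    by move=> Uu; apply: diff_rV => j; have [+ _] := IH j; apply.
  split=> [u Uu|i].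
    apply: (@differentiable_comp _ _ _ _ F f); first exact: dF.
    by apply: smooth_diff sf _; apply: FO.
  have /choice[g gP] : forall j, exists g, smooth_class U B g /\
      forall u, U u -> partial i (fun v => F v 0 j) u = g u.
    by move=> j; have [_ /(_ i)] := IH j.
  exists (fun v => \sum_j g j v * partial j f (F v)); split.
    apply: SCsum => j; apply: SCmul; first by have [] := gP j.
    by apply: (@SCcomp _ _ _ _ _ O F (partial j f)) => //; apply: smooth_partial.
  move=> u Uu; rewrite partial_comp //; last first.
  - by apply: smooth_diff sf _; apply: FO.
  - exact: dF.
  by apply: eq_bigr => j _; have [_ ->] := gP j.
Qed.

Lemma smooth_class_on (R : realType) (m : nat) (U : set 'rV[R]_m) f : open U ->
  smooth_class U (smooth_on U) f -> smooth_on U f.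
Proof.
move=> oU; apply: smooth_class_smooth => // {}f sf; split.
  by move=> u; apply: smooth_diff.
by move=> i; exists (partial i f); split=> //; apply: SCbase; apply: smooth_partial.
Qed.

Lemma smooth_coord (R : realType) (m n : nat) (U : set 'rV[R]_m)
    (F : 'rV[R]_m -> 'rV[R]_n) j : open U ->
  smooth_on U F -> smooth_on U (fun v => F v 0 j).
Proof.
move=> oU sF.
pose Q (h : 'rV[R]_m -> R) := exists2 H : 'rV[R]_m -> 'rV[R]_n, smooth_on U H & h = (fun v => H v 0 j).
suff sQ : forall h, Q h -> smooth_on U h by apply: sQ; exists F.
apply: smooth_coind => //.
move=> _ [H sH ->]; split.
  by move=> u Uu; apply: diff_coord_ext; apply: smooth_diff sH Uu.
move=> i; exists (fun v => partial i H v 0 j); split.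
  by exists (partial i H) => //; apply: smooth_partial.
by move=> u Uu; rewrite partial_coord //; apply: smooth_diff sH Uu.
Qed.

Lemma smooth_rV (R : realType) (m n : nat) (U : set 'rV[R]_m)
    (F : 'rV[R]_m -> 'rV[R]_n) : open U ->
  (forall j, smooth_on U (fun v => F v 0 j)) -> smooth_on U F.
Proof.
move=> oU sF.
pose Q (H : 'rV[R]_m -> 'rV[R]_n) := forall j, smooth_on U (fun v => H v 0 j).
suff sQ : forall H, Q H -> smooth_on U H by exact: sQ.
apply: smooth_coind => // H QH.
have dH u : U u -> differentiable H u.
  by move=> Uu; apply: diff_rV => j; apply: smooth_diff (QH j) Uu.
split=> // i; exists (partial i H); split=> // j.
apply: smooth_eq (smooth_partial i (QH j)) => // u Uu.
by rewrite partial_coord //; apply: dH.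
Qed.

Lemma mvt_rV (R : realType) (m : nat) (f : 'rV[R]_m -> R) (u v : 'rV[R]_m) :
  (forall t, 0 <= t <= 1 -> differentiable f (u + t *: (v - u))) ->
  exists2 t, 0 < t < 1 &
    f v - f u = \sum_i (v - u) 0 i * partial i f (u + t *: (v - u)).
Proof.
move=> df; pose g t := f (u + t *: (v - u)).
pose dg t := \sum_i (v - u) 0 i * partial i f (u + t *: (v - u)).
have dgE t : 0 <= t <= 1 -> dder g t 1 (dg t).
  move=> t01; have dl : differentiable (fun t : R => u + t *: (v - u)) t.
    by apply: differentiableD; [exact: differentiable_cst|exact: differentiableZl].
  have dgt : differentiable g t by apply: (differentiable_comp dl); exact: df.
  apply: dder_eq (@differentiable_dder _ _ g t _ dgt) _.
  rewrite deriveE // /g (_ : (fun _ => _) = f \o (fun t : R => u + t *: (v - u))) //.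
  rewrite diff_comp //; last exact: df.
  rewrite /= -(deriveE _ dl) -deriveE; last exact: df.
  rewrite derive_partial; last exact: df.
  rewrite /dg; apply: eq_bigr => i _; congr (_ 0 i * _).
  rewrite deriveD //; last exact/diff_derivable/differentiableZl.
  rewrite derive_cst add0r deriveE; last exact: differentiableZl.
  by rewrite diffZl //= diff_val /= scale1r.
have [||t t01 e] := @MVT R g dg 0 1 ltr01.
- move=> t; rewrite in_itv /= => /andP[t0 t1]; apply: dgE.
  by rewrite !ltW.
- apply: continuous_in_subspaceT => t; rewrite inE /= in_itv /= => t01.
  exact: dder1_cont (dgE t t01).
exists t; first by move: t01; rewrite in_itv.
move: e; rewrite /g scale1r scale0r addr0 subr0 mulr1 => e.
rewrite -[RHS]/(dg t) -e.
by congr (f _ - _); rewrite addrC subrK.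
Qed.

Lemma diff_shift (R : realType) (m : nat) (f : 'rV[R]_m -> R) (w a : 'rV[R]_m) :
  differentiable f (a + w) -> differentiable (fun v => f (v + w)) a.
Proof.
move=> df; exact: (@differentiable_comp _ _ _ _ (fun v => v + w) f).
Qed.

Lemma partial_shift (R : realType) (m : nat) (f : 'rV[R]_m -> R) (w a : 'rV[R]_m) i :
  partial i (fun v => f (v + w)) a = partial i f (a + w).
Proof.
rewrite /partial /derive.
rewrite (_ : (fun h => _) = (fun h : R => h^-1 *: ((f \o shift (a + w))
  (h *: delta_mx 0 i) - f (a + w)))) //.
by apply/funext => h /=; rewrite addrA.
Qed.

Lemma sum_deltaE (R : realType) (m : nat) (h : R) (i : 'I_m) (F : 'I_m -> R) :
  \sum_k (h *: delta_mx 0 i : 'rV[R]_m) 0 k * F k = h * F i.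
Proof.
rewrite (bigD1 i) //= big1 ?addr0; first by rewrite !mxE !eqxx mulr1.
by move=> k ki; rewrite !mxE eqxx (negbTE ki) mulr0 mul0r.
Qed.

Lemma ball_rV (R : realType) (m : nat) (U : set 'rV[R]_m) u : open U -> U u ->
  exists2 r : R, 0 < r & forall v, `|v - u| < r -> U v.
Proof.
move=> oU Uu; have /nbhs_ballP[r /= r0 rU] : nbhs u U by apply: open_nbhs_nbhs.
by exists r => // v vr; apply: rU; rewrite -ball_normE /= distrC.
Qed.

Lemma near_rV (R : realType) (m : nat) (P : 'rV[R]_m -> Prop) (u : 'rV[R]_m) :
  (\forall v \near u, P v) -> exists2 r : R, 0 < r & forall v, `|v - u| < r -> P v.
Proof.
move=> /nbhs_ballP[r /= r0 rU].
by exists r => // v vr; apply: rU; rewrite -ball_normE /= distrC.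
Qed.

Lemma subr_swap (V : zmodType) (a b c d : V) : a - b - (c - d) = a - c - (b - d).
Proof. by rewrite !opprB addrACA [RHS]addrACA [- b - c]addrC. Qed.

(** The mean value theorem is applied to the increment [phi] in the direction j, and then to the
    partial derivative in the direction i. *)
Lemma second_difference (R : realType) (m : nat) (f : 'rV[R]_m -> R) (U : set 'rV[R]_m)
    (u : 'rV[R]_m) (r h : R) i j :
  smooth_on U f -> (forall v, `|v - u| < r -> U v) -> 0 < h ->
  h * (`|delta_mx 0 i : 'rV[R]_m| + `|delta_mx 0 j : 'rV[R]_m|) < r ->
  exists2 p, `|p - u| <= h * (`|delta_mx 0 i : 'rV[R]_m| + `|delta_mx 0 j : 'rV[R]_m|) &
    f (u + h *: delta_mx 0 i + h *: delta_mx 0 j) - f (u + h *: delta_mx 0 i)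
    - (f (u + h *: delta_mx 0 j) - f u) = h * (h * partial j (partial i f) p).
Proof.
move=> sf rU h0 hr.
set ei := delta_mx 0 i; set ej := delta_mx 0 j.
have inU a b : 0 <= a <= 1 -> 0 <= b <= 1 ->
    `|u + a *: (h *: ei) + b *: (h *: ej) - u| <= h * (`|ei| + `|ej|).
  move=> /andP[a0 a1] /andP[b0 b1].
  rewrite -[u + _ + _]addrA [u + (_ + _)]addrC addrK (le_trans (ler_normD _ _)) // !normrZ.
  rewrite (ger0_norm a0) (ger0_norm b0) (gtr0_norm h0) mulrDr lerD //.
    by rewrite ler_piMl // mulr_ge0 // ltW.
  by rewrite ler_piMl // mulr_ge0 // ltW.
have i01 : 0 <= (1 : R) <= 1 by rewrite ler01 lexx.
have i00 : 0 <= (0 : R) <= 1 by rewrite ler01 lexx.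
pose phi v := f (v + h *: ej) - f v.
have dphi v : U (v + h *: ej) -> U v -> differentiable phi v.
  move=> U1 U2; apply: differentiableB; last exact: smooth_diff sf U2.
  by apply: diff_shift; apply: smooth_diff sf U1.
have seg1 t : 0 <= t <= 1 -> U (u + t *: (h *: ei) + h *: ej) /\ U (u + t *: (h *: ei)).
  move=> t01; split; apply: rU; apply: le_lt_trans hr.
    by have := inU t 1 t01 i01; rewrite scale1r.
  by have := inU t 0 t01 i00; rewrite scale0r addr0.
have [|t t01] := @mvt_rV R m phi u (u + h *: ei).
  move=> t t01; rewrite addrAC subrr add0r.
  by have [U1 U2] := seg1 t t01; apply: dphi.
have t01' : 0 <= t <= 1 by case/andP: t01 => ? ?; rewrite !ltW.
have [U1 U2] := seg1 t t01'.
rewrite [u + h *: ei - u]addrAC subrr add0r sum_deltaE.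
set q := u + t *: (h *: ei) in U1 U2 *.
have -> : partial i phi q = partial i f (q + h *: ej) - partial i f q.
  rewrite -partial_shift; apply: dderE.
  apply: dderB; apply: differentiable_dder; last exact: smooth_diff sf U2.
  by apply: diff_shift; apply: smooth_diff sf U1.
have [|t' t01''] := @mvt_rV R m (partial i f) q (q + h *: ej).
  move=> t' t01''; rewrite [q + h *: ej - q]addrAC subrr add0r.
  apply: smooth_diff (smooth_partial i sf) _; apply: rU; apply: le_lt_trans hr.
  exact: inU.
have t01''' : 0 <= t' <= 1 by case/andP: t01'' => ? ?; rewrite !ltW.
rewrite [q + h *: ej - q]addrAC subrr add0r sum_deltaE => -> e.
by exists (q + t' *: (h *: ej)); first exact: inU.
Qed.

(** The second difference is symmetric in i and j, so the two mixed derivatives take a common value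
    at points p and q arbitrarily close to u; continuity concludes. *)
Lemma schwarz (R : realType) (m : nat) (f : 'rV[R]_m -> R) (U : set 'rV[R]_m) u i j :
  open U -> U u -> smooth_on U f ->
  partial i (partial j f) u = partial j (partial i f) u.
Proof.
move=> oU Uu sf; have [r r0 rU] := ball_rV oU Uu.
set A := partial i (partial j f) u; set B := partial j (partial i f) u.
apply/eqP; rewrite -subr_eq0 -normr_le0; apply/ler_addgt0Pr => e e0; rewrite add0r.
have e2 : 0 < e / 2 by rewrite divr_gt0.
have cA : {for u, continuous (partial i (partial j f))}.
  apply: differentiable_near; apply: smooth_diff Uu.
  by do 2!apply: smooth_partial.
have cB : {for u, continuous (partial j (partial i f))}.
  apply: differentiable_near; apply: smooth_diff Uu.
  by do 2!apply: smooth_partial.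
have /near_rV[r1 r10 hA] : \forall q \near u, `|A - partial i (partial j f) q| < e / 2.
  exact: (cvgr_dist_lt _ _ cA _ e2).
have /near_rV[r2 r20 hB] : \forall q \near u, `|B - partial j (partial i f) q| < e / 2.
  exact: (cvgr_dist_lt _ _ cB _ e2).
set C := `|delta_mx 0 i : 'rV[R]_m| + `|delta_mx 0 j : 'rV[R]_m|.
have C0 : 0 <= C by rewrite addr_ge0.
pose rr := Num.min r (Num.min r1 r2).
have rr0 : 0 < rr by rewrite !lt_min r0 r10 r20.
pose h := rr / (C + 1) / 2.
have h0 : 0 < h by rewrite !divr_gt0 // ltr_wpDl.
have hC : h * C < rr.
  have C1 : 0 < C + 1 by rewrite ltr_wpDl.
  apply: (@le_lt_trans _ _ (h * (C + 1))).
    by rewrite ler_pM2l // lerDl.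
  rewrite /h mulrAC divfK ?gt_eqF // ltr_pdivrMr // mulr_natr mulr2n.
  by rewrite ltrDl.
have [hr hr1 hr2] : [/\ h * C < r, h * C < r1 & h * C < r2].
  by move: hC; rewrite /rr !lt_min => /and3P[].
have [p pu e1] := second_difference sf rU h0 (hr : h * (_ + _) < r).
have hr' : h * (`|delta_mx 0 j : 'rV[R]_m| + `|delta_mx 0 i : 'rV[R]_m|) < r.
  by rewrite [_ + `|_|]addrC.
have [q qu e3] := second_difference sf rU h0 hr'.
have pq : partial j (partial i f) p = partial i (partial j f) q.
  have : h * (h * partial j (partial i f) p) = h * (h * partial i (partial j f) q).
    apply: etrans (esym e1) _; apply: etrans _ e3.
    rewrite subr_swap; congr (f _ - _ - _); exact: addrAC.
  by do 2!move/(mulfI (lt0r_neq0 h0)).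
have dA : `|A - partial i (partial j f) q| < e / 2.
  by apply: hA; apply: le_lt_trans qu _; rewrite [_ + `|_|]addrC.
have dB : `|B - partial j (partial i f) p| < e / 2.
  by apply: hB; apply: le_lt_trans pu _.
rewrite (splitr e) (_ : A - B = (A - partial i (partial j f) q) -
  (B - partial j (partial i f) p)); last by rewrite pq opprB addrA subrK.
exact: le_trans (ler_normB _ _) (lerD (ltW dA) (ltW dB)).
Qed.

Lemma dder_prod (R : realType) (V : normedModType R) (v : V) (I : eqType) (r : seq I)
    (f : I -> V -> R) (a : V) (d : I -> R) : uniq r ->
  (forall i, dder (f i) a v (d i)) ->
  dder (fun x => \prod_(i <- r) f i x) a v
    (\sum_(i <- r) d i * \prod_(k <- r | k != i) f k a).
Proof.
move=> ur h; elim: r ur => [_|i r IH /= /andP[ir ur]].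
  rewrite big_nil (_ : (fun x => _) = (fun=> 1)); first exact: dder_cst.
  by apply/funext => x; rewrite big_nil.
rewrite (_ : (fun x => _) = (fun x => f i x * \prod_(i <- r) f i x)); last first.
  by apply/funext => x; rewrite big_cons.
apply: dder_eq (dderM (h i) (IH ur)) _.
rewrite big_cons big_cons eqxx /=; congr (_ * _ + _).
  rewrite [LHS]big_seq [RHS]big_seq_cond [RHS](eq_bigl (fun k => k \in r)) //.
  move=> k; case kr: (k \in r) => //=.
  by apply: contraNneq ir => <-.
rewrite mulr_sumr [LHS]big_seq [RHS]big_seq; apply: eq_bigr => k kr.
rewrite big_cons; have -> : i != k by apply: contraNneq ir => ->.
by rewrite mulrCA.
Qed.

(** Expansion along row i of the matrix in which that row is replaced by [w]. It collects the
    permutation sum that the product rule produces in [dder_det], which is Jacobi's formula. *)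
Lemma det_replace_row (R : comPzRingType) (n : nat) (A : 'M[R]_n) (w : 'rV[R]_n) i :
  \sum_(s : {perm 'I_n}) (-1) ^+ s * (w 0 (s i) * \prod_(k | k != i) A k (s k)) =
  \sum_j w 0 j * cofactor A i j.
Proof.
pose B := \matrix_(k, j) (if k == i then w 0 j else A k j).
transitivity (\det B).
  apply: eq_bigr => s _; congr (_ * _); rewrite [RHS](bigD1 i) //= mxE eqxx.
  by congr (_ * _); apply: eq_bigr => k ki; rewrite mxE (negbTE ki).
rewrite (expand_det_row B i); apply: eq_bigr => j _; rewrite mxE eqxx.
congr (_ * (_ * \det _)); apply/matrixP => k l; rewrite !mxE.
by rewrite eq_sym (negbTE (neq_lift i k)).
Qed.

Lemma dder_det (R : realType) (V : normedModType R) (v : V) (n : nat)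
    (A : V -> 'M[R]_n) (a : V) (D : 'M[R]_n) :
  (forall i j, dder (fun x => A x i j) a v (D i j)) ->
  dder (fun x => \det (A x)) a v (\sum_i \sum_j D i j * cofactor (A a) i j).
Proof.
move=> h.
have e : forall s : {perm 'I_n}, dder (fun x => (-1) ^+ s * \prod_i A x i (s i)) a v
   ((-1) ^+ s * \sum_i D i (s i) * \prod_(k | k != i) A a k (s k)).
  move=> s; apply: dderZ.
  by apply: (dder_prod (f := fun i x => A x i (s i))) => //; exact: index_enum_uniq.
rewrite /determinant; apply: dder_eq (@dder_sum _ _ v _ (index_enum {perm 'I_n}) xpredT
  (fun s x => (-1) ^+ s * \prod_i A x i (s i)) a _ (fun s _ => e s)) _.
under eq_bigr => s _ do rewrite mulr_sumr.
rewrite exchange_big; apply: eq_bigr => i _ /=.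
transitivity (\sum_(s : {perm 'I_n}) (-1) ^+ s * (row i D 0 (s i) *
    \prod_(k | k != i) A a k (s k))).
  by apply: eq_bigr => s _; rewrite mxE.
by rewrite det_replace_row; apply: eq_bigr => j _; rewrite mxE.
Qed.

Lemma ler_rV_norm (R : realType) (n : nat) (v : 'rV[R]_n) i : `|v 0 i| <= `|v|.
Proof.
rewrite [leRHS]/Num.Def.normr/= mx_normrE; exact: (le_bigmax _ _ (0, i)).
Qed.

Lemma rV_norm_le (R : realType) (n : nat) (v : 'rV[R]_n) (c : R) : 0 <= c ->
  (forall i, `|v 0 i| <= c) -> `|v| <= c.
Proof.
move=> c0 h; rewrite [leLHS]/Num.Def.normr/= mx_normrE.
by apply: bigmax_le => // -[a b] _; rewrite /= (ord1 a).
Qed.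

Lemma mulmx_norm_le (R : realType) (m n : nat) (B : 'M[R]_(m, n)) :
  exists2 b, 0 < b & forall w : 'rV[R]_m, `|w *m B| <= b * `|w|.
Proof.
pose b := \sum_j \sum_k `|B j k|.
have b0 : 0 <= b by apply: sumr_ge0 => j _; apply: sumr_ge0.
exists (b + 1); first by rewrite ltr_wpDl.
move=> w; apply: rV_norm_le; first by rewrite mulr_ge0 // addr_ge0.
move=> k; rewrite mxE (le_trans (ler_norm_sum _ _ _)) //.
apply: (@le_trans _ _ (b * `|w|)); last by rewrite ler_wpM2r // lerDl.
rewrite /b mulr_suml; apply: ler_sum => j _; rewrite normrM mulrC.
apply: ler_pM => //; last exact: ler_rV_norm.
by rewrite (bigD1 k) //= lerDl sumr_ge0.
Qed.

Lemma coord_dder (R : realType) (n : nat) (v w : 'rV[R]_n) k :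
  dder (fun N : 'rV[R]_n => N 0 k) v w (w 0 k).
Proof.
apply: dder_eq (differentiable_dder _ (differentiable_coord _ _ _)) _.
have := @derive_mx R _ 1 n id v w (@derivable_id _ _ v w).
by rewrite derive_id => /matrixP /(_ 0 k); rewrite mxE.
Qed.

(** If [B] is a right inverse of the differential at v0, then [psi *m B] minus the identity has zero
    derivative at v0, hence is Lipschitz with constant 1/2 nearby. *)
Lemma immersion_lower (R : realType) (m n : nat) (U : set 'rV[R]_m)
    (psi : 'rV[R]_m -> 'rV[R]_n) v0 : open U -> immersion_on U psi -> U v0 ->
  exists c r : R, [/\ 0 < c, 0 < r, (forall v, `|v - v0| < r -> U v) &
    forall v v', `|v - v0| < r -> `|v' - v0| < r ->
      `|v' - v| <= c * `|psi v' - psi v|].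
Proof.
move=> oU [spsi imm] Uv0.
have /row_freeP[B JB] := imm v0 Uv0.
have [r0 r00 rU] := ball_rV oU Uv0.
pose g k v := \sum_j psi v 0 j * B j k - v 0 k.
pose dg i k v := \sum_j partial i (fun v => psi v 0 j) v * B j k - (i == k)%:R.
have spj j : smooth_on U (fun v => psi v 0 j) by apply: smooth_coord.
have dgE v i k : U v -> dder (g k) v (delta_mx 0 i) (dg i k v).
  move=> Uv; apply: dderB.
    apply: dder_sum => j _; apply: dder_eq (dderM _ (dder_cst _ _ _)) _.
      exact: (differentiable_dder (delta_mx 0 i) (smooth_diff (spj j) Uv)).
    by rewrite mulr0 addr0.
  by apply: dder_eq (coord_dder _ _ _) _; rewrite mxE eqxx eq_sym.
have cdg i k : {for v0, continuous (dg i k)}.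
  apply: differentiable_near; apply: differentiableB; last exact: differentiable_cst.
  apply: diff_sum_ext => j _; apply: diffM_ext; last exact: differentiable_cst.
  exact: smooth_diff (smooth_partial i (spj j)) Uv0.
have dg0 i k : dg i k v0 = 0.
  rewrite /dg; have := JB => /matrixP /(_ i k); rewrite !mxE => <-; apply/eqP; rewrite subr_eq0.
  apply/eqP; apply: eq_bigr => j _; rewrite jacobianE //; exact: smooth_diff spsi Uv0.
(* The increment of a component is a sum of m terms; this bound on each partial derivative yields
   the constant 1/2. *)
pose e : R := (2 * m.+1%:R)^-1.
have e0 : 0 < e by rewrite invr_gt0 mulr_gt0.
have : \forall v \near v0, forall ik : 'I_m * 'I_m, `|dg ik.1 ik.2 v| < e.
  apply: (@filter_forall _ _ (fun ik v => is_true (`|dg ik.1 ik.2 v| < e)) (nbhs v0) (nbhs_filter v0)) => -[i k] /=.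
  have : \forall v \near v0, `|dg i k v0 - dg i k v| < e.
    exact: (cvgr_dist_lt _ _ (cdg i k) _ e0).
  by apply: filterS => v; rewrite dg0 sub0r normrN.
move=> /near_rV[r1 r10 hdg].
have [b b0 hb] := mulmx_norm_le B.
exists (2 * b), (Num.min r0 r1); split.
- by rewrite mulr_gt0.
- by rewrite lt_min r00.
- by move=> v; rewrite lt_min => /andP[/rU].
move=> v v' vr vr'.
have seg t : 0 <= t <= 1 -> `|v + t *: (v' - v) - v0| < Num.min r0 r1.
  move=> /andP[t0 t1].
  have -> : v + t *: (v' - v) - v0 = (1 - t) *: (v - v0) + t *: (v' - v0).
    by rewrite !scalerBr !scalerBl !scale1r; apply/rowP => i; rewrite !mxE; ring.
  apply: le_lt_trans (ler_normD _ _) _; rewrite !normrZ.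
  rewrite ger0_norm ?subr_ge0 // [`|t|]ger0_norm //.
  have [->|tn0] := eqVneq t 0; first by rewrite subr0 mul1r mul0r addr0.
  have tp : 0 < t by rewrite lt0r tn0.
  apply: (@lt_le_trans _ _ ((1 - t) * Num.min r0 r1 + t * Num.min r0 r1)); last first.
    by rewrite -mulrDl subrK mul1r.
  apply: ler_ltD; last by rewrite ltr_pM2l.
  by rewrite ler_wpM2l ?subr_ge0 // ltW.
have gk k : `|g k v' - g k v| <= 2^-1 * `|v' - v|.
  have [|t t01 ->] := @mvt_rV R m (g k) v v'.
    move=> t /seg; rewrite lt_min => /andP[tr _].
    apply: differentiableB; last exact: differentiable_coord.
    apply: diff_sum_ext => j _; apply: diffM_ext; last exact: differentiable_cst.
    exact: smooth_diff (spj j) (rU _ tr).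
  have t01' : 0 <= t <= 1 by case/andP: t01 => ? ?; rewrite !ltW.
  have := seg t t01'; set w := v + _; rewrite lt_min => /andP[wr0 wr1].
  rewrite (le_trans (ler_norm_sum _ _ _)) //.
  apply: (@le_trans _ _ (\sum_(i < m) `|v' - v| * e)).
    apply: ler_sum => i _; rewrite normrM; apply: ler_pM => //; first exact: ler_rV_norm.
    rewrite /partial (dderE (dgE w i k (rU _ wr0))) ltW //.
    exact: (hdg _ wr1 (i, k)).
  rewrite sumr_const card_ord -[_ *+ m]mulr_natr -mulrA [leRHS]mulrC.
  rewrite ler_wpM2l // /e invfM -mulrA ler_piMr ?invr_ge0 //.
  by rewrite mulrC ler_pdivrMr // mul1r ler_nat.
have : `|v' - v| <= `|(psi v' - psi v) *m B| + 2^-1 * `|v' - v|.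
  apply: rV_norm_le => [|k]; first by rewrite addr_ge0 // mulr_ge0.
  have -> : (v' - v) 0 k = ((psi v' - psi v) *m B) 0 k - (g k v' - g k v).
    rewrite mulmxBl !mxE /g; ring.
  apply: le_trans (ler_normB _ _) _; apply: lerD => //; exact: ler_rV_norm.
move: (hb (psi v' - psi v)).
move: `|v' - v| `|(psi v' - psi v) *m B| => A C h1 h2.
have h3 : A <= 2 * C by lra.
apply: le_trans h3 _; rewrite -mulrA ler_pM2l //.
Qed.

Lemma dotv_norm_le (R : realType) (n : nat) (v : 'rV[R]_n) : `|v| ^+ 2 <= dotv v v.
Proof.
have d0 : 0 <= dotv v v by apply: sumr_ge0 => j _; rewrite -expr2 sqr_ge0.
rewrite -[leRHS]sqr_sqrtr // ler_pXn2r ?nnegrE ?sqrtr_ge0 //.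
apply: rV_norm_le; first exact: sqrtr_ge0.
move=> i; rewrite -sqrtr_sqr ler_wsqrtr // /dotv (bigD1 i) //= -expr2 lerDl.
by apply: sumr_ge0 => j _; rewrite -expr2 sqr_ge0.
Qed.

Lemma dotv_le_norm (R : realType) (n : nat) (v : 'rV[R]_n) :
  dotv v v <= n%:R * `|v| ^+ 2.
Proof.
rewrite /dotv; apply: (@le_trans _ _ (\sum_(j < n) `|v| ^+ 2)).
  apply: ler_sum => j _; rewrite -expr2 -real_normK ?num_real //.
  by rewrite ler_pXn2r ?nnegrE // ler_rV_norm.
by rewrite sumr_const card_ord mulr_natl.
Qed.

Lemma dotvC (R : realType) (n : nat) (v w : 'rV[R]_n) : dotv v w = dotv w v.
Proof. by apply: eq_bigr => j _; rewrite mulrC. Qed.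

Lemma dotvE (R : realType) (n : nat) (v w : 'rV[R]_n) : dotv v w = (v *m w^T) 0 0.
Proof. by rewrite mxE; apply: eq_bigr => j _; rewrite mxE. Qed.

Lemma dotv_eq0 (R : realType) (n : nat) (v : 'rV[R]_n) : dotv v v = 0 -> v = 0.
Proof.
move=> e; have := dotv_norm_le v; rewrite e => h.
by apply/eqP; rewrite -normr_eq0 -sqrf_eq0 eq_le h sqr_ge0.
Qed.

Lemma dotv_ge0 (R : realType) (n : nat) (v : 'rV[R]_n) : 0 <= dotv v v.
Proof. by apply: sumr_ge0 => j _; rewrite -expr2 sqr_ge0. Qed.

(** * Riemannian submersions onto a flat base *)

Lemma sym_form_eq0 (R : realType) (k : nat) (M : 'M[R]_k) : M^T = M ->
  (forall c : 'rV[R]_k, c *m M *m c^T = 0) -> M = 0.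
Proof.
move=> sM h.
have dE i j : ((delta_mx 0 i : 'rV[R]_k) *m M *m (delta_mx 0 j : 'rV[R]_k)^T) 0 0 = M i j.
  by rewrite trmx_delta -rowE -colE !mxE.
have aD (A B : 'M[R]_1) : (A + B) 0 0 = A 0 0 + B 0 0 by rewrite mxE.
have hij i j : M i i + M i j + (M j i + M j j) = 0.
  have := h (delta_mx 0 i + delta_mx 0 j) => /matrixP /(_ 0 0).
  rewrite linearD /= mulmxDl mulmxDl !mulmxDr.
  by rewrite !aD !dE mxE.
have dg i : M i i = 0 by have := hij i i; lra.
apply/matrixP => i j; rewrite mxE; have := hij i j; rewrite !dg.
have := congr1 (fun A : 'M[R]_k => A i j) sM; rewrite mxE => e1 e2.
by rewrite e1 in e2; lra.
Qed.

Lemma sum3_factor (R : comPzRingType) (n : nat) (A B : 'I_n -> 'I_n -> R) (u v : 'I_n -> R) :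
  \sum_l \sum_i (\sum_j A i j * B l j) * u i * v l =
  \sum_j (\sum_i A i j * u i) * (\sum_l B l j * v l).
Proof.
transitivity (\sum_l \sum_i \sum_j A i j * B l j * u i * v l).
  by apply: eq_bigr => l _; apply: eq_bigr => i _; rewrite !mulr_suml.
under eq_bigr => l _ do rewrite exchange_big.
rewrite exchange_big; apply: eq_bigr => j _ /=.
rewrite mulr_sumr; apply: eq_bigr => l _; rewrite !mulr_suml; apply: eq_bigr => i _.
ring.
Qed.

Section Submersion.
Context (R : realType) (n : nat) (Pi : 'rV[R]_n -> 'rV[R]_2) (O : set 'rV[R]_n).
Hypothesis oO : open O.
Hypothesis sPi : smooth_on O Pi.
Hypothesis rPi : forall p, O p -> riemannian_submersion_at Pi p.

Definition gr (a : 'I_2) (p : 'rV[R]_n) j := partial j (fun q => Pi q 0 a) p.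
Definition hs a p i j := partial i (fun q => gr a q j) p.
Definition ths a p l i j := partial l (fun q => hs a q i j) p.
Definition gradv a p : 'rV[R]_n := \row_j gr a p j.

Lemma sPia a : smooth_on O (fun q => Pi q 0 a).
Proof. exact: smooth_coord. Qed.

Lemma sgr a j : smooth_on O (fun q => gr a q j).
Proof. exact: smooth_partial (sPia a). Qed.

Lemma shs a i j : smooth_on O (fun q => hs a q i j).
Proof. exact: smooth_partial (sgr a j). Qed.

Lemma hs_sym a p i j : O p -> hs a p i j = hs a p j i.
Proof. by move=> Op; apply: schwarz Op (sPia a). Qed.

Lemma ths_sym12 a p l i j : O p -> ths a p l i j = ths a p i l j.
Proof. by move=> Op; apply: schwarz Op (sgr a j). Qed.

Lemma ths_sym23 a p l i j : O p -> ths a p l i j = ths a p l j i.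
Proof. by move=> Op; apply: eq_on_partial oO _ Op => q Oq; apply: hs_sym. Qed.

Lemma JPi p i a : O p -> ('J Pi p) i a = gr a p i.
Proof. by move=> Op; rewrite jacobianE //; apply: smooth_diff sPi Op. Qed.

(** Let A be the Gram matrix. The vectors [c *m J^T] are horizontal, and the isometry condition on
    them says that A^2 and A define the same quadratic form; by symmetry A^2 = A. The rank condition
    makes A invertible. *)
Lemma gram_mx p : O p -> ('J Pi p)^T *m 'J Pi p = 1%:M.
Proof.
move=> Op; have [rk iso] := rPi Op; set J := 'J Pi p in rk iso *.
set A := J^T *m J.
have sA : A^T = A by rewrite trmx_mul trmxK.
have e (c : 'rV[R]_2) : c *m (A *m A - A) *m c^T = 0.
  have := iso (c *m J^T).
  have hw (w : 'rV[R]_n) : w *m J = 0 -> dotv w (c *m J^T) = 0.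
    by move=> wJ; rewrite dotvE trmx_mul trmxK mulmxA wJ mul0mx mxE.
  move=> /(_ hw); rewrite !dotvE !trmx_mul !trmxK => h.
  apply/matrixP => i j; rewrite !ord1 [RHS]mxE mulmxBr mulmxBl mxE [X in _ + X]mxE.
  apply/eqP; rewrite subr_eq0 /A -?mulmxA; apply/eqP.
  by move: h; rewrite -!mulmxA.
have M0 : A *m A - A = 0.
  by apply: sym_form_eq0 e; rewrite linearB /= trmx_mul sA.
have Au : A \in unitmx.
  rewrite -row_free_unit -kermx_eq0; apply/eqP/row_matrixP => i.
  rewrite row0; set c := row i _.
  have cA : c *m A = 0 by rewrite /c -row_mul mulmx_ker row0.
  have cJ : c *m J^T = 0.
    by apply: dotv_eq0; rewrite dotvE trmx_mul trmxK mulmxA -[c *m _ *m _]mulmxA cA mul0mx mxE.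
  have fJ : row_free J^T by rewrite /row_free mxrank_tr rk.
  by apply/eqP; rewrite -(mulmx_free_eq0 _ fJ) cJ.
have : A *m (A - 1%:M) = 0 by rewrite mulmxBr mulmx1.
move/(congr1 (mulmx (invmx A))); rewrite mulmxA mulVmx // mul1mx mulmx0.
by move/eqP; rewrite subr_eq0 => /eqP.
Qed.

Lemma gram p a b : O p -> \sum_j gr a p j * gr b p j = (a == b)%:R.
Proof.
move=> Op; have := gram_mx Op => /matrixP /(_ a b); rewrite !mxE => <-.
by apply: eq_bigr => j _; rewrite mxE !JPi.
Qed.

Lemma dgr a j p i : O p -> dder (fun q => gr a q j) p (delta_mx 0 i) (hs a p i j).
Proof. by move=> Op; apply: differentiable_dder; apply: smooth_diff (sgr a j) Op. Qed.

Lemma dhs a i j p l : O p ->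
  dder (fun q => hs a q i j) p (delta_mx 0 l) (ths a p l i j).
Proof. by move=> Op; apply: differentiable_dder; apply: smooth_diff (shs a i j) Op. Qed.

Lemma dder_on (f : 'rV[R]_n -> R) p w e c : O p -> (forall q, O q -> f q = c) ->
  dder f p w e -> e = 0.
Proof.
move=> Op fc fe; apply: dder_uniq fe _; apply: dder_near (dder_cst _ c _).
by apply: open_near Op _ => // q Oq; rewrite fc.
Qed.

(** The covariant derivative of the gradient of the component a along the gradient of b. Its
    antisymmetry in a and b comes from the inner products of the gradients being constant. *)
Definition hg a b p i := \sum_j hs a p i j * gr b p j.

Lemma hg_anti a b p i : O p -> hg a b p i + hg b a p i = 0.
Proof.
move=> Op; rewrite /hg.
rewrite -[RHS](@dder_on (fun q => \sum_j gr a q j * gr b q j) p (delta_mx 0 i)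
  (\sum_j (hs a p i j * gr b p j + gr a p j * hs b p i j)) (a == b)%:R) //.
- rewrite big_split /=; congr (_ + _); apply: eq_bigr => j _; exact: mulrC.
- by move=> q Oq; apply: gram.
- by apply: dder_sum => j _; apply: dderM; apply: dgr.
Qed.

Lemma hg_diag a p i : O p -> hg a a p i = 0.
Proof. by move=> Op; have := hg_anti a a i Op; lra. Qed.

Lemma hg_tr a b p j : O p -> \sum_i hs a p i j * gr b p i = hg a b p j.
Proof. by move=> Op; apply: eq_bigr => i _; rewrite hs_sym. Qed.

(** By antisymmetry this is minus the Hessian of b on the gradients of a and b, and by symmetry of
    that Hessian it is a component of [hg b b], which vanishes. *)
Lemma hg_horizontal a b p : O p -> \sum_i hg a b p i * gr b p i = 0.
Proof.
move=> Op.
transitivity (- \sum_i hg b a p i * gr b p i).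
  rewrite -sumrN; apply: eq_bigr => i _; rewrite -mulNr; congr (_ * _).
  by apply/eqP; rewrite -addr_eq0 hg_anti.
rewrite /hg; under eq_bigr => i _ do rewrite mulr_suml.
rewrite exchange_big /= big1 ?oppr0 // => j _.
transitivity (gr a p j * \sum_i hs b p i j * gr b p i).
  by rewrite mulr_sumr; apply: eq_bigr => i _; ring.
by rewrite hg_tr // hg_diag // mulr0.
Qed.

Lemma dhg a b p l i : O p -> dder (fun q => hg a b q i) p (delta_mx 0 l)
  (\sum_j (ths a p l i j * gr b p j + hs a p i j * hs b p l j)).
Proof.
by move=> Op; apply: dder_sum => j _; apply: dderM; [exact: dhs|exact: dgr].
Qed.

(* With [Z := hg a b p], differentiating [hg a a = 0] twice along [b] and
   [<hg a b, grad b> = 0] along [a] gives [T = - |Z|^2] and [T = 2 |Z|^2] for the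
   same component [T] of the third derivative: a flat base forces the O'Neill
   tensor of the submersion to vanish. *)
Lemma hess_grad0 a b p i : O p -> hg a b p i = 0.
Proof.
move=> Op.
pose T := \sum_l \sum_i (\sum_j ths a p l i j * gr b p j) * gr b p i * gr a p l.
have TE : T = \sum_l \sum_i \sum_j ths a p l i j * gr b p j * gr b p i * gr a p l.
  by apply: eq_bigr => l _; apply: eq_bigr => k _; rewrite !mulr_suml.
have hba j : hg b a p j = - hg a b p j.
  by apply/eqP; rewrite -addr_eq0 hg_anti.
have e1 : T + \sum_j hg a b p j ^+ 2 = 0.
  have h l k : \sum_j (ths a p l k j * gr a p j + hs a p k j * hs a p l j) = 0.
    apply: (@dder_on (fun q => hg a a q k) p (delta_mx 0 l) _ 0) => //.
      by move=> q Oq; apply: hg_diag.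
    exact: dhg.
  have : \sum_l \sum_k (\sum_j (ths a p l k j * gr a p j + hs a p k j * hs a p l j))
      * gr b p k * gr b p l = 0.
    by rewrite big1 // => l _; rewrite big1 // => k _; rewrite h !mul0r.
  move=> e0; rewrite -[RHS]e0 {e0}.
  transitivity (\sum_l \sum_k (\sum_j ths a p l k j * gr a p j) * gr b p k * gr b p l +
     \sum_l \sum_k (\sum_j hs a p k j * hs a p l j) * gr b p k * gr b p l); last first.
    rewrite -big_split; apply: eq_bigr => l _; rewrite -big_split /=; apply: eq_bigr => k _.
    by rewrite big_split /= !mulrDl.
  congr (_ + _).
    rewrite TE exchange_big; apply: eq_bigr => k _ /=.
    transitivity (\sum_l \sum_j ths a p k j l * gr a p l * gr b p j * gr b p k).
      apply: eq_bigr => l _; apply: eq_bigr => j _.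
      rewrite (@ths_sym12 _ _ l k) // (@ths_sym23 _ _ k l) //; ring.
    by rewrite exchange_big; apply: eq_bigr => j _; rewrite !mulr_suml.
  rewrite sum3_factor; apply: eq_bigr => j _.
  by rewrite hg_tr // expr2.
have e2 : T - 2 * \sum_j hg a b p j ^+ 2 = 0.
  have h l : \sum_k ((\sum_j (ths a p l k j * gr b p j + hs a p k j * hs b p l j)) * gr b p k
      + hg a b p k * hs b p l k) = 0.
    apply: (@dder_on (fun q => \sum_k hg a b q k * gr b q k) p (delta_mx 0 l) _ 0) => //.
      by move=> q Oq; apply: hg_horizontal.
    by apply: dder_sum => k _; apply: dderM; [exact: dhg|exact: dgr].
  have : \sum_l (\sum_k ((\sum_j (ths a p l k j * gr b p j + hs a p k j * hs b p l j)) * gr b p k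
      + hg a b p k * hs b p l k)) * gr a p l = 0.
    by rewrite big1 // => l _; rewrite h !mul0r.
  move=> e0; rewrite -[RHS]e0 {e0}.
  transitivity (T + (\sum_l \sum_k (\sum_j hs a p k j * hs b p l j) * gr b p k * gr a p l
    + \sum_l \sum_k hg a b p k * hs b p l k * gr a p l)); last first.
    rewrite /T -!big_split; apply: eq_bigr => l _ /=; rewrite -!big_split /= [RHS]mulr_suml.
    apply: eq_bigr => k _; rewrite big_split /=; ring.
  rewrite mulr2n mulrDl !mul1r opprD; congr (_ + (_ + _)).
    rewrite sum3_factor -sumrN; apply: eq_bigr => j _.
    by rewrite !hg_tr // hba mulrN expr2.
  rewrite exchange_big -sumrN; apply: eq_bigr => k _ /=.
  transitivity (hg a b p k * \sum_l hs b p l k * gr a p l).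
    by rewrite hg_tr // hba mulrN expr2.
  by rewrite [LHS]mulr_sumr; apply: eq_bigr => l _; rewrite mulrA.
have h0 : \sum_j hg a b p j ^+ 2 = 0 by lra.
have sq_ge0 j : true -> 0 <= hg a b p j ^+ 2 by rewrite sqr_ge0.
have := @psumr_eq0P _ _ _ _ sq_ge0 h0 i isT => /eqP.
by rewrite sqrf_eq0 => /eqP.
Qed.

(** Differentiating [hess_grad0] trades the third derivative for a product of two Hessians, one of
    which is again applied to a gradient. *)
Lemma ths_horizontal a b c p l : O p ->
  \sum_i (\sum_j ths a p l i j * gr b p j) * gr c p i = 0.
Proof.
move=> Op.
have h i : \sum_j (ths a p l i j * gr b p j + hs a p i j * hs b p l j) = 0.
  apply: (@dder_on (fun q => hg a b q i) p (delta_mx 0 l) _ 0) => //.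
    by move=> q Oq; apply: hess_grad0.
  exact: dhg.
transitivity (- \sum_i (\sum_j hs a p i j * hs b p l j) * gr c p i).
  rewrite -sumrN; apply: eq_bigr => i _; rewrite -mulNr; congr (_ * _).
  by apply/eqP; rewrite -addr_eq0 -big_split /= h.
under eq_bigr => i _ do rewrite mulr_suml.
rewrite exchange_big big1 ?oppr0 // => j _ /=.
transitivity (hs b p l j * \sum_i hs a p i j * gr c p i).
  by rewrite [RHS]mulr_sumr; apply: eq_bigr => i _; rewrite mulrAC mulrC.
by rewrite hg_tr // hess_grad0 // mulr0.
Qed.

End Submersion.

(** * Straight horizontal lines *)

Lemma halving_eq0 (R : realType) (A : Type) (E : A -> R) (K : R) :
  (forall x, `|E x| <= K) ->
  (forall K', (forall x, `|E x| <= K') -> forall x, `|E x| <= K' / 2) ->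
  forall x, E x = 0.
Proof.
move=> hK half x.
have h N y : `|E y| <= K / 2 ^+ N.
  elim: N y => [|N IH] y; first by rewrite expr0 divr1.
  by rewrite exprSr invfM mulrA; apply: half.
apply/eqP; rewrite -normr_le0; apply/ler_addgt0Pr => e e0; rewrite add0r.
have K0 : 0 <= K := le_trans (normr_ge0 _) (hK x).
pose N := Num.truncn (K / e).
apply: le_trans (h N.+1 x) _; rewrite ler_pdivrMr ?exprn_gt0 //.
rewrite mulrC -ler_pdivrMr //; apply: ltW.
apply: (lt_le_trans (_ : K / e < N.+1%:R)); first exact: truncnS_gt.
rewrite -natrX ler_nat; exact: ltnW (ltn_expl _ _).
Qed.

Section Lines.
Context (R : realType) (n : nat) (Pi : 'rV[R]_n -> 'rV[R]_2) (O : set 'rV[R]_n).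
Hypothesis oO : open O.
Hypothesis sPi : smooth_on O Pi.
Hypothesis rPi : forall p, O p -> riemannian_submersion_at Pi p.

Definition hlift (c : 'rV[R]_2) p : 'rV[R]_n := \sum_a c 0 a *: gradv Pi a p.

Lemma hliftE c p i : hlift c p 0 i = \sum_a c 0 a * gr Pi a p i.
Proof. by rewrite summxE; apply: eq_bigr => a _; rewrite !mxE. Qed.

Lemma dot_lift_grad c p b : O p -> \sum_i hlift c p 0 i * gr Pi b p i = c 0 b.
Proof.
move=> Op.
transitivity (\sum_a c 0 a * \sum_i gr Pi a p i * gr Pi b p i).
  under [RHS]eq_bigr => a _ do rewrite mulr_sumr.
  rewrite [RHS]exchange_big /=; apply: eq_bigr => i _.
  by rewrite hliftE mulr_suml; apply: eq_bigr => a _; rewrite mulrA.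
rewrite (bigD1 b) //= (gram sPi rPi) // eqxx mulr1 big1 ?addr0 // => a ab.
by rewrite (gram sPi rPi) // (negbTE ab) mulr0.
Qed.

Lemma gr_le1 a p j : O p -> `|gr Pi a p j| <= 1.
Proof.
move=> Op; rewrite -[leRHS]sqrtr1 -sqrtr_sqr ler_wsqrtr //.
have g1 : \sum_j gr Pi a p j * gr Pi a p j = 1 by rewrite (gram sPi rPi) // eqxx.
rewrite -[leRHS]g1 (bigD1 j) //= -expr2 lerDl; apply: sumr_ge0 => i _.
by rewrite -expr2 sqr_ge0.
Qed.

Lemma lift_norm c p : O p -> `|hlift c p| <= 2 * `|c|.
Proof.
move=> Op; apply: rV_norm_le => [|i]; first by rewrite mulr_ge0.
rewrite hliftE (le_trans (ler_norm_sum _ _ _)) //.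
apply: (@le_trans _ _ (\sum_(a < 2) `|c|)).
  apply: ler_sum => a _; rewrite normrM -[leRHS]mulr1.
  by apply: ler_pM => //; [exact: ler_rV_norm|exact: gr_le1].
by rewrite sumr_const card_ord mulr_natl.
Qed.

Lemma hs_bounded p0 : O p0 -> exists C r : R, [/\ 0 < C, 0 < r &
  forall p, `|p - p0| < r -> O p /\ forall a i j, `|hs Pi a p i j| <= C].
Proof.
move=> Op0; have [R0 R00 R0O] := ball_rV oO Op0.
pose C := 1 + \sum_(t : 'I_2 * 'I_n * 'I_n) `|hs Pi t.1.1 p0 t.1.2 t.2|.
have C0 : 0 < C by rewrite ltr_pwDl // sumr_ge0.
have : \forall p \near p0, forall t : 'I_2 * 'I_n * 'I_n,
    `|hs Pi t.1.1 p t.1.2 t.2| <= C.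
  apply: (@filter_forall _ _ (fun (t : 'I_2 * 'I_n * 'I_n) p =>
    is_true (`|hs Pi t.1.1 p t.1.2 t.2| <= C)) (nbhs p0) (nbhs_filter p0)) => -[[a i] j] /=.
  have ch : {for p0, continuous (fun q => hs Pi a q i j)}.
    by apply: differentiable_near; apply: smooth_diff Op0; exact: shs.
  have : \forall p \near p0, `|hs Pi a p0 i j - hs Pi a p i j| < 1.
    exact: (cvgr_dist_lt _ _ ch _ ltr01).
  apply: filterS => p hp.
  have : `|hs Pi a p i j| <= `|hs Pi a p0 i j - hs Pi a p i j| + `|hs Pi a p0 i j|.
    by rewrite distrC -{1}(subrK (hs Pi a p0 i j) (hs Pi a p i j)) ler_normD.
  move=> /le_trans; apply; rewrite /C lerD //; first exact: ltW.
  by rewrite (bigD1 ((a, i), j)) //= lerDl sumr_ge0.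
move=> /near_rV[r1 r10 hr1].
exists C, (Num.min R0 r1); split=> //; first by rewrite lt_min R00.
move=> p; rewrite lt_min => /andP[/R0O Op /hr1 h]; split=> // a i j.
exact: (h ((a, i), j)).
Qed.

(** At each point of the segment the Hessian kills the lift of [c] at that point. The direction of
    the segment is the lift at the starting point, so the variation of the gradients is bounded by a
    small multiple of itself, hence is zero; then [Pi] is affine along the segment. *)
Lemma straight_lines p0 : O p0 -> exists2 r : R, 0 < r &
  forall p (c : 'rV[R]_2), `|p - p0| < r -> `|c| < r ->
   [/\ O (p + hlift c p), Pi (p + hlift c p) = Pi p + c &
    forall a, gradv Pi a (p + hlift c p) = gradv Pi a p].
Proof.
move=> Op0; have [C [R0 [C0 R00 hC]]] := hs_bounded Op0.
(* R0 / 4 keeps the segment in the ball of radius R0, since the lift has norm at most 2 |c|. The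
   other bound makes the contraction factor 2 n |c| C at most 1/2. *)
pose r := Num.min (R0 / 4) (4 * n%:R * C + 1)^-1.
have nC0 : 0 < 4 * n%:R * C + 1 by rewrite ltr_wpDl // !mulr_ge0 // ltW.
exists r; first by rewrite lt_min divr_gt0 //= invr_gt0.
move=> p c; rewrite !lt_min => /andP[pR _] /andP[cR cC].
have Op : O p.
  apply: (proj1 (hC p _)); apply: lt_le_trans pR _.
  by rewrite ler_pdivrMr // ler_peMr ?ler1n // ltW.
set X := hlift c p.
have Xn : `|X| <= 2 * `|c| := lift_norm c Op.
have seg t : 0 <= t <= 1 -> `|p + t *: X - p0| < R0.
  move=> /andP[t0 t1]; rewrite addrAC (le_lt_trans (ler_normD _ _)) // normrZ ger0_norm //.
  have tX : t * `|X| <= 2 * `|c|.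
    by apply: le_trans Xn; rewrite ler_piMl.
  move: pR cR tX; move: `|p - p0| `|c| (t * `|X|) => A B D *; lra.
have segO t : 0 <= t <= 1 -> O (p + t *: X) by move=> /seg /hC[].
(* The value 0 outside [0, 1] lets a single bound cover all parameters, as [halving_eq0]
   requires. *)
pose E (tt : R * ('I_2 * 'I_n)) :=
  if 0 <= tt.1 <= 1 then gr Pi tt.2.1 (p + tt.1 *: X) tt.2.2 - gr Pi tt.2.1 p tt.2.2
  else 0.
have E0 : forall tt, E tt = 0.
  apply: (@halving_eq0 _ _ _ 2).
    move=> [t [a j]]; rewrite /E /=; case: ifP => [t01|_]; last by rewrite normr0.
    rewrite (le_trans (ler_normB _ _)) // [leRHS]mulr2n lerD // gr_le1 //.
    exact: segO.
  move=> K hK [t [a j]]; rewrite /E /=.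
  have K0 : 0 <= K := le_trans (normr_ge0 _) (hK (0, (a, j))).
  case: ifP => [t01|_]; last by rewrite normr0 divr_ge0.
  have st x : 0 <= x <= 1 -> 0 <= x * t <= 1.
    move=> /andP[x0 x1]; case/andP: t01 => t0 t1.
    by rewrite mulr_ge0 //= mulr_ile1.
  have [|x x01 ->] := @mvt_rV R n (fun q => gr Pi a q j) p (p + t *: X).
    move=> x x01; rewrite [p + t *: X - p]addrAC subrr add0r scalerA.
    by apply: smooth_diff (segO _ (st _ x01)); exact: sgr.
  have x01' : 0 <= x <= 1 by case/andP: x01 => ? ?; rewrite !ltW.
  rewrite [p + t *: X - p]addrAC subrr add0r scalerA.
  set q := p + (x * t) *: X.
  have Oq : O q := segO _ (st _ x01').
  have -> : \sum_i (t *: X) 0 i * partial i (fun q => gr Pi a q j) q =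
     \sum_i \sum_b - (t * (c 0 b * E (x * t, (b, i)) * hs Pi a q i j)).
    transitivity (\sum_i \sum_b (t * (c 0 b * gr Pi b p i * hs Pi a q i j))).
      apply: eq_bigr => i _; rewrite mxE -/(hs Pi a q i j) hliftE -mulrA mulr_suml mulr_sumr.
      by apply: eq_bigr => b _.
    apply/eqP; rewrite -subr_eq0 -sumrB; apply/eqP.
    transitivity (\sum_b t * c 0 b * hg Pi a b q j).
      under eq_bigr => i _ do rewrite -sumrB.
      rewrite exchange_big; apply: eq_bigr => b _ /=.
      rewrite -(hg_tr oO sPi) // mulr_sumr; apply: eq_bigr => i _.
      rewrite /E /= st // /q; ring.
    by rewrite big1 // => b _; rewrite (hess_grad0 oO sPi rPi) // mulr0.
  rewrite (le_trans (ler_norm_sum _ _ _)) //.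
  apply: (@le_trans _ _ (\sum_(i < n) 2 * (`|c| * K * C))).
    apply: ler_sum => i _; rewrite (le_trans (ler_norm_sum _ _ _)) //.
    apply: (@le_trans _ _ (\sum_(b < 2) `|c| * K * C)); last first.
      by rewrite sumr_const card_ord mulr_natl.
    apply: ler_sum => b _; rewrite normrN !normrM.
    rewrite -[leRHS]mul1r; apply: ler_pM; rewrite ?mulr_ge0 //.
      by case/andP: t01 => t0 t1; rewrite ger0_norm.
    apply: ler_pM; rewrite ?mulr_ge0 //; last by have [_] := hC q (seg _ (st _ x01')).
    by apply: ler_pM => //; exact: ler_rV_norm.
  rewrite sumr_const card_ord -[_ *+ n]mulr_natl.
  have : `|c| * (4 * n%:R * C + 1) <= 1.
    by rewrite -ler_pdivlMr // mul1r ltW.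
  move=> hc.
  have -> : n%:R * (2 * (`|c| * K * C)) = (`|c| * (4 * n%:R * C)) * (K / 2) by field.
  rewrite ler_piMl ?divr_ge0 //; apply: le_trans hc.
  by rewrite ler_wpM2l // lerDl.
have i01 : 0 <= (1 : R) <= 1 by rewrite ler01 lexx.
have gE t a : 0 <= t <= 1 -> forall j, gr Pi a (p + t *: X) j = gr Pi a p j.
  move=> t01 j; apply/eqP; rewrite -subr_eq0; apply/eqP.
  by have := E0 (t, (a, j)); rewrite /E /= t01.
split.
- by have := segO 1 i01; rewrite scale1r.
- apply/rowP => a; rewrite mxE; apply/eqP; rewrite addrC -subr_eq; apply/eqP.
  have [|x x01 ->] := @mvt_rV R n (fun q => Pi q 0 a) p (p + X).
    move=> x x01; rewrite [p + X - p]addrAC subrr add0r.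
    by apply: smooth_diff (segO _ x01); exact: sPia.
  have x01' : 0 <= x <= 1 by case/andP: x01 => ? ?; rewrite !ltW.
  rewrite [p + X - p]addrAC subrr add0r -[RHS](dot_lift_grad c a Op).
  by apply: eq_bigr => i _; congr (_ * _); rewrite -(gE x a x01' i).
- move=> a; apply/rowP => j; rewrite !mxE.
  by have := gE 1 a i01 j; rewrite scale1r.
Qed.

End Lines.

(** * Hypersurfaces over a profile curve *)

Lemma gram_unit (R : realType) (m n : nat) (J : 'M[R]_(m, n)) :
  row_free J -> J *m J^T \in unitmx.
Proof.
move=> fJ; rewrite -row_free_unit -kermx_eq0; apply/eqP/row_matrixP => i.
rewrite row0; set c := row i _.
have cA : c *m (J *m J^T) = 0 by rewrite /c -row_mul mulmx_ker row0.
have cJ : c *m J = 0.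
  by apply: dotv_eq0; rewrite dotvE trmx_mul mulmxA -[c *m J *m _]mulmxA cA mul0mx mxE.
by apply/eqP; rewrite -(mulmx_free_eq0 _ fJ) cJ.
Qed.

(** In codimension one the rows of [J] together with [N] form a basis, on which both sides agree. *)
Lemma tangent_projection (R : realType) (m : nat) (J : 'M[R]_(m, m.+1)) (N : 'rV[R]_m.+1) :
  row_free J -> J *m N^T = 0 -> dotv N N = 1 ->
  J^T *m invmx (J *m J^T) *m J = 1%:M - N^T *m N.
Proof.
move=> fJ JN NN; have Gu := gram_unit fJ.
have NJ : N *m J^T = 0 by rewrite -[N]trmxK -trmx_mul JN trmx0.
set P := J^T *m _ *m J.
pose B := col_mx J N.
have fB : row_free B.
  have inj (c : 'rV[R]_(m + 1)) : c *m B = 0 -> c = 0.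
    rewrite -[c]hsubmxK mul_row_col; set c1 := lsubmx c; set c2 := rsubmx c => e.
    have c20 : c2 = 0.
      have := congr1 (mulmx^~ N^T) e; rewrite mulmxDl -!mulmxA JN mulmx0 add0r mul0mx.
      rewrite [N *m N^T]mx11_scalar -dotvE NN => h.
      by move: h; rewrite mulmx1.
    move: e; rewrite c20 mul0mx addr0 => e.
    have -> : c1 = 0 by apply/eqP; rewrite -(mulmx_free_eq0 _ fJ) e.
    by rewrite row_mx0.
  rewrite -kermx_eq0; apply/eqP/row_matrixP => i; rewrite row0; apply: inj.
  by rewrite -row_mul mulmx_ker row0.
have fullB : row_full B by move: fB; rewrite /row_free /row_full => /eqP ->; rewrite addn1.
have BP : B *m (P - (1%:M - N^T *m N)) = 0.
  rewrite mul_col_mx !mulmxBr !mulmx1 /P !mulmxA JN NJ !mul0mx [J - 0]subr0.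
  rewrite mulmxV // mul1mx [J - J]subrr.
  by rewrite [N *m N^T]mx11_scalar -dotvE NN mul1mx subrr subr0 col_mx0.
have [D DB] := row_fullP fullB.
by apply/eqP; rewrite -subr_eq0 -[P - _]mul1mx -{1}DB -mulmxA BP mulmx0.
Qed.

Lemma sum2E (R : nmodType) (F : 'I_2 -> R) : \sum_a F a = F 0 + F 1.
Proof. by rewrite big_ord_recl big_ord1; congr (_ + F _); apply/val_inj. Qed.

Lemma row2E0 (R : realType) (x y : R) : row2 x y 0 0 = x.
Proof. by rewrite mxE. Qed.

Lemma row2E1 (R : realType) (x y : R) : row2 x y 0 1 = y.
Proof. by rewrite mxE. Qed.

Definition tang (R : realType) (m n : nat) (psi : 'rV[R]_m -> 'rV[R]_n) (i : 'I_m) (j : 'I_n)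
  (v : 'rV[R]_m) : R := partial i (fun u => psi u 0 j) v.

Section Hyper.
Context (R : realType) (m : nat) (Pi : 'rV[R]_m.+1 -> 'rV[R]_2) (O : set 'rV[R]_m.+1).
Hypothesis oO : open O.
Hypothesis sPi : smooth_on O Pi.
Hypothesis rPi : forall p, O p -> riemannian_submersion_at Pi p.
Context (U : set 'rV[R]_m) (psi : 'rV[R]_m -> 'rV[R]_m.+1) (s : 'rV[R]_m -> R).
Context (a b : R) (z z1 z2 : 'I_2 -> R -> R).
Hypothesis oU : open U.
Hypothesis ipsi : immersion_on U psi.
Hypothesis ss : smooth_on U s.
Hypothesis sab : forall v, U v -> a < s v < b.
Hypothesis dz : forall c t, a < t < b -> dder (z c) t 1 (z1 c t).
Hypothesis dz1 : forall c t, a < t < b -> dder (z1 c) t 1 (z2 c t).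
Hypothesis unit_z : forall t, a < t < b -> z1 0 t ^+ 2 + z1 1 t ^+ 2 = 1.
Hypothesis Opsi : forall v, U v -> O (psi v).
Hypothesis Pipsi : forall v c, U v -> Pi (psi v) 0 c = z c (s v).

Definition lapPi c p : R := \sum_i hs Pi c p i i.
(** Horizontal lifts of the unit normal and of the unit tangent of the profile. As s is the arc
    length, [tgt] is the gradient of s on the hypersurface (see [grad_tgt]). *)
Definition nrm v := hlift Pi (row2 (- z1 1 (s v)) (z1 0 (s v))) (psi v).
Definition tgt v := hlift Pi (row2 (z1 0 (s v)) (z1 1 (s v))) (psi v).

Let spsi := proj1 ipsi.

Lemma spsij j : smooth_on U (fun u => psi u 0 j).
Proof. exact: smooth_coord. Qed.

Lemma stang i j : smooth_on U (tang psi i j).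
Proof. exact: smooth_partial (spsij j). Qed.

Lemma dpsi v : U v -> differentiable psi v.
Proof. exact: smooth_diff spsi. Qed.

Lemma jac_tang i j v : U v -> ('J psi v) i j = tang psi i j v.
Proof. by move=> Uv; rewrite jacobianE //; apply: dpsi. Qed.

Lemma tang_grad c i v : U v ->
  \sum_j tang psi i j v * gr Pi c (psi v) j = z1 c (s v) * partial i s v.
Proof.
move=> Uv; rewrite -(partial_comp (f := fun q => Pi q 0 c)); last first.
- exact: smooth_diff (sPia oO sPi c) (Opsi Uv).
- exact: dpsi.
have [_ <-] := partial_comp1 i (smooth_diff ss Uv) (dz c (sab Uv)).
by apply: eq_on_partial oU _ Uv => u Uu; apply: Pipsi.
Qed.

Lemma tang_lift (c : 'rV[R]_2) i v : U v ->
  \sum_j tang psi i j v * hlift Pi c (psi v) 0 j =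
  (\sum_k c 0 k * z1 k (s v)) * partial i s v.
Proof.
move=> Uv; transitivity (\sum_k c 0 k * \sum_j tang psi i j v * gr Pi k (psi v) j).
  under [RHS]eq_bigr => k _ do rewrite mulr_sumr.
  rewrite [RHS]exchange_big; apply: eq_bigr => j _ /=.
  by rewrite hliftE mulr_sumr; apply: eq_bigr => k _; rewrite mulrCA.
rewrite mulr_suml; apply: eq_bigr => k _; rewrite tang_grad //; exact: mulrA.
Qed.

Lemma tang_nrm i v : U v -> \sum_j tang psi i j v * nrm v 0 j = 0.
Proof. by move=> Uv; rewrite tang_lift // sum2E !mxE /=; ring. Qed.

Lemma tang_tgt i v : U v -> \sum_j tang psi i j v * tgt v 0 j = partial i s v.
Proof.
move=> Uv; rewrite tang_lift // sum2E !mxE /= -!expr2 unit_z ?mul1r //; exact: sab.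
Qed.

Lemma lift_dot (c c' : 'rV[R]_2) p : O p ->
  dotv (hlift Pi c p) (hlift Pi c' p) = \sum_k c 0 k * c' 0 k.
Proof.
move=> Op; transitivity (\sum_k c' 0 k * \sum_j hlift Pi c p 0 j * gr Pi k p j).
  under [RHS]eq_bigr => k _ do rewrite mulr_sumr.
  rewrite [RHS]exchange_big; apply: eq_bigr => j _ /=.
  by rewrite [hlift Pi c' p 0 j]hliftE mulr_sumr; apply: eq_bigr => k _; rewrite mulrCA.
by apply: eq_bigr => k _; rewrite (dot_lift_grad sPi rPi) // mulrC.
Qed.

Lemma nrm_unit v : U v -> dotv (nrm v) (nrm v) = 1.
Proof.
move=> Uv; rewrite lift_dot; last exact: Opsi.
by rewrite sum2E !mxE /= mulrNN -!expr2 addrC unit_z //; apply: sab.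
Qed.

Lemma tgt_unit v : U v -> dotv (tgt v) (tgt v) = 1.
Proof.
move=> Uv; rewrite lift_dot; last exact: Opsi.
by rewrite sum2E !mxE /= -!expr2 unit_z //; apply: sab.
Qed.

Lemma tgt_nrm v : U v -> dotv (tgt v) (nrm v) = 0.
Proof.
move=> Uv; rewrite lift_dot; last exact: Opsi.
by rewrite sum2E !mxE /=; ring.
Qed.

Lemma completeness v j l : U v ->
  \sum_i \sum_k inv_metric psi v i k * (tang psi i j v * tang psi k l v) =
  (j == l)%:R - nrm v 0 j * nrm v 0 l.
Proof.
move=> Uv.
have JN : 'J psi v *m (nrm v)^T = 0.
  apply/matrixP => i k; rewrite !mxE -[RHS](tang_nrm i Uv); apply: eq_bigr => j' _.
  by rewrite [_^T _ _]mxE ord1 jac_tang.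
have := tangent_projection (proj2 ipsi v Uv) JN (nrm_unit Uv).
move/matrixP => /(_ j l); rewrite !mxE big_ord1 !mxE => <-.
under [RHS]eq_bigr => i _ do rewrite [X in X * _]mxE mulr_suml.
rewrite [RHS]exchange_big; apply: eq_bigr => i _ /=; apply: eq_bigr => k _.
by rewrite [_^T _ _]mxE !jac_tang // -/(metric psi v) -/(inv_metric psi v); ring.
Qed.

(** By [completeness], a trace over the tangent space is the full trace minus the value on the
    normal. *)
Lemma contraction v (B : 'I_m.+1 -> 'I_m.+1 -> R) : U v ->
  \sum_i \sum_k inv_metric psi v i k * (\sum_j \sum_l tang psi i j v * tang psi k l v * B j l) =
  \sum_j B j j - \sum_j \sum_l nrm v 0 j * nrm v 0 l * B j l.
Proof.
move=> Uv.
transitivity (\sum_j \sum_l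
   (\sum_i \sum_k inv_metric psi v i k * (tang psi i j v * tang psi k l v)) * B j l).
  transitivity (\sum_i \sum_k \sum_j \sum_l
      inv_metric psi v i k * (tang psi i j v * tang psi k l v) * B j l).
    apply: eq_bigr => i _; apply: eq_bigr => k _; rewrite mulr_sumr; apply: eq_bigr => j _.
    by rewrite mulr_sumr; apply: eq_bigr => l _; rewrite mulrA.
  under eq_bigr => i _ do rewrite exchange_big.
  rewrite exchange_big; apply: eq_bigr => j _ /=.
  under eq_bigr => i _ do rewrite exchange_big.
  rewrite exchange_big; apply: eq_bigr => l _ /=.
  by rewrite mulr_suml; apply: eq_bigr => i _; rewrite mulr_suml.
rewrite -sumrB; apply: eq_bigr => j _.
under eq_bigr => l _ do rewrite completeness // mulrBl.
rewrite sumrB; congr (_ - _).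
rewrite (bigD1 j) //= eqxx mul1r big1 ?addr0 // => l lj.
by rewrite eq_sym (negbTE lj) mul0r.
Qed.

Lemma hs_nrm c v j : U v -> \sum_l nrm v 0 l * hs Pi c (psi v) j l = 0.
Proof.
move=> Uv; have Op := Opsi Uv.
transitivity (\sum_k row2 (- z1 1 (s v)) (z1 0 (s v)) 0 k * hg Pi c k (psi v) j).
  under [RHS]eq_bigr => k _ do rewrite /hg mulr_sumr.
  rewrite [RHS]exchange_big; apply: eq_bigr => l _ /=.
  by rewrite hliftE mulr_suml; apply: eq_bigr => k _; rewrite mulrAC mulrA.
by rewrite big1 // => k _; rewrite (hess_grad0 oO sPi rPi) // mulr0.
Qed.

(** The derivative of [tang_grad] in the direction k, computed on both sides. *)
Lemma second_order c i k v : U v ->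
  \sum_j partial k (tang psi i j) v * gr Pi c (psi v) j
  + \sum_j \sum_l tang psi i j v * tang psi k l v * hs Pi c (psi v) l j =
  z2 c (s v) * partial k s v * partial i s v + z1 c (s v) * partial k (partial i s) v.
Proof.
move=> Uv.
have dgrpsi j : dder (fun u => gr Pi c (psi u) j) v (delta_mx 0 k)
   (\sum_l tang psi k l v * hs Pi c (psi v) l j).
  have dg : differentiable (fun q => gr Pi c q j) (psi v).
    by apply: smooth_diff (Opsi Uv); apply: sgr.
  have dc : differentiable (fun u => gr Pi c (psi u) j) v.
    exact: (differentiable_comp (dpsi Uv) dg).
  apply: dder_eq (differentiable_dder _ dc) _.
  exact: (partial_comp k (dpsi Uv) dg).
have e1 : dder (fun u => \sum_j tang psi i j u * gr Pi c (psi u) j) v (delta_mx 0 k)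
   (\sum_j (partial k (tang psi i j) v * gr Pi c (psi v) j +
     tang psi i j v * \sum_l tang psi k l v * hs Pi c (psi v) l j)).
  apply: dder_sum => j _; apply: dderM => //.
  by apply: differentiable_dder; apply: smooth_diff Uv; apply: stang.
have [dzs pzs] := partial_comp1 k (smooth_diff ss Uv) (dz1 c (sab Uv)).
have e2 : dder (fun u => z1 c (s u) * partial i s u) v (delta_mx 0 k)
   (z2 c (s v) * partial k s v * partial i s v + z1 c (s v) * partial k (partial i s) v).
  apply: dderM.
    by apply: dder_eq (differentiable_dder _ dzs) _; rewrite -pzs.
  by apply: differentiable_dder; apply: smooth_diff Uv; apply: smooth_partial.
have e1' := dder_near (open_near oU Uv (fun u Uu => tang_grad c i Uu)) e1.
rewrite -(dder_uniq e1' e2).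
rewrite big_split; congr (_ + _); apply: eq_bigr => j _ /=.
by rewrite mulr_sumr; apply: eq_bigr => l _; rewrite mulrA.
Qed.

Lemma grad_s_unit v : U v ->
  \sum_i \sum_k inv_metric psi v i k * (partial i s v * partial k s v) = 1.
Proof.
move=> Uv; have := contraction (fun j l => tgt v 0 j * tgt v 0 l) Uv.
have -> : \sum_j \sum_l nrm v 0 j * nrm v 0 l * (tgt v 0 j * tgt v 0 l) = 0.
  rewrite (eq_bigr (fun j => nrm v 0 j * tgt v 0 j * dotv (tgt v) (nrm v))).
    by rewrite -mulr_suml tgt_nrm // mulr0.
  by move=> j _; rewrite mulr_sumr; apply: eq_bigr => l _; ring.
rewrite subr0 => h; rewrite -[RHS](tgt_unit Uv) -[RHS]h.
apply: eq_bigr => i _; apply: eq_bigr => k _; congr (_ * _).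
rewrite -!tang_tgt // mulr_suml; apply: eq_bigr => j _.
by rewrite mulr_sumr; apply: eq_bigr => l _; ring.
Qed.

(** [second_order] contracted with the inverse metric. The Hessian of [Pi] contributes its full
    trace because it kills the normal, and the gradient of s has length one. The vector [c] is left
    free to serve for the normal and for the tangent of the profile. *)
Lemma trace_along (c : 'rV[R]_2) v : U v ->
  \sum_i \sum_k inv_metric psi v i k *
     (\sum_j partial k (tang psi i j) v * hlift Pi c (psi v) 0 j) =
  \sum_l c 0 l * z2 l (s v) - \sum_l c 0 l * lapPi l (psi v) +
  (\sum_l c 0 l * z1 l (s v)) *
    \sum_i \sum_k inv_metric psi v i k * partial k (partial i s) v.
Proof.
move=> Uv.
have lapE l : \sum_i \sum_k inv_metric psi v i k *
    (\sum_j \sum_l' tang psi i j v * tang psi k l' v * hs Pi l (psi v) l' j) = lapPi l (psi v).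
  rewrite (contraction (fun j l' => hs Pi l (psi v) l' j) Uv).
  rewrite -[RHS]subr0; congr (_ - _).
  rewrite exchange_big big1 // => j _ /=.
  transitivity (nrm v 0 j * \sum_l' nrm v 0 l' * hs Pi l (psi v) j l').
    by rewrite mulr_sumr; apply: eq_bigr => l' _; ring.
  by rewrite hs_nrm // mulr0.
have -> : \sum_l c 0 l * z2 l (s v) = (\sum_l c 0 l * z2 l (s v)) *
   (\sum_i \sum_k inv_metric psi v i k * (partial i s v * partial k s v)).
  by rewrite grad_s_unit // mulr1.
apply/eqP; rewrite addrAC eq_sym subr_eq eq_sym; apply/eqP.
under [X in _ + X]eq_bigr => l _ do rewrite -lapE mulr_sumr.
rewrite [X in _ + X]exchange_big -big_split mulr_sumr mulr_sumr -big_split.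
apply: eq_bigr => i _ /=.
under [X in _ + X]eq_bigr => l _ do rewrite mulr_sumr.
rewrite [X in _ + X]exchange_big -big_split mulr_sumr mulr_sumr -big_split.
apply: eq_bigr => k _ /=.
transitivity (inv_metric psi v i k * \sum_l c 0 l * (
  \sum_j partial k (tang psi i j) v * gr Pi l (psi v) j
  + \sum_j \sum_l' tang psi i j v * tang psi k l' v * hs Pi l (psi v) l' j)).
  under [X in _ = _ * X]eq_bigr => l _ do rewrite mulrDr.
  rewrite big_split mulrDr; congr (_ + _); last first.
    by rewrite mulr_sumr; apply: eq_bigr => l _; rewrite mulrCA.
  congr (_ * _).
  under [RHS]eq_bigr => l _ do rewrite mulr_sumr.
  rewrite [RHS]exchange_big; apply: eq_bigr => j _ /=.
  by rewrite hliftE mulr_sumr; apply: eq_bigr => l _; ring.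
transitivity (inv_metric psi v i k * \sum_l c 0 l * (
  z2 l (s v) * partial k s v * partial i s v + z1 l (s v) * partial k (partial i s) v)).
  by congr (_ * _); apply: eq_bigr => l _; rewrite second_order.
rewrite !sum2E; ring.
Qed.

Definition ncrv v : R := z1 0 (s v) * z2 1 (s v) - z1 1 (s v) * z2 0 (s v).

(* The left-hand side is the trace of the second fundamental form. *)
Lemma trace_second_form v : U v ->
  \sum_i \sum_k inv_metric psi v i k * (\sum_j partial k (tang psi i j) v * nrm v 0 j) =
  ncrv v + z1 1 (s v) * lapPi 0 (psi v) - z1 0 (s v) * lapPi 1 (psi v).
Proof.
move=> Uv; rewrite trace_along // !sum2E !row2E0 !row2E1 /ncrv.
move: (lapPi 0 _) (lapPi 1 _) (\sum_i _) (z1 0 _) (z1 1 _) (z2 0 _) (z2 1 _) => *; ring.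
Qed.

End Hyper.

Lemma trace_char_poly_roots (R : comNzRingType) (m : nat) (A : 'M[R]_m.+1) (ps : seq R) :
  size ps = m.+1 -> char_poly A = \prod_(p <- ps) ('X - p%:P) -> \tr A = \sum_(p <- ps) p.
Proof.
move=> sz e; apply: oppr_inj; rewrite -char_poly_trace // e.
by rewrite -coefPn_prod_XsubC sz.
Qed.

Lemma trace_char_poly (R : comNzRingType) (m d : nat) (A : 'M[R]_m.+1) (k0 : R)
    (mult : 'I_d -> nat) (k : 'I_d -> R) : (\sum_i mult i = m)%N ->
  char_poly A = ('X - k0%:P) * \prod_(i < d) ('X - (k i)%:P) ^+ mult i ->
  \tr A = k0 + \sum_i k i *+ mult i.
Proof.
move=> sz e.
pose ps := k0 :: flatten [seq nseq (mult i) (k i) | i <- enum 'I_d].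
rewrite (@trace_char_poly_roots _ _ A ps).
- rewrite big_cons big_flatten big_map big_enum /=; congr (_ + _).
  by apply: eq_bigr => i _; rewrite big_nseq iter_addr_0.
- rewrite /= size_flatten /shape -map_comp sumnE big_map big_enum -sz /=; congr _.+1.
  by apply: eq_bigr => i _; rewrite size_nseq.
- rewrite e big_cons big_flatten big_map big_enum /=; congr (_ * _).
  by apply: eq_bigr => i _; rewrite big_nseq iter_mulr_1.
Qed.

Lemma smooth_dder (R : realType) (a b : R) (z : R -> R) (k : nat) (t : R) :
  smooth_fun_on `]a, b[%classic z -> a < t < b ->
  dder (derive1n k z) t 1 (derive1n k.+1 z t).
Proof.
move=> sz tab; rewrite derive1nS derive1E; apply: dderP; apply: sz.
by rewrite /= in_itv.
Qed.

Lemma affine_derive1n (R : realType) (c e : R) (k : nat) :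
  exists c' e', derive1n k (fun t : R => c + t * e) = (fun t => c' + t * e').
Proof.
elim: k => [|k [c' [e' IH]]]; first by exists c, e.
exists e', 0; rewrite derive1nS IH; apply/funext => t; rewrite mulr0 addr0 derive1E.
apply: dderE; apply: dder_eq (dderD (dder_cst _ _ _) (dderM (is_derive_id _ _) (dder_cst _ _ _))) _.
by rewrite mul1r mulr0 addr0 add0r.
Qed.

Lemma affine_dder (R : realType) (c e : R) (t : R) : dder (fun t : R => c + t * e) t 1 e.
Proof.
apply: dder_eq (dderD (dder_cst _ _ _) (dderM (is_derive_id _ _) (dder_cst _ _ _))) _.
by rewrite mul1r mulr0 addr0 add0r.
Qed.

Lemma affine_smooth (R : realType) (c e : R) (I : set R) :
  smooth_fun_on I (fun t : R => c + t * e).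
Proof.
move=> k t _; have [c' [e' ->]] := affine_derive1n c e k.
exact: dder_derivable (affine_dder _ _ _).
Qed.

Lemma coord_smooth (R : realType) (m : nat) (U : set 'rV[R]_m) j : open U ->
  smooth_on U (fun w : 'rV[R]_m => w 0 j).
Proof.
move=> oU.
pose Q (h : 'rV[R]_m -> R) := h = (fun w => w 0 j) \/ exists c, h = fun=> c.
suff sQ : forall h, Q h -> smooth_on U h by apply: sQ; left.
apply: smooth_coind => // h [->|[c ->]]; split.
- by move=> u _; apply: differentiable_coord.
- move=> i; exists (fun=> (delta_mx 0 i : 'rV[R]_m) 0 j); split.
    by right; exists ((delta_mx 0 i : 'rV[R]_m) 0 j).
  by move=> u _; apply: dderE; apply: coord_dder.
- by move=> u _; apply: differentiable_cst.
- move=> i; exists (fun=> 0); split; first by right; exists 0.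
  by move=> u _; apply: (dderE (dder_cst _ _ _)).
Qed.

Lemma smooth_comp (R : realType) (m n : nat) (U : set 'rV[R]_m) (O : set 'rV[R]_n)
    (F : 'rV[R]_m -> 'rV[R]_n) (f : 'rV[R]_n -> R) : open U -> smooth_on O f ->
  (forall j, smooth_on U (fun v => F v 0 j)) -> (forall u, U u -> O (F u)) ->
  smooth_on U (fun v => f (F v)).
Proof.
move=> oU sf sF FO; apply: smooth_class_on => //.
by apply: (SCcomp sf) => // j; apply: SCbase.
Qed.

Lemma smoothD (R : realType) (m : nat) (U : set 'rV[R]_m) (f g : 'rV[R]_m -> R) :
  open U -> smooth_on U f -> smooth_on U g -> smooth_on U (fun v => f v + g v).
Proof.
by move=> oU sf sg; apply: smooth_class_on => //; apply: SCadd; apply: SCbase.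
Qed.

Lemma smoothM (R : realType) (m : nat) (U : set 'rV[R]_m) (f g : 'rV[R]_m -> R) :
  open U -> smooth_on U f -> smooth_on U g -> smooth_on U (fun v => f v * g v).
Proof.
by move=> oU sf sg; apply: smooth_class_on => //; apply: SCmul; apply: SCbase.
Qed.

Lemma smooth_cst (R : realType) (m : nat) (U : set 'rV[R]_m) (c : R) :
  open U -> smooth_on U (fun=> c).
Proof. by move=> oU; apply: smooth_class_on => //; apply: SCcst. Qed.

Lemma smooth_sum (R : realType) (m : nat) (U : set 'rV[R]_m) (I : Type) (r : seq I)
    (f : I -> 'rV[R]_m -> R) : open U -> (forall i, smooth_on U (f i)) ->
  smooth_on U (fun v => \sum_(i <- r) f i v).
Proof.
by move=> oU sf; apply: smooth_class_on => //; apply: SCsum => i; apply: SCbase.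
Qed.

Lemma differentiable_det (R : realType) (V : normedModType R) (k : nat)
    (A : V -> 'M[R]_k) (a : V) : (forall i j, differentiable (fun x => A x i j) a) ->
  differentiable (fun x => \det (A x)) a.
Proof.
move=> h; apply: diff_sum_ext => p _; apply: diffM_ext; first exact: differentiable_cst.
by apply: diff_prod_ext => i _; apply: h.
Qed.

Lemma metricE (R : realType) (m n : nat) (psi : 'rV[R]_m -> 'rV[R]_n) v i k :
  differentiable psi v ->
  metric psi v i k = \sum_j tang psi i j v * tang psi k j v.
Proof.
by move=> dv; rewrite mxE; apply: eq_bigr => j _; rewrite [_^T _ _]mxE !jacobianE.
Qed.

Lemma differentiable_metric (R : realType) (m n : nat) (U : set 'rV[R]_m)
    (psi : 'rV[R]_m -> 'rV[R]_n) v i k : open U -> smooth_on U psi -> U v ->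
  differentiable (fun u => metric psi u i k) v.
Proof.
move=> oU sp Uv; apply: near_eq_differentiable
    (_ : differentiable (fun u => \sum_j tang psi i j u * tang psi k j u) v).
  apply: open_near oU Uv _ => u Uu; rewrite metricE //; exact: smooth_diff sp Uu.
apply: diff_sum_ext => j _; apply: diffM_ext; apply: smooth_diff Uv;
  apply: smooth_partial; exact: smooth_coord.
Qed.

Lemma unit_metric (R : realType) (m n : nat) (psi : 'rV[R]_m -> 'rV[R]_n) v :
  row_free ('J psi v) = (metric psi v \in unitmx).
Proof.
apply/idP/idP => [|Gu]; first exact: gram_unit.
apply/row_freeP; exists (('J psi v)^T *m invmx (metric psi v)).
by rewrite mulmxA mulmxV.
Qed.

Lemma open_immersion (R : realType) (m n : nat) (U : set 'rV[R]_m)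
    (psi : 'rV[R]_m -> 'rV[R]_n) : open U -> smooth_on U psi ->
  open [set v | U v /\ row_free ('J psi v)].
Proof.
move=> oU sp; rewrite openE => v /= [Uv fv]; apply: filterI; first exact: open_nbhs_nbhs.
have dv : {for v, continuous (fun u => \det (metric psi u))}.
  apply: differentiable_near; apply: differentiable_det => i k.
  exact: differentiable_metric oU sp Uv.
have d0 : \det (metric psi v) != 0 by move: fv; rewrite unit_metric unitmxE unitfE.
have : \forall u \near v, \det (metric psi u) != 0 by exact: (cvgr_neq0 _ dv d0).
by apply: filterS => u; rewrite unit_metric unitmxE unitfE.
Qed.

Lemma row_free_inj (R : fieldType) (m n : nat) (J : 'M[R]_(m, n)) :
  (forall c : 'rV[R]_m, c *m J = 0 -> c = 0) -> row_free J.
Proof.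
move=> inj; rewrite -kermx_eq0; apply/eqP/row_matrixP => i; rewrite row0; apply: inj.
by rewrite -row_mul mulmx_ker row0.
Qed.

(** * The Laplacians of the coordinates of the projection *)

Definition wgrad (R : realType) (d i : nat) (c : 'I_2) (q : 'rV[R]_2) : R :=
  (if c == 0 then sin (wall_angle R d i) else - cos (wall_angle R d i)) /
  wfun d i (q 0 0) (q 0 1).

(* The gradient of the logarithm of [V = \prod_i w_i ^ m_i]. *)
Definition logvol_grad (R : realType) (d : nat) (mult : 'I_d -> nat) (c : 'I_2)
    (q : 'rV[R]_2) : R := \sum_(i < d) wgrad d i c q *+ mult i.

Definition coords (R : realType) (x y : R -> R) (c : 'I_2) : R -> R :=
  if c == 0 then x else y.

Section OrbitLaplacian.
Context (R : realType) (n' d : nat) (mult : 'I_d -> nat)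
  (Pi : 'rV[R]_n'.+3 -> 'rV[R]_2).
Let O := Pi @^-1` interior (@cone R d).
Hypothesis sum_mult : (\sum_i mult i = n'.+1)%N.
Hypothesis oO : open O.
Hypothesis sPi : smooth_on O Pi.
Hypothesis rPi : forall p, O p -> riemannian_submersion_at Pi p.
Hypothesis curvatures : principal_curvature_formula mult Pi.

Section Profile.
Context (a b : R) (x y : R -> R) (U : set 'rV[R]_n'.+2)
  (psi : 'rV[R]_n'.+2 -> 'rV[R]_n'.+3) (s : 'rV[R]_n'.+2 -> R).
Hypothesis cxy : profile_curve d a b x y.
Hypothesis pxy : profile_param Pi a b x y U psi s.

Lemma profile_dder c t k : a < t < b ->
  dder (derive1n k (coords x y c)) t 1 (derive1n k.+1 (coords x y c) t).
Proof.
by case: cxy => sx sy _ tab; apply: smooth_dder tab; rewrite /coords; case: ifP.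
Qed.

Lemma profile_O v : U v -> O (psi v).
Proof.
case: pxy => _ _ _ h Uv; have [sab e] := h v Uv; rewrite /O /= e.
by case: cxy => _ _ /(_ _ sab)[].
Qed.

Lemma profile_coords v c : U v -> Pi (psi v) 0 c = coords x y c (s v).
Proof.
case: pxy => _ _ _ h Uv; have [_ ->] := h v Uv; rewrite /coords mxE; by case: ifP.
Qed.

(** The trace of the second fundamental form is computed in two ways, by [trace_second_form] and as
    the sum of the roots in the principal curvature formula. The curvature of the profile cancels,
    and one linear relation between the two Laplacians remains. *)
Lemma profile_trace v : U v ->
  derive1 y (s v) * (lapPi Pi 0 (psi v) - logvol_grad mult 0 (Pi (psi v))) =
  derive1 x (s v) * (lapPi Pi 1 (psi v) - logvol_grad mult 1 (Pi (psi v))).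
Proof.
move=> Uv; case: (pxy) => oU ipsi ss sP.
pose z c := coords x y c.
pose z1 c := derive1 (z c); pose z2 c := derive1n 2 (z c).
have dz c t : a < t < b -> dder (z c) t 1 (z1 c t) by move=> /(@profile_dder c t 0).
have dz1 c t : a < t < b -> dder (z1 c) t 1 (z2 c t) by move=> /(@profile_dder c t 1).
have uz t : a < t < b -> z1 0 t ^+ 2 + z1 1 t ^+ 2 = 1.
  by case: cxy => _ _ h /h[].
have sab u : U u -> a < s u < b by move=> /sP[].
have tr := trace_second_form oO sPi rPi oU ipsi ss sab dz dz1 uz profile_O
  (fun u c => @profile_coords u c) Uv.
set eta := nrm Pi psi s z1 v in tr.
have eta1 : dotv eta eta = 1.
  exact: (nrm_unit sPi rPi sab uz profile_O Uv).
have dpsi u : U u -> differentiable psi u by apply: smooth_diff (proj1 ipsi).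
have tE i j u : U u -> partial i psi u 0 j = tang psi i j u.
  by move=> Uu; rewrite partial_coord //; apply: dpsi.
have tE2 i k j : partial k (partial i psi) v 0 j = partial k (tang psi i j) v.
  rewrite partial_coord; last by apply: smooth_diff Uv; apply: smooth_partial (proj1 ipsi).
  by apply: eq_on_partial oU _ Uv => u; apply: tE.
have eta0 i : dotv (partial i psi v) eta = 0.
  rewrite -[RHS](tang_nrm oO sPi oU ipsi ss sab dz profile_O
    (fun u c => @profile_coords u c) i Uv).
  by apply: eq_bigr => j _; rewrite tE.
have etaP : eta *m 'J Pi (psi v) = row2 (- derive1 y (s v)) (derive1 x (s v)).
  apply/rowP => c; rewrite mxE.
  rewrite -(dot_lift_grad sPi rPi (row2 (- z1 1 (s v)) (z1 0 (s v))) c (profile_O Uv)).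
  by apply: eq_bigr => j _; rewrite (JPi sPi) //; apply: profile_O.
have cp := curvatures cxy pxy Uv eta1 eta0 etaP.
have := trace_char_poly sum_mult cp.
have -> : \tr (shape_operator psi v eta) =
   \sum_i \sum_k inv_metric psi v i k * (\sum_j partial k (tang psi i j) v * eta 0 j).
  apply: eq_bigr => i _; rewrite mxE; apply: eq_bigr => k _; rewrite mxE.
  by congr (_ * _); apply: eq_bigr => j _; rewrite tE2.
rewrite tr /curv_profile /ncrv.
have -> : \sum_(i < d) curv d i x y (s v) *+ mult i =
   derive1 y (s v) * logvol_grad mult 0 (Pi (psi v)) -
   derive1 x (s v) * logvol_grad mult 1 (Pi (psi v)).
  rewrite /logvol_grad !mulr_sumr -sumrB; apply: eq_bigr => i _.
  rewrite !mulrnAr -mulrnBl; congr (_ *+ _); rewrite /curv /wgrad /wall_angle /=.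
  by rewrite !profile_coords // /coords /=; ring.
rewrite /z1 /z2 /z /coords /=.
move: (lapPi _ _ _) (lapPi _ _ _) (logvol_grad _ _ _) (logvol_grad _ _ _) => A B C D.
move: (derive1 y _) (derive1 x _) (derive1 (derive1 y) _) (derive1 (derive1 x) _) => y1 x1 y2 x2 h.
by apply/eqP; rewrite -subr_eq0; apply/eqP; move/eqP: h; rewrite -subr_eq0 => /eqP <-; ring.
Qed.

End Profile.

(** The test hypersurface consists of the horizontal straight lines of direction (c0, c1) issuing
    from the piece of orbit [psi0]. By [straight_lines] it lies over a line through the image of p,
    so that [profile_trace] applies. *)
Lemma lapPi_orbit (U0 : set 'rV[R]_n'.+1) (psi0 : 'rV[R]_n'.+1 -> 'rV[R]_n'.+3)
    (th0 : 'rV[R]_n'.+1) (c0 c1 : R) (p : 'rV[R]_n'.+3) :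
  open U0 -> immersion_on U0 psi0 -> U0 th0 -> psi0 th0 = p -> O p ->
  (forall th, U0 th -> Pi (psi0 th) = Pi p) -> c0 ^+ 2 + c1 ^+ 2 = 1 ->
  c1 * (lapPi Pi 0 p - logvol_grad mult 0 (Pi p)) =
  c0 * (lapPi Pi 1 p - logvol_grad mult 1 (Pi p)).
Proof.
move=> oU0 [spsi0 imm0] Uth0 pp Op Pi0 c01.
pose c := row2 c0 c1.
have c_le k : `|c 0 k| <= 1.
  rewrite -[leRHS]sqrtr1 -sqrtr_sqr ler_wsqrtr // -c01 mxE; case: ifP => _.
    by rewrite lerDl sqr_ge0.
  by rewrite lerDr sqr_ge0.
have [r r0 lines] := straight_lines oO sPi rPi Op.
have dpsi0 th : U0 th -> differentiable psi0 th by apply: smooth_diff.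
have [r1 r10 hr1] : exists2 r1 : R, 0 < r1 & forall th, `|th - th0| < r1 ->
    U0 th /\ `|psi0 th - p| < r.
  apply: near_rV; apply: filterI; first exact: open_nbhs_nbhs.
  have ct : {for th0, continuous psi0} by apply: differentiable_near; apply: dpsi0.
  have : \forall th \near th0, `|psi0 th0 - psi0 th| < r.
    exact: (cvgr_dist_lt _ _ ct _ r0).
  by apply: filterS => th; rewrite pp distrC.
pose r2 := Num.min r r1.
have r20 : 0 < r2 by rewrite lt_min r0.
(* Coordinate 0 is the parameter along the lines; the others parametrize the orbit. *)
pose th (w : 'rV[R]_n'.+2) : 'rV[R]_n'.+1 := \row_k w 0 (fintype.lift ord0 k).
pose w0 : 'rV[R]_n'.+2 := \row_i (if unlift ord0 i is Some k then th0 0 k else 0).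
have w00 : w0 0 0 = 0 by rewrite mxE unlift_none.
have thw0 : th w0 = th0 by apply/rowP => k; rewrite !mxE liftK.
pose U1 := [set w : 'rV[R]_n'.+2 | ball w0 r2 w].
have oU1 : open U1 by exact: ball_open.
have U1P w : U1 w -> `|w 0 0| < r2 /\ `|th w - th0| < r2.
  rewrite /U1 /= -ball_normE /= distrC => wr.
  have cw i : `|w 0 i - w0 0 i| < r2.
    by apply: le_lt_trans wr; have := ler_rV_norm (w - w0) i; rewrite !mxE.
  split; first by have := cw 0; rewrite w00 subr0.
  apply: le_lt_trans wr; apply: rV_norm_le => // k.
  have := ler_rV_norm (w - w0) (fintype.lift ord0 k).
  by rewrite !mxE liftK.
have th_U1 w : U1 w -> U0 (th w) /\ `|psi0 (th w) - p| < r.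
  by move=> /U1P[_ h]; apply: hr1; apply: lt_le_trans h _; rewrite ge_min lexx orbT.
pose psi w := psi0 (th w) + hlift Pi (w 0 0 *: c) (psi0 (th w)).
have line_U1 w : U1 w -> O (psi w) /\ Pi (psi w) = Pi p + w 0 0 *: c.
  move=> U1w; have [Ut tr] := th_U1 w U1w.
  have wc : `|w 0 0 *: c| < r.
    have [h _] := U1P w U1w.
    apply: (@le_lt_trans _ _ `|w 0 0|); last by apply: lt_le_trans h _; rewrite ge_min lexx.
    by apply: rV_norm_le => // k; rewrite mxE normrM ler_piMr.
  by have [Oy e1 _] := lines _ _ tr wc; rewrite Pi0 // in e1.
have psiE w j : psi w 0 j = psi0 (th w) 0 j +
    w 0 0 * \sum_k c 0 k * gr Pi k (psi0 (th w)) j.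
  rewrite mxE hliftE mulr_sumr; congr (_ + _); apply: eq_bigr => k _.
  by rewrite mxE mulrA.
have Opsi0 t : U0 t -> O (psi0 t) by move=> Ut; rewrite /O /= Pi0.
have sth k : smooth_on U1 (fun w => th w 0 k).
  apply: smooth_eq (coord_smooth (fintype.lift ord0 k) oU1) => // w _.
  by rewrite mxE.
have sgp k j : smooth_on U0 (fun t => gr Pi k (psi0 t) j).
  by apply: (smooth_comp oU0 (sgr oO sPi k j)) => // i; apply: smooth_coord.
have scg j : smooth_on U0 (fun t => \sum_k c 0 k * gr Pi k (psi0 t) j).
  apply: smooth_sum => // k; apply: smoothM => //; exact: smooth_cst.
have U1U0 w : U1 w -> U0 (th w) by move=> /th_U1[].
have sA j : smooth_on U1 (fun w => psi0 (th w) 0 j).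
  by apply: (smooth_comp oU1 (smooth_coord j oU0 spsi0)).
have sB j : smooth_on U1 (fun w => \sum_k c 0 k * gr Pi k (psi0 (th w)) j).
  exact: (smooth_comp oU1 (scg j)).
have spsi : smooth_on U1 psi.
  apply: smooth_rV => // j; apply: (@smooth_eq _ _ _ U1 (fun w => psi0 (th w) 0 j +
    w 0 0 * \sum_k c 0 k * gr Pi k (psi0 (th w)) j)) => //.
  by apply: smoothD => //; apply: smoothM => //; apply: coord_smooth.
(* The immersion property is verified at [w0] alone; [U] keeps the points where it holds, which form
   an open set. *)
pose U := [set w | U1 w /\ row_free ('J psi w)].
have oU : open U by exact: open_immersion.
have U1w0 : U1 w0 by exact: ballxx.
have pth i k w : U1 w -> partial i (fun w => th w 0 k) w = (i == fintype.lift ord0 k)%:R.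
  move=> U1w; transitivity (partial i (fun w : 'rV[R]_n'.+2 => w 0 (fintype.lift ord0 k)) w).
    by apply: eq_on_partial oU1 _ U1w => u _; rewrite mxE.
  by rewrite /partial (dderE (coord_dder _ _ _)) mxE eqxx eq_sym.
have dth w : U1 w -> differentiable th w.
  by move=> U1w; apply: diff_rV => k; apply: smooth_diff (sth k) U1w.
have tangE i j : tang psi i j w0 =
    \sum_k (i == fintype.lift ord0 k)%:R * tang psi0 k j th0 +
    (i == 0)%:R * hlift Pi c p 0 j.
  have e1 : partial i (fun w => psi0 (th w) 0 j) w0 =
      \sum_k (i == fintype.lift ord0 k)%:R * tang psi0 k j th0.
    rewrite (partial_comp (f := fun t => psi0 t 0 j) i (dth _ U1w0)); last first.
      by apply: smooth_diff (smooth_coord j oU0 spsi0) (U1U0 _ U1w0).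
    by apply: eq_bigr => k _; rewrite pth // thw0.
  apply: (@dderE _ _ (delta_mx 0 i) (fun w => psi w 0 j) w0).
  apply: dder_near (_ : dder (fun w => psi0 (th w) 0 j +
    w 0 0 * \sum_k c 0 k * gr Pi k (psi0 (th w)) j) w0 _ _).
    by apply: open_near oU1 U1w0 _ => w _; rewrite psiE.
  apply: dderD; first by rewrite -e1; apply: differentiable_dder; apply: smooth_diff (sA j) U1w0.
  apply: dder_eq (dderM (coord_dder _ _ _) (differentiable_dder _ (smooth_diff (sB j) U1w0))) _.
  by rewrite w00 mul0r addr0 mxE eqxx thw0 pp hliftE eq_sym.
have tang_gr0 k b : \sum_j tang psi0 k j th0 * gr Pi b p j = 0.
  rewrite -pp -(partial_comp (f := fun q => Pi q 0 b) k (dpsi0 _ Uth0)); last first.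
    by apply: smooth_diff (sPia oO sPi b) (Opsi0 _ Uth0).
  transitivity (partial k (fun _ : 'rV[R]_n'.+1 => Pi p 0 b) th0).
    by apply: eq_on_partial oU0 _ Uth0 => t Ut; rewrite Pi0.
  exact: (dderE (dder_cst _ _ _)).
have Uw0 : U w0.
  split=> //; apply: row_free_inj => cf ccJ.
  have hj j : cf 0 0 * hlift Pi c p 0 j +
      \sum_k cf 0 (fintype.lift ord0 k) * tang psi0 k j th0 = 0.
    have := congr1 (fun A : 'rV[R]_n'.+3 => A 0 j) ccJ; rewrite !mxE => e.
    transitivity (\sum_i cf 0 i * tang psi i j w0); last first.
      by rewrite -[RHS]e; apply: eq_bigr => i _; rewrite jacobianE //; apply: smooth_diff spsi U1w0.
    under [RHS]eq_bigr => i _ do rewrite tangE.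
    rewrite [RHS]big_ord_recl eqxx mul1r; congr (_ + _).
      by rewrite big1 ?add0r // => k _; rewrite mul0r.
    apply: eq_bigr => k _; rewrite -[_ == 0]/false mul0r addr0; congr (_ * _).
    rewrite (bigD1 k) //= eqxx mul1r big1 ?addr0 // => l lk.
    by rewrite (inj_eq lift_inj) eq_sym (negbTE lk) mul0r.
  have cc0 : cf 0 0 = 0.
    have hb b : cf 0 0 * c 0 b = 0.
      have : \sum_j (cf 0 0 * hlift Pi c p 0 j +
          \sum_k cf 0 (fintype.lift ord0 k) * tang psi0 k j th0) * gr Pi b p j = 0.
        by rewrite big1 // => j _; rewrite hj mul0r.
      under eq_bigr => j _ do rewrite mulrDl -mulrA.
      rewrite big_split /= -mulr_sumr (dot_lift_grad sPi rPi) //.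
      under [X in _ + X]eq_bigr => j _ do rewrite mulr_suml.
      rewrite exchange_big [X in _ + X]big1 ?addr0 // => k _ /=.
      under eq_bigr => j _ do rewrite -mulrA.
      by rewrite -mulr_sumr tang_gr0 mulr0.
    rewrite -[LHS]mulr1 -c01 mulrDr !expr2 !mulrA.
    by have := hb 0; have := hb 1; rewrite !mxE /= => -> ->; rewrite !mul0r addr0.
  have cck : (\row_k cf 0 (fintype.lift ord0 k)) *m 'J psi0 th0 = 0.
    apply/rowP => j; rewrite !mxE -[RHS](hj j) cc0 mul0r add0r; apply: eq_bigr => k _.
    by rewrite mxE jacobianE //; apply: dpsi0.
  have := imm0 _ Uth0 => fJ.
  have := mulmx_free_eq0 (\row_k cf 0 (fintype.lift ord0 k)) fJ; rewrite cck eqxx => /esym/eqP e.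
  apply/rowP => i; rewrite [RHS]mxE; case: (unliftP 0 i) => [k ->|-> //].
  by have := congr1 (fun A : 'rV[R]_n'.+1 => A 0 k) e; rewrite !mxE.
pose x t := Pi p 0 0 + t * c0; pose y t := Pi p 0 1 + t * c1.
have dx t : derive1 x t = c0 by rewrite derive1E; apply: dderE; apply: affine_dder.
have dy t : derive1 y t = c1 by rewrite derive1E; apply: dderE; apply: affine_dder.
have Pixy w : U1 w -> Pi (psi w) = row2 (x (w 0 0)) (y (w 0 0)).
  move=> U1w; have [_ ->] := line_U1 w U1w; apply/rowP => k; rewrite !mxE.
  by case: ifP => [/eqP ->//|]; case: k => [[|[|//]]] // i _; congr (Pi p _ _ + _); apply/val_inj.
have cxy : profile_curve d (- r2) r2 x y.
  split; [exact: affine_smooth|exact: affine_smooth|move=> t tr; split].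
    by rewrite dx dy.
  pose wt := w0 + t *: delta_mx 0 0.
  have U1wt : U1 wt.
    rewrite /U1 /= -ball_normE /= /wt opprD addrA subrr sub0r normrN.
    apply: (@le_lt_trans _ _ `|t|); last by rewrite ltr_norml.
    apply: rV_norm_le => // i; rewrite !mxE eqxx /= normrM ler_piMr //.
    by case: eqP => _; rewrite ?normr1 ?normr0.
  have wt0 : wt 0 0 = t by rewrite mxE w00 add0r !mxE !eqxx mulr1.
  by have [] := line_U1 wt U1wt; rewrite /O /= (Pixy wt U1wt) wt0.
have pxy : profile_param Pi (- r2) r2 x y U psi (fun w => w 0 0).
  split => //.
  - by split=> [|w []//]; apply: smooth_sub spsi => w [].
  - exact: coord_smooth.
  move=> w [U1w _]; split; last exact: Pixy.
  by have [h _] := U1P w U1w; rewrite -ltr_norml.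
have psiw0 : psi w0 = p.
  apply/rowP => j; rewrite psiE w00 mul0r addr0 thw0 pp //.
by have := profile_trace cxy pxy Uw0; rewrite dx dy psiw0.
Qed.

(** Each of the two coordinate directions isolates one of the two Laplacians. *)
Lemma lapPi_formula (U0 : set 'rV[R]_n'.+1) (psi0 : 'rV[R]_n'.+1 -> 'rV[R]_n'.+3)
    (th0 : 'rV[R]_n'.+1) c (p : 'rV[R]_n'.+3) :
  open U0 -> immersion_on U0 psi0 -> U0 th0 -> psi0 th0 = p -> O p ->
  (forall th, U0 th -> Pi (psi0 th) = Pi p) ->
  lapPi Pi c p = logvol_grad mult c (Pi p).
Proof.
move=> h1 h2 h3 h4 h5 h6.
have := @lapPi_orbit U0 psi0 th0 0 1 p h1 h2 h3 h4 h5 h6.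
rewrite expr0n /= expr1n add0r mul1r mul0r => /(_ erefl) e0.
have := @lapPi_orbit U0 psi0 th0 1 0 p h1 h2 h3 h4 h5 h6.
rewrite expr0n /= expr1n addr0 mul1r mul0r => /(_ erefl) e1.
have [->|->] : c = 0 \/ c = 1.
- by case: c => [[|[|//]]] i; [left|right]; apply/val_inj.
- by apply/eqP; rewrite -subr_eq0 e0.
- by apply/eqP; rewrite -subr_eq0 -e1.
Qed.

End OrbitLaplacian.

(** * The Laplace-Beltrami operator *)

(** The segment from the identity to the Gram matrix consists of invertible matrices, so the
    determinant, which is 1 at the start, cannot become zero or negative. *)
Lemma det_gram_gt0 (R : realType) (m n : nat) (J : 'M[R]_(m, n)) :
  row_free J -> 0 < \det (J *m J^T).
Proof.
move=> fJ; set G := J *m J^T.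
pose A (t : R) := (1 - t) *: (1%:M : 'M[R]_m) + t *: G.
have A_unit t : 0 <= t <= 1 -> \det (A t) != 0.
  move=> /andP[t0 t1]; rewrite -unitfE -[_ \is a _]/(_ \in unitmx) -row_free_unit.
  apply: row_free_inj => c cA.
  have : (1 - t) * dotv c c + t * dotv (c *m J) (c *m J) = 0.
    have := congr1 (fun B : 'rV[R]_m => dotv B c) cA.
    rewrite [RHS]big1 => [|j _]; last by rewrite mxE mul0r.
    rewrite /A mulmxDr -!scalemxAr mulmx1 => <-.
    rewrite !dotvE mulmxDl -!scalemxAl [RHS]mxE [X in _ = X + _]mxE [X in _ = _ + X]mxE.
    by rewrite trmx_mul !mulmxA.
  have h1 := dotv_ge0 c; have h2 := dotv_ge0 (c *m J).
  have [->|tn1] := eqVneq t 1.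
    rewrite subrr mul0r add0r mul1r => /dotv_eq0 cJ.
    by apply/eqP; rewrite -(mulmx_free_eq0 _ fJ) cJ.
  have t1' : 0 < 1 - t by rewrite subr_gt0 lt_neqAle tn1.
  move=> /eqP; rewrite paddr_eq0 ?mulr_ge0 // ?(ltW t1') // => /andP[+ _].
  by rewrite mulf_eq0 (gt_eqF t1') /= => /eqP /dotv_eq0.
have cA t : {for t, continuous (fun t => \det (A t))}.
  apply: differentiable_near; apply: differentiable_det => i k.
  rewrite (_ : (fun x => _) = (fun x => (1 - x) * (1%:M : 'M[R]_m) i k + x * G i k)); last first.
    by apply/funext => x; rewrite !mxE.
  by apply: diffD_ext; apply: diffM_ext => //; apply: differentiableB.
rewrite ltNge; apply/negP => d0.
have A0 : \det (A 0) = 1 by rewrite /A subr0 scale1r scale0r addr0 det1.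
have A1 : \det (A 1) = \det G by rewrite /A subrr scale1r scale0r add0r.
have [||t t01 e] := @IVT R (fun t => \det (A t)) 0 1 0 ler01.
- by apply: continuous_subspaceT => t; exact: cA.
- by rewrite A0 A1 ge_min le_max d0 ler01 orbT.
by have := A_unit t; rewrite e eqxx; case/(_ t01).
Qed.

Section Laplacian.
Context (R : realType) (m n : nat) (U : set 'rV[R]_m) (psi : 'rV[R]_m -> 'rV[R]_n).
Hypothesis oU : open U.
Hypothesis ipsi : immersion_on U psi.

Let G := metric psi.
Let gi := inv_metric psi.
Let spsi := proj1 ipsi.

Definition density v : R := Num.sqrt (\det (metric psi v)).

Lemma dpsi_chart v : U v -> differentiable psi v.
Proof. exact: smooth_diff spsi. Qed.

Lemma det_metric_gt0 v : U v -> 0 < \det (G v).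
Proof. by move=> Uv; apply: det_gram_gt0; apply: (proj2 ipsi). Qed.

Lemma density_gt0 v : U v -> 0 < density v.
Proof. by move=> Uv; rewrite sqrtr_gt0; apply: det_metric_gt0. Qed.

Lemma metric_unit v : U v -> G v \in unitmx.
Proof. by move=> Uv; rewrite unitmxE unitfE gt_eqF // det_metric_gt0. Qed.

Lemma metric_sym v : (G v)^T = G v.
Proof. by rewrite /G /metric trmx_mul trmxK. Qed.

Lemma inv_metric_sym v i k : gi v i k = gi v k i.
Proof.
have : (gi v)^T = gi v by rewrite /gi /inv_metric trmx_inv -/(G v) metric_sym.
by move=> /matrixP /(_ k i); rewrite mxE.
Qed.

Lemma inv_metricP v i k : U v -> \sum_l gi v i l * G v l k = (i == k)%:R.
Proof.
by move=> Uv; have := mulVmx (metric_unit Uv) => /matrixP /(_ i k); rewrite !mxE.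
Qed.

Lemma stang_chart i j : smooth_on U (tang psi i j).
Proof. by apply: smooth_partial; apply: smooth_coord. Qed.

Lemma dtang i j v w : U v -> dder (tang psi i j) v w ('D_w (tang psi i j) v).
Proof.
by move=> Uv; apply: differentiable_dder; apply: smooth_diff Uv; apply: stang_chart.
Qed.

Lemma partial_tang_sym i k j v : U v -> partial k (tang psi i j) v = partial i (tang psi k j) v.
Proof.
by move=> Uv; apply: schwarz Uv _ => //; apply: smooth_coord.
Qed.

Definition dmetric k i l v : R :=
  \sum_j (partial k (tang psi i j) v * tang psi l j v + tang psi i j v * partial k (tang psi l j) v).

Lemma dder_metric k i l v : U v ->
  dder (fun u => G u i l) v (delta_mx 0 k) (dmetric k i l v).
Proof.
move=> Uv; apply: dder_near (_ : dder (fun u => \sum_j tang psi i j u * tang psi l j u) v _ _).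
  by apply: open_near oU Uv _ => u Uu; rewrite /G metricE //; apply: dpsi_chart.
by apply: dder_sum => j _; apply: dderM; apply: dtang.
Qed.

Lemma diff_metric i l v : U v -> differentiable (fun u => G u i l) v.
Proof. by move=> Uv; apply: differentiable_metric Uv. Qed.

Lemma diff_density v : U v -> differentiable density v.
Proof.
move=> Uv; apply: (@differentiable_comp _ _ _ _ (fun u => \det (G u)) Num.sqrt).
  by apply: differentiable_det => i l; apply: diff_metric.
by apply/derivable1_diffP; case: (is_derive1_sqrt (det_metric_gt0 Uv)).
Qed.

Lemma diff_inv_metric i l v : U v -> differentiable (fun u => gi u i l) v.
Proof.
move=> Uv; apply: near_eq_differentiable
   (_ : differentiable (fun u => (\det (G u))^-1 * cofactor (G u) l i) v).
  apply: open_near oU Uv _ => u Uu.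
  by rewrite /gi /inv_metric /invmx -/(G u) metric_unit // !mxE.
apply: diffM_ext.
  apply: diffV_ext; first by rewrite gt_eqF // det_metric_gt0.
  by apply: differentiable_det => ? ?; apply: diff_metric.
apply: diffM_ext; first exact: differentiable_cst.
apply: differentiable_det => a b.
rewrite (_ : (fun x => _) = fun x => G x (fintype.lift l a) (fintype.lift i b)).
  exact: diff_metric.
by apply/funext => x; rewrite !mxE.
Qed.

Lemma partial_density k v : U v -> partial k density v =
  density v * \sum_i \sum_l gi v i l * \sum_j partial k (tang psi i j) v * tang psi l j v.
Proof.
move=> Uv; set S := \sum_i _.
have [_] : differentiable (fun v => Num.sqrt (\det (G v))) v /\
    partial k (fun v => Num.sqrt (\det (G v))) v =
    (2 * Num.sqrt (\det (G v)))^-1 * partial k (fun v => \det (G v)) v.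
  apply: (partial_comp1 (c := Num.sqrt)).
    by apply: differentiable_det => i l; apply: diff_metric.
  exact: is_derive1_sqrt (det_metric_gt0 Uv).
rewrite -[partial k density v]/(partial k (fun v => Num.sqrt (\det (G v))) v) => ->.
have -> : partial k (fun v => \det (G v)) v = \det (G v) * (2 * S).
  have dG i l : dder (fun u => G u i l) v (delta_mx 0 k) ((\matrix_(i, l) dmetric k i l v) i l).
    by rewrite mxE; apply: dder_metric.
  rewrite /partial (dderE (dder_det dG)).
  transitivity (\det (G v) * \sum_i \sum_l gi v i l * dmetric k i l v).
    rewrite mulr_sumr; apply: eq_bigr => i _; rewrite mulr_sumr; apply: eq_bigr => l _.
    rewrite [in LHS]mxE inv_metric_sym /gi /inv_metric /invmx -/(G v) metric_unit // !mxE.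
    have d0 : \det (G v) != 0 by rewrite gt_eqF // det_metric_gt0.
    by move: (\det (G v)) (cofactor _ _ _) (dmetric _ _ _ _) d0 => D K B d0; field.
  congr (_ * _).
  transitivity (S + \sum_i \sum_l gi v i l * \sum_j tang psi i j v * partial k (tang psi l j) v).
    rewrite -big_split; apply: eq_bigr => i _ /=; rewrite -big_split; apply: eq_bigr => l _ /=.
    by rewrite -mulrDr -big_split.
  rewrite mulrDl mul1r; congr (_ + _); rewrite exchange_big; apply: eq_bigr => l _ /=.
  apply: eq_bigr => i _; rewrite inv_metric_sym; congr (_ * _); apply: eq_bigr => j _.
  exact: mulrC.
rewrite -/(density v) -[\det (G v)]sqr_sqrtr ?ltW ?det_metric_gt0 // -/(density v).
by have := density_gt0 Uv; move: (density v) S => D S D0; field; rewrite gt_eqF.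
Qed.

Definition wmetric i k v : R := density v * gi v i k.

Lemma diff_wmetric i k v : U v -> differentiable (wmetric i k) v.
Proof.
by move=> Uv; apply: diffM_ext; [exact: diff_density|exact: diff_inv_metric].
Qed.

Lemma dwmetric i k v w : U v -> dder (wmetric i k) v w ('D_w (wmetric i k) v).
Proof. by move=> Uv; apply: differentiable_dder; apply: diff_wmetric. Qed.

(** Minus the contracted Christoffel symbols. With these first-order coefficients [lapl] is the
    expanded Laplacian, of sign opposite to [laplace_beltrami]. *)
Definition drift k v : R := (density v)^-1 * \sum_i partial i (wmetric i k) v.

Definition lapl (h : 'rV[R]_m -> R) v : R :=
  \sum_i \sum_k inv_metric psi v i k * partial i (partial k h) v + \sum_k drift k v * partial k h v.

Lemma laplace_beltramiE h v : U v -> (forall k, differentiable (partial k h) v) ->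
  laplace_beltrami psi h v = - lapl h v.
Proof.
move=> Uv dh; rewrite /laplace_beltrami; apply: (congr1 -%R).
have D0 : density v != 0 by rewrite gt_eqF // density_gt0.
have e i : partial i (fun u => density u * \sum_k gi u i k * partial k h u) v =
   \sum_k (partial i (wmetric i k) v * partial k h v + wmetric i k v * partial i (partial k h) v).
  apply: dderE; apply: dder_near (_ : dder (fun u => \sum_k wmetric i k u * partial k h u) v _ _).
    apply: open_near oU Uv _ => u Uu; rewrite mulr_sumr; apply: eq_bigr => k _.
    by rewrite mulrA.
  apply: dder_sum => k _; apply: dderM; first exact: dwmetric.
  exact: differentiable_dder.
transitivity ((density v)^-1 * \sum_i (\sum_k partial i (wmetric i k) v * partial k h v +
    \sum_k wmetric i k v * partial i (partial k h) v)).
  apply: (congr1 (fun x => (density v)^-1 * x)); apply: eq_bigr => i _.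
  by rewrite -big_split; apply: e.
rewrite big_split mulrDr addrC; apply: (congr2 +%R).
  rewrite mulr_sumr; apply: eq_bigr => i _; rewrite mulr_sumr; apply: eq_bigr => k _.
  by rewrite /wmetric !mulrA mulVf // mul1r.
rewrite exchange_big mulr_sumr; apply: eq_bigr => k _ /=.
by rewrite -mulr_suml mulrA.
Qed.

(** The Laplacian of an isometric immersion is the trace of its second fundamental form, hence
    normal. The drift is evaluated by differentiating the product of the density, the inverse metric
    and the metric, which is the density times the identity. *)
Lemma lapl_normal k v : U v -> \sum_j lapl (fun u => psi u 0 j) v * tang psi k j v = 0.
Proof.
move=> Uv.
have D0 : density v != 0 by rewrite gt_eqF // density_gt0.
apply: (mulfI D0); rewrite mulr0.
have drift_metric : density v * \sum_l drift l v * G v l k =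
    partial k density v - \sum_i \sum_l wmetric i l v * dmetric i l k v.
  have e i : \sum_l (partial i (wmetric i l) v * G v l k + wmetric i l v * dmetric i l k v) =
     (i == k)%:R * partial i density v.
    apply: (@dder_uniq _ _ (delta_mx 0 i) (fun u => \sum_l wmetric i l u * G u l k) v).
      by apply: dder_sum => l _; apply: dderM; [exact: dwmetric|exact: dder_metric].
    apply: dder_near (_ : dder (fun u => (i == k)%:R * density u) v _ _).
      apply: open_near oU Uv _ => u Uu; rewrite -(inv_metricP i k Uu) mulr_suml.
      by apply: eq_bigr => l _; rewrite /wmetric; ring.
    by apply: dderZ; apply: differentiable_dder; apply: diff_density.
  have -> : partial k density v = \sum_i (i == k)%:R * partial i density v.
    by rewrite (bigD1 k) //= eqxx mul1r big1 ?addr0 // => i /negbTE ->; rewrite mul0r.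
  rewrite -sumrB; under [RHS]eq_bigr => i _ do rewrite -e big_split addrK.
  rewrite [RHS]exchange_big mulr_sumr; apply: eq_bigr => l _ /=.
  by rewrite /drift -mulr_suml !mulrA divff // mul1r.
have drift_tang : \sum_j (\sum_l drift l v * tang psi l j v) * tang psi k j v =
    \sum_l drift l v * G v l k.
  under eq_bigr => j _ do rewrite mulr_suml.
  rewrite exchange_big; apply: eq_bigr => l _ /=.
  rewrite metricE; last exact: dpsi_chart.
  by rewrite mulr_sumr; apply: eq_bigr => j _; rewrite mulrA.
under eq_bigr => j _ do rewrite mulrDl.
rewrite big_split /= mulrDr drift_tang drift_metric partial_density //.
have -> : \sum_i \sum_l wmetric i l v * dmetric i l k v =
   density v * (\sum_i \sum_l gi v i l * \sum_j partial i (tang psi l j) v * tang psi k j v) +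
   density v * (\sum_i \sum_l gi v i l * \sum_j tang psi l j v * partial i (tang psi k j) v).
  rewrite -mulrDr -big_split mulr_sumr; apply: eq_bigr => i _ /=.
  rewrite -big_split mulr_sumr; apply: eq_bigr => l _ /=.
  by rewrite -mulrDr -big_split /wmetric mulrA.
have -> : \sum_j (\sum_i \sum_k0 inv_metric psi v i k0 * partial i (partial k0 (fun u => psi u 0 j)) v) * tang psi k j v =
  \sum_i \sum_l gi v i l * \sum_j partial i (tang psi l j) v * tang psi k j v.
  under eq_bigr => j _ do rewrite mulr_suml.
  rewrite exchange_big; apply: eq_bigr => i _ /=.
  under eq_bigr => j _ do rewrite mulr_suml.
  rewrite exchange_big; apply: eq_bigr => l _ /=.
  by rewrite mulr_sumr; apply: eq_bigr => j _; rewrite mulrA.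
have -> : \sum_i \sum_l gi v i l * \sum_j tang psi l j v * partial i (tang psi k j) v =
   \sum_i \sum_l gi v i l * \sum_j partial k (tang psi i j) v * tang psi l j v.
  apply: eq_bigr => i _; apply: eq_bigr => l _; congr (_ * _); apply: eq_bigr => j _.
  by rewrite partial_tang_sym // mulrC.
move: (density v) (\sum_i _) (\sum_i _) => D A B; ring.
Qed.

End Laplacian.

Section Products.
Context (R : realType) (m n : nat) (U : set 'rV[R]_m) (psi : 'rV[R]_m -> 'rV[R]_n).
Hypothesis oU : open U.

Definition twice_diff (f : 'rV[R]_m -> R) : Prop := forall u, U u ->
  differentiable f u /\ forall k, differentiable (partial k f) u.

Lemma partialM (f g : 'rV[R]_m -> R) k u : differentiable f u -> differentiable g u ->
  partial k (fun w => f w * g w) u = partial k f u * g u + f u * partial k g u.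
Proof. by move=> df dg; apply: dderE; apply: dderM; apply: differentiable_dder. Qed.

Lemma twice_diffM f g : twice_diff f -> twice_diff g -> twice_diff (fun u => f u * g u).
Proof.
move=> tf tg u Uu; have [df pf] := tf u Uu; have [dg pg] := tg u Uu.
split=> [|k]; first exact: diffM_ext.
apply: near_eq_differentiable
    (_ : differentiable (fun w => partial k f w * g w + f w * partial k g w) u).
  apply: open_near oU Uu _ => w Uw.
  by rewrite partialM //; [have [] := tf w Uw|have [] := tg w Uw].
by apply: diffD_ext; apply: diffM_ext.
Qed.

Lemma twice_diff_sum (I : Type) (r : seq I) (f : I -> 'rV[R]_m -> R) :
  (forall i, twice_diff (f i)) -> twice_diff (fun u => \sum_(i <- r) f i u).
Proof.
move=> tf u Uu; split=> [|k]; first by apply: diff_sum_ext => i _; have [] := tf i u Uu.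
apply: near_eq_differentiable (_ : differentiable (fun w => \sum_(i <- r) partial k (f i) w) u).
  apply: open_near oU Uu _ => w Uw; apply/esym/dderE; apply: dder_sum => i _.
  by apply: differentiable_dder; have [] := tf i w Uw.
by apply: diff_sum_ext => i _; have [_] := tf i u Uu.
Qed.

Lemma lapl_sum (I : Type) (r : seq I) (f : I -> 'rV[R]_m -> R) v : U v ->
  (forall i, twice_diff (f i)) ->
  lapl psi (fun u => \sum_(i <- r) f i u) v = \sum_(i <- r) lapl psi (f i) v.
Proof.
move=> Uv tf.
have p1 k u : U u -> partial k (fun u => \sum_(i <- r) f i u) u = \sum_(i <- r) partial k (f i) u.
  move=> Uu; apply: dderE; apply: dder_sum => i _.
  by apply: differentiable_dder; have [] := tf i u Uu.
have p2 k l : partial l (partial k (fun u => \sum_(i <- r) f i u)) v =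
    \sum_(i <- r) partial l (partial k (f i)) v.
  transitivity (partial l (fun u => \sum_(i <- r) partial k (f i) u) v).
    by apply: eq_on_partial oU _ Uv => u; apply: p1.
  apply: dderE; apply: dder_sum => i _.
  by apply: differentiable_dder; have [] := tf i v Uv.
rewrite /lapl big_split; congr (_ + _).
  rewrite [RHS]exchange_big; apply: eq_bigr => k _ /=.
  rewrite [RHS]exchange_big; apply: eq_bigr => l _ /=.
  by rewrite p2 mulr_sumr.
by rewrite [RHS]exchange_big; apply: eq_bigr => k _ /=; rewrite p1 // mulr_sumr.
Qed.

Definition grad_dot (f g : 'rV[R]_m -> R) v : R :=
  \sum_i \sum_k inv_metric psi v i k * (partial i f v * partial k g v).

Lemma grad_dotC f g v : grad_dot f g v = grad_dot g f v.
Proof.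
rewrite /grad_dot exchange_big; apply: eq_bigr => i _; apply: eq_bigr => k _.
by rewrite inv_metric_sym [partial i g v * _]mulrC.
Qed.

Lemma laplM f g v : U v -> twice_diff f -> twice_diff g ->
  lapl psi (fun u => f u * g u) v =
  g v * lapl psi f v + f v * lapl psi g v + 2 * grad_dot f g v.
Proof.
move=> Uv tf tg; have [df pf] := tf v Uv; have [dg pg] := tg v Uv.
have p2 k l : partial l (partial k (fun u => f u * g u)) v =
    g v * partial l (partial k f) v + f v * partial l (partial k g) v +
    (partial l f v * partial k g v + partial l g v * partial k f v).
  transitivity (partial l (fun w => partial k f w * g w + f w * partial k g w) v).
    apply: eq_on_partial oU _ Uv => w Uw.
    by rewrite partialM //; [have [] := tf w Uw|have [] := tg w Uw].
  apply: etrans (dderE (dderD (dderM _ _) (dderM _ _))) _;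
    try (apply: differentiable_dder; by [|apply: pf|apply: pg]).
  rewrite -!/(partial _ _ _).
  move: (partial l (partial k f) v) (partial l (partial k g) v) (partial l f v) (partial k g v).
  move: (partial l g v) (partial k f v) (f v) (g v) => *; ring.
pose snd h := \sum_i \sum_k inv_metric psi v i k * partial i (partial k h) v.
pose fst h := \sum_k drift psi k v * partial k h v.
have e2 : snd (fun u => f u * g u) = g v * snd f + f v * snd g + (grad_dot f g v + grad_dot g f v).
  rewrite !mulr_sumr -!big_split; apply: eq_bigr => i _ /=.
  rewrite !mulr_sumr -!big_split; apply: eq_bigr => k _ /=; rewrite p2.
  move: (partial i (partial k f) v) (partial i (partial k g) v) (partial i f v) (partial k g v).
  move: (partial i g v) (partial k f v) (f v) (g v) (inv_metric _ _ _ _) => *; ring.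
have e1 : fst (fun u => f u * g u) = g v * fst f + f v * fst g.
  rewrite !mulr_sumr -big_split; apply: eq_bigr => k _ /=; rewrite partialM //.
  move: (partial k f v) (partial k g v) (f v) (g v) (drift _ _ _) => *; ring.
rewrite -[LHS]/(snd _ + fst _) e1 e2 [grad_dot g f v]grad_dotC.
rewrite -[lapl psi f v]/(snd f + fst f) -[lapl psi g v]/(snd g + fst g).
move: (snd f) (snd g) (fst f) (fst g) (grad_dot _ _ _) (f v) (g v) => *; ring.
Qed.

End Products.

(** * The Laplacian of a basic field along the hypersurface *)

Section Field.
Context (R : realType) (m : nat) (Pi : 'rV[R]_m.+1 -> 'rV[R]_2) (O : set 'rV[R]_m.+1).
Hypothesis oO : open O.
Hypothesis sPi : smooth_on O Pi.
Hypothesis rPi : forall p, O p -> riemannian_submersion_at Pi p.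
Context (U : set 'rV[R]_m) (psi : 'rV[R]_m -> 'rV[R]_m.+1) (s : 'rV[R]_m -> R).
Context (a b : R) (z z1 z2 : 'I_2 -> R -> R).
Hypothesis oU : open U.
Hypothesis ipsi : immersion_on U psi.
Hypothesis ss : smooth_on U s.
Hypothesis sab : forall v, U v -> a < s v < b.
Hypothesis dz : forall c t, a < t < b -> dder (z c) t 1 (z1 c t).
Hypothesis dz1 : forall c t, a < t < b -> dder (z1 c) t 1 (z2 c t).
Hypothesis unit_z : forall t, a < t < b -> z1 0 t ^+ 2 + z1 1 t ^+ 2 = 1.
Hypothesis Opsi : forall v, U v -> O (psi v).
Hypothesis Pipsi : forall v c, U v -> Pi (psi v) 0 c = z c (s v).


Lemma grad_tgt v j : U v ->
  \sum_i \sum_k inv_metric psi v i k * (partial i s v * tang psi k j v) =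
  tgt Pi psi s z1 v 0 j.
Proof.
move=> Uv; set e := tgt Pi psi s z1 v; set N := nrm Pi psi s z1 v.
transitivity (\sum_l e 0 l *
   \sum_i \sum_k inv_metric psi v i k * (tang psi i l v * tang psi k j v)).
  under [RHS]eq_bigr => l _ do rewrite mulr_sumr.
  rewrite [RHS]exchange_big; apply: eq_bigr => i _ /=.
  under [RHS]eq_bigr => l _ do rewrite mulr_sumr.
  rewrite [RHS]exchange_big; apply: eq_bigr => k _ /=.
  rewrite -(tang_tgt oO sPi oU ipsi ss sab dz unit_z Opsi Pipsi i Uv) mulr_suml mulr_sumr.
  by apply: eq_bigr => l _; rewrite -/e; ring.
under eq_bigr => l _ do rewrite (completeness oO sPi rPi oU ipsi ss sab dz unit_z Opsi Pipsi) //.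
under eq_bigr => l _ do rewrite mulrBr.
rewrite sumrB (bigD1 j) //= eqxx mulr1 big1 => [|l /negbTE ->]; last by rewrite mulr0.
rewrite addr0 -[RHS]subr0; congr (_ - _).
transitivity (dotv e N * N 0 j); last by rewrite (tgt_nrm sPi rPi s z1 Opsi) // mul0r.
by rewrite mulr_suml; apply: eq_bigr => l _; rewrite mulrA.
Qed.

Lemma hs_hlift c (q : 'rV[R]_2) v j : U v ->
  \sum_l hlift Pi q (psi v) 0 l * hs Pi c (psi v) l j = 0.
Proof.
move=> Uv; have Op := Opsi Uv.
transitivity (\sum_k q 0 k * hg Pi c k (psi v) j).
  under [RHS]eq_bigr => k _ do rewrite /hg mulr_sumr.
  rewrite [RHS]exchange_big; apply: eq_bigr => l _ /=.
  rewrite hliftE mulr_suml; apply: eq_bigr => k _.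
  by rewrite (hs_sym oO sPi c l j Op) mulrAC mulrA.
by rewrite big1 // => k _; rewrite (hess_grad0 oO sPi rPi) // mulr0.
Qed.

Lemma normal_part_nrm (X : 'I_m.+1 -> R) v j : U v ->
  (forall k, \sum_l X l * tang psi k l v = 0) ->
  X j = (\sum_l X l * nrm Pi psi s z1 v 0 l) * nrm Pi psi s z1 v 0 j.
Proof.
move=> Uv X0; set N := nrm Pi psi s z1 v.
have : \sum_l X l * \sum_i \sum_k inv_metric psi v i k * (tang psi i l v * tang psi k j v) = 0.
  transitivity (\sum_i \sum_k inv_metric psi v i k * tang psi k j v * \sum_l X l * tang psi i l v).
    under [LHS]eq_bigr => l _ do rewrite mulr_sumr.
    rewrite [LHS]exchange_big; apply: eq_bigr => i _ /=.
    under [LHS]eq_bigr => l _ do rewrite mulr_sumr.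
    rewrite [LHS]exchange_big; apply: eq_bigr => k _ /=.
    by rewrite mulr_sumr; apply: eq_bigr => l _; ring.
  by rewrite big1 // => i _; rewrite big1 // => k _; rewrite X0 mulr0.
under eq_bigr => l _ do rewrite (completeness oO sPi rPi oU ipsi ss sab dz unit_z Opsi Pipsi) // mulrBr.
rewrite sumrB (bigD1 j) //= eqxx mulr1 big1 => [|l /negbTE ->]; last by rewrite mulr0.
rewrite addr0 => /eqP; rewrite subr_eq0 => /eqP ->.
by rewrite mulr_suml; apply: eq_bigr => l _; rewrite mulrA.
Qed.

Lemma lapl_coord_perp_tgt v : U v ->
  \sum_j lapl psi (fun u => psi u 0 j) v * tgt Pi psi s z1 v 0 j = 0.
Proof.
move=> Uv; set N := nrm Pi psi s z1 v.
under eq_bigr => j _ do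
  rewrite (@normal_part_nrm (fun j => lapl psi (fun u => psi u 0 j) v) v j Uv
    (fun k => lapl_normal oU ipsi k Uv)) -/N -mulrA.
rewrite -mulr_sumr [X in _ * X](_ : _ = 0) ?mulr0 //.
by rewrite -[RHS](tgt_nrm sPi rPi s z1 Opsi Uv) dotvC.
Qed.

Lemma z1_z2_perp t : a < t < b -> z1 0 t * z2 0 t + z1 1 t * z2 1 t = 0.
Proof.
move=> tab.
have e : dder (fun t => z1 0 t ^+ 2 + z1 1 t ^+ 2) t 1
   (2 * z1 0 t * z2 0 t + 2 * z1 1 t * z2 1 t).
  by apply: dderD; apply: dder_eq (dder_pow 2 (dz1 _ tab)) _; rewrite /= expr1.
have : 2 * z1 0 t * z2 0 t + 2 * z1 1 t * z2 1 t = 0.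
  apply: dder_uniq e (dder_near _ (dder_cst _ 1 _)).
  by apply: filterS (near_itvoo tab) => u /unit_z.
by move: (z1 0 t) (z1 1 t) (z2 0 t) (z2 1 t) => *; lra.
Qed.

Definition slope v : R := \sum_l z1 l (s v) * lapPi Pi l (psi v).

(** The Laplacian of [psi] is normal, so its product with [tgt] is zero. [trace_along] in the
    tangent direction, where z'' drops out because z' has unit length, turns this into the Laplacian
    of s. *)
Lemma lapl_s v : U v -> lapl psi s v = slope v.
Proof.
move=> Uv; set c := row2 (z1 0 (s v)) (z1 1 (s v)).
have cE l : c 0 l = z1 l (s v).
  by rewrite mxE; case: l => [[|[|//]]] i //=; congr (z1 _ _); apply/val_inj.
have tr := trace_along oO sPi rPi oU ipsi ss sab dz dz1 unit_z Opsi Pipsi c Uv.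
have sq : \sum_l c 0 l * z1 l (s v) = 1.
  under eq_bigr => l _ do rewrite cE -expr2.
  by rewrite sum2E unit_z //; apply: sab.
have sz : \sum_l c 0 l * z2 l (s v) = 0.
  under eq_bigr => l _ do rewrite cE.
  by rewrite sum2E z1_z2_perp //; apply: sab.
rewrite sq sz mul1r sub0r in tr.
rewrite -[RHS]add0r -[X in _ = X + _](lapl_coord_perp_tgt Uv).
have -> : slope v = \sum_l c 0 l * lapPi Pi l (psi v).
  by apply: eq_bigr => l _; rewrite cE.
have swap (f : 'rV[R]_m -> R) : \sum_i \sum_k inv_metric psi v i k * partial i (partial k f) v =
   \sum_i \sum_k inv_metric psi v i k * partial k (partial i f) v.
  rewrite [LHS]exchange_big; apply: eq_bigr => i _; apply: eq_bigr => k _ /=.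
  by rewrite (inv_metric_sym psi v k i).
rewrite -[LHS]/(_ + _) (swap s).
have -> : \sum_j (\sum_i \sum_k inv_metric psi v i k * partial i (partial k (fun u => psi u 0 j)) v
    + \sum_k drift psi k v * partial k (fun u => psi u 0 j) v) * tgt Pi psi s z1 v 0 j =
  \sum_i \sum_k inv_metric psi v i k *
     (\sum_j partial k (tang psi i j) v * hlift Pi c (psi v) 0 j) +
  \sum_k drift psi k v * partial k s v.
  under eq_bigr => j _ do rewrite mulrDl.
  rewrite big_split; congr (_ + _) => /=.
    under eq_bigr => j _ do rewrite (swap (fun u => psi u 0 j)) mulr_suml.
    rewrite exchange_big; apply: eq_bigr => i _ /=.
    under eq_bigr => j _ do rewrite mulr_suml.
    rewrite exchange_big; apply: eq_bigr => k _ /=.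
    by rewrite mulr_sumr; apply: eq_bigr => j _; rewrite mulrA.
  under eq_bigr => j _ do rewrite mulr_suml.
  rewrite exchange_big; apply: eq_bigr => k _ /=.
  rewrite -(tang_tgt oO sPi oU ipsi ss sab dz unit_z Opsi Pipsi k Uv) mulr_sumr.
  by apply: eq_bigr => j _; rewrite mulrA.
rewrite tr.
move: (\sum_i _) (\sum_k _) (\sum_l _) => A B C; ring.
Qed.

Lemma comp_s (f f1 f2 : R -> R) :
  (forall t, a < t < b -> dder f t 1 (f1 t)) ->
  (forall t, a < t < b -> dder f1 t 1 (f2 t)) ->
  twice_diff U (fun u => f (s u)) /\ forall v, U v ->
  (forall k, partial k (fun u => f (s u)) v = f1 (s v) * partial k s v) /\
  lapl psi (fun u => f (s u)) v = f2 (s v) + f1 (s v) * slope v.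
Proof.
move=> df df1.
have ds u : U u -> differentiable s u by apply: smooth_diff.
have dps u k : U u -> differentiable (partial k s) u.
  by apply: smooth_diff; apply: smooth_partial.
have p1 k u : U u -> partial k (fun u => f (s u)) u = f1 (s u) * partial k s u.
  by move=> Uu; have [_ ->] := partial_comp1 k (ds u Uu) (df _ (sab Uu)).
have df1s u : U u -> differentiable (fun u => f1 (s u)) u.
  move=> Uu; apply: (@differentiable_comp _ _ _ _ s f1); first exact: ds.
  by apply/derivable1_diffP; case: (df1 _ (sab Uu)).
split.
  move=> u Uu; split=> [|k].
    apply: (@differentiable_comp _ _ _ _ s f); first exact: ds.
    by apply/derivable1_diffP; case: (df _ (sab Uu)).
  apply: near_eq_differentiable (_ : differentiable (fun u => f1 (s u) * partial k s u) u).
    by apply: open_near oU Uu _ => w Uw; rewrite p1.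
  by apply: diffM_ext; [exact: df1s|exact: dps].
move=> v Uv; split=> [k|]; first exact: p1.
have p2 i k : partial i (partial k (fun u => f (s u))) v =
   f2 (s v) * (partial i s v * partial k s v) + f1 (s v) * partial i (partial k s) v.
  transitivity (partial i (fun u => f1 (s u) * partial k s u) v).
    by apply: eq_on_partial oU _ Uv => u; apply: p1.
  rewrite partialM //; [|exact: df1s|exact: dps].
  by have [_ ->] := partial_comp1 i (ds v Uv) (df1 _ (sab Uv)); rewrite mulrA.
rewrite -(lapl_s Uv) -[f2 (s v)]mulr1.
rewrite -(grad_s_unit oO sPi rPi oU ipsi ss sab dz unit_z Opsi Pipsi Uv) /lapl mulrDr addrA.
congr (_ + _).
  rewrite !mulr_sumr -big_split; apply: eq_bigr => i _ /=.
  rewrite !mulr_sumr -big_split; apply: eq_bigr => k _ /=; rewrite p2; ring.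
rewrite mulr_sumr; apply: eq_bigr => k _; rewrite p1 //; ring.
Qed.

Lemma partial_gr c j k v : U v ->
  differentiable (fun u => gr Pi c (psi u) j) v /\
  partial k (fun u => gr Pi c (psi u) j) v = \sum_l tang psi k l v * hs Pi c (psi v) l j.
Proof.
move=> Uv; have dp : differentiable psi v by apply: smooth_diff (proj1 ipsi) Uv.
have dg : differentiable (fun q => gr Pi c q j) (psi v).
  by apply: smooth_diff (Opsi Uv); apply: sgr.
split; first exact: (differentiable_comp dp dg).
exact: (partial_comp k dp dg).
Qed.

Lemma partial_hs c l j k v : U v ->
  differentiable (fun u => hs Pi c (psi u) l j) v /\
  partial k (fun u => hs Pi c (psi u) l j) v = \sum_p tang psi k p v * ths Pi c (psi v) p l j.
Proof.
move=> Uv; have dp : differentiable psi v by apply: smooth_diff (proj1 ipsi) Uv.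
have dg : differentiable (fun q => hs Pi c q l j) (psi v).
  by apply: smooth_diff (Opsi Uv); apply: shs.
split; first exact: (differentiable_comp dp dg).
exact: (partial_comp k dp dg).
Qed.

Lemma twice_gr c j : twice_diff U (fun u => gr Pi c (psi u) j).
Proof.
move=> u Uu; split=> [|k]; first exact:
  (differentiable_comp (smooth_diff (proj1 ipsi) Uu) (smooth_diff (sgr oO sPi c j) (Opsi Uu))).
apply: near_eq_differentiable
   (_ : differentiable (fun u => \sum_l tang psi k l u * hs Pi c (psi u) l j) u).
  by apply: open_near oU Uu _ => w Uw; have [_ ->] := partial_gr c j k Uw.
apply: diff_sum_ext => l _; apply: diffM_ext; last by have [] := partial_hs c l j k Uu.
by apply: smooth_diff Uu; apply: (stang_chart oU ipsi).
Qed.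

(** The Laplacian of a restricted function differs from the tangential trace of its Hessian by its
    derivative along the trace of the second fundamental form. Here that derivative is a Hessian of
    [Pi] applied to the normal, which vanishes. *)
Lemma lapl_gr c j v : U v -> lapl psi (fun u => gr Pi c (psi u) j) v =
  \sum_l ths Pi c (psi v) l l j -
  \sum_p \sum_l nrm Pi psi s z1 v 0 p * nrm Pi psi s z1 v 0 l * ths Pi c (psi v) p l j.
Proof.
move=> Uv.
have p2 i k : partial i (partial k (fun u => gr Pi c (psi u) j)) v =
  \sum_l partial i (tang psi k l) v * hs Pi c (psi v) l j +
  \sum_p \sum_l tang psi i p v * tang psi k l v * ths Pi c (psi v) p l j.
  transitivity (partial i (fun u => \sum_l tang psi k l u * hs Pi c (psi u) l j) v).
    by apply: eq_on_partial oU _ Uv => u Uu; have [_ ->] := partial_gr c j k Uu.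
  rewrite [X in _ + X]exchange_big -big_split; apply: dderE; apply: dder_sum => l _ /=.
  apply: dder_eq (dderM (dtang oU ipsi k l _ Uv) (differentiable_dder _ (proj1 (partial_hs c l j i Uv)))) _.
  congr (_ + _); rewrite -/(partial i _ v).
  have [_ ->] := partial_hs c l j i Uv; rewrite mulr_sumr; apply: eq_bigr => p _.
  by ring.
rewrite -(contraction oO sPi rPi oU ipsi ss sab dz unit_z Opsi Pipsi
  (fun p l => ths Pi c (psi v) p l j) Uv).
transitivity (\sum_l lapl psi (fun u => psi u 0 l) v * hs Pi c (psi v) l j +
  \sum_i \sum_k inv_metric psi v i k *
   (\sum_p \sum_l tang psi i p v * tang psi k l v * ths Pi c (psi v) p l j)); last first.
  rewrite -[RHS]add0r; congr (_ + _).
  transitivity ((\sum_l lapl psi (fun u => psi u 0 l) v * nrm Pi psi s z1 v 0 l) *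
     \sum_l nrm Pi psi s z1 v 0 l * hs Pi c (psi v) l j).
    rewrite mulr_sumr; apply: eq_bigr => l _.
    rewrite {1}(@normal_part_nrm (fun j => lapl psi (fun u => psi u 0 j) v) v l Uv
      (fun k => lapl_normal oU ipsi k Uv)); exact/esym/mulrA.
  by rewrite hs_hlift // mulr0.
rewrite /lapl; under [X in _ = X + _]eq_bigr => l _ do rewrite mulrDl.
rewrite [X in _ = X + _]big_split /= -!addrA [X in _ = _ + X]addrC addrA; congr (_ + _); last first.
  under [RHS]eq_bigr => l _ do rewrite mulr_suml.
  rewrite [RHS]exchange_big; apply: eq_bigr => k _ /=.
  have [_ ->] := partial_gr c j k Uv; rewrite mulr_sumr.
  by apply: eq_bigr => l _; rewrite mulrA.
under [X in _ = X + _]eq_bigr => l _ do rewrite mulr_suml.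
rewrite [X in _ = X + _]exchange_big -big_split; apply: eq_bigr => i _ /=.
under [X in _ = X + _]eq_bigr => l _ do rewrite mulr_suml.
rewrite [X in _ = X + _]exchange_big -big_split; apply: eq_bigr => k _ /=.
rewrite p2 mulrDr; congr (_ + _); rewrite mulr_sumr; apply: eq_bigr => l _.
by rewrite mulrA.
Qed.


End Field.

Section Field.
Context (R : realType) (m : nat) (Pi : 'rV[R]_m.+1 -> 'rV[R]_2) (O : set 'rV[R]_m.+1).
Hypothesis oO : open O.
Hypothesis sPi : smooth_on O Pi.
Hypothesis rPi : forall p, O p -> riemannian_submersion_at Pi p.
Context (U : set 'rV[R]_m) (psi : 'rV[R]_m -> 'rV[R]_m.+1) (s : 'rV[R]_m -> R).
Context (a b : R) (z z1 z2 : 'I_2 -> R -> R).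
Hypothesis oU : open U.
Hypothesis ipsi : immersion_on U psi.
Hypothesis ss : smooth_on U s.
Hypothesis sab : forall v, U v -> a < s v < b.
Hypothesis dz : forall c t, a < t < b -> dder (z c) t 1 (z1 c t).
Hypothesis dz1 : forall c t, a < t < b -> dder (z1 c) t 1 (z2 c t).
Hypothesis unit_z : forall t, a < t < b -> z1 0 t ^+ 2 + z1 1 t ^+ 2 = 1.
Hypothesis Opsi : forall v, U v -> O (psi v).
Hypothesis Pipsi : forall v c, U v -> Pi (psi v) 0 c = z c (s v).



(** The contracted third derivatives form the gradient of the Laplacian, which factors through [Pi]
    by [LE]; orthonormality of the gradients extracts the component e. *)
Lemma partial_grad_compat (L : 'I_2 -> 'rV[R]_2 -> R) c e p :
  (forall c q, O q -> lapPi Pi c q = L c (Pi q)) -> O p -> differentiable (L c) (Pi p) ->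
  \sum_j gr Pi e p j * \sum_l ths Pi c p l l j = partial e (L c) (Pi p).
Proof.
move=> LE Op dL.
have dP : differentiable Pi p by apply: smooth_diff Op.
have h j : \sum_l ths Pi c p l l j = \sum_b gr Pi b p j * partial b (L c) (Pi p).
  transitivity (partial j (fun q => L c (Pi q)) p); last exact: partial_comp.
  transitivity (partial j (lapPi Pi c) p); last by apply: eq_on_partial oO _ Op => q; apply: LE.
  apply/esym/dderE; apply: dder_sum => l _; apply: dder_eq (dhs oO sPi c l l j Op) _.
  by rewrite (ths_sym12 oO sPi c j l l Op) (ths_sym23 oO sPi c l j l Op).
under eq_bigr => j _ do rewrite h mulr_sumr.
rewrite exchange_big (bigD1 e) //= [X in _ + X]big1 ?addr0 => [|b' be].
  under eq_bigr => j _ do rewrite mulrA.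
  by rewrite -mulr_suml (gram sPi rPi) // eqxx mul1r.
under eq_bigr => j _ do rewrite mulrA.
by rewrite -mulr_suml (gram sPi rPi) // eq_sym (negbTE be) mul0r.
Qed.

(** The Laplacian of the field is paired with the gradient of the component c. The cross terms
    contain a Hessian of [Pi] applied to [tgt], and the third derivatives along the normal vanish by
    [ths_horizontal]. *)
Lemma field_ode (F F' F'' L : 'I_2 -> _) c v :
  (forall c t, a < t < b -> dder (F c) t 1 (F' c t)) ->
  (forall c t, a < t < b -> dder (F' c) t 1 (F'' c t)) ->
  (forall c q, O q -> lapPi Pi c q = L c (Pi q)) ->
  (forall c q, O q -> differentiable (L c) (Pi q)) -> U v ->
  (forall j, lapl psi (fun u => \sum_e F e (s u) * gr Pi e (psi u) j) v = 0) ->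
  F'' c (s v) + slope Pi psi s z1 v * F' c (s v) + \sum_e F e (s v) * partial c (L e) (Pi (psi v)) = 0.
Proof.
move=> dF dF' LE dL Uv lap0; have Op := Opsi Uv.
have tF e : twice_diff U (fun u => F e (s u)) by have [] := comp_s oO sPi rPi oU ipsi ss sab dz dz1 unit_z Opsi Pipsi (dF e) (dF' e).
have lapj j : \sum_e (gr Pi e (psi v) j * (F'' e (s v) + F' e (s v) * slope Pi psi s z1 v) +
    F e (s v) * (\sum_l ths Pi e (psi v) l l j -
  \sum_p \sum_l nrm Pi psi s z1 v 0 p * nrm Pi psi s z1 v 0 l * ths Pi e (psi v) p l j)) = 0.
  rewrite -[RHS](lap0 j) (lapl_sum psi oU _ Uv); last first.
    by move=> e; exact: (twice_diffM oU (tF e) (twice_gr oO sPi oU ipsi Opsi e j)).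
  apply: eq_bigr => e _; have [_ /(_ v Uv)[pF lapF]] := comp_s oO sPi rPi oU ipsi ss sab dz dz1 unit_z Opsi Pipsi (dF e) (dF' e).
  rewrite (laplM psi oU Uv (tF e) (twice_gr oO sPi oU ipsi Opsi e j)) lapF.
  rewrite (lapl_gr oO sPi rPi oU ipsi ss sab dz unit_z Opsi Pipsi e j Uv).
  rewrite [X in _ = _ + 2 * X](_ : _ = 0) ?mulr0 ?addr0 //.
  transitivity (F' e (s v) * \sum_l tgt Pi psi s z1 v 0 l * hs Pi e (psi v) l j).
    under [X in _ = _ * X]eq_bigr => l _ do rewrite -(grad_tgt oO sPi rPi oU ipsi ss sab dz unit_z Opsi Pipsi l Uv) mulr_suml.
    rewrite [X in _ = _ * X]exchange_big mulr_sumr; apply: eq_bigr => i _ /=.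
    under [X in _ = _ * X]eq_bigr => l _ do rewrite mulr_suml.
    rewrite [X in _ = _ * X]exchange_big mulr_sumr; apply: eq_bigr => k _ /=.
    rewrite pF; have [_ ->] := partial_gr oO sPi ipsi Opsi e j k Uv; rewrite !mulr_sumr; apply: eq_bigr => l _.
    by move: (F' _ _) (inv_metric _ _ _ _) (partial _ _ _) (tang _ _ _ _) (hs _ _ _ _ _) => *; ring.
  by rewrite (hs_hlift oO sPi rPi Opsi e _ j Uv) mulr0.
have nths e : \sum_j gr Pi c (psi v) j * \sum_p \sum_l
    nrm Pi psi s z1 v 0 p * nrm Pi psi s z1 v 0 l * ths Pi e (psi v) p l j = 0.
  set q := row2 (- z1 1 (s v)) (z1 0 (s v)).
  transitivity (\sum_p nrm Pi psi s z1 v 0 p *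
     \sum_b q 0 b * \sum_l (\sum_j ths Pi e (psi v) p l j * gr Pi c (psi v) j) * gr Pi b (psi v) l).
    under eq_bigr => j _ do rewrite mulr_sumr.
    rewrite exchange_big; apply: eq_bigr => p _ /=.
    under eq_bigr => j _ do rewrite mulr_sumr.
    rewrite exchange_big mulr_sumr /=.
    under [RHS]eq_bigr => b' _ do rewrite mulr_sumr mulr_sumr.
    rewrite [RHS]exchange_big; apply: eq_bigr => l _ /=.
    transitivity (nrm Pi psi s z1 v 0 p * nrm Pi psi s z1 v 0 l *
       \sum_j ths Pi e (psi v) p l j * gr Pi c (psi v) j).
      rewrite mulr_sumr; apply: eq_bigr => j _.
      by move: (gr _ _ _ _) (nrm _ _ _ _ _ _ _) (nrm _ _ _ _ _ _ _) (ths _ _ _ _ _ _) => *; ring.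
    rewrite [nrm Pi psi s z1 v 0 l]hliftE -/q -mulrA mulr_suml mulr_sumr; apply: eq_bigr => b' _.
    by move: (nrm _ _ _ _ _ _ _) (q 0 b') (gr _ _ _ _) (\sum_j _) => *; ring.
  rewrite big1 // => p _; rewrite big1 ?mulr0 // => b' _.
  by rewrite (ths_horizontal oO sPi rPi) // mulr0.
have : \sum_j gr Pi c (psi v) j * (\sum_e (gr Pi e (psi v) j * (F'' e (s v) + F' e (s v) * slope Pi psi s z1 v) +
    F e (s v) * (\sum_l ths Pi e (psi v) l l j -
  \sum_p \sum_l nrm Pi psi s z1 v 0 p * nrm Pi psi s z1 v 0 l * ths Pi e (psi v) p l j))) = 0.
  by rewrite big1 // => j _; rewrite lapj mulr0.
move=> e0; rewrite -[RHS]e0.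
under [RHS]eq_bigr => j _ do rewrite mulr_sumr.
rewrite [RHS]exchange_big /=.
transitivity (\sum_e ((c == e)%:R * (F'' e (s v) + F' e (s v) * slope Pi psi s z1 v) +
    F e (s v) * partial c (L e) (Pi (psi v)))).
  rewrite big_split /=; congr (_ + _); rewrite (bigD1 c) //= eqxx mul1r big1 ?addr0; last first.
    by move=> e ec; rewrite eq_sym (negbTE ec) mul0r.
  by congr (_ + _); exact: mulrC.
apply: eq_bigr => e _.
rewrite -(gram sPi rPi c e Op) -(partial_grad_compat c LE Op (dL e _ Op)).
transitivity ((\sum_j gr Pi c (psi v) j * gr Pi e (psi v) j) * (F'' e (s v) + F' e (s v) * slope Pi psi s z1 v)
   + F e (s v) * (\sum_j gr Pi c (psi v) j * \sum_l ths Pi e (psi v) l l j -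
   \sum_j gr Pi c (psi v) j * \sum_p \sum_l
    nrm Pi psi s z1 v 0 p * nrm Pi psi s z1 v 0 l * ths Pi e (psi v) p l j)).
  by rewrite nths subr0.
have split3 (A B D : 'I_m.+1 -> R) g h : (\sum_j A j) * g + h * (\sum_j B j - \sum_j D j) =
    \sum_j (A j * g + h * (B j - D j)).
  by rewrite -sumrB mulr_suml mulr_sumr -big_split.
rewrite split3; apply: eq_bigr => j _ /=.
move: (gr Pi c _ _) (gr Pi e _ _) (F e _) (F'' e _) (F' e _) (slope _ _ _ _ _).
by move: (\sum_l _) (\sum_p _) => *; ring.
Qed.

Lemma mean_curvature_nrm v : U v -> mean_curvature psi v =
  (m%:R^-1 * (ncrv s z1 z2 v + z1 1 (s v) * lapPi Pi 0 (psi v) - z1 0 (s v) * lapPi Pi 1 (psi v)))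
   *: nrm Pi psi s z1 v.
Proof.
move=> Uv; set N := nrm Pi psi s z1 v.
rewrite -(trace_second_form oO sPi rPi oU ipsi ss sab dz dz1 unit_z Opsi Pipsi Uv).
rewrite /mean_curvature -scalerA; congr (_ *: _).
have JN : 'J psi v *m N^T = 0.
  apply/matrixP => i k; rewrite !mxE -[RHS](tang_nrm oO sPi oU ipsi ss sab dz Opsi Pipsi i Uv).
  apply: eq_bigr => j' _; rewrite [_^T _ _]mxE ord1 jacobianE //.
  exact: smooth_diff (proj1 ipsi) Uv.
have P := tangent_projection (proj2 ipsi v Uv) JN (nrm_unit sPi rPi sab unit_z Opsi Uv).
have np X : normal_part psi v X = dotv X N *: N.
  rewrite /normal_part /inv_metric /metric -!mulmxA [_^T *m _]mulmxA P mulmxBr mulmx1 subKr.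
  by rewrite mulmxA [X *m N^T]mx11_scalar -dotvE mul_scalar_mx.
rewrite exchange_big scaler_suml; apply: eq_bigr => i _ /=.
rewrite scaler_suml; apply: eq_bigr => k _ /=.
rewrite np scalerA inv_metric_sym; congr ((_ * _) *: _); apply: eq_bigr => j _; congr (_ * _).
rewrite partial_coord; last by apply: smooth_diff (smooth_partial _ (proj1 ipsi)) Uv.
apply: eq_on_partial oU _ Uv => u Uu; rewrite partial_coord //.
exact: smooth_diff (proj1 ipsi) Uu.
Qed.

End Field.

(** * The equation of the profile curve *)

Lemma interior_shift (R : realType) (d : nat) (q w : 'rV[R]_2) :
  interior (@cone R d) q -> exists2 e : R, 0 < e & cone d (q + e *: w).
Proof.
move=> hq; have /near_rV[r r0 hr] : \forall v \near q, cone d v by exact: hq.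
exists (r / (`|w| + 1) / 2); first by rewrite !divr_gt0 // ltr_wpDl.
apply: hr; rewrite addrAC subrr add0r normrZ gtr0_norm; last by rewrite !divr_gt0 // ltr_wpDl.
have w1 : 0 < `|w| + 1 by rewrite ltr_wpDl.
apply: (@le_lt_trans _ _ (r / 2)); last by rewrite ltr_pdivrMr // mulr_natr mulr2n ltrDl.
rewrite mulrAC ler_wpM2r ?invr_ge0 // mulrAC ler_pdivrMr // ler_pM2l //.
by rewrite lerDl.
Qed.

(** With al = pi / d, sin al w_i = sin (i al) w_1 + y sin ((i - 1) al), where y and w_1 are positive
    inside the cone. For i = 0 the wall function is - y. *)
Lemma interior_wfun (R : realType) (d : nat) (q : 'rV[R]_2) (i : 'I_d) : (0 < d)%N ->
  interior (@cone R d) q -> wfun d i (q 0 0) (q 0 1) != 0.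
Proof.
move=> d0 hq.
have y0 : 0 < q 0 1.
  have [e e0 [+ _]] := interior_shift (row2 0 (-1)) hq; rewrite !mxE /= => h.
  by apply: (lt_le_trans e0); move: h; rewrite mulrN1 subr_ge0.
have [i0|i0] := eqVneq (i : nat) 0%N.
  by rewrite /wfun i0 !mul0r sin0 cos0 mulr0 mulr1 sub0r oppr_eq0 gt_eqF.
have d1 : (1 < d)%N by apply: leq_ltn_trans (ltn_ord i); rewrite lt0n.
pose al : R := pi / d%:R; have dR : 0 < d%:R :> R by rewrite ltr0n.
have ipi : i%:R * pi / d%:R = i%:R * al by rewrite mulrA.
have al0 : 0 < al by rewrite divr_gt0 // pi_gt0.
have ali (k : nat) : (k < d)%N -> k%:R * al < pi.
  by move=> kd; rewrite mulrA ltr_pdivrMr // mulrC ltr_pM2l ?pi_gt0 // ltr_nat.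
have sal : 0 < sin al.
  by apply: sin_gt0_pi; rewrite al0 /=; have := ali 1%N d1; rewrite mul1r.
have sth : 0 < sin (i%:R * al).
  by apply: sin_gt0_pi; rewrite ali // mulr_gt0 // ltr0n lt0n.
have w1 : 0 < q 0 0 * sin al - q 0 1 * cos al.
  have [e e0 [_ +]] := interior_shift (row2 (-1) 0) hq; rewrite !mxE /= mulr0 addr0 => h.
  apply: (lt_le_trans (mulr_gt0 e0 sal)); rewrite -subr_ge0; apply: le_trans h _.
  by rewrite -/al le_eqVlt; apply/orP; left; apply/eqP; ring.
have s1 : 0 <= sin (i%:R * al - al).
  have -> : i%:R * al - al = (i.-1)%:R * al.
    by rewrite -{1}(prednK (n := i)) ?lt0n // -natr1; ring.
  apply: sin_ge0_pi; apply/andP; split; first by rewrite mulr_ge0 ?ler0n ?(ltW al0).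
  apply/ltW/ali; exact: leq_ltn_trans (leq_pred _) (ltn_ord i).
rewrite gt_eqF // -(pmulr_rgt0 _ sal) /wfun ipi.
have -> : sin al * (q 0 0 * sin (i%:R * al) - q 0 1 * cos (i%:R * al)) =
   sin (i%:R * al) * (q 0 0 * sin al - q 0 1 * cos al) + q 0 1 * sin (i%:R * al - al).
  by rewrite sinB; ring.
by apply: ltr_pwDl; [exact: mulr_gt0|rewrite mulr_ge0 // ltW].
Qed.

Definition wall_coef (R : realType) (d i : nat) (c : 'I_2) : R :=
  if c == 0 then sin (wall_angle R d i) else - cos (wall_angle R d i).

Lemma wfunE (R : realType) (d i : nat) (q : 'rV[R]_2) :
  wfun d i (q 0 0) (q 0 1) = \sum_c wall_coef R d i c * q 0 c.
Proof. by rewrite sum2E /wall_coef /wfun /= -!/(wall_angle R d i); ring. Qed.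

Lemma logvol_grad_diff (R : realType) (d : nat) (mult : 'I_d -> nat) c (q : 'rV[R]_2) :
  (0 < d)%N -> interior (@cone R d) q -> differentiable (logvol_grad mult c) q.
Proof.
move=> d0 hq.
have dw i : differentiable (wgrad (R := R) d i c) q \/ (d <= i)%N.
  have [di|id_] := leqP d i; [by right|left].
  apply: diffM_ext; first exact: differentiable_cst.
  apply: diffV_ext; first exact: (interior_wfun (Ordinal id_) d0 hq).
  apply: near_eq_differentiable
    (_ : differentiable (fun q : 'rV[R]_2 => \sum_c wall_coef R d i c * q 0 c) q).
    by near=> p; rewrite wfunE.
  apply: diff_sum_ext => e _; apply: diffM_ext; first exact: differentiable_cst.
  exact: differentiable_coord.
apply: diff_sum_ext => i _.
apply: near_eq_differentiable (_ : differentiable (fun q => (mult i)%:R * wgrad d i c q) q).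
  by near=> p; rewrite mulr_natl.
apply: diffM_ext; first exact: differentiable_cst.
by case: (dw i) => // di; have := ltn_ord i; rewrite ltnNge di.
Unshelve. all: by end_near. Qed.

Lemma partial_logvol_grad (R : realType) (d : nat) (mult : 'I_d -> nat) c e (q : 'rV[R]_2) :
  (0 < d)%N -> interior (@cone R d) q ->
  partial e (logvol_grad mult c) q = - \sum_(i < d) (wgrad d i c q * wgrad d i e q) *+ mult i.
Proof.
move=> d0 hq; rewrite -sumrN; apply: dderE; apply: dder_sum => i _.
rewrite -mulNrn; apply: dderMn.
have w0 := interior_wfun i d0 hq.
have dw : dder (fun q : 'rV[R]_2 => wfun d i (q 0 0) (q 0 1)) q (delta_mx 0 e) (wall_coef R d i e).
  apply: dder_near (_ : dder (fun q : 'rV[R]_2 => \sum_c wall_coef R d i c * q 0 c) q _ _).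
    by near=> p; rewrite wfunE.
  apply: dder_eq (@dder_sum _ _ _ _ _ _ (fun c (q : 'rV[R]_2) => wall_coef R d i c * q 0 c) _
    (fun c => wall_coef R d i c * (delta_mx 0 e : 'rV[R]_2) 0 c) _) _.
    by move=> k _; apply: dderZ; apply: coord_dder.
  rewrite (bigD1 e) //= big1 => [|k ke]; first by rewrite !mxE !eqxx mulr1 addr0.
  by rewrite mxE (negbTE ke) andbF mulr0.
apply: (@dder_near _ _ _ (fun p : 'rV[R]_2 => wall_coef R d i c / wfun d i (p 0 0) (p 0 1))).
  by near=> p.
apply: dder_eq (dderZ _
  (@dderV _ _ _ (fun q : 'rV[R]_2 => wfun d i (q 0 0) (q 0 1)) q _ w0 dw)) _.
rewrite /wgrad -!/(wall_coef R d i _).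
by move: w0; move: (wfun _ _ _ _) (wall_coef _ _ _ _) (wall_coef _ _ _ _) => w A B w0; field.
Unshelve. all: by end_near. Qed.

(** Intermediate value theorem along a coordinate line on which the partial derivative keeps its
    sign. It provides whole intervals of parameters in [profile_minimal] and the criticality of
    minima in [local_min_critical]. *)
Lemma range_nbhs (R : realType) (m : nat) (U : set 'rV[R]_m) (s : 'rV[R]_m -> R) v0 k :
  open U -> smooth_on U s -> U v0 -> partial k s v0 != 0 ->
  exists2 e : R, 0 < e & forall t, s v0 - e < t < s v0 + e -> exists2 v, U v & s v = t.
Proof.
move=> oU ss Uv0.
wlog : s ss / 0 < partial k s v0.
  move=> wl p0; have [|n0] := ltP 0 (partial k s v0); first by move=> p; apply: wl.
  have sN : smooth_on U (fun v => - s v).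
    apply: (@smooth_eq _ _ _ U (fun v => -1 * s v)) => //; first by move=> u _; rewrite mulN1r.
    by apply: smoothM => //; apply: smooth_cst.
  have pN : partial k (fun v => - s v) v0 = - partial k s v0.
    by apply: dderE; apply: dderN; apply: differentiable_dder; apply: smooth_diff Uv0.
  have [||e e0 he] := wl (fun v => - s v) sN.
  - by rewrite pN oppr_gt0 lt_neqAle p0.
  - by rewrite pN oppr_eq0.
  exists e => // t /andP[t1 t2]; have [|v Uv /oppr_inj <-] := he (- t); last by exists v.
  by apply/andP; split; lra.
move=> pk _.
have cp : {for v0, continuous (partial k s)}.
  by apply: differentiable_near; apply: smooth_diff Uv0; apply: smooth_partial.
have [r r0 hr] : exists2 r, 0 < r & forall v, `|v - v0| < r -> U v /\ 0 < partial k s v.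
  apply: near_rV; apply: filterI; first exact: open_nbhs_nbhs.
  have : \forall v \near v0, `|partial k s v0 - partial k s v| < partial k s v0.
    exact: (cvgr_dist_lt _ _ cp _ pk).
  by apply: filterS => v; rewrite ltr_distlC subrr => /andP[].
set D := delta_mx 0 k : 'rV[R]_m.
have D1 : `|D| <= 1.
  by apply: rV_norm_le => // i; rewrite !mxE eqxx /=; case: eqP => _; rewrite ?normr1 ?normr0.
pose g t := s (v0 + t *: D).
have inb t : `|t| < r -> U (v0 + t *: D) /\ 0 < partial k s (v0 + t *: D).
  move=> tr; apply: hr; rewrite addrAC subrr add0r normrZ; apply: le_lt_trans tr.
  by rewrite ler_piMr.
pose h := r / 2.
have h0 : 0 < h by rewrite divr_gt0.
have hr2 : h < r by rewrite ltr_pdivrMr // mulr_natr mulr2n ltrDl.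
have mono t : 0 < `|t| < r -> exists2 p, 0 < p & g t - g 0 = t * p.
  move=> /andP[t0 tr].
  have [|x x01] := @mvt_rV R m s v0 (v0 + t *: D).
    move=> x /andP[x0 x1]; rewrite [v0 + _ - v0]addrAC subrr add0r scalerA.
    apply: smooth_diff ss _; apply: (proj1 (inb _ _)); apply: le_lt_trans tr.
    by rewrite normrM ger0_norm // ler_piMl.
  rewrite [v0 + _ - v0]addrAC subrr add0r scalerA sum_deltaE => e.
  exists (partial k s (v0 + (x * t) *: D)); last by rewrite /g scale0r addr0.
  apply: (proj2 (inb _ _)); apply: le_lt_trans tr.
  by case/andP: x01 => x0 x1; rewrite normrM gtr0_norm // ler_piMl // ltW.
have [p1 p10 e1] : exists2 p, 0 < p & g h - g 0 = h * p.
  by apply: mono; rewrite gtr0_norm // h0.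
have [p2 p20 e2] : exists2 p, 0 < p & g (- h) - g 0 = - h * p.
  by apply: mono; rewrite normrN gtr0_norm // h0.
have g0 : g 0 = s v0 by rewrite /g scale0r addr0.
exists (h * Num.min p1 p2); first by rewrite mulr_gt0 // lt_min p10.
move=> t /andP[ta tb].
have m1 : h * Num.min p1 p2 <= h * p1 by rewrite ler_pM2l // ge_min lexx.
have m2 : h * Num.min p1 p2 <= h * p2 by rewrite ler_pM2l // ge_min lexx orbT.
have gl : g (- h) <= t by move: e2; rewrite g0 mulNr; lra.
have gu : t <= g h by move: e1; rewrite g0; lra.
have [|||x] := @IVT R g (- h) h t.
- by lra.
- apply: continuous_in_subspaceT => x; rewrite inE /= in_itv /= => /andP[x1 x2].
  have xr : `|x| < r by rewrite ltr_norml; apply/andP; split; lra.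
  apply: differentiable_near.
  apply: (@differentiable_comp _ _ _ _ (fun t : R => v0 + t *: D) s).
    by apply: differentiableD; [exact: differentiable_cst|exact: differentiableZl].
  by apply: smooth_diff ss _; exact: (proj1 (inb _ xr)).
- by rewrite ge_min le_max gl gu orbT.
rewrite in_itv /= => /andP[x1 x2] <-.
have xr : `|x| < r by rewrite ltr_norml; apply/andP; split; lra.
by exists (v0 + x *: D) => //; exact: (proj1 (inb _ xr)).
Qed.

Lemma lapl_eq (R : realType) (m n : nat) (U : set 'rV[R]_m) (psi : 'rV[R]_m -> 'rV[R]_n)
    (h h' : 'rV[R]_m -> R) v : open U -> (forall u, U u -> h u = h' u) -> U v ->
  lapl psi h v = lapl psi h' v.
Proof.
move=> oU hh Uv.
have p1 k u : U u -> partial k h u = partial k h' u by move=> Uu; apply: eq_on_partial oU hh Uu.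
apply: (congr2 +%R).
  apply: eq_bigr => i _; apply: eq_bigr => k _; apply: (congr1 ( *%R _)).
  by apply: eq_on_partial oU _ Uv => u; apply: p1.
by apply: eq_bigr => k _; rewrite p1.
Qed.

Lemma logvol_contract (R : realType) (d : nat) (mult : 'I_d -> nat) (G : 'I_2 -> R) (q : 'rV[R]_2) :
  \sum_c G c * logvol_grad mult c q =
  \sum_(i < d) (\sum_c G c * wgrad d i c q) *+ mult i.
Proof.
transitivity (\sum_c \sum_(i < d) (G c * wgrad d i c q) *+ mult i).
  apply: eq_bigr => c _; rewrite /logvol_grad mulr_sumr; apply: eq_bigr => i _.
  exact: mulrnAr.
by rewrite exchange_big; apply: eq_bigr => i _; rewrite sumrMnl.
Qed.

Section ProfileMinimal.
Context (R : realType) (n' d : nat) (mult : 'I_d -> nat)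
  (Pi : 'rV[R]_n'.+3 -> 'rV[R]_2).
Let O := Pi @^-1` interior (@cone R d).
Hypothesis d_gt0 : (0 < d)%N.
Hypothesis mult_gt0 : forall i, (0 < mult i)%N.
Hypothesis oO : open O.
Hypothesis sPi : smooth_on O Pi.
Hypothesis rPi : forall p, O p -> riemannian_submersion_at Pi p.
Hypothesis lapE : forall c p, O p -> lapPi Pi c p = logvol_grad mult c (Pi p).

Context (a b : R) (x y : R -> R) (U : set 'rV[R]_n'.+2)
  (psi : 'rV[R]_n'.+2 -> 'rV[R]_n'.+3) (s : 'rV[R]_n'.+2 -> R).
Hypothesis cxy : profile_curve d a b x y.
Hypothesis pxy : profile_param Pi a b x y U psi s.
Hypothesis bih : forall v, U v -> forall j,
  laplace_beltrami psi (fun w => mean_curvature psi w 0 j) v = 0.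

Let z := coords x y.
Let z1 c := derive1 (z c).
Let z2 c := derive1n 2 (z c).
Let c1 := derive1 x.
Let c2 := derive1 y.
Let k := curv_profile x y.
Let k1 t := derive1n 3 y t * c1 t - derive1n 3 x t * c2 t.
Let k2 t := derive1n 4 y t * c1 t + derive1n 3 y t * derive1n 2 x t
  - (derive1n 4 x t * c2 t + derive1n 3 x t * derive1n 2 y t).
Let S t := \sum_(i < d) ncurv d i (x t) (y t) (c1 t) (c2 t) *+ mult i.
Let T t := \sum_(i < d) tcurv d i (x t) (y t) (c1 t) (c2 t) *+ mult i.
Let n1 : R := n'.+2%:R.
Let f t := (k t + S t) / n1.
Let F1 t := f t * - c2 t.
Let F2 t := f t * c1 t.
Let F := coords F1 F2.

Let oU : open U. Proof. by case: pxy. Qed.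
Let ipsi : immersion_on U psi. Proof. by case: pxy. Qed.
Let ss : smooth_on U s. Proof. by case: pxy. Qed.
Let sab v : U v -> a < s v < b. Proof. by case: pxy => _ _ _ h /h[]. Qed.
Let dz c t : a < t < b -> dder (z c) t 1 (z1 c t).
Proof. exact: (profile_dder cxy c 0). Qed.
Let dz1 c t : a < t < b -> dder (z1 c) t 1 (z2 c t).
Proof. exact: (profile_dder cxy c 1). Qed.
Let uz t : a < t < b -> z1 0 t ^+ 2 + z1 1 t ^+ 2 = 1.
Proof. by case: cxy => _ _ h /h[]. Qed.
Let Opsi v : U v -> O (psi v). Proof. exact: (profile_O cxy pxy). Qed.
Let Pipsi v c : U v -> Pi (psi v) 0 c = z c (s v). Proof. exact: (profile_coords pxy). Qed.
Let dx t : a < t < b -> dder x t 1 (c1 t). Proof. exact: (dz 0). Qed.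
Let dy t : a < t < b -> dder y t 1 (c2 t). Proof. exact: (dz 1). Qed.
Let Dx j t : a < t < b -> dder (derive1n j x) t 1 (derive1n j.+1 x t).
Proof. exact: (profile_dder cxy 0 j). Qed.
Let Dy j t : a < t < b -> dder (derive1n j y) t 1 (derive1n j.+1 y t).
Proof. exact: (profile_dder cxy 1 j). Qed.

Let perp t : a < t < b -> c1 t * derive1n 2 x t + c2 t * derive1n 2 y t = 0.
Proof. exact: (z1_z2_perp dz1 uz). Qed.

Let dc1 t : a < t < b -> dder c1 t 1 (- k t * c2 t).
Proof.
move=> tab; apply: dder_eq (Dx 1 tab) _; rewrite /k /curv_profile -/(c1 t) -/(c2 t).
have := perp tab; have : c1 t ^+ 2 + c2 t ^+ 2 = 1 by exact: uz.
move: (derive1n 2 x t) (derive1n 2 y t) (c1 t) (c2 t) => x2 y2 u w e1 e2.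
rewrite -[LHS]mul1r -e1 -[RHS]addr0 -[X in _ = _ + X](mulr0 u) -e2; ring.
Qed.

Let dc2 t : a < t < b -> dder c2 t 1 (k t * c1 t).
Proof.
move=> tab; apply: dder_eq (Dy 1 tab) _; rewrite /k /curv_profile -/(c1 t) -/(c2 t).
have := perp tab; have : c1 t ^+ 2 + c2 t ^+ 2 = 1 by exact: uz.
move: (derive1n 2 x t) (derive1n 2 y t) (c1 t) (c2 t) => x2 y2 u w e1 e2.
rewrite -[LHS]mul1r -e1 -[RHS]addr0 -[X in _ = _ + X](mulr0 w) -e2; ring.
Qed.

Let dk t : a < t < b -> dder k t 1 (k1 t).
Proof.
move=> tab.
apply: dder_eq (dderB (dderM (Dy 2 tab) (Dx 1 tab)) (dderM (Dx 2 tab) (Dy 1 tab))) _.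
rewrite /k1 -[derive1n 1 x t]/(c1 t) -[derive1n 1 y t]/(c2 t).
move: (derive1n 2 x t) (derive1n 2 y t) (derive1n 3 x t) (derive1n 3 y t) (c1 t) (c2 t) => *; ring.
Qed.

Let dk1 t : a < t < b -> dder k1 t 1 (k2 t).
Proof.
move=> tab.
exact: (dderB (dderM (Dy 3 tab) (Dx 1 tab)) (dderM (Dx 3 tab) (Dy 1 tab))).
Qed.

Let slice v : U v -> Pi (psi v) = row2 (x (s v)) (y (s v)).
Proof. by case: pxy => _ _ _ h /h[]. Qed.

Let w_neq0 t (i : 'I_d) : a < t < b -> wfun d i (x t) (y t) != 0.
Proof.
move=> tab; have [_ _ /(_ t tab)[_ ic]] := cxy.
by have := interior_wfun i d_gt0 ic; rewrite !mxE.
Qed.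

Let F_dder e t : a < t < b -> dder (F e) t 1 (derive1 (F e) t).
Proof.
move=> tab; rewrite /F /coords; case: ifP => _.
  exact: (proj1 (planar_dder2_F1 mult dx dy dc1 dc2 dk dk1 w_neq0 n1 tab)).
exact: (proj1 (planar_dder2_F2 mult dx dy dc1 dc2 dk dk1 w_neq0 n1 tab)).
Qed.

Let F_dder2 e t : a < t < b -> dder (derive1 (F e)) t 1 (derive1n 2 (F e) t).
Proof.
move=> tab; rewrite /F /coords; case: ifP => _.
  exact: (proj2 (planar_dder2_F1 mult dx dy dc1 dc2 dk dk1 w_neq0 n1 tab)).
exact: (proj2 (planar_dder2_F2 mult dx dy dc1 dc2 dk dk1 w_neq0 n1 tab)).
Qed.

Let mean_curvature_f v : U v -> mean_curvature psi v = f (s v) *: nrm Pi psi s z1 v.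
Proof.
move=> Uv; rewrite (mean_curvature_nrm oO sPi rPi oU ipsi ss sab dz dz1 uz Opsi Pipsi Uv).
congr (_ *: _); rewrite /f mulrC -/n1; congr (_ / _).
rewrite !lapE; try exact: Opsi.
rewrite -addrA; congr (_ + _).
  rewrite -[ncrv _ _ _ _]/(c1 (s v) * derive1n 2 y (s v) - c2 (s v) * derive1n 2 x (s v)).
  rewrite -[k (s v)]/(derive1n 2 y (s v) * c1 (s v) - derive1n 2 x (s v) * c2 (s v)).
  by rewrite mulrC [c2 _ * _]mulrC.
have := logvol_contract mult (fun c : 'I_2 => if c == 0 then c2 (s v) else - c1 (s v)) (Pi (psi v)).
rewrite sum2E /= mulNr -[z1 0 _]/(c1 _) -[z1 1 _]/(c2 _) => ->.
apply: eq_bigr => i _; rewrite sum2E /= /wgrad /ncurv slice // !mxE /=.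
by congr (_ *+ _); move: (wfun _ _ _ _) (c1 _) (c2 _) (sin _) (cos _) => *; ring.
Qed.

Let mean_curvature_field v j : U v ->
  mean_curvature psi v 0 j = \sum_e F e (s v) * gr Pi e (psi v) j.
Proof.
move=> Uv; rewrite mean_curvature_f // mxE hliftE mulr_sumr; apply: eq_bigr => e _.
rewrite mulrA mxE /F /F1 /F2 /coords -[z1 0 _]/(c1 _) -[z1 1 _]/(c2 _); by case: ifP.
Qed.

Let lapl_mean v j : U v ->
  lapl psi (fun u => \sum_e F e (s u) * gr Pi e (psi u) j) v = 0.
Proof.
move=> Uv; set h := fun u => _.
have th : twice_diff U h.
  apply: (twice_diff_sum oU) => e.
  have tF : twice_diff U (fun u => F e (s u)).
    by have [] := comp_s oO sPi rPi oU ipsi ss sab dz dz1 uz Opsi Pipsi (@F_dder e) (@F_dder2 e).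
  exact: (twice_diffM oU tF (twice_gr oO sPi oU ipsi Opsi e j)).
have hE u : U u -> mean_curvature psi u 0 j = h u by move=> Uu; apply: mean_curvature_field.
rewrite -(lapl_eq psi oU hE Uv); apply: oppr_inj; rewrite oppr0.
rewrite -(laplace_beltramiE oU ipsi Uv) ?bih // => l.
apply: near_eq_differentiable (proj2 (th v Uv) l).
by apply: open_near oU Uv _ => u Uu; rewrite (eq_on_partial l oU hE Uu).
Qed.

Let ode c v : U v ->
  derive1n 2 (F c) (s v) + T (s v) * derive1 (F c) (s v) -
  \sum_(i < d) ((F1 (s v) * sin (wall_angle R d i) - F2 (s v) * cos (wall_angle R d i)) /
     wfun d i (x (s v)) (y (s v)) *
     (wall_coef R d i c / wfun d i (x (s v)) (y (s v)))) *+ mult i = 0.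
Proof.
move=> Uv; have Op := Opsi Uv.
have dL e q : O q -> differentiable (logvol_grad mult e) (Pi q).
  by move=> Oq; apply: logvol_grad_diff.
have := field_ode oO sPi rPi oU ipsi ss sab dz dz1 uz Opsi Pipsi c
  (@F_dder) (@F_dder2) lapE dL Uv (fun j => lapl_mean j Uv).
have -> : slope Pi psi s z1 v = T (s v).
  rewrite /slope; under eq_bigr => l _ do rewrite lapE //.
  rewrite logvol_contract; apply: eq_bigr => i _; rewrite sum2E /wgrad /tcurv slice // !mxE /=.
  rewrite -[z1 0 _]/(c1 _) -[z1 1 _]/(c2 _).
  by congr (_ *+ _); move: (wfun _ _ _ _) (c1 _) (c2 _) (sin _) (cos _) => *; ring.
move=> ef; rewrite -[RHS]ef {ef}; congr (_ + _).
rewrite sum2E !partial_logvol_grad // !mulrN -opprD; congr (- _).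
rewrite !mulr_sumr -big_split; apply: eq_bigr => i _ /=.
rewrite !mulrnAr -mulrnDl; congr (_ *+ _).
rewrite /wgrad -/(wall_coef R d i c) slice // !mxE /= -[F 0 _]/(F1 _) -[F 1 _]/(F2 _).
by move: (wfun _ _ _ _) (F1 _) (F2 _) (sin _) (cos _) (wall_coef _ _ _ _) => *; ring.
Qed.

(** The equations are known at the parameters attained by [s] only. Its gradient has length one, so
    [s] attains an interval around [s v], on which [planar_biharmonic] applies. *)
Lemma profile_minimal v : U v -> mean_curvature psi v = 0.
Proof.
move=> Uv; rewrite mean_curvature_f // (_ : f (s v) = 0) ?scale0r //.
have [i pi0] : exists i, partial i s v != 0.
  apply: contrapT => none.
  have := grad_s_unit oO sPi rPi oU ipsi ss sab dz uz Opsi Pipsi Uv.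
  rewrite big1 => [/esym/eqP|i _]; first by rewrite oner_eq0.
  rewrite big1 // => l _; have -> : partial i s v = 0; last by rewrite mul0r mulr0.
  by apply/eqP/negPn/negP => pi; apply: none; exists i.
have [e e0 he] := range_nbhs oU ss Uv pi0.
have hab t : s v - e < t < s v + e -> a < t < b by move=> /he[u Uu <-]; apply: sab.
have sve : s v - e < s v < s v + e by rewrite ltrBlDr !ltrDl e0.
have n10 : n1 != 0 by rewrite pnatr_eq0.
rewrite /f (@planar_biharmonic R d mult x y c1 c2 k k1 k2 (s v - e) (s v + e) d_gt0 mult_gt0
  _ _ _ _ _ _ _ _ n1 n10 _ _ (s v) sve) ?mul0r //.
- by move=> t /hab; apply: dx.
- by move=> t /hab; apply: dy.
- by move=> t /hab; apply: dc1.
- by move=> t /hab; apply: dc2.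
- by move=> t /hab; apply: dk.
- by move=> t /hab; apply: dk1.
- by move=> t /hab; apply: uz.
- by move=> t l /hab; apply: w_neq0.
- by move=> t /he[u Uu <-]; exact: (ode 0 Uu).
- by move=> t /he[u Uu <-]; exact: (ode 1 Uu).
Qed.

End ProfileMinimal.

(** * Arbitrary charts *)

(** The projection of the curve to its tangent line at t0 has derivative 1 there, so it is locally
    increasing and [g] inverts it. *)
Lemma curve_local_inverse (R : realType) (a b : R) (z z1 : 'I_2 -> R -> R) (t0 : R) :
  (forall c t, a < t < b -> dder (z c) t 1 (z1 c t)) ->
  (forall c t, a < t < b -> {for t, continuous (z1 c)}) ->
  (forall t, a < t < b -> z1 0 t ^+ 2 + z1 1 t ^+ 2 = 1) -> a < t0 < b ->
  exists g : R -> R, dder g (\sum_c z1 c t0 * z c t0) 1 1 /\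
    \forall t \near t0, g (\sum_c z1 c t0 * z c t) = t.
Proof.
move=> dz cz1 uz t0ab; pose f t := \sum_c z1 c t0 * z c t; pose f1 t := \sum_c z1 c t0 * z1 c t.
have df t : a < t < b -> dder f t 1 (f1 t).
  by move=> tab; apply: dder_sum => c _; apply: dderZ; apply: dz.
have f10 : f1 t0 = 1 by rewrite /f1 sum2E -!expr2 uz.
have cf1 : {for t0, continuous f1}.
  rewrite /f1 (_ : (fun t => _) = (fun t => z1 0 t0 * z1 0 t + z1 1 t0 * z1 1 t)); last first.
    by apply/funext => t; rewrite sum2E.
  by apply: cvgD; apply: cvgM; [exact: cvg_cst|exact: cz1|exact: cvg_cst|exact: cz1].
have near1 : \forall t \near t0, a < t < b /\ 0 < f1 t.
  near=> t; split; first by near: t; exact: near_itvoo.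
  near: t; have : \forall t \near t0, `|f1 t0 - f1 t| < f1 t0.
    by apply: (cvgr_dist_lt _ _ cf1); rewrite f10.
  by apply: filterS => t; rewrite ltr_distlC subrr => /andP[].
have [p [q [t0pq hpq]]] := nbhs_itvoo near1.
have inc t1 t2 : p < t1 -> t1 < t2 -> t2 < q -> f t1 < f t2.
  move=> pt1 t12 t2q.
  have inpq t : t1 <= t <= t2 -> p < t < q.
    by move=> /andP[h1 h2]; rewrite (lt_le_trans pt1 h1) (le_lt_trans h2 t2q).
  have [||c + e] := @MVT R f f1 t1 t2 t12.
  - move=> t; rewrite in_itv /= => /andP[h1 h2]; apply: df.
    by have [] := hpq t (inpq t _); rewrite ?(ltW h1) ?(ltW h2).
  - apply: continuous_in_subspaceT => t; rewrite inE /= in_itv /= => tt.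
    by apply: dder1_cont (df t _); have [] := hpq t (inpq t tt).
  rewrite in_itv /= => /andP[h1 h2]; rewrite -subr_gt0 e mulr_gt0 ?subr_gt0 //.
  by have [] := hpq c (inpq c _); rewrite ?(ltW h1) ?(ltW h2).
pose g u := xget 0 [set t | p < t < q /\ f t = u].
have gf t : p < t < q -> g (f t) = t.
  move=> tpq; have [gpq fg] : p < g (f t) < q /\ f (g (f t)) = f t.
    by apply: (@xgetI _ 0 [set t' | p < t' < q /\ f t' = f t] t).
  case/andP: tpq => pt tq; case/andP: gpq => pg gq.
  have [lt|lt|//] := ltgtP (g (f t)) t.
    by have := inc _ _ pg lt tq; rewrite fg ltxx.
  by have := inc _ _ pt lt gq; rewrite fg ltxx.
have gfn : \forall t \near t0, g (f t) = t.
  by near=> t; apply: gf; near: t; exact: near_itvoo.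
exists g; split=> //.
have h := @is_derive_inverse R f g 1 t0.
rewrite invr1 in h; apply: h => //.
- near=> t; apply: (dder1_cont (df t _)).
  by near: t; exact: near_itvoo.
- by have := df t0 t0ab; rewrite f10.
Unshelve. all: by end_near. Qed.

(** By [curve_local_inverse], [t] is locally a function of a combination of the components of [P],
    hence differentiable. Its partial derivatives are sums of products of the z'(t) and the partial
    derivatives of [P], so smooth functions and functions of [t] generate a class stable under
    differentiation. *)
Lemma continuous_param_smooth (R : realType) (m : nat) (U : set 'rV[R]_m) (a b : R)
    (z : 'I_2 -> R -> R) (P : 'rV[R]_m -> 'rV[R]_2) (t : 'rV[R]_m -> R) :
  open U -> (forall c, smooth_fun_on `]a, b[%classic (z c)) ->
  (forall u, a < u < b -> derive1 (z 0) u ^+ 2 + derive1 (z 1) u ^+ 2 = 1) ->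
  smooth_on U P -> (forall v, U v -> {for v, continuous t}) ->
  (forall v, U v -> a < t v < b) -> (forall v c, U v -> P v 0 c = z c (t v)) ->
  smooth_on U t.
Proof.
move=> oU sz uz sP ct tab Pz.
have Dz k c u : a < u < b -> dder (derive1n k (z c)) u 1 (derive1n k.+1 (z c) u).
  by move=> uab; apply: smooth_dder uab; apply: sz.
have sPc c : smooth_on U (fun v => P v 0 c) by apply: smooth_coord.
have dt v : U v -> differentiable t v /\
    forall i, partial i t v = \sum_c derive1 (z c) (t v) * partial i (fun v => P v 0 c) v.
  move=> Uv.
  have [||g [dg gK]] := @curve_local_inverse R a b z (fun c => derive1 (z c)) (t v) _ _ uz (tab v Uv).
  - by move=> c u; apply: (Dz 0%N).
  - by move=> c u /(Dz 1%N c u) /dder1_cont.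
  pose w u := \sum_c derive1 (z c) (t v) * P u 0 c.
  have dw : differentiable w v.
    apply: diff_sum_ext => c _; apply: diffM_ext; first exact: differentiable_cst.
    exact: smooth_diff (sPc c) Uv.
  have wE u : U u -> w u = \sum_c derive1 (z c) (t v) * z c (t u).
    by move=> Uu; apply: eq_bigr => c _; rewrite Pz.
  have tw : \forall u \near v, g (w u) = t u.
    have gt : \forall u \near v, g (\sum_c derive1 (z c) (t v) * z c (t u)) = t u.
      exact: (ct v Uv _ gK).
    near=> u; rewrite wE; first by near: u.
    by near: u; apply: open_nbhs_nbhs.
  have dgw : dder g (w v) 1 1 by rewrite wE.
  split.
    apply: near_eq_differentiable tw _; apply: (@differentiable_comp _ _ _ _ w g) => //.
    by apply/derivable1_diffP; case: dgw.
  move=> i; transitivity (partial i (fun u => g (w u)) v).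
    by apply: near_eq_derive; near=> u; apply/esym; near: u.
  have [_ ->] := partial_comp1 i dw dgw; rewrite mul1r; apply: dderE; apply: dder_sum => c _; apply: dderZ.
  by apply: differentiable_dder; apply: smooth_diff (sPc c) Uv.
pose B (f : 'rV[R]_m -> R) := smooth_on U f \/
   exists2 h, smooth_fun_on `]a, b[%classic h & f = (fun v => h (t v)).
suff sB : forall f, smooth_class U B f -> smooth_on U f.
  apply: (@smooth_eq _ _ _ U (fun v => 0 + t v * 1)) => // [v _|].
    by rewrite add0r mulr1.
  apply: sB; apply: SCbase; right; exists (fun u => 0 + u * 1) => //.
  exact: affine_smooth.
apply: smooth_class_smooth => // f [sf|[h sh ->]].
  split=> [v|i]; first exact: smooth_diff.
  by exists (partial i f); split=> //; apply: SCbase; left; apply: smooth_partial.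
have dh v : U v -> dder h (t v) 1 (derive1 h (t v)).
  by move=> Uv; apply: (smooth_dder 0 sh (tab v Uv)).
have sh1 : smooth_fun_on `]a, b[%classic (derive1 h).
  by move=> k u uab; rewrite -derive1Sn; apply: sh.
split=> [v Uv|i].
  apply: (@differentiable_comp _ _ _ _ t h); first by have [] := dt v Uv.
  by apply/derivable1_diffP; case: (dh v Uv).
exists (fun v => derive1 h (t v) * \sum_c derive1 (z c) (t v) * partial i (fun v => P v 0 c) v).
split=> [|v Uv].
  apply: SCmul; first by apply: SCbase; right; exists (derive1 h).
  apply: SCsum => c; apply: SCmul; apply: SCbase.
    right; exists (derive1 (z c)); last by [].
    by move=> k u uab; rewrite -derive1Sn; apply: sz.
  by left; apply: smooth_partial.
have [dtv pt] := dt v Uv.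
by have [_ ->] := partial_comp1 i dtv (dh v Uv); rewrite pt.
Unshelve. all: by end_near. Qed.

Section Charts.
Context (R : realType) (n' d : nat) (mult : 'I_d -> nat)
  (Pi : 'rV[R]_n'.+3 -> 'rV[R]_2).
Let O := Pi @^-1` interior (@cone R d).
Hypothesis d_gt0 : (0 < d)%N.
Hypothesis mult_gt0 : forall i, (0 < mult i)%N.
Hypothesis oO : open O.
Hypothesis sPi : smooth_on O Pi.
Hypothesis rPi : forall p, O p -> riemannian_submersion_at Pi p.
Hypothesis lapE : forall c p, O p -> lapPi Pi c p = logvol_grad mult c (Pi p).

Lemma chart_continuous (M : topologicalType) (phi : M -> 'rV[R]_n'.+3) U u v :
  local_param phi U u -> U v -> {for v, continuous u}.
Proof.
move=> [oU cu _ _ _] Uv; move: cu; rewrite continuous_open_subspace // => cu.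
by apply: cu; rewrite inE.
Qed.

(** The profile is given in the chart [u] and the conclusion is about [u']. The arc length parameter
    is carried over by the transition map, which is only known to be continuous;
    [continuous_param_smooth] makes it smooth. *)
Lemma chart_minimal (M : topologicalType) (phi : M -> 'rV[R]_n'.+3)
    (a b : R) (x y : R -> R) U (u : 'rV[R]_n'.+2 -> M) s U' u' v' :
  local_param phi U u -> profile_curve d a b x y -> profile_param Pi a b x y U (phi \o u) s ->
  local_param phi U' u' -> biharmonic phi -> U' v' -> (u @` U) (u' v') ->
  mean_curvature (phi \o u') v' = 0.
Proof.
move=> lu cxy pxy lu' bih U'v' uv'.
have [oU _ inj_u op_u _] := lu; have [oU' _ _ _ ip'] := lu'.
have [_ _ ss sP] := pxy.
pose inv (p : M) := xget 0 [set w | U w /\ u w = p].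
have invP p : (u @` U) p -> U (inv p) /\ u (inv p) = p.
  by move=> [w Uw <-]; apply: (@xgetI _ 0 [set w' | U w' /\ u w' = u w] w).
pose W := [set v | U' v /\ (u @` U) (u' v)].
pose t v := s (inv (u' v)).
have near_in (V : set _) v : V `<=` U -> open V -> U' v -> (u @` V) (u' v) ->
    \forall q \near v, (u @` V) (u' q).
  move=> VU oV U'v uV; apply: (chart_continuous lu' U'v).
  by apply: open_nbhs_nbhs; split=> //; apply: op_u.
have oW : open W.
  rewrite openE => v [U'v uv]; apply: filterI; first exact: open_nbhs_nbhs.
  exact: near_in.
have ct v : W v -> {for v, continuous t}.
  move=> [U'v uv]; have [Ui ui] := invP _ uv.
  have cs : {for inv (u' v), continuous s} by apply: differentiable_near; apply: smooth_diff ss Ui.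
  move=> A tA; have : nbhs (inv (u' v)) (s @^-1` A `&` U).
    by apply: filterI; [exact: cs|exact: open_nbhs_nbhs].
  rewrite nbhsE => -[V [oV Vi] VA].
  have := near_in V v (fun q h => proj2 (VA q h)) oV U'v _.
  rewrite -ui => /(_ (imageP u Vi)); rewrite /nbhs /=; apply: filterS => q [w Vw wq].
  have [Uq uq] : U (inv (u' q)) /\ u (inv (u' q)) = u' q.
    by apply: invP; exists w => //; apply: (proj2 (VA w Vw)).
  rewrite /t /= (_ : inv (u' q) = w); first exact: (proj1 (VA w Vw)).
  by apply: inj_u => //; [exact: (proj2 (VA w Vw))|rewrite uq wq].
have Pt v : W v -> a < t v < b /\ Pi (phi (u' v)) = row2 (x (t v)) (y (t v)).
  move=> [U'v uv]; have [Ui ui] := invP _ uv.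
  by have [tab e] := sP _ Ui; split=> //; rewrite -ui.
have sp' : smooth_on W (phi \o u') by apply: smooth_sub (proj1 ip') => v [].
have pO v : W v -> O (phi (u' v)).
  move=> Wv; have [tab e] := Pt v Wv; rewrite /O /= e.
  by case: cxy => _ _ /(_ _ tab)[].
have st : smooth_on W t.
  apply: (@continuous_param_smooth R _ W a b (coords x y) (fun v => Pi (phi (u' v)))) => //.
  - by move=> c; rewrite /coords; case: cxy => sx sy _; case: ifP.
  - by case: cxy => _ _ h w /h[].
  - apply: smooth_rV => // c; apply: (smooth_comp oW (sPia oO sPi c) _ pO) => j.
    exact: smooth_coord.
  - by move=> v /Pt[].
  - by move=> v c /Pt[_ ->]; rewrite mxE /coords; case: ifP.
have pW : profile_param Pi a b x y W (phi \o u') t.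
  by split=> //; split=> // v [U'v _]; apply: (proj2 ip').
apply: (profile_minimal d_gt0 mult_gt0 oO sPi rPi lapE cxy pW) => // v [U'v _] j.
exact: bih lu' _ U'v j.
Qed.

End Charts.

(** * Isometry groups and their orbits *)

Lemma ler_mx_norm (R : realType) (m n : nat) (A : 'M[R]_(m, n)) i j : `|A i j| <= `|A|.
Proof. rewrite [leRHS]/Num.Def.normr/= mx_normrE; exact: (le_bigmax _ _ (i, j)). Qed.

Lemma mx_norm_le (R : realType) (m n : nat) (A : 'M[R]_(m, n)) (c : R) : 0 <= c ->
  (forall i j, `|A i j| <= c) -> `|A| <= c.
Proof.
move=> c0 h; rewrite [leLHS]/Num.Def.normr/= mx_normrE.
by apply: bigmax_le => // -[i j] _; apply: h.
Qed.

Lemma mulmx_norm (R : realType) (k m n : nat) (B : 'M[R]_(k, m)) (A : 'M[R]_(m, n)) :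
  `|B *m A| <= m%:R * `|B| * `|A|.
Proof.
apply: mx_norm_le; first by rewrite !mulr_ge0.
move=> i j; rewrite mxE (le_trans (ler_norm_sum _ _ _)) //.
apply: (@le_trans _ _ (\sum_(l < m) `|B| * `|A|)).
  by apply: ler_sum => l _; rewrite normrM ler_pM // ler_mx_norm.
by rewrite sumr_const card_ord -[_ *+ m]mulr_natl mulrA.
Qed.

Lemma lipschitz_continuous (R : realType) (V W : normedModType R) (f : V -> W) (k : R) :
  0 <= k -> (forall x y, `|f x - f y| <= k * `|x - y|) -> continuous f.
Proof.
move=> k0 fk x; apply/cvgrPdist_lt => e e0; have k1 : 0 < k + 1 by rewrite ltr_wpDl.
have : \forall y \near x, `|x - y| < e / (k + 1).
  apply/nbhs_ballP; exists (e / (k + 1)); first by rewrite /= divr_gt0.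
  by move=> y; rewrite -ball_normE.
apply: filterS => y; rewrite ltr_pdivlMr // => h.
by apply: le_lt_trans (fk x y) _; apply: le_lt_trans h; rewrite mulrC ler_wpM2l // lerDl.
Qed.

Lemma mulmxl_continuous (R : realType) (k m n : nat) (B : 'M[R]_(k, m)) :
  continuous (fun A : 'M[R]_(m, n) => B *m A).
Proof.
apply: (@lipschitz_continuous R 'M[R]_(m, n) 'M[R]_(k, n) _ (m%:R * `|B|)).
  by rewrite mulr_ge0.
by move=> A A'; rewrite -mulmxBr; apply: mulmx_norm.
Qed.

Definition close (R : realType) (n : nat) (e : R) (g : 'M[R]_n * 'rV[R]_n) : Prop :=
  `|g.1 - 1%:M| < e /\ `|g.2| < e.

Lemma near_close (R : realType) (n : nat) (P : 'M[R]_n * 'rV[R]_n -> Prop) :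
  (\forall g \near isom_one R n, P g) -> exists2 e, 0 < e & forall g, close e g -> P g.
Proof.
move=> /nbhs_ballP[e /= e0 he]; exists e => // g [h1 h2]; apply: he.
split; rewrite /= -ball_normE /= distrC //.
by rewrite subr0.
Qed.

Lemma closeW (R : realType) (n : nat) (e e' : R) (g : 'M[R]_n * 'rV[R]_n) :
  e <= e' -> close e g -> close e' g.
Proof. by move=> ee [h1 h2]; split; apply: lt_le_trans ee. Qed.

Lemma isom_app_continuous (R : realType) (n : nat) (p : 'rV[R]_n) :
  continuous (fun g : 'M[R]_n * 'rV[R]_n => isom_app g p).
Proof.
move=> g; apply: cvgD; last exact: cvg_snd.
apply: (@cvg_comp _ _ _ fst (fun A => p *m A)); first exact: cvg_fst.
exact: mulmxl_continuous.
Qed.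

Lemma isom_mul_app (R : realType) (n : nat) (g h : 'M[R]_n * 'rV[R]_n) p :
  isom_app (isom_mul g h) p = isom_app g (isom_app h p).
Proof. by rewrite /isom_app /= mulmxDl addrA mulmxA. Qed.

Lemma isom_one_app (R : realType) (n : nat) (p : 'rV[R]_n) : isom_app (isom_one R n) p = p.
Proof. by rewrite /isom_app /= mulmx1 addr0. Qed.

Lemma isom_appB (R : realType) (n : nat) (g : 'M[R]_n * 'rV[R]_n) p q :
  isom_app g p - isom_app g q = (p - q) *m g.1.
Proof. by rewrite /isom_app mulmxBl opprD addrACA subrr addr0. Qed.

Section IsometryGroup.
Context (R : realType) (n : nat) (G : set ('M[R]_n * 'rV[R]_n)).
Hypothesis hG : isometry_group G.

Lemma ortho g : G g -> g.1 *m g.1^T = 1%:M.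
Proof. by case: hG => _ h _ _ _; apply: h. Qed.

Lemma ortho_tr g : G g -> g.1^T *m g.1 = 1%:M.
Proof. by move=> Gg; apply: mulmx1C; apply: ortho. Qed.

Lemma ortho_dotv g (v w : 'rV[R]_n) : G g -> dotv (v *m g.1) (w *m g.1) = dotv v w.
Proof.
by move=> Gg; rewrite !dotvE trmx_mul mulmxA -[v *m g.1 *m _]mulmxA ortho // mulmx1.
Qed.

Lemma ortho_entry g i j : G g -> `|g.1 i j| <= 1.
Proof.
move=> Gg; rewrite -[leRHS]sqrtr1 -sqrtr_sqr ler_wsqrtr //.
have := ortho Gg => /matrixP /(_ i i); rewrite !mxE eqxx => e1.
rewrite -[leRHS]/(true%:R) -e1 (bigD1 j) //= mxE -expr2 lerDl; apply: sumr_ge0 => k _.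
by rewrite mxE -expr2 sqr_ge0.
Qed.

Lemma ortho_norm g (v : 'rV[R]_n) : G g -> `|v *m g.1| <= n%:R * `|v|.
Proof.
move=> Gg; apply: le_trans (mulmx_norm _ _) _; rewrite -[leRHS]mulr1 ler_wpM2l ?mulr_ge0 //.
by apply: mx_norm_le => // i j; apply: ortho_entry.
Qed.

Lemma G_one : G (isom_one R n). Proof. by case: hG. Qed.

Lemma G_mul g h : G g -> G h -> G (isom_mul g h).
Proof. by case: hG => _ _ _ h1 _; apply: h1. Qed.

(** The loss of n + 1 in the closeness of the inverse comes from the sup norm, which an orthogonal
    matrix multiplies by at most n. *)
Lemma G_inv g : G g -> exists h, [/\ G h, isom_mul h g = isom_one R n,
  isom_mul g h = isom_one R n, h.1 = g.1^T & forall e, 0 < e -> close (e / n.+1%:R) g -> close e h].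
Proof.
move=> Gg; case: (hG) => _ _ _ _ /(_ g Gg)[h Gh hg].
have e1 : g.1 *m h.1 = 1%:M by have := congr1 fst hg.
have e2 : g.2 *m h.1 + h.2 = 0 by have := congr1 snd hg.
have h1 : h.1 = g.1^T by rewrite -[h.1]mul1mx -(ortho_tr Gg) -mulmxA e1 mulmx1.
have h2 : h.2 = - (g.2 *m h.1) by apply/eqP; rewrite -addr_eq0 addrC e2.
exists h; split=> //.
  rewrite /isom_mul h2 h1 ortho_tr // mulNmx -mulmxA ortho_tr // mulmx1 addNr //.
move=> e e0 [c1 c2]; have n1 : 1 <= n.+1%:R :> R by rewrite ler1n.
split.
  rewrite h1 (_ : _ - _ = (g.1 - 1%:M)^T); last by rewrite linearB /= trmx1.
  apply: le_lt_trans (lt_le_trans c1 _); last by rewrite ler_pdivrMr ?ltr0n // ler_peMr // ltW.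
  apply: mx_norm_le => // i j; rewrite [X in `|X|]mxE; exact: ler_mx_norm.
rewrite h2 normrN; apply: le_lt_trans (ortho_norm _ Gh) _.
move: c2; rewrite ltr_pdivlMr ?ltr0n // => c2; apply: le_lt_trans c2.
by rewrite mulrC ler_wpM2l // ler_nat.
Qed.

Lemma isom_app_inv g h p : isom_mul h g = isom_one R n -> isom_app h (isom_app g p) = p.
Proof. by move=> hg; rewrite -isom_mul_app hg isom_one_app. Qed.

Lemma unit_matrices_compact : compact [set A : 'M[R]_n | forall i j, `|A i j| <= 1].
Proof.
have -> : [set A : 'M[R]_n | forall i j, `|A i j| <= 1] =
    vec_mx @` [set x : 'rV[R]_(n * n) | `|x| <= 1].
  apply/seteqP; split=> [A hA|_ [x hx <-] i j] /=.
    exists (mxvec A); last exact: mxvecK.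
    apply: rV_norm_le => // k; case/mxvec_indexP: k => i j; rewrite mxvecE; exact: hA.
  rewrite mxE; apply: le_trans hx; exact: ler_rV_norm.
apply: continuous_compact.
  apply: continuous_subspaceT.
  apply: (@lipschitz_continuous R 'rV[R]_(n * n) 'M[R]_n _ 1) => // x y; rewrite mul1r -linearB.
  by apply: mx_norm_le => // i j; rewrite mxE; apply: ler_rV_norm.
apply: bounded_closed_compact.
  exists 1; split=> // M M1 x /= hx; exact: le_trans hx (ltW M1).
rewrite (_ : [set x | _] = (fun x : _ => `|x|) @^-1` [set y : R | y <= 1]) //.
apply: (@preimage_closed _ _ (fun x : 'rV[R]_(n * n) => `|x|)); last exact: closed_le.
by move=> x _; apply: norm_continuous.
Qed.

(* Orbits are properly embedded: [G] is closed and the isometries that move [q] by at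
   most 1 form a compact set. *)
Lemma orbit_proper q e : 0 < e -> exists2 dl : R, 0 < dl & forall q', orbit G q q' ->
  `|q' - q| < dl -> exists g, [/\ G g, close e g & q' = isom_app g q].
Proof.
move=> e0.
pose f (g : 'M[R]_n * 'rV[R]_n) := `|isom_app g q - q|.
have cf : continuous f.
  move=> g; apply: (@cvg_comp _ _ _ (fun g => isom_app g q - q) Num.norm); last exact: norm_continuous.
  by apply: cvgB; [exact: isom_app_continuous|exact: cvg_cst].
pose far h := [set g : 'M[R]_n * 'rV[R]_n |
  e <= Num.max `|h.1 *m g.1 - 1%:M| `|h.2 *m g.1 + g.2| ].
have farP g h : ~ close e (isom_mul g h) <-> far h g.
  rewrite /far /close /= le_max; split.
    by move=> nc; apply/orP; case: ltP => c1; [right|left] => //; rewrite leNgt; apply/negP => c2; apply: nc.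
  by case/orP => c [c1 c2]; move: c; rewrite leNgt ?c1 ?c2.
have far_closed h : closed (far h).
  rewrite (_ : far h = (fun g : 'M[R]_n * 'rV[R]_n =>
    Num.max `|h.1 *m g.1 - 1%:M| `|h.2 *m g.1 + g.2|) @^-1` [set y | e <= y]) //.
  apply: preimage_closed; last exact: closed_ge.
  move=> g _; apply: (@continuous_max _ _ (fun g => `|h.1 *m g.1 - 1%:M|)
    (fun g : 'M[R]_n * 'rV[R]_n => `|h.2 *m g.1 + g.2|)) => //.
    apply: (@cvg_comp _ _ _ (fun g : 'M[R]_n * 'rV[R]_n => h.1 *m g.1 - 1%:M) Num.norm);
      last exact: norm_continuous.
    apply: cvgB; last exact: cvg_cst.
    apply: (@cvg_comp _ _ _ fst (fun A => h.1 *m A)); first exact: cvg_fst.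
    exact: mulmxl_continuous.
  apply: (@cvg_comp _ _ _ (fun g : 'M[R]_n * 'rV[R]_n => h.2 *m g.1 + g.2) Num.norm);
    last exact: norm_continuous.
  apply: cvgD; last exact: cvg_snd.
  apply: (@cvg_comp _ _ _ fst (fun A => h.2 *m A)); first exact: cvg_fst.
  exact: mulmxl_continuous.
pose Stab := [set h | G h /\ isom_app h q = q].
(* The elements that move q by at most 1 and are not brought near the identity by the stabilizer of
   q. On this compact set |g q - q| has a positive minimum, since an element fixing q is undone by
   its inverse, which lies in the stabilizer. *)
pose B := (G `&` f @^-1` [set y | y <= 1]) `&` \bigcap_(h in Stab) far h.
have cB : compact B.
  pose X := [set A : 'M[R]_n | forall i j, `|A i j| <= 1] `*`
    [set b : 'rV[R]_n | `|b| <= 1 + `|q| + n%:R * `|q| ].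
  apply: (@subclosed_compact _ _ X).
  - apply: closedI; last by apply: closed_bigI => h _; apply: far_closed.
    apply: closedI; first by case: hG.
    by apply: preimage_closed; [move=> g _; apply: cf|exact: closed_le].
  - apply: compact_setX; first exact: unit_matrices_compact.
    apply: bounded_closed_compact.
      exists (1 + `|q| + n%:R * `|q|); split; first exact: num_real.
      by move=> M M1 x /= hx; exact: le_trans hx (ltW M1).
    rewrite (_ : [set x | _] = (fun x : _ => `|x|) @^-1` [set y : R | y <= 1 + `|q| + n%:R * `|q| ]) //.
    apply: (@preimage_closed _ _ (fun x : 'rV[R]_n => `|x|)); last exact: closed_le.
    by move=> x _; apply: norm_continuous.
  move=> g [[Gg fg] _]; split=> [i j|] /=; first exact: ortho_entry.
  have -> : g.2 = (isom_app g q - q) + q - q *m g.1.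
    by rewrite subrK /isom_app addrAC subrr add0r.
  rewrite (le_trans (ler_normB _ _)) // lerD ?ortho_norm //.
  by rewrite (le_trans (ler_normD _ _)) // lerD.
have [B0|] := pselect (B !=set0); last first.
  move=> nB; exists 1 => // q' [g Gg <-] gq; apply: contrapT => none; apply: nB; exists g.
  split; first by split=> //; apply: ltW.
  move=> h [Gh hq]; apply/farP => cl; apply: none; exists (isom_mul g h).
  by split=> //; [exact: G_mul|rewrite isom_mul_app hq].
have [g0] := compact_EVT_min B0 cB (continuous_subspaceT cf).
rewrite inE => -[[Gg0 _] far0] min0.
have f0 : 0 < f g0.
  rewrite normr_gt0 subr_eq0; apply/eqP => g0q.
  have [h [Gh hg gh _ _]] := G_inv Gg0.
  have hS : Stab h by split=> //; rewrite -{1}g0q isom_app_inv.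
  have /farP := far0 h hS; apply; rewrite gh.
  by split; rewrite /= ?subrr normr0.
exists (Num.min 1 (f g0)); first by rewrite lt_min ltr01.
move=> q' [g Gg <-]; rewrite lt_min => /andP[g1 gf]; apply: contrapT => none.
have Bg : B g.
  split; first by split=> //; apply: ltW.
  move=> h [Gh hq]; apply/farP => cl; apply: none; exists (isom_mul g h).
  by split=> //; [exact: G_mul|rewrite isom_mul_app hq].
by have := min0 g; rewrite inE => /(_ Bg); rewrite leNgt gf.
Qed.

End IsometryGroup.

(** * Transfer of the dimension between orbits *)

Lemma dder0_small (R : realType) (m : nat) (f : 'rV[R]_m -> R) (a v : 'rV[R]_m) (e : R) :
  dder f a v 0 -> 0 < e -> \forall h \near (0 : R), `|f (a + h *: v) - f a| <= e * `|h|.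
Proof.
move=> df e0.
have cv : (fun h : R => h^-1 *: ((f \o shift a) (h *: v) - f a)) @ 0^' --> (0 : R).
  have := dder_derivable df; rewrite /derivable => d; apply: cvg_trans d _.
  by rewrite -/(derive f a v) (dderE df).
have : \forall h \near 0^', `|h^-1 *: ((f \o shift a) (h *: v) - f a)| < e.
  by move/cvgr0_norm_lt : cv; apply.
rewrite near_withinE; apply: filterS => h hh.
have [->|h0] := eqVneq h 0; first by rewrite scale0r addr0 subrr !normr0 mulr0.
have := hh h0; rewrite normrZ normfV /= [h *: v + a]addrC.
by rewrite mulrC ltr_pdivrMr ?normr_gt0 // => /ltW.
Qed.

(** In a direction killed by the differential of [F] the increments of [F] are of smaller order than
    h, while those of [psi] are at least of order h by [immersion_lower]. *)
Lemma lower_bound_row_free (R : realType) (k n : nat) (U : set 'rV[R]_k)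
    (psi F : 'rV[R]_k -> 'rV[R]_n) (C : R) th :
  open U -> immersion_on U psi -> differentiable F th -> U th ->
  (forall th', U th' -> `|psi th' - psi th| <= C * `|F th' - F th|) -> row_free ('J F th).
Proof.
move=> oU ip dF Uth low; apply: row_free_inj => c cJ.
have dFj j : dder (fun t => F t 0 j) th c 0.
  have dj : differentiable (fun t => F t 0 j) th by apply: diff_coord_ext.
  apply: dder_eq (differentiable_dder _ dj) _; rewrite derive_partial //.
  have := congr1 (fun A : 'rV[R]_n => A 0 j) cJ; rewrite !mxE => e; rewrite -[RHS]e.
  by apply: eq_bigr => i _; rewrite jacobianE.
have [c0 [r [c00 r0 rU lowp]]] := immersion_lower oU ip Uth.
have C0 : 0 <= `|C| by [].
apply/eqP; rewrite -normr_le0; apply/ler_addgt0Pr => e e0; rewrite add0r.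
pose e1 := e / (c0 * (`|C| + 1)).
have c1 : 0 < c0 * (`|C| + 1) by rewrite mulr_gt0 // ltr_wpDl.
have e10 : 0 < e1 by rewrite divr_gt0.
have nj : \forall h \near (0 : R), forall j, `|F (th + h *: c) 0 j - F th 0 j| <= e1 * `|h|.
  apply: (@filter_forall _ _ (fun j h => is_true (`|F (th + h *: c) 0 j - F th 0 j| <= e1 * `|h|))
    (nbhs (0 : R)) (nbhs_filter (0 : R))) => j.
  exact: (dder0_small (dFj j) e10).
have /nbhs_ballP[r1 /= r10 hr1] := nj.
pose h := Num.min r1 (r / (`|c| + 1)) / 2.
have cc0 : 0 < `|c| + 1 by rewrite ltr_wpDl.
have m0 : 0 < Num.min r1 (r / (`|c| + 1)) by rewrite lt_min r10 divr_gt0.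
have h0 : 0 < h by rewrite divr_gt0.
have hm : h < Num.min r1 (r / (`|c| + 1)) by rewrite ltr_pdivrMr // mulr_natr mulr2n ltrDl.
move: hm; rewrite lt_min => /andP[hr1' hr].
have hc : `|th + h *: c - th| < r.
  rewrite addrAC subrr add0r normrZ gtr0_norm //.
  move: hr; rewrite ltr_pdivlMr // => hr; apply: le_lt_trans hr.
  by rewrite ler_pM2l // lerDl.
have th_r : `|th - th| < r by rewrite subrr normr0.
have := lowp th (th + h *: c) th_r hc.
rewrite [X in `|X| <= _]addrAC subrr add0r normrZ gtr0_norm // => l1.
have l2 := low _ (rU _ hc).
have l3 : `|F (th + h *: c) - F th| <= e1 * h.
  apply: rV_norm_le => [|j]; first by rewrite mulr_ge0 // ltW.
  rewrite !mxE -{2}(gtr0_norm h0); apply: hr1.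
  by rewrite -ball_normE /= sub0r normrN gtr0_norm.
have l4 : h * `|c| <= c0 * ((`|C| + 1) * (e1 * h)).
  apply: le_trans l1 _; rewrite ler_pM2l //; apply: le_trans l2 _.
  apply: (@le_trans _ _ ((`|C| + 1) * `|F (th + h *: c) - F th|)).
    by rewrite ler_wpM2r // (le_trans (ler_norm C)) // lerDl.
  by rewrite ler_wpM2l // addr_ge0.
rewrite -(ler_pM2l h0); apply: le_trans l4 _; rewrite le_eqVlt; apply/orP; left; apply/eqP.
by rewrite /e1; field; rewrite !gt_eqF // ltr_wpDl.
Qed.

Section OrbitTransfer.
Context (R : realType) (n k : nat) (G : set ('M[R]_n * 'rV[R]_n)).
Hypothesis hG : isometry_group G.
Context (O : set 'rV[R]_n) (Theta : 'rV[R]_n -> 'rV[R]_n) (q : 'rV[R]_n).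
Hypothesis oO : open O.
Hypothesis sTheta : smooth_on O Theta.
Hypothesis orbit_O : forall q', orbit G q q' -> O q'.
Hypothesis Theta_equiv : forall g q', G g -> orbit G q q' ->
  Theta (isom_app g q') = isom_app g (Theta q').

Lemma orbit_app g p p' : G g -> orbit G p p' -> orbit G p (isom_app g p').
Proof.
by move=> Gg [h Gh <-]; exists (isom_mul g h); [exact: G_mul|exact: isom_mul_app].
Qed.

Lemma orbit_refl p : orbit G p p.
Proof. by exists (isom_one R n); [exact: G_one|exact: isom_one_app]. Qed.

Lemma orbit_sym p p' : orbit G p p' -> orbit G p' p.
Proof.
move=> [g Gg <-]; have [h [Gh hg _ _ _]] := G_inv hG Gg.
by exists h => //; apply: isom_app_inv.
Qed.

Lemma orbit_trans p p' p'' : orbit G p p' -> orbit G p' p'' -> orbit G p p''.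
Proof. by move=> pp' [g Gg <-]; apply: orbit_app. Qed.

(** The isometry from q to q' conjugates the inequality; each passage costs a factor n because of
    the sup norm. *)
Lemma lower_bound_transport (C dl : R) q' : 0 < dl -> 0 <= C ->
  (forall q1 q2, orbit G q q1 -> orbit G q q2 -> `|q1 - q| < dl -> `|q2 - q| < dl ->
     `|q1 - q2| <= C * `|Theta q1 - Theta q2|) -> orbit G q q' ->
  exists C' dl', [/\ 0 < dl', 0 <= C' & forall q1 q2, orbit G q q1 -> orbit G q q2 ->
    `|q1 - q'| < dl' -> `|q2 - q'| < dl' -> `|q1 - q2| <= C' * `|Theta q1 - Theta q2|].
Proof.
move=> dl0 C0 low [h Gh hq].
have [h' [Gh' h'h hh' _ _]] := G_inv hG Gh.
exists (n%:R * (C * n%:R)), (dl / n.+1%:R); split; [by rewrite divr_gt0|by rewrite !mulr_ge0|].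
move=> q1 q2 o1 o2; rewrite !ltr_pdivlMr ?ltr0n // => d1 d2.
have back y : `|y - q'| * n.+1%:R < dl -> `|isom_app h' y - q| < dl.
  move=> dy; have -> : q = isom_app h' q' by rewrite -hq isom_app_inv.
  rewrite isom_appB; apply: le_lt_trans (ortho_norm hG _ Gh') _; apply: le_lt_trans dy.
  by rewrite mulrC ler_wpM2l // ler_nat.
have := low _ _ (orbit_app Gh' o1) (orbit_app Gh' o2) (back _ d1) (back _ d2).
rewrite !Theta_equiv // !isom_appB => l.
have -> : q1 - q2 = (q1 - q2) *m h'.1 *m h.1.
  by rewrite -!isom_appB !isom_app_inv.
apply: le_trans (ortho_norm hG _ Gh) _; rewrite -!mulrA ler_wpM2l //.
apply: le_trans l _; rewrite ler_wpM2l //; exact: (ortho_norm hG).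
Qed.

(** The parametrizations of the orbit of q are composed with [Theta]. The lower bound makes the
    composites injective immersions, and [orbit_proper] makes the images of open sets open in the
    orbit. *)
Lemma orbit_transfer (C dl : R) : 0 < dl -> 0 <= C ->
  (forall q1 q2, orbit G q q1 -> orbit G q q2 -> `|q1 - q| < dl -> `|q2 - q| < dl ->
     `|q1 - q2| <= C * `|Theta q1 - Theta q2|) ->
  orbit_has_dim G q k -> orbit_has_dim G (Theta q) k.
Proof.
move=> dl0 C0 low dimq p' [h Gh hp].
pose q' := isom_app h q.
have oq' : orbit G q q' by exists h.
have p'E : p' = Theta q' by rewrite Theta_equiv //; exact: orbit_refl.
have [C' [dl' [dl'0 C'0 low']]] := lower_bound_transport dl0 C0 low oq'.
have [W [U [psi0 [[oW Wq'] oU ip [inj im] op]]]] := dimq q' oq'.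
have [th0 Uth0 eth0] : (psi0 @` U) q' by rewrite im.
have psi_orbit th : U th -> orbit G q (psi0 th).
  by move=> Uth; have := imageP psi0 Uth; rewrite im => -[].
have [r r0 hr] : exists2 r : R, 0 < r & forall th, `|th - th0| < r ->
    U th /\ `|psi0 th - q'| < dl'.
  apply: near_rV; apply: filterI; first exact: open_nbhs_nbhs.
  have ct : {for th0, continuous psi0}.
    by apply: differentiable_near; apply: smooth_diff (proj1 ip) Uth0.
  have : \forall th \near th0, `|psi0 th0 - psi0 th| < dl'.
    exact: (cvgr_dist_lt _ _ ct _ dl'0).
  by apply: filterS => th; rewrite eth0 distrC.
pose U1 := [set th | ball th0 r th].
have U1P th : U1 th -> U th /\ `|psi0 th - q'| < dl'.
  by rewrite /U1 /= -ball_normE /= distrC; apply: hr.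
have oU1 : open U1 by exact: ball_open.
have U1th0 : U1 th0 by exact: ballxx.
pose F th := Theta (psi0 th).
have Opsi th : U1 th -> O (psi0 th) by move=> /U1P[/psi_orbit /orbit_O].
have sF : smooth_on U1 F.
  apply: smooth_rV => // j; apply: (smooth_comp oU1 (smooth_coord j oO sTheta)) => // i.
  by apply: smooth_coord => //; apply: smooth_sub (proj1 ip) => th /U1P[].
have lowF th th' : U1 th -> U1 th' -> `|psi0 th' - psi0 th| <= C' * `|F th' - F th|.
  by move=> /U1P[U1th d1] /U1P[U2th d2]; apply: low' => //; apply: psi_orbit.
have F_orbit th : U1 th -> orbit G (Theta q) (F th).
  move=> /U1P[/psi_orbit[g Gg gq] _]; exists g => //.
  by rewrite -Theta_equiv ?gq //; exact: orbit_refl.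
have open_image (V : set 'rV[R]_k) : V `<=` U1 -> open V ->
    exists2 W' : set 'rV[R]_n, open W' & F @` V = orbit G (Theta q) `&` W'.
  move=> VU oV.
  have VU' : V `<=` U by move=> th /VU /U1P[].
  have [W0 oW0 imV] := op V VU' oV.
  pose good th dl := 0 < dl /\ forall y, orbit G (Theta q) y -> `|y - F th| < dl -> (F @` V) y.
  have goodP th : V th -> exists dl, good th dl.
    move=> Vth.
    have Wth : W0 (psi0 th).
      by have := imageP psi0 Vth; rewrite imV => -[].
    have : \forall g \near isom_one R n, W0 (isom_app g (psi0 th)).
      apply: isom_app_continuous; rewrite isom_one_app; exact: open_nbhs_nbhs.
    move=> /near_close[e e0 he].
    have [dl1 dl10 hdl] := orbit_proper hG (F th) e0.
    exists dl1; split=> // y oy dy.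
    have [g [Gg cg ->]] := hdl y (orbit_trans (orbit_sym (F_orbit _ (VU _ Vth))) oy) dy.
    have og : orbit G q (isom_app g (psi0 th)).
      by apply: orbit_app => //; apply: psi_orbit; apply: VU'.
    have [th' Vth' e'] : (psi0 @` V) (isom_app g (psi0 th)).
      by rewrite imV; split=> //; apply: he.
    exists th' => //; rewrite /F e' Theta_equiv //; apply: psi_orbit; exact: VU'.
  exists [set y | exists th, V th /\ exists dl, good th dl /\ `|y - F th| < dl].
    rewrite openE => y [th [Vth [dl1 [gd dy]]]].
    apply/nbhs_ballP; exists (dl1 - `|y - F th|); first by rewrite /= subr_gt0.
    move=> y'; rewrite -ball_normE /= ltrBrDr => dy'.
    exists th; split=> //; exists dl1; split=> //; apply: le_lt_trans dy'.
    have -> : y' - F th = (y - F th) - (y - y') by rewrite opprB [RHS]addrC addrA subrK.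
    by rewrite [leRHS]addrC ler_normB.
  apply/seteqP; split=> [_ [th Vth <-]|y [oy [th [Vth [dl1 [[_ gd] dy]]]]]].
    split; first by apply: F_orbit; apply: VU.
    have [dl1 gd] := goodP th Vth; exists th; split=> //; exists dl1; split=> //.
    by rewrite subrr normr0; case: gd.
  exact: gd.
have [W1 oW1 imW1] := open_image U1 (@subset_refl _ U1) oU1.
exists W1, U1, F; split=> //.
- split=> //; have : (F @` U1) p' by exists th0 => //; rewrite p'E /F eth0.
  by rewrite imW1 => -[].
- split=> // th U1th.
  apply: (@lower_bound_row_free R k n U1 psi0 F C' th) => //.
  + split; first by apply: smooth_sub (proj1 ip) => t /U1P[].
    by move=> t /U1P[Ut _]; apply: (proj2 ip).
  + exact: smooth_diff sF U1th.
  + by move=> th' U1th'; apply: lowF.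
- split=> // th th' U1th U1th' e; apply: inj; [by case: (U1P _ U1th)|by case: (U1P _ U1th')|].
  apply/eqP; rewrite -subr_eq0 -normr_le0.
  by have := lowF th' th U1th' U1th; rewrite e subrr normr0 mulr0.
Qed.

End OrbitTransfer.

(** * Density of the principal part *)

(** The shift follows the bisector of the cone, along which both defining linear functions grow at
    the rate sin (pi / (2 d)). *)
Lemma cone_interior_shift (R : realType) (d : nat) (z : 'rV[R]_2) (t : R) :
  (0 < d)%N -> cone d z -> 0 < t ->
  interior (@cone R d) (z + t *: row2 (cos (pi / d%:R / 2)) (sin (pi / d%:R / 2))).
Proof.
move=> d0 [z1 zw] t0; set al := pi / d%:R; set w := z + _.
have dR : 0 < d%:R :> R by rewrite ltr0n.
have al0 : 0 < al by rewrite divr_gt0 // pi_gt0.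
have alpi : al <= pi by rewrite /al ler_pdivrMr // ler_peMr ?pi_ge0 // ler1n.
have s0 : 0 < sin (al / 2).
  apply: sin_gt0_pi; rewrite divr_gt0 //=; apply: le_lt_trans (_ : pi / 2 < pi).
    by rewrite ler_wpM2r // invr_ge0.
  by rewrite ltr_pdivrMr // mulr_natr mulr2n ltrDl pi_gt0.
have w1 : 0 < w 0 1 by rewrite !mxE /= ltr_pwDr ?mulr_gt0.
have w2 : 0 < w 0 0 * sin al - w 0 1 * cos al.
  have e : sin (al / 2) = cos (al / 2) * sin al - sin (al / 2) * cos al.
    transitivity (sin (al - al / 2)); first by congr (sin _); field.
    by rewrite sinB; ring.
  have -> : w 0 0 * sin al - w 0 1 * cos al = z 0 0 * sin al - z 0 1 * cos al + t * sin (al / 2).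
    by rewrite [in RHS]e !mxE /=; ring.
  by rewrite ltr_pwDr // mulr_gt0.
pose f1 (v : 'rV[R]_2) := v 0 1.
pose f2 (v : 'rV[R]_2) := v 0 0 * sin al - v 0 1 * cos al.
have c1 : {for w, continuous f1} by exact: coord_continuous.
have c2 : {for w, continuous f2}.
  apply: differentiable_near; apply: differentiableB; apply: diffM_ext;
    by [exact: differentiable_coord|exact: differentiable_cst].
have h1 : \forall v \near w, `|f1 w - f1 v| < f1 w by exact: (cvgr_dist_lt _ _ c1 _ w1).
have h2 : \forall v \near w, `|f2 w - f2 v| < f2 w by exact: (cvgr_dist_lt _ _ c2 _ w2).
have : \forall v \near w, cone d v.
  apply: filterS2 h1 h2 => v; rewrite !ltr_distlC !subrr => /andP[v1 _] /andP[v2 _].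
  by split; apply: ltW.
by [].
Qed.

Lemma principal_dense (R : realType) (n : nat) (G : set ('M[R]_n * 'rV[R]_n)) (d : nat)
    (Pi : 'rV[R]_n -> 'rV[R]_2) (p : 'rV[R]_n) (e : R) : (0 < d)%N ->
  orbit_space_is_cone G d Pi -> 0 < e ->
  exists2 q, interior (@cone R d) (Pi q) & `|q - p| < e.
Proof.
move=> d0 [_ rPi _ openPi] e0.
have [B oB imB] := openPi [set q | ball p e q] (ball_open p e).
have pB : (cone d `&` B) (Pi p) by rewrite -imB; exists p => //; exact: ballxx.
set D := row2 (cos (pi / d%:R / 2)) (sin (pi / d%:R / 2)) : 'rV[R]_2.
have [r r0 hr] := ball_rV oB (proj2 pB).
have D0 : 0 < `|D| + 1 by rewrite ltr_wpDl.
pose t := r / (`|D| + 1) / 2.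
have t0 : 0 < t by rewrite !divr_gt0.
have ic := cone_interior_shift d0 (proj1 pB) t0.
have Bt : B (Pi p + t *: D).
  apply: hr; rewrite addrAC subrr add0r normrZ gtr0_norm //.
  apply: (@le_lt_trans _ _ (r / 2)); last by rewrite ltr_pdivrMr // mulr_natr mulr2n ltrDl.
  rewrite /t mulrAC ler_wpM2r ?invr_ge0 // mulrAC ler_pdivrMr // ler_pM2l //.
  by rewrite lerDl.
have : (cone d `&` B) (Pi p + t *: D) by split=> //; apply: interior_subset ic.
rewrite -imB => -[q /= bq Pq]; exists q; first by rewrite Pq.
by move: bq; rewrite -ball_normE /= distrC.
Qed.

Lemma gradv_equiv (R : realType) (n : nat) (G : set ('M[R]_n * 'rV[R]_n)) (O : set 'rV[R]_n)
    (Pi : 'rV[R]_n -> 'rV[R]_2) g q a : isometry_group G -> open O -> smooth_on O Pi ->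
  (forall g q, G g -> Pi (isom_app g q) = Pi q) -> G g -> O q -> O (isom_app g q) ->
  gradv Pi a (isom_app g q) = gradv Pi a q *m g.1.
Proof.
move=> hG oO sPi inv Gg Oq Ogq.
have e : gradv Pi a q = gradv Pi a (isom_app g q) *m g.1^T.
  apply/rowP => i; rewrite !mxE.
  have dcoord j : dder (fun p => isom_app g p 0 j) q (delta_mx 0 i) (g.1 i j).
    rewrite (_ : (fun p => _) = fun p : 'rV[R]_n => \sum_k p 0 k * g.1 k j + g.2 0 j); last first.
      by apply/funext => p; rewrite !mxE.
    apply: dder_eq (dderD (@dder_sum _ _ _ _ _ _ (fun k (p : 'rV[R]_n) => p 0 k * g.1 k j) _
      (fun k => (delta_mx 0 i : 'rV[R]_n) 0 k * g.1 k j) _) (dder_cst _ _ _)) _.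
      move=> k _; apply: dder_eq (dderM (coord_dder _ _ _) (dder_cst _ _ _)) _.
      by rewrite mulr0 addr0.
    rewrite addr0 (bigD1 i) //= big1 => [|k ki]; first by rewrite !mxE !eqxx mul1r addr0.
    by rewrite mxE (negbTE ki) andbF mul0r.
  have dapp : differentiable (isom_app g) q.
    apply: diff_rV => j; rewrite (_ : (fun p => _) = fun p : 'rV[R]_n => \sum_k p 0 k * g.1 k j + g.2 0 j).
      apply: diffD_ext; last exact: differentiable_cst.
      apply: diff_sum_ext => k _; apply: diffM_ext; last exact: differentiable_cst.
      exact: differentiable_coord.
    by apply/funext => p; rewrite !mxE.
  transitivity (partial i (fun p => Pi (isom_app g p) 0 a) q).
    by rewrite /gr; congr (partial i _ q); apply/funext => p; rewrite inv.
  rewrite (partial_comp (f := fun p => Pi p 0 a)) //; last first.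
    exact: smooth_diff (sPia oO sPi a) Ogq.
  by apply: eq_bigr => j _; rewrite /partial (dderE (dcoord j)) !mxE mulrC.
by rewrite e -mulmxA (ortho_tr hG) // mulmx1.
Qed.

Lemma local_min_critical (R : realType) (m : nat) (U : set 'rV[R]_m) (f : 'rV[R]_m -> R) v i :
  open U -> smooth_on U f -> U v -> (forall u, U u -> f v <= f u) -> partial i f v = 0.
Proof.
move=> oU sf Uv fmin; apply/eqP/negPn/negP => p0.
have [e e0 he] := range_nbhs oU sf Uv p0.
have [|u Uu fu] := he (f v - e / 2); first by apply/andP; split; lra.
by have := fmin u Uu; rewrite fu; lra.
Qed.

Lemma nearest_normal (R : realType) (m n : nat) (U : set 'rV[R]_m) (psi : 'rV[R]_m -> 'rV[R]_n)
    (p : 'rV[R]_n) v i : open U -> smooth_on U psi -> U v ->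
  (forall u, U u -> dotv (p - psi v) (p - psi v) <= dotv (p - psi u) (p - psi u)) ->
  \sum_j tang psi i j v * (p - psi v) 0 j = 0.
Proof.
move=> oU sp Uv near_p.
have sj j : smooth_on U (fun u => psi u 0 j) by apply: smooth_coord.
pose f u := \sum_j (p 0 j + -1 * psi u 0 j) * (p 0 j + -1 * psi u 0 j).
have fE u : f u = dotv (p - psi u) (p - psi u).
  by apply: eq_bigr => j _; rewrite !mxE mulN1r.
have s1 j : smooth_on U (fun u => p 0 j + -1 * psi u 0 j).
  apply: smoothD => //; first exact: smooth_cst.
  by apply: smoothM => //; apply: smooth_cst.
have sf : smooth_on U f by apply: smooth_sum => // j; apply: smoothM.
have := @local_min_critical R m U f v i oU sf Uv.
have -> : partial i f v = -2 * \sum_j tang psi i j v * (p - psi v) 0 j.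
  have d1 j : dder (fun u => p 0 j + -1 * psi u 0 j) v (delta_mx 0 i) (- tang psi i j v).
    apply: dder_eq (dderD (dder_cst _ _ _) (dderZ (-1) (differentiable_dder _ (smooth_diff (sj j) Uv)))) _.
    by rewrite add0r mulN1r.
  rewrite /partial (dderE (@dder_sum _ _ _ _ _ _ (fun j u => (p 0 j + -1 * psi u 0 j) *
    (p 0 j + -1 * psi u 0 j)) _ _ (fun j _ => dderM (d1 j) (d1 j)))).
  rewrite mulr_sumr; apply: eq_bigr => j _; rewrite !mxE.
  by move: (tang _ _ _ _) (p 0 j) (psi v 0 j) => *; ring.
move=> h; have {h} : -2 * \sum_j tang psi i j v * (p - psi v) 0 j = 0.
  by apply: h => u Uu; rewrite !fE; apply: near_p.
by move/eqP; rewrite mulf_eq0 oppr_eq0 pnatr_eq0 /= => /eqP.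
Qed.

Lemma segment_ball (R : realType) (m : nat) (v0 v v' : 'rV[R]_m) (r t : R) :
  `|v - v0| < r -> `|v' - v0| < r -> 0 <= t <= 1 -> `|v + t *: (v' - v) - v0| < r.
Proof.
move=> vr vr' /andP[t0 t1].
have -> : v + t *: (v' - v) - v0 = (1 - t) *: (v - v0) + t *: (v' - v0).
  by rewrite !scalerBr !scalerBl !scale1r; apply/rowP => i; rewrite !mxE; ring.
apply: le_lt_trans (ler_normD _ _) _; rewrite !normrZ.
rewrite ger0_norm ?subr_ge0 // [`|t|]ger0_norm //.
have [->|tn0] := eqVneq t 0; first by rewrite subr0 mul1r mul0r addr0.
have tp : 0 < t by rewrite lt0r tn0.
apply: (@lt_le_trans _ _ ((1 - t) * r + t * r)); last by rewrite -mulrDl subrK mul1r.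
apply: ler_ltD; last by rewrite ltr_pM2l.
by rewrite ler_wpM2l ?subr_ge0 // ltW.
Qed.

Lemma lipschitz_family (R : realType) (m : nat) (I : finType) (U : set 'rV[R]_m)
    (f : I -> 'rV[R]_m -> R) v0 : open U -> (forall i, smooth_on U (f i)) -> U v0 ->
  exists L r : R, [/\ 0 < L, 0 < r & forall i v v', `|v - v0| < r -> `|v' - v0| < r ->
    `|f i v' - f i v| <= L * `|v' - v| ].
Proof.
move=> oU sf Uv0; have [r0 r00 rU] := ball_rV oU Uv0.
pose C := 1 + \sum_(ik : I * 'I_m) `|partial ik.2 (f ik.1) v0|.
have C0 : 0 < C by rewrite ltr_pwDl // sumr_ge0.
have : \forall v \near v0, forall ik : I * 'I_m, `|partial ik.2 (f ik.1) v| <= C.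
  apply: (@filter_forall _ _ (fun (ik : I * 'I_m) v => is_true (`|partial ik.2 (f ik.1) v| <= C))
    (nbhs v0) (nbhs_filter v0)) => -[i k] /=.
  have cp : {for v0, continuous (partial k (f i))}.
    by apply: differentiable_near; apply: smooth_diff Uv0; apply: smooth_partial.
  have : \forall v \near v0, `|partial k (f i) v0 - partial k (f i) v| < 1.
    exact: (cvgr_dist_lt _ _ cp _ ltr01).
  apply: filterS => v hv.
  have : `|partial k (f i) v| <= `|partial k (f i) v0 - partial k (f i) v| + `|partial k (f i) v0|.
    by rewrite distrC -{1}(subrK (partial k (f i) v0) (partial k (f i) v)) ler_normD.
  move=> /le_trans; apply; rewrite /C lerD //; first exact: ltW.
  by rewrite (bigD1 (i, k)) //= lerDl sumr_ge0.
move=> /near_rV[r1 r10 hC].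
exists (m.+1%:R * C), (Num.min r0 r1); split; [by rewrite mulr_gt0|by rewrite lt_min r00|].
move=> i v v' vr vr'.
have [|t t01 ->] := @mvt_rV R m (f i) v v'.
  move=> t t01; apply: smooth_diff (sf i) _; apply: rU.
  by have := segment_ball vr vr' t01; rewrite lt_min => /andP[].
have t01' : 0 <= t <= 1 by case/andP: t01 => ? ?; rewrite !ltW.
have := segment_ball vr vr' t01'; rewrite lt_min => /andP[_ wr].
rewrite (le_trans (ler_norm_sum _ _ _)) //.
apply: (@le_trans _ _ (\sum_(k < m) `|v' - v| * C)).
  apply: ler_sum => k _; rewrite normrM; apply: ler_pM => //; first exact: ler_rV_norm.
  exact: (hC _ wr (i, k)).
rewrite sumr_const card_ord -[_ *+ m]mulr_natl [`|_| * C]mulrC mulrA.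
by rewrite ler_wpM2r // ler_wpM2r ?ltW // ltr_nat.
Qed.

Lemma dotv_norm_bound (R : realType) (n : nat) (v w : 'rV[R]_n) (K c : R) : 0 <= K -> 0 <= c ->
  (forall j, `|v 0 j| <= K) -> (forall j, `|w 0 j| <= c) -> `|dotv v w| <= n%:R * (K * c).
Proof.
move=> K0 c0 hv hw; rewrite (le_trans (ler_norm_sum _ _ _)) //.
apply: (@le_trans _ _ (\sum_(j < n) K * c)).
  by apply: ler_sum => j _; rewrite normrM ler_pM.
by rewrite sumr_const card_ord mulr_natl.
Qed.

Lemma row_free_cols (R : fieldType) (m k n : nat) (A : 'M[R]_(m, n)) (B : 'M[R]_(k, n)) :
  (forall (c1 : 'rV[R]_m) (c2 : 'rV[R]_k), c1 *m A + c2 *m B = 0 -> c1 = 0 /\ c2 = 0) ->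
  row_free (col_mx A B).
Proof.
move=> inj; apply: row_free_inj => c; rewrite -[c]hsubmxK mul_row_col => /inj[-> ->].
by rewrite row_mx0.
Qed.

(** The rows of [J] and [xi] form a basis, so [X] depends linearly on its products with them. *)
Lemma tangent_normal_bound (R : realType) (m : nat) (J : 'M[R]_(m, m.+1)) (xi : 'rV[R]_m.+1) :
  row_free J -> J *m xi^T = 0 -> xi != 0 -> exists2 b : R, 0 < b &
  forall (X : 'rV[R]_m.+1) (K : R), 0 <= K -> (forall i, `|(X *m J^T) 0 i| <= K) ->
    `|dotv X xi| <= K -> `|X| <= b * K.
Proof.
move=> fJ Jxi xi0; pose B := col_mx J xi.
have fB : row_free B.
  apply: row_free_cols => c1 c2 e.
  have c2E : c2 *m xi = c2 0 0 *: xi by rewrite [c2]mx11_scalar mul_scalar_mx !mxE mulr1n.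
  have : c2 0 0 * dotv xi xi = 0.
    have := congr1 (fun A => (A *m xi^T) 0 0) e; rewrite c2E mulmxDl -mulmxA Jxi mulmx0 add0r mul0mx.
    by rewrite -scalemxAl mxE -dotvE mxE.
  move/eqP; rewrite mulf_eq0 => /orP[/eqP c20|/eqP/dotv_eq0 x0]; last by rewrite x0 eqxx in xi0.
  have c2z : c2 = 0 by rewrite [c2]mx11_scalar c20 raddf0.
  split=> //; apply/eqP; rewrite -(mulmx_free_eq0 _ fJ) -[X in X == _]addr0.
  by rewrite -[X in _ + X](mul0mx _ xi) -c2z e.
have fullB : row_full B by move: fB; rewrite /row_free /row_full => /eqP ->; rewrite addn1.
have [D DB] := row_fullP fullB.
have [b b0 hb] := mulmx_norm_le D^T.
exists b => // X K K0 hJ hxi.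
have -> : X = X *m B^T *m D^T by rewrite -mulmxA -trmx_mul DB trmx1 mulmx1.
apply: le_trans (hb _) _; rewrite ler_pM2l //; apply: rV_norm_le => // i.
rewrite tr_col_mx mul_mx_row; case: (split_ordP i) => k ->; first by rewrite row_mxEl.
by rewrite row_mxEr ord1 -dotvE.
Qed.

Section NormalTransport.
Context (R : realType) (m : nat) (G : set ('M[R]_m.+1 * 'rV[R]_m.+1)).
Hypothesis hG : isometry_group G.
Context (V : set 'rV[R]_m) (psi : 'rV[R]_m -> 'rV[R]_m.+1) (v1 : 'rV[R]_m) (q : 'rV[R]_m.+1)
  (vg : 'M[R]_m.+1 * 'rV[R]_m.+1 -> 'rV[R]_m) (e0 : R).
Hypothesis oV : open V.
Hypothesis ip : immersion_on V psi.
Hypothesis Vv1 : V v1.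
Hypothesis e0_gt0 : 0 < e0.
Let xi := q - psi v1.
Hypothesis xi_neq0 : xi != 0.
Hypothesis v1_normal : forall i, \sum_j tang psi i j v1 * xi 0 j = 0.
Hypothesis vg_psi : forall g, G g -> close e0 g -> psi (vg g) = isom_app g (psi v1).
Hypothesis vg_normal : forall g i, G g -> close e0 g ->
  \sum_j tang psi i j (vg g) * (xi *m g.1) 0 j = 0.
Hypothesis vg_cont : forall r : R, 0 < r -> exists2 e, 0 < e &
  forall g, G g -> close e g -> `|vg g - v1| < r.

(* The vectors [xi *m g.1] are normals of constant length along the hypersurface, so that
   they depend on the foot point in a Lipschitz way. *)
Lemma normal_transport : exists C e : R, [/\ 0 <= C, 0 < e & forall g h, G g -> G h ->
  close e g -> close e h ->
  `|isom_app g q - isom_app h q| <= C * `|isom_app g (psi v1) - isom_app h (psi v1)| ].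
Proof.
have dpsi v : V v -> differentiable psi v by apply: smooth_diff (proj1 ip).
have J0 : 'J psi v1 *m xi^T = 0.
  apply/matrixP => i k; rewrite !mxE -[RHS](v1_normal i); apply: eq_bigr => j _.
  by rewrite [_^T _ _]mxE ord1 jacobianE //; apply: dpsi.
have [b b0 hb] := tangent_normal_bound (proj2 ip v1 Vv1) J0 xi_neq0.
have [L [r1 [L0 r10 lip]]] := @lipschitz_family R m ('I_m * 'I_m.+1)%type V
  (fun ij => tang psi ij.1 ij.2) v1 oV
  (fun ij => smooth_partial ij.1 (smooth_coord ij.2 oV (proj1 ip))) Vv1.
have [c [r2 [c0 r20 _ low]]] := immersion_lower oV ip Vv1.
set N : R := m.+1%:R; have N0 : 0 < N by rewrite ltr0n.
pose A := `|xi|; have A0 : 0 <= A := normr_ge0 xi.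
(* This radius and [e2] are chosen so that the changes of tangent vectors and the rotation of [xi]
   each contribute at most |X| / (4 b). *)
pose r := Num.min (Num.min r1 r2) (4 * b * (N * L))^-1.
have r0 : 0 < r by rewrite !lt_min r10 r20 invr_gt0 !mulr_gt0.
have [e1 e10 he1] := vg_cont r0.
pose e2 := (8 * b * (N * (N * A + 1)))^-1.
have e20 : 0 < e2 by rewrite invr_gt0 !mulr_gt0 // ltr_wpDl // mulr_ge0 // ltW.
pose e := Num.min e0 (Num.min e1 e2).
pose C := 1 + 2 * b * (N * (N * A * L)) * c.
exists C, e; split.
- by rewrite addr_ge0 // !mulr_ge0 // ltW.
- by rewrite !lt_min e0_gt0 e10 e20.
move=> g h Gg Gh cg ch.
have [lee0 lee1 lee2] : [/\ e <= e0, e <= e1 & e <= e2].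
  by rewrite /e; split; rewrite !ge_min ?lexx ?orbT.
have [cg0 ch0] := (closeW lee0 cg, closeW lee0 ch).
have rot g' : G g' -> close e g' -> `|xi - xi *m g'.1| <= N * A * e2.
  move=> Gg' [cl _]; rewrite -[X in X - _](mulmx1 xi) -mulmxBr.
  apply: le_trans (mulmx_norm _ _) _; rewrite -/N -/A ler_wpM2l ?mulr_ge0 ?(ltW N0) //.
  by rewrite distrC ltW // (lt_le_trans cl).
have near_v g' : G g' -> close e g' -> `|vg g' - v1| < r.
  by move=> Gg' cg'; apply: he1 => //; apply: closeW cg'.
set X := xi *m g.1 - xi *m h.1.
have XE j : X 0 j = (xi *m g.1) 0 j - (xi *m h.1) 0 j by rewrite !mxE.
have dE j : (xi - xi *m h.1) 0 j = xi 0 j - (xi *m h.1) 0 j by rewrite !mxE.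
have NA0 : 0 <= N * A by rewrite mulr_ge0 // ltW.
have X_small : `|X| <= 2 * (N * A * e2).
  have -> : X = (xi - xi *m h.1) - (xi - xi *m g.1) by rewrite opprB addrC addrA subrK.
  by rewrite (le_trans (ler_normB _ _)) // mulr2n mulrDl !mul1r lerD // rot.
have e2E : 8 * b * (N * (N * A * e2)) <= 1.
  have -> : 8 * b * (N * (N * A * e2)) = 8 * b * (N * (N * A)) * e2 by ring.
  rewrite /e2 ler_pdivrMr ?mul1r; last by rewrite !mulr_gt0 // ltr_wpDl.
  by rewrite ler_pM2l ?mulr_gt0 // ler_pM2l // lerDl.
have hNe : N * (N * A * e2) <= (4 * b)^-1.
  rewrite -[leRHS]mul1r ler_pdivlMr ?mulr_gt0 //.
  have : 0 <= b * (N * (N * A * e2)) by rewrite !mulr_ge0 // ltW.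
  move: e2E; move: (N * (N * A * e2)) => y *; lra.
have dv := near_v g Gg cg; have dh := near_v h Gh ch.
have in1 w : `|w - v1| < r -> `|w - v1| < r1 by move=> hw; apply: lt_le_trans hw _; rewrite /r !ge_min lexx.
have in2 w : `|w - v1| < r -> `|w - v1| < r2 by move=> hw; apply: lt_le_trans hw _; rewrite /r !ge_min lexx orbT.
have in3 w : `|w - v1| < r -> `|w - v1| <= (4 * b * (N * L))^-1.
  by move=> hw; apply: le_trans (ltW hw) _; rewrite /r ge_min lexx orbT.
have v1r1 : `|v1 - v1| < r1 by rewrite subrr normr0.
pose W := `|vg g - vg h|.
(* After multiplication by [b], the first two terms make up half of |X| and are absorbed in the left
   side; what remains is proportional to the distance of the foot points. *)
pose K := (4 * b)^-1 * `|X| + (4 * b)^-1 * `|X| + N * (N * A * L) * W.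
have W0 : 0 <= W := normr_ge0 _.
have b40 : 0 <= (4 * b)^-1 by rewrite invr_ge0 mulr_ge0 // ltW.
have K1 : 0 <= N * (N * A * L) * W by rewrite !mulr_ge0 // ltW.
have KX : 0 <= (4 * b)^-1 * `|X| by rewrite mulr_ge0.
have hK : `|X| <= b * K.
  apply: hb => [|i|]; first by rewrite !addr_ge0.
    (* The rotated vectors are normal at their own foot points, so that only differences of tangent
       vectors remain. *)
    have -> : (X *m ('J psi v1)^T) 0 i =
        dotv X (\row_j (tang psi i j v1 - tang psi i j (vg h))) +
        dotv (xi *m g.1) (\row_j (tang psi i j (vg h) - tang psi i j (vg g))).
      have -> : dotv (xi *m g.1) (\row_j (tang psi i j (vg h) - tang psi i j (vg g))) =
         \sum_j tang psi i j (vg h) * X 0 j.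
        rewrite -[LHS]addr0 -[X in _ + X](vg_normal i Gg cg0) -[RHS]addr0.
        rewrite -[X in _ = _ + X](vg_normal i Gh ch0) -!big_split; apply: eq_bigr => j _ /=.
        rewrite XE [(\row__ _) 0 j]mxE.
        by move: ((xi *m g.1) 0 j) ((xi *m h.1) 0 j) (tang _ _ _ _) (tang _ _ _ _) => *; ring.
      rewrite mxE -big_split; apply: eq_bigr => j _ /=.
      rewrite [_^T _ _]mxE [(\row__ _) 0 j]mxE jacobianE; last exact: dpsi.
      by rewrite -/(tang psi i j v1); move: (X 0 j) (tang _ _ _ _) (tang _ _ _ _) => *; ring.
    apply: le_trans (ler_normD _ _) _; rewrite /K [leRHS]addrAC -[leRHS]addrA lerD //.
      apply: (@le_trans _ _ (N * (`|X| * (L * (4 * b * (N * L))^-1)))).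
        apply: dotv_norm_bound => // [|j|j].
        - by rewrite mulr_ge0 ?invr_ge0 ?mulr_ge0 // ltW.
        - exact: ler_rV_norm.
        rewrite mxE; apply: le_trans (lip (i, j) (vg h) v1 (in1 _ dh) v1r1) _.
        by rewrite ler_pM2l // distrC in3.
      rewrite le_eqVlt; apply/orP; left; apply/eqP.
      by move: (`|X|) => x; field; rewrite !gt_eqF.
    apply: (@le_trans _ _ (N * (N * A * (L * W)))).
      apply: dotv_norm_bound => // [|j|j]; first by rewrite mulr_ge0 // ltW.
        by apply: le_trans (ler_rV_norm _ _) _; apply: (ortho_norm hG).
      rewrite mxE /W [`|vg g - vg h|]distrC.
      exact: (lip (i, j) (vg g) (vg h) (in1 _ dv) (in1 _ dh)).
    by rewrite [leLHS](_ : _ = N * (N * A * L) * W) ?lerDl //; ring.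
  (* [xi *m g.1] and [xi *m h.1] have equal length, so the product of [X] with the second is - |X|^2
     / 2, which is quadratic in the small vector [X]. *)
  have -> : dotv X xi = dotv X (xi - xi *m h.1) - 2^-1 * dotv X X.
    have e1' : dotv X (xi - xi *m h.1) = dotv X xi - dotv X (xi *m h.1).
      by rewrite -sumrB; apply: eq_bigr => j _; rewrite dE mulrBr.
    have e2' : dotv X (xi *m h.1) = dotv (xi *m g.1) (xi *m h.1) - dotv xi xi.
      rewrite -(ortho_dotv hG xi xi Gh) -sumrB; apply: eq_bigr => j _.
      by rewrite XE mulrBl.
    have e3' : dotv X X = 2 * dotv xi xi - 2 * dotv (xi *m g.1) (xi *m h.1).
      transitivity (dotv (xi *m g.1) (xi *m g.1) + dotv (xi *m h.1) (xi *m h.1)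
         - 2 * dotv (xi *m g.1) (xi *m h.1)); last first.
        rewrite !(ortho_dotv hG) //.
        by move: (dotv xi xi) (dotv (xi *m g.1) (xi *m h.1)) => *; ring.
      rewrite mulr_sumr -big_split -sumrB; apply: eq_bigr => j _ /=.
      rewrite XE.
      by move: ((xi *m g.1) 0 j) ((xi *m h.1) 0 j) => *; ring.
    rewrite e1' e2' e3'.
    by move: (dotv X xi) (dotv xi xi) (dotv (xi *m g.1) (xi *m h.1)) => *; field.
  apply: le_trans (ler_normB _ _) _; rewrite /K -[leRHS]addrA lerD //.
    apply: (@le_trans _ _ (N * (`|X| * (N * A * e2)))).
      apply: dotv_norm_bound => // [|j|j]; first by rewrite mulr_ge0 // ltW.
        exact: ler_rV_norm.
      by apply: le_trans (ler_rV_norm _ _) _; apply: rot.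
    by rewrite mulrCA mulrC ler_wpM2r.
  apply: (@le_trans _ _ ((4 * b)^-1 * `|X|)); last by rewrite lerDl.
  rewrite normrM ger0_norm ?invr_ge0 //.
  apply: (@le_trans _ _ (2^-1 * (N * (`|X| * (2 * (N * A * e2)))))).
    rewrite ler_wpM2l ?invr_ge0 //; apply: dotv_norm_bound => // [|j|j].
    - by rewrite !mulr_ge0 // ltW.
    - exact: ler_rV_norm.
    - exact: le_trans (ler_rV_norm _ _) X_small.
  have -> : 2^-1 * (N * (`|X| * (2 * (N * A * e2)))) = N * (N * A * e2) * `|X|.
    by move: (`|X|) => x; field.
  by rewrite ler_wpM2r.
have X_lip : `|X| <= 2 * b * (N * (N * A * L)) * W.
  have : b * K = 2^-1 * `|X| + b * (N * (N * A * L) * W).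
    by rewrite /K; move: (`|X|) => x; field; rewrite gt_eqF.
  move: hK => + E; rewrite E -![_ * W]mulrA -!mulrA.
  by move: (`|X|) (b * _) => x y hh; lra.
have W_low : W <= c * `|isom_app g (psi v1) - isom_app h (psi v1)|.
  by rewrite -!vg_psi // /W; apply: low; apply: in2.
have -> : isom_app g q - isom_app h q = (isom_app g (psi v1) - isom_app h (psi v1)) + X.
  have qE g' : isom_app g' q = isom_app g' (psi v1) + xi *m g'.1.
    by rewrite /isom_app addrAC -mulmxDl /xi addrC [psi v1 + _]addrC subrK addrC.
  by rewrite !qE opprD addrACA.
apply: le_trans (ler_normD _ _) _; rewrite /C mulrDl mul1r lerD //.
apply: le_trans X_lip _; rewrite -[leRHS]mulrA ler_wpM2l //.
by rewrite !mulr_ge0 // ltW.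
Qed.

End NormalTransport.

(** The tangent vectors of the orbit and the two gradients of [Pi] span the space, their numbers
    being k and 2. Both sides have the same products with all of them. *)
Lemma horizontal_decomp (R : realType) (k : nat) (Pi : 'rV[R]_k.+2 -> 'rV[R]_2)
    (O : set 'rV[R]_k.+2) (U0 : set 'rV[R]_k) (psi0 : 'rV[R]_k -> 'rV[R]_k.+2) th0
    (xi : 'rV[R]_k.+2) :
  open O -> smooth_on O Pi -> (forall p, O p -> riemannian_submersion_at Pi p) ->
  open U0 -> immersion_on U0 psi0 -> U0 th0 -> O (psi0 th0) ->
  (forall th, U0 th -> Pi (psi0 th) = Pi (psi0 th0)) ->
  (forall l, \sum_j tang psi0 l j th0 * xi 0 j = 0) ->
  xi = hlift Pi (xi *m 'J Pi (psi0 th0)) (psi0 th0).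
Proof.
move=> oO sPi rPi oU0 ip Uth Oq Pi0 xi_perp.
set q := psi0 th0 in Oq Pi0 *; pose A := 'J psi0 th0; pose B := ('J Pi q)^T; pose c := xi *m 'J Pi q.
have dp : differentiable psi0 th0 by apply: smooth_diff (proj1 ip) Uth.
have AJ : A *m 'J Pi q = 0.
  apply/matrixP => l b; rewrite !mxE.
  transitivity (\sum_j partial l (fun u => psi0 u 0 j) th0 * partial j (fun p => Pi p 0 b) q).
    by apply: eq_bigr => j _; rewrite (JPi sPi) // /A jacobianE.
  rewrite -(partial_comp (f := fun p => Pi p 0 b) l dp); last exact: smooth_diff (sPia oO sPi b) Oq.
  transitivity (partial l (fun _ : 'rV[R]_k => Pi q 0 b) th0).
    by apply: eq_on_partial oU0 _ Uth => t Ut; rewrite Pi0.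
  exact: (dderE (dder_cst _ _ _)).
have gr1 : B *m 'J Pi q = 1%:M := gram_mx rPi Oq.
have fB : row_free (col_mx A B).
  apply: row_free_cols => c1 c2 e.
  have c20 : c2 = 0.
    have := congr1 (mulmx^~ ('J Pi q)) e.
    by rewrite mulmxDl -!mulmxA AJ gr1 mulmx0 mulmx1 add0r mul0mx.
  split=> //; apply/eqP; rewrite -(mulmx_free_eq0 _ (proj2 ip th0 Uth)) -/A.
  by move: e; rewrite c20 mul0mx addr0 => ->.
have fullB : row_full (col_mx A B) by move: fB; rewrite /row_free /row_full => /eqP ->; rewrite addn2.
have [D DB] := row_fullP fullB.
have cB : hlift Pi c q = c *m B.
  by apply/rowP => j; rewrite hliftE mxE; apply: eq_bigr => b _; rewrite [B _ _]mxE (JPi sPi).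
pose zeta := xi - c *m B.
have zA : zeta *m A^T = 0.
  rewrite mulmxBl -mulmxA -[B *m A^T]trmxK trmx_mul !trmxK AJ trmx0 mulmx0 subr0.
  apply/rowP => l; rewrite !mxE -[RHS](xi_perp l); apply: eq_bigr => j _.
  by rewrite [_^T _ _]mxE /A jacobianE // mulrC.
have zB : zeta *m B^T = 0 by rewrite mulmxBl -mulmxA /B trmxK gr1 mulmx1 subrr.
have z0 : zeta = 0.
  have -> : zeta = zeta *m (col_mx A B)^T *m D^T by rewrite -mulmxA -trmx_mul DB trmx1 mulmx1.
  by rewrite tr_col_mx mul_mx_row zA zB row_mx0 mul0mx.
by rewrite -/c cB; apply/eqP; rewrite -subr_eq0 -/zeta z0.
Qed.

Lemma act_near (R : realType) (n : nat) (G : set ('M[R]_n * 'rV[R]_n)) (M : topologicalType)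
    (act : 'M[R]_n * 'rV[R]_n -> M -> M) (A : set M) p0 : G (isom_one R n) ->
  {within G `*` [set: M], continuous (fun gp => act gp.1 gp.2)} ->
  (forall p, act (isom_one R n) p = p) -> open A -> A p0 ->
  exists e : R, exists N : set M, [/\ 0 < e, open N, N p0 &
    forall g x, G g -> close e g -> N x -> A (act g x)].
Proof.
move=> G1 cact act1 oA Ap0.
have hA : nbhs (act (isom_one R n) p0) A by rewrite act1; exact: open_nbhs_nbhs.
move/subspace_continuousP: cact => /(_ (isom_one R n, p0) (conj G1 I) A hA).
rewrite /nbhs /= /within /= => -[[P Q] /= [nP nQ] PQ].
have [e e0 he] := near_close nP.
move: nQ; rewrite nbhsE => -[N [oN Np0] NQ].
exists e, N; split=> // g x Gg cg Nx.
apply: (PQ (g, x)); first by split; [exact: he|exact: NQ].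
by split.
Qed.

Section Density.
Context (R : realType) (n' d : nat) (G : set ('M[R]_n'.+3 * 'rV[R]_n'.+3))
  (Pi : 'rV[R]_n'.+3 -> 'rV[R]_2).
Let O := Pi @^-1` interior (@cone R d).
Hypothesis hG : isometry_group G.
Hypothesis d_gt0 : (0 < d)%N.
Hypothesis cone_Pi : orbit_space_is_cone G d Pi.
Hypothesis sPi : smooth_on O Pi.
Hypothesis rPi : forall p, O p -> riemannian_submersion_at Pi p.
Hypothesis dim_O : forall p, orbit_has_dim G p n'.+1 <-> O p.
Context (M : topologicalType) (phi : M -> 'rV[R]_n'.+3) (U : set 'rV[R]_n'.+2)
  (u : 'rV[R]_n'.+2 -> M).
Hypothesis invM : G_invariant G phi.
Hypothesis lu : local_param phi U u.

Lemma principal_open : open O.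
Proof. by case: cone_Pi => cPi _ _ _; apply: open_comp => [p _|]; [exact: cPi|exact: open_interior]. Qed.

Lemma Pi_orbit p q : orbit G p q -> Pi q = Pi p.
Proof. by case: cone_Pi => _ _ h _ /h. Qed.

(* If a piece of the hypersurface avoided the principal part, then the segment from a nearby
   principal point [q] to its nearest point [p] on the piece would be normal both to the
   hypersurface and to the orbit of [q].  Following the hypersurface along [G], the normals
   make [gp |-> gq] Lipschitz, so that the orbit of [p] would be principal too. *)
Lemma principal_part_dense (V : set 'rV[R]_n'.+2) v0 : open V -> V `<=` U -> V v0 ->
  exists2 v, V v & O (phi (u v)).
Proof.
move=> oV VU Vv0; apply: contrapT => none.
have notO v : V v -> ~ O (phi (u v)) by move=> Vv Ov; apply: none; exists v.
have oO := principal_open.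
have [act [act1 actM cact equiv]] := invM.
have [oU cu inj_u op_u iU] := lu.
pose psi := phi \o u.
have ip : immersion_on V psi.
  by split; [apply: smooth_sub (proj1 iU)|move=> v /VU; apply: (proj2 iU)].
have dpsi v : V v -> differentiable psi v by apply: smooth_diff (proj1 ip).
have G1 := G_one hG.
have [c [r [c0 r0 rV low]]] := immersion_lower oV ip Vv0.
set N : R := n'.+3%:R; have N1 : 1 <= N by rewrite ler1n.
have N0 : 0 < N := lt_le_trans ltr01 N1.
pose rho := r / 2.
have rho0 : 0 < rho by rewrite divr_gt0.
have rho_r : rho < r by rewrite ltr_pdivrMr // mulr_natr mulr2n ltrDl.
(* The constant forces the nearest point on the closed ball [K] to be an interior one; [N] compares
   the Euclidean distance that is minimized with the sup norm. *)
pose eq_ := rho / (2 * c * N).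
have eq0 : 0 < eq_ by rewrite divr_gt0 // !mulr_gt0.
have [q Oq qv0] := principal_dense (psi v0) d_gt0 cone_Pi eq0.
pose K := [set v : 'rV[R]_n'.+2 | `|v - v0| <= rho].
have KV v : K v -> V v by move=> /= h; apply: rV; apply: le_lt_trans rho_r.
pose D v := dotv (q - psi v) (q - psi v).
have cK : compact K.
  apply: bounded_closed_compact.
    exists (rho + `|v0|); split; first exact: num_real.
    move=> x hx v /= Kv; apply: le_trans (ltW hx).
    by rewrite -[v in leLHS](subrK v0) (le_trans (ler_normD _ _)) // lerD.
  rewrite (_ : K = (fun v : 'rV[R]_n'.+2 => `|v - v0|) @^-1` [set y : R | y <= rho]) //.
  apply: preimage_closed; last exact: closed_le.
  move=> v _; apply: (@lipschitz_continuous R 'rV[R]_n'.+2 R^o _ 1) => // w w'.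
  by rewrite mul1r (le_trans (ler_dist_dist _ _)) // opprB addrA subrK.
have cD : {within K, continuous D}.
  apply: continuous_in_subspaceT => v; rewrite inE => Kv; apply: differentiable_near.
  have dj j : differentiable (fun u => (q - psi u) 0 j) v.
    apply: near_eq_differentiable (_ : differentiable (fun u => q 0 j - psi u 0 j) v).
      by near=> w; rewrite !mxE.
    apply: differentiableB; first exact: differentiable_cst.
    by apply: diff_coord_ext; apply: dpsi; apply: KV.
  by apply: diff_sum_ext => j _; apply: diffM_ext.
have K0 : K !=set0 by exists v0; rewrite /K /= subrr normr0 ltW.
have [v1] := EVT_min_rV K0 cK cD.
rewrite inE => Kv1 min1.
have Vv1 := KV _ Kv1.
have v1_int : `|v1 - v0| < rho.
  have l1 : `|psi v1 - q| <= N * `|psi v0 - q|.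
    rewrite -(ler_pXn2r (n := 2)) ?nnegrE ?mulr_ge0 ?(ltW N0) //.
    rewrite distrC; apply: le_trans (dotv_norm_le _) _.
    apply: le_trans (min1 v0 _) _; first by rewrite inE /K /= subrr normr0 ltW.
    apply: le_trans (dotv_le_norm _) _; rewrite -/N exprMn [`|q - _|]distrC.
    by rewrite ler_wpM2r ?sqr_ge0 // expr2 ler_peMr // ltW.
  have l2 : `|psi v1 - psi v0| < 2 * N * eq_.
    have -> : psi v1 - psi v0 = (psi v1 - q) - (psi v0 - q) by rewrite opprB addrA subrK.
    apply: le_lt_trans (ler_normB _ _) _.
    apply: (@le_lt_trans _ _ (N * `|psi v0 - q| + N * `|psi v0 - q|)).
      by rewrite lerD // ler_peMl.
    move: qv0; rewrite distrC; move: (`|psi v0 - q|) => y hy.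
    by rewrite -mulrDr -mulrA mulrCA ltr_pM2l // mulr2n mulrDl mul1r ltrD.
  have v0r : `|v0 - v0| < r by rewrite subrr normr0.
  have := low v0 v1 v0r (le_lt_trans Kv1 rho_r) => l3.
  apply: le_lt_trans l3 _; rewrite -ltr_pdivlMl //; apply: lt_le_trans l2 _.
  by rewrite le_eqVlt; apply/orP; left; apply/eqP; rewrite /eq_; field; rewrite !gt_eqF.
pose p0 := u v1; pose p := psi v1; pose xi := q - p.
have xi0 : xi != 0.
  by rewrite subr_eq0; apply/eqP => qp; apply: (notO v1 Vv1); rewrite -[phi _]/p -qp.
have Dmin w : `|w - v0| < rho -> D v1 <= D w.
  by move=> wr; apply: min1; rewrite inE; apply: ltW.
have ball_open_image (x : 'rV[R]_n'.+2) e : (forall w, `|w - x| < e -> V w) ->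
    open (u @` [set w | ball x e w]).
  move=> hV; apply: op_u; last exact: ball_open.
  by move=> w /=; rewrite -ball_normE /= distrC => /hV /VU.
have rhoV w : `|w - v0| < rho -> V w by move=> h; apply: KV; apply: ltW.
have [|e1 [N1' [e10 oN1 N1p0 act_back]]] := @act_near R _ G M act _ p0 G1 cact act1 (ball_open_image v0 rho rhoV).
  by exists v1; rewrite //= -ball_normE /= distrC.
have [rho1 rho10 hrho1] : exists2 rho1 : R, 0 < rho1 &
    forall v, `|v - v1| < rho1 -> `|v - v0| < rho /\ N1' (u v).
  apply: near_rV; apply: filterI.
    have : \forall v \near v1, `|v1 - v| < rho - `|v1 - v0|.
      apply/nbhs_ballP; exists (rho - `|v1 - v0|); first by rewrite /= subr_gt0.
      by move=> v; rewrite -ball_normE.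
    apply: filterS => v; rewrite ltrBrDr => hv; apply: le_lt_trans hv.
    by rewrite -[v in leLHS](subrK v1) -addrA (le_trans (ler_normD _ _)) // distrC.
  by apply: (chart_continuous lu (VU _ Vv1)); apply: open_nbhs_nbhs.
pose inv (x : M) := xget 0 [set w | U w /\ u w = x].
pose vg g := inv (act g p0).
have vg_near r' : 0 < r' -> r' <= rho1 -> exists2 e, 0 < e & forall g, G g -> close e g ->
    `|vg g - v1| < r' /\ u (vg g) = act g p0.
  move=> r'0 r'1.
  have r'V w : `|w - v1| < r' -> V w.
    by move=> h; apply: rhoV; apply: (proj1 (hrho1 w _)); apply: lt_le_trans h r'1.
  have [|e [N2 [e0 _ N2p0 h2]]] := @act_near R _ G M act _ p0 G1 cact act1 (ball_open_image v1 r' r'V).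
    by exists v1 => //=; exact: ballxx.
  exists e => // g Gg cg; have [w wb uw] := h2 g p0 Gg cg N2p0.
  have wr : `|w - v1| < r' by move: wb; rewrite /= -ball_normE /= distrC.
  have [Uv uv] : U (vg g) /\ u (vg g) = act g p0.
    by apply: (@xgetI _ 0 [set w | U w /\ u w = act g p0] w); split; [exact/VU/r'V|].
  by split=> //; rewrite (inj_u (vg g) w) ?uv ?uw //; apply/VU/r'V.
have [e2 e20 he2] := vg_near rho1 rho10 (lexx _).
(* Divided by n + 1 so that inverses of isometries close within [e0] satisfy the bounds [e1] and
   [e2], by [G_inv]. *)
pose e0 := Num.min e1 e2 / n'.+4%:R.
have m0 : 0 < Num.min e1 e2 by rewrite lt_min e10 e20.
have e00 : 0 < e0 by rewrite divr_gt0.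
have e0m : e0 <= Num.min e1 e2 by rewrite ler_pdivrMr ?ltr0n // ler_peMr ?ler1n // ltW.
have close2 (g : 'M[R]_n'.+3 * 'rV[R]_n'.+3) : close e0 g -> close e2 g.
  by apply: closeW; apply: le_trans e0m _; rewrite ge_min lexx orbT.
have vg_psi g : G g -> close e2 g -> psi (vg g) = isom_app g p.
  by move=> Gg cg; have [_ e] := he2 g Gg cg; rewrite /psi /= e equiv.
have inverse g : G g -> close e0 g -> exists h, [/\ G h, isom_mul h g = isom_one R _,
    isom_mul g h = isom_one R _, close e1 h & close e2 h].
  move=> Gg cg; have [h [Gh hg gh _ hc]] := G_inv hG Gg; have cm := hc _ m0 cg.
  by exists h; split=> //; apply: closeW cm; rewrite ge_min lexx ?orbT.
have dist_isom g x y : G g ->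
    dotv (isom_app g x - isom_app g y) (isom_app g x - isom_app g y) = dotv (x - y) (x - y).
  by move=> Gg; rewrite isom_appB (ortho_dotv hG).
pose B1 := [set v | ball v1 rho1 v].
have oB1 : open B1 by exact: ball_open.
have B1P v : B1 v -> `|v - v1| < rho1 by rewrite /B1 /= -ball_normE /= distrC.
have B1V v : B1 v -> V v by move=> /B1P h; apply: rhoV; apply: (proj1 (hrho1 v h)).
have sB1 : smooth_on B1 psi by apply: smooth_sub (proj1 ip).
(* Near it, g p is the point of the hypersurface nearest to g q: the inverse of g would carry a
   nearer point back to a point of the ball nearer to q than p. *)
have vg_normal g i : G g -> close e0 g ->
    \sum_j tang psi i j (vg g) * (xi *m g.1) 0 j = 0.
  move=> Gg cg; have cg2 := close2 g cg; have [vgr _] := he2 g Gg cg2.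
  have Bvg : B1 (vg g) by rewrite /B1 /= -ball_normE /= distrC.
  rewrite -isom_appB -/p -(vg_psi g Gg cg2).
  apply: (nearest_normal i oB1 sB1 Bvg) => v /B1P vr.
  have [h [Gh hg gh ch1 _]] := inverse g Gg cg.
  have [w wb uw] := act_back h (u v) Gh ch1 (proj2 (hrho1 v vr)).
  have wr : `|w - v0| < rho by move: wb; rewrite /= -ball_normE /= distrC.
  have ew : psi v = isom_app g (psi w).
    by rewrite /psi /= uw equiv // isom_app_inv.
  by rewrite vg_psi // ew !dist_isom //; apply: Dmin.
have v1_normal i : \sum_j tang psi i j v1 * xi 0 j = 0.
  have Bv1 : B1 v1 by exact: ballxx.
  by apply: (nearest_normal i oB1 sB1 Bv1) => v /B1P /hrho1[vr _]; apply: Dmin.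
have vg_cont r' : 0 < r' -> exists2 e, 0 < e & forall g, G g -> close e g -> `|vg g - v1| < r'.
  move=> r'0; have [||e e_gt0 he] := vg_near (Num.min r' rho1).
  - by rewrite lt_min r'0.
  - by rewrite ge_min lexx orbT.
  exists e => // g Gg cg; have [h _] := he g Gg cg.
  by apply: lt_le_trans h _; rewrite ge_min lexx.
have [C [e3 [C0 e30 low_q]]] := normal_transport hG oV ip Vv1 e00 xi0 v1_normal
  (fun g Gg cg => vg_psi g Gg (close2 g cg)) vg_normal vg_cont.
have oq : orbit G q q := orbit_refl hG q.
have [W [U0 [psi0 [[oW Wq] oU0 ip0 [inj0 im0] _]]]] := (dim_O q).2 Oq q oq.
have [th0 Uth0 eth0] : (psi0 @` U0) q by rewrite im0.
have orb0 th : U0 th -> orbit G q (psi0 th) by move=> /(imageP psi0); rewrite im0 => -[].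
have [dl dl0 hdl] := orbit_proper hG q e00.
have [r' r'0 hr'] : exists2 r' : R, 0 < r' & forall th, `|th - th0| < r' ->
    U0 th /\ `|psi0 th - q| < dl.
  apply: near_rV; apply: filterI; first exact: open_nbhs_nbhs.
  have ct : {for th0, continuous psi0}.
    by apply: differentiable_near; apply: smooth_diff (proj1 ip0) Uth0.
  have : \forall th \near th0, `|psi0 th0 - psi0 th| < dl.
    exact: (cvgr_dist_lt _ _ ct _ dl0).
  by apply: filterS => th; rewrite eth0 distrC.
pose U0' := [set th | ball th0 r' th].
have U0'P th : U0' th -> U0 th /\ `|psi0 th - q| < dl.
  by rewrite /U0' /= -ball_normE /= distrC; apply: hr'.
(* If a nearby point h q of the orbit were nearer to p than q is, then the inverse of h would carry
   p to a point of the hypersurface nearer to q. *)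
have xi_perp l : \sum_j tang psi0 l j th0 * xi 0 j = 0.
  have sU0' : smooth_on U0' psi0 by apply: smooth_sub (proj1 ip0) => th /U0'P[].
  have Bth0 : U0' th0 by exact: ballxx.
  have -> : \sum_j tang psi0 l j th0 * xi 0 j = - \sum_j tang psi0 l j th0 * (p - psi0 th0) 0 j.
    by rewrite -sumrN; apply: eq_bigr => j _; rewrite eth0 -mulrN /xi !mxE opprB.
  apply/eqP; rewrite oppr_eq0; apply/eqP.
  apply: (nearest_normal l (ball_open _ _) sU0' Bth0) => th /U0'P[Uth dth].
  have [h [Gh ch ->]] := hdl _ (orb0 th Uth) dth.
  have [h' [Gh' h'h hh' _ ch']] := inverse h Gh ch.
  have [vr _] := he2 h' Gh' ch'.
  have sw (x y : 'rV[R]_n'.+3) : dotv (x - y) (x - y) = dotv (y - x) (y - x).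
    by apply: eq_bigr => j _; rewrite !mxE; ring.
  rewrite eth0 sw [leRHS]sw -[p in leRHS](isom_app_inv p hh') dist_isom // -vg_psi //.
  by apply: Dmin; apply: (proj1 (hrho1 _ vr)).
have Oth0 : O (psi0 th0) by rewrite eth0.
have Pi0 th : U0 th -> Pi (psi0 th) = Pi (psi0 th0).
  by move=> Uth; rewrite eth0; apply: Pi_orbit; apply: orb0.
have xiE := horizontal_decomp oO sPi rPi oU0 ip0 Uth0 Oth0 Pi0 xi_perp.
rewrite eth0 in xiE; set cc := xi *m 'J Pi q in xiE.
(* Subtracting the horizontal lift of the fixed vector [cc] commutes with [G] on the orbit of q, by
   equivariance of the gradients of [Pi], and by [xiE] it sends q to p. *)
pose Theta x := x - hlift Pi cc x.
have sTheta : smooth_on O Theta.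
  apply: smooth_rV => // j.
  apply: (@smooth_eq _ _ _ O (fun x => x 0 j + -1 * \sum_b cc 0 b * gr Pi b x j)) => // [x _|].
    by rewrite mulN1r -hliftE /Theta [RHS]mxE [X in _ = _ + X]mxE.
  apply: smoothD => //; first exact: coord_smooth.
  apply: smoothM => //; first exact: smooth_cst.
  apply: smooth_sum => // b; apply: smoothM => //; first exact: smooth_cst.
  exact: sgr.
have orbit_O x : orbit G q x -> O x by move=> ox; rewrite /O /= (Pi_orbit ox).
have Pi_inv g x : G g -> Pi (isom_app g x) = Pi x by move=> Gg; apply: Pi_orbit; exists g.
have Theta_equiv g x : G g -> orbit G q x -> Theta (isom_app g x) = isom_app g (Theta x).
  move=> Gg ox; have Ox := orbit_O x ox.
  have Ogx : O (isom_app g x) by rewrite /O /= Pi_inv.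
  have hE : hlift Pi cc (isom_app g x) = hlift Pi cc x *m g.1.
    rewrite /hlift mulmx_suml; apply: eq_bigr => b _.
    by rewrite (gradv_equiv b hG oO sPi Pi_inv Gg Ox Ogx) scalemxAl.
  by rewrite /Theta hE /isom_app mulmxBl addrAC.
have Tq : Theta q = p by rewrite /Theta -xiE /xi opprB addrC subrK.
have [dl2 dl20 hdl2] := orbit_proper hG q e30.
have Op : orbit_has_dim G p n'.+1.
  rewrite -Tq; apply: (orbit_transfer hG oO sTheta orbit_O Theta_equiv dl20 C0).
    move=> q1 q2 o1 o2 d1 d2.
    have [g1 [Gg1 cg1 ->]] := hdl2 q1 o1 d1; have [g2 [Gg2 cg2 ->]] := hdl2 q2 o2 d2.
    by rewrite !Theta_equiv // Tq; apply: low_q.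
  exact: (dim_O q).2.
by apply: (notO v1 Vv1); apply: (dim_O p).1.
Unshelve. all: by end_near. Qed.

End Density.

(** * Continuity of the mean curvature, and the conclusion *)

Lemma mean_curvature_coord (R : realType) (m n : nat) (U : set 'rV[R]_m)
    (psi : 'rV[R]_m -> 'rV[R]_n) v j : open U -> immersion_on U psi -> U v ->
  mean_curvature psi v 0 j = m%:R^-1 * \sum_i \sum_k inv_metric psi v i k *
    (partial i (tang psi k j) v - \sum_l \sum_a \sum_b
      partial i (tang psi k l) v * tang psi a l v * inv_metric psi v a b * tang psi b j v).
Proof.
move=> oU ip Uv.
have dpsi w : U w -> differentiable psi w by apply: smooth_diff (proj1 ip).
have pE i k l : partial i (partial k psi) v 0 l = partial i (tang psi k l) v.
  rewrite partial_coord; last by apply: smooth_diff (smooth_partial _ (proj1 ip)) Uv.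
  by apply: eq_on_partial oU _ Uv => w Uw; rewrite partial_coord //; apply: dpsi.
rewrite mxE; congr (_ * _); rewrite summxE; apply: eq_bigr => i _.
rewrite summxE; apply: eq_bigr => k _; rewrite mxE; congr (_ * _).
rewrite /normal_part [LHS]mxE [X in _ + X]mxE pE; congr (_ - _).
set X := partial i (partial k psi) v.
rewrite mxE; under eq_bigr => b _ do rewrite mxE mulr_suml.
under eq_bigr => b _ do under eq_bigr => a _ do rewrite mxE !mulr_suml.
under eq_bigr => b _ do rewrite exchange_big.
rewrite exchange_big; apply: eq_bigr => l _ /=; rewrite exchange_big.
apply: eq_bigr => a _; apply: eq_bigr => b _.
by rewrite [_^T _ _]mxE !jacobianE ?pE //; apply: dpsi.
Qed.

Lemma mean_curvature_continuous (R : realType) (m n : nat) (U : set 'rV[R]_m)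
    (psi : 'rV[R]_m -> 'rV[R]_n) v j : open U -> immersion_on U psi -> U v ->
  {for v, continuous (fun w => mean_curvature psi w 0 j)}.
Proof.
move=> oU ip Uv; apply: differentiable_near.
apply: near_eq_differentiable (_ : differentiable (fun v => m%:R^-1 * \sum_i \sum_k
    inv_metric psi v i k * (partial i (tang psi k j) v + -1 * \sum_l \sum_a \sum_b
      partial i (tang psi k l) v * tang psi a l v * inv_metric psi v a b * tang psi b j v)) v).
  apply: (open_near oU Uv) => w Uw; rewrite (mean_curvature_coord j oU ip Uw).
  congr (_ * _); apply: eq_bigr => i _; apply: eq_bigr => k _; congr (_ * _).
  by rewrite mulN1r.
have dt i l : differentiable (tang psi i l) v by apply: smooth_diff (stang_chart oU ip i l) Uv.
have dpt k i l : differentiable (partial k (tang psi i l)) v.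
  exact: smooth_diff (smooth_partial k (stang_chart oU ip i l)) Uv.
have dg a b : differentiable (fun v => inv_metric psi v a b) v by apply: diff_inv_metric Uv.
apply: diffM_ext; first exact: differentiable_cst.
apply: diff_sum_ext => i _; apply: diff_sum_ext => k _; apply: diffM_ext => //.
apply: diffD_ext => //; apply: diffM_ext; first exact: differentiable_cst.
apply: diff_sum_ext => l _; apply: diff_sum_ext => a _; apply: diff_sum_ext => b _.
by do 3!apply: diffM_ext => //.
Qed.

Theorem theorem1p2 (R : realType) (n : nat) (hn : (3 <= n)%N)
    (G : set ('M[R]_n * 'rV[R]_n))
    (hG : isometry_group G)
    (hcoh : cohomogeneity G 2)
    (hHL : exists (d : nat) (mult : 'I_d -> nat) (Pi : 'rV[R]_n -> 'rV[R]_2),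
       hsiang_lawson G mult Pi)
    (M : topologicalType) (phi : M -> 'rV[R]_n)
    (himm : immersed_hypersurface phi)
    (hinv : G_invariant G phi)
    (hbih : biharmonic phi) :
  minimal phi.
Proof.
case: n hn G hG hcoh hHL phi himm hinv hbih => [|[|[|n']]] // _ G hG _.
move=> [d [mult [Pi [[d_in mult_gt0 sum_mult] cone_Pi [sPi rPi dim_O] _ [profiles curvatures]]]]].
move=> phi himm hinv hbih U u lu v Uv.
have d_gt0 : (0 < d)%N by move: d_in; rewrite !inE => /or4P[|||/orP[]] /eqP ->.
have sum_mult' : (\sum_i mult i = n'.+1)%N.
  by move: sum_mult; rewrite addn2 => -[].
pose O := Pi @^-1` interior (@cone R d).
have oO : open O := principal_open cone_Pi.
have lapE c p : O p -> lapPi Pi c p = logvol_grad mult c (Pi p).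
  (* Orbits over the interior have dimension n - 2, and a parametrization of the orbit through p is
     the piece on which [lapPi_formula] builds its test hypersurfaces. *)
  move=> Op; have [W [U0 [psi0 [[_ Wp] oU0 ip0 [_ im] _]]]] := (dim_O p).2 Op p (orbit_refl hG p).
  have [th0 Uth0 eth0] : (psi0 @` U0) p by rewrite im; split=> //; apply: orbit_refl.
  apply: (lapPi_formula sum_mult' oO sPi rPi curvatures c oU0 ip0 Uth0 eth0 Op) => th Uth.
  by apply: (Pi_orbit cone_Pi); have := imageP psi0 Uth; rewrite im => -[].
have interior_case w : U w -> O (phi (u w)) -> mean_curvature (phi \o u) w = 0.
  move=> Uw Ow; have [U1 [u1 [a [b [x [y [s [[lu1 iu1] cxy pxy _]]]]]]]] := profiles M phi himm hinv _ Ow.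
  exact: (chart_minimal d_gt0 mult_gt0 oO sPi rPi lapE lu1 cxy pxy lu hbih Uw iu1).
apply/rowP => j; rewrite [RHS]mxE; apply/eqP/negPn/negP => H0.
have [oU _ _ _ ip] := lu.
have cH := @mean_curvature_continuous R _ _ U (phi \o u) v j oU ip Uv.
have nearH : \forall w \near v, mean_curvature (phi \o u) w 0 j != 0.
  exact: (cvgr_neq0 _ cH H0).
have [r r0 hr] : exists2 r : R, 0 < r & forall w, `|w - v| < r ->
    U w /\ mean_curvature (phi \o u) w 0 j != 0.
  by apply: near_rV; apply: filterI => //; exact: open_nbhs_nbhs.
pose V := [set w | ball v r w].
have VP w : V w -> U w /\ mean_curvature (phi \o u) w 0 j != 0.
  by rewrite /V /= -ball_normE /= distrC; apply: hr.
have [w Vw Ow] := principal_part_dense hG d_gt0 cone_Pi sPi rPi dim_O hinv lu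
  (ball_open v r) (fun w Vw => proj1 (VP w Vw)) (ballxx v r0).
have [Uw] := VP w Vw.
by rewrite (interior_case w Uw Ow) mxE eqxx.
Qed.
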